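(* Let $(\mathcal M,g)$ be a smooth compact connected Riemannian manifold without boundary, $\mathfrak f\in C^3(\mathcal M;\mathbb R)$, $q\in L^\infty(\mathcal M;\mathbb R)$, $\omega\subset\mathcal M$ a nonempty open set and $T>0$. Assume that $(\mathcal M,\nabla_g\mathfrak f,\overline\omega)$ does not satisfy (GCC). Then $$d_{([0,T],\overline\omega)}:=\sup_{y\in\mathcal M}\ \inf_{x\in\overline\omega,\,t\in[0,T]}d_{\nabla_g\mathfrak f}(x,y,t)>0.$$ Moreover, for any $\delta>0$ there is $\varepsilon_0>0$ such that for all $\varepsilon\in(0,\varepsilon_0)$, $$C_0(T,\varepsilon)\ \ge\ C_0^+(T,\varepsilon)\ \ge\ e^{\frac{d_{([0,T],\overline\omega)}-\delta}{\varepsilon}}.$$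
   Context: (GCC): with $(\phi_t)$ the flow of $\nabla_g\mathfrak f$, $(\mathcal M,\nabla_g\mathfrak f,\overline\omega)$ satisfies (GCC) if there is $T'>0$ such that for all $x\in\mathcal M$ there is $t\in(0,T')$ with $\phi_{-t}(x)\in\overline\omega$. For $x,y\in\mathcal M$, $$d_{\nabla_g\mathfrak f}(x,y,t)=\frac14\inf\Big\{\int_0^t|\dot\gamma(s)-\nabla_g\mathfrak f(\gamma(s))|_g^2\,ds:\ \gamma\in W^{1,\infty}([0,t];\mathcal M),\ \gamma(0)=x,\ \gamma(t)=y\Big\}$$ ($\inf\emptyset=+\infty$, relevant for $t=0$). Equation, for $\varepsilon>0$: $(\partial_t-\nabla_g\mathfrak f\cdot\nabla_g-q-\varepsilon\Delta_g)u=0$ in $(0,\infty)\times\mathcal M$, $u|_{t=0}=u_0$. $C_0(T,\varepsilon)$ (resp. $C_0^+(T,\varepsilon)$) denotes the best constant $C$ in $C^2\int_0^T\int_\omega|u|^2\,d\mathrm{Vol}_g\,dt\ge\|u(T)\|^2_{L^2(\mathcal M)}$ for all $u_0\in L^2(\mathcal M)$ (resp. for all $u_0\in L^2(\mathcal M;\mathbb R^+)$). *)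

(* Defs.v *)
(* Smooth Riemannian manifolds, gradient flows, the action functional of a
   vector field and vanishing-viscosity transport-diffusion equations, set up
   on top of MathComp-Analysis. Points of R^n are row vectors. *)
From HB Require Import structures.
From mathcomp Require Import all_boot all_order all_algebra.
From mathcomp Require Import all_classical all_reals all_analysis.
Set Implicit Arguments.
Unset Strict Implicit.
Unset Printing Implicit Defensive.
Import Order.TTheory GRing.Theory Num.Theory.
Import numFieldNormedType.Exports.

Local Open Scope classical_set_scope.
Local Open Scope ring_scope.

Section EuclideanSpace.
Context {R : realType}.

(* The value is junk where the derivative does not exist. *)
Definition partial (n : nat) (j : 'I_n) (h : 'rV[R]_n -> R) (x : 'rV[R]_n) : R :=
  'D_(delta_mx 0 j) h x.

(* h is of class C^k on the open set U. *)
Fixpoint Ck_on (n : nat) (k : nat) (U : set 'rV[R]_n) (h : 'rV[R]_n -> R) : Prop :=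
  (forall x, U x -> {for x, continuous h}) /\
  match k with
  | 0%N => True
  | k'.+1 => forall j : 'I_n,
      (forall x, U x -> derivable h x (delta_mx 0 j)) /\
      Ck_on k' U (partial j h)
  end.

(* Lebesgue integral over R^n of a nonnegative Borel function, as an iterated
   integral (Tonelli). *)
Fixpoint integral_rV (n : nat) : ('rV[R]_n -> \bar R) -> \bar R :=
  match n return ('rV[R]_n -> \bar R) -> \bar R with
  | 0%N => fun h => h 0
  | n'.+1 => fun h =>
      (\int[@lebesgue_measure R]_t
         integral_rV (fun x : 'rV[R]_n' =>
                        h (row_mx (const_mx t : 'rV[R]_1) x)))%E
  end.

End EuclideanSpace.

(* An atlas of C^infinity-compatible charts of dimension n on M. chart_to and
   chart_from are total functions, meaningful only on chart_dom c and
   chart_cod c respectively; chart_at picks a chart around each point. *)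
Record smooth_atlas (R : realType) (n : nat) (M : ptopologicalType) := SmoothAtlas {
  chart : Type;
  chart_dom : chart -> set M;
  chart_to : chart -> M -> 'rV[R]_n;
  chart_from : chart -> 'rV[R]_n -> M;
  chart_cod := fun c => chart_to c @` chart_dom c;
  chart_at : M -> chart;
  chart_dom_open : forall c, open (chart_dom c);
  chart_cod_open : forall c, open (chart_cod c);
  chart_toK : forall c p, chart_dom c p -> chart_from c (chart_to c p) = p;
  chart_to_cont : forall c p, chart_dom c p -> {for p, continuous (chart_to c)};
  chart_from_cont : forall c x, chart_cod c x ->
    {for x, continuous (chart_from c)};
  chart_atP : forall p, chart_dom (chart_at p) p;
  chart_compat : forall c d (j : 'I_n) (k : nat),
    Ck_on k (chart_cod c `&` chart_from c @^-1` chart_dom d)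
            (fun x => chart_to d (chart_from c x) 0 j)
}.

(* metric c x is the matrix (g_ij) in the chart c at the point of coordinates x.
   With row vectors, a tangent vector v in the chart c is v *m 'J in the chart d,
   whence the transformation rule metric_compat. *)
Record riemannian (R : realType) (n : nat) (M : ptopologicalType) := Riemannian {
  atlas :> smooth_atlas R n M;
  metric : chart atlas -> 'rV[R]_n -> 'M[R]_n;
  metric_smooth : forall c (i j : 'I_n) (k : nat),
    Ck_on k (chart_cod c) (fun x => metric c x i j);
  metric_sym : forall c x, chart_cod c x -> (metric c x)^T = metric c x;
  metric_pos : forall c x (v : 'rV[R]_n), chart_cod c x -> v != 0 ->
    0 < (v *m metric c x *m v^T) 0 0;
  metric_compat : forall (c d : chart atlas) (x : 'rV[R]_n),
    chart_cod c x -> chart_dom d (chart_from c x) ->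
    let tau : 'rV[R]_n -> 'rV[R]_n := fun z => chart_to d (chart_from c z) in
    metric c x = 'J tau x *m metric d (tau x) *m ('J tau x)^T
}.

Notation borel M := (g_sigma_algebraType (@open M)).

Section Riemannian.
Context {R : realType} {n : nat} {M : ptopologicalType}.
Variable G : riemannian R n M.

Definition Ck (k : nat) (h : M -> R) : Prop :=
  forall c : chart G, Ck_on k (chart_cod c) (h \o chart_from c).

Definition smooth (h : M -> R) : Prop := forall k, Ck k h.

(* A vector field, given by its components in each chart. *)
Definition vfield := chart G -> 'rV[R]_n -> 'rV[R]_n.

Definition norm_sq (c : chart G) (x v : 'rV[R]_n) : R :=
  (v *m metric c x *m v^T) 0 0.

(* v^i = g^{ij} d_j h *)
Definition grad (h : M -> R) : vfield := fun c x =>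
  (\row_j partial j (h \o chart_from c) x) *m invmx (metric c x).

Definition vol_density (c : chart G) (x : 'rV[R]_n) : R :=
  Num.sqrt (\det (metric c x)).

(* |g|^{-1/2} d_j (|g|^{1/2} X^j) *)
Definition divergence (X : vfield) (p : M) : R :=
  let c := chart_at G p in
  let x := chart_to c p in
  (vol_density c x)^-1 *
  \sum_(j < n) partial j (fun z => vol_density c z * X c z 0 j) x.

Definition laplacian (h : M -> R) : M -> R := divergence (grad h).

Definition scale_vfield (h : M -> R) (X : vfield) : vfield :=
  fun c x => h (chart_from c x) *: X c x.

(* The Riemannian volume, determined by dVol_g = |g|^{1/2} dx in each chart. *)
Definition is_volume (mu : {measure set (borel M) -> \bar R}) : Prop :=
  forall (c : chart G) (A : set (borel M)), measurable A -> A `<=` chart_dom c ->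
    mu A = integral_rV (fun x =>
             if `[< (chart_cod c `&` chart_from c @^-1` A) x >]
             then (vol_density c x)%:E else 0%E).

Definition is_flow (X : vfield) (phi : R -> M -> M) : Prop :=
  forall p,
    [/\ phi 0 p = p,
        continuous (fun t => phi t p) &
        forall (c : chart G) (t : R), chart_dom c (phi t p) ->
          is_derive t 1 (fun s => chart_to c (phi s p))
                        (X c (chart_to c (phi t p)))].

Definition GCC (phi : R -> M -> M) (F : set M) : Prop :=
  exists2 T' : R, 0 < T' &
    forall x, exists t : R, [/\ 0 < t, t < T' & F (phi (- t) x)].

(* gamma is in W^{1,oo}([0,t]; M): it is continuous and, in charts, the primitive
   of a bounded measurable function. *)
Definition W1oo_path (t : R) (gamma : R -> M) : Prop :=
  {within `[0, t], continuous gamma} /\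
  forall (c : chart G) (a b : R), 0 <= a -> a <= b -> b <= t ->
    (forall s : R, s \in `[a, b] -> chart_dom c (gamma s)) ->
    forall j : 'I_n, exists v : R -> R,
      [/\ measurable_fun [set: R] v,
          (exists K : R, forall s : R, `|v s| <= K) &
          forall s : R, s \in `[a, b] ->
            chart_to c (gamma s) 0 j =
            chart_to c (gamma a) 0 j +
            \int[@lebesgue_measure R]_(r in `[a, s]) v r].

(* gamma' in the chart chart_at (gamma s); for a W^{1,oo} path it makes sense for
   almost every s, and norms of it do not depend on the chart. *)
Definition velocity (gamma : R -> M) (s : R) : 'rV[R]_n :=
  derive1 (fun r : R => chart_to (chart_at G (gamma s)) (gamma r)) s.

Definition action (X : vfield) (t : R) (gamma : R -> M) : \bar R :=
  (\int[@lebesgue_measure R]_(s in `[0%R, t])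
    (let c := chart_at G (gamma s) in
     let x := chart_to c (gamma s) in
     norm_sq c x (velocity gamma s - X c x))%:E)%E.

Definition action_dist (X : vfield) (x y : M) (t : R) : \bar R :=
  ((4^-1)%:E * ereal_inf [set action X t gamma | gamma in
     [set gamma | [/\ W1oo_path t gamma, gamma 0%R = x & gamma t = y]]])%E.

Definition action_dist_set (X : vfield) (T : R) (F : set M) : \bar R :=
  ereal_sup (range (fun y : M =>
    ereal_inf [set z | exists (x : M) (t : R),
      [/\ F x, 0 <= t, t <= T & z = action_dist X x y t]])).

Section Equation.
Variables (mu : {measure set (borel M) -> \bar R}) (f q : M -> R) (eps : R).

(* Formal adjoint in L^2(dVol_g) of grad f . grad + q + eps laplacian. *)
Definition adjoint_op (h : M -> R) (p : M) : R :=
  - divergence (scale_vfield h (grad f)) p + q p * h p + eps * laplacian h p.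

(* The solution u in C([0,oo); L^2), in the weak sense, of
   (d_t - grad f . grad - q - eps laplacian) u = 0, u|_{t=0} = u0. *)
Definition weak_solution (u0 : M -> R) (u : R -> M -> R) : Prop :=
  [/\ (forall t : R, 0 <= t -> (u t : borel M -> R) \in Lfun mu 2%:E),
      (forall t : R, 0 <= t ->
         Lnorm mu 2%:E (fun p : borel M => (u s p - u t p)%:E)
           @[s --> within [set s | 0 <= s] (nbhs t)] --> 0%E),
      {ae mu, forall p, u 0 p = u0 p} &
      forall h : M -> R, smooth h -> forall t : R, 0 <= t ->
        \int[mu]_p (u t p * h p) =
        \int[mu]_p (u0 p * h p) +
        \int[@lebesgue_measure R]_(s in `[0, t])
          \int[mu]_p (u s p * adjoint_op h p)].

(* Best constant C >= 0 in the observability inequality from (0,T) x omega, for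
   the initial data in the class P; +oo if there is none. *)
Definition obs_constant (T : R) (omega : set M) (P : (M -> R) -> Prop) : \bar R :=
  ereal_inf [set C%:E | C in [set C : R | 0 <= C /\
    forall (u0 : M -> R) (u : R -> M -> R),
      (u0 : borel M -> R) \in Lfun mu 2%:E -> P u0 -> weak_solution u0 u ->
      (Lnorm mu 2%:E (fun p : borel M => (u T p)%:E) ^+ 2 <=
       (C ^+ 2)%:E * \int[@lebesgue_measure R]_(t in `[0%R, T])
                       \int[mu]_(p in (omega : set (borel M)))
                         (`|u t p| ^+ 2)%:E)%E]].

Definition C0 (T : R) (omega : set M) : \bar R :=
  obs_constant T omega (fun=> True).

Definition C0plus (T : R) (omega : set M) : \bar R :=
  obs_constant T omega (fun u0 => {ae mu, forall p, 0 <= u0 p}).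

End Equation.
End Riemannian.

(* Main.v *)
(* The lower bound is a semiclassical Agmon estimate. If W satisfies the Hamilton-Jacobi
   inequality d_s W >= |grad W|^2 + grad f . grad W up to a small error, then the energy
   \int u(s)^2 exp (- 2 W(s) / eps) of a nonnegative solution grows by a factor bounded uniformly
   in eps. Over a short time, W is the action of straight lines for coefficients frozen at the
   target point z: the energy of u near z is then at most the initial energy weighted by
   exp (- 2 d(z, y, t) / eps), and infimal convolutions extend this to [0, T]. Choose y almost
   realising the supremum in the distance and u_0 a bump at y. The energy observed in omega is
   at most exp (- 2 (d - delta / 2) / eps), while testing the equation against the constant 1
   shows that the mass of u(T), hence its L^2 norm, stays bounded below independently of eps.

   The nonnegative solution is the limit, weakly in L^2 and along an ultrafilter, of an implicit
   Euler scheme whose steps almost minimise a convex functional; the weighted energy estimate is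
   proved for the scheme and passes to the limit by lower semicontinuity.

   The distance is positive because the failure of (GCC) yields a backward trajectory of the flow
   that avoids the closure of omega during a time longer than T, and a path of small action
   ending on that trajectory stays close to it. *)
Require Import Defs.
From HB Require Import structures.
From mathcomp Require Import all_boot all_order all_algebra.
From mathcomp Require Import all_classical all_reals all_analysis.
From mathcomp Require Import measurable_realfun ess_sup_inf ring lra.
Import Order.TTheory GRing.Theory Num.Theory.
Import numFieldNormedType.Exports.
Import HBNNSimple.
Set Implicit Arguments.
Unset Strict Implicit.
Unset Printing Implicit Defensive.
Local Open Scope classical_set_scope.
Local Open Scope ring_scope.

(** * Differential calculus on R^n *)

(** The action distance is in general neither finite nor of class $C^1$, so it cannot itself serve
    as an Agmon weight. It is truncated at a level [K] above $d$, and over a time [tau] it is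
    replaced by explicit quadratic-over-linear functions in a chart. Three losses result: a factor
    [1 - mm], an additive [eta] per unit time, and a term [Av * tau] paid only when the last short
    step is incomplete. A minimum of $C^1$ weights is not $C^1$ either, so the gluing is done on
    energies, each being bounded by finitely many energies localised near the points of a cover. The
    number of short steps does not depend on $\varepsilon$, hence neither do the constants in front
    of the exponentials. Squares do not pass to weak limits: the chain runs on limits of the
    energies of the scheme, and only its last link is transferred to the solution. Several
    integrands, such as the action of a path or the observed energy as a function of time, come
    without measurability; they are handled as lower integrals, for which monotonicity and
    superadditivity survive. *)

Section Calculus.
Context {R : realType}.

Lemma differentiable_intro (V W : normedModType R) (h : V -> W) (x : V)
    (L : {linear V -> W}) :
  continuous L ->
  (forall e, 0 < e -> \forall v \near (0 : V), `|h (v + x) - h x - L v| <= e * `|v|) ->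
  differentiable h x /\ 'd h x = L :> (V -> W).
Proof.
move=> Lc H.
have E : h \o shift x = cst (h x) + L +o_ 0 id.
  apply/eqaddoP => e e0; have := H e e0; apply: filter_app.
  by near=> v => /=; rewrite /cst /= !fctE opprD addrA.
have dE := diff_unique Lc E.
split=> //; apply/diff_locallyP; split; first by rewrite dE.
by rewrite dE.
Unshelve. all: by end_near. Qed.

Lemma coord_norm_le n (v : 'rV[R]_n) j : `|v 0 j| <= `|v|.
Proof.
rewrite [leRHS]/Num.norm/= mx_normrE.
by apply/bigmax_geP; right => /=; exists (0, j).
Qed.

Lemma rV_norm_le n (v : 'rV[R]_n) e : 0 <= e ->
  (forall j, `|v 0 j| <= e) -> `|v| <= e.
Proof.
move=> e0 H; rewrite [leLHS]/Num.norm/= mx_normrE.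
by apply/bigmax_leP; split=> // -[i j] _ /=; rewrite ord1.
Qed.

Lemma is_derive_line (V W : normedModType R) (h : V -> W) (y w : V) (t : R) :
  derivable h (y + t *: w) w ->
  is_derive t (1 : R) (fun s => h (y + s *: w)) ('D_w h (y + t *: w)).
Proof.
move=> dh; have E : (fun s : R => s^-1 *: (((fun s => h (y + s *: w)) \o shift t) (s *: 1) - h (y + t *: w))) =
   (fun s : R => s^-1 *: ((h \o shift (y + t *: w)) (s *: w) - h (y + t *: w))).
  apply/funext => s /=; congr (_ *: (h _ - _)).
  by rewrite [s%:A]mulr1 scalerDl addrCA.
by split; rewrite /derivable /derive E.
Qed.

(** Mean value theorem on a segment, compared with a constant slope [a]. Both signs of [s] are
    treated because coordinate increments have no sign. *)
Lemma line_mean_value (V : normedModType R) (h : V -> R) (y w : V) (s a e : R) :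
  (forall t, `|t| <= `|s| -> derivable h (y + t *: w) w /\
     `|'D_w h (y + t *: w) - a| <= e) ->
  `|h (y + s *: w) - h y - s * a| <= e * `|s|.
Proof.
move=> H; set g := fun t => h (y + t *: w).
have gd t : `|t| <= `|s| -> is_derive t (1:R) g ('D_w h (y + t *: w)).
  by move=> /H [? _]; apply: is_derive_line.
have gc t : `|t| <= `|s| -> {for t, continuous g}.
  move=> /gd [+ _]; by move/derivable1_diffP/differentiable_continuous.
have g0 : g 0 = h y by rewrite /g scale0r addr0.
have fin c : `|c| <= `|s| -> `|'D_w h (y + c *: w) * s - s * a| <= e * `|s|.
  by move=> /H[_ ?]; rewrite mulrC -mulrBr normrM mulrC ler_wpM2r.
have [s0|s0] := leP 0 s.
  have [|||c] := @MVT_segment R g (fun t => 'D_w h (y + t *: w)) 0 s.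
  - by [].
  - move=> t; rewrite in_itv/= => /andP[t0 ts]; apply: gd.
    by rewrite (ger0_norm (ltW t0)) (ger0_norm s0) ltW.
  - apply: continuous_in_subspaceT => t /set_mem; rewrite /= in_itv/= => /andP[t0 ts].
    by apply: gc; rewrite (ger0_norm t0) (ger0_norm s0).
  - rewrite in_itv/= => /andP[c0 cs]; rewrite g0 subr0 => E.
    rewrite -/(g s) E; apply: fin; by rewrite (ger0_norm c0) (ger0_norm s0).
have [|||c] := @MVT_segment R g (fun t => 'D_w h (y + t *: w)) s 0.
- exact: ltW.
- move=> t; rewrite in_itv/= => /andP[t0 ts]; apply: gd.
  by rewrite (ltr0_norm s0) (ltr0_norm ts) lerN2 ltW.
- apply: continuous_in_subspaceT => t /set_mem; rewrite /= in_itv/= => /andP[t0 ts].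
  by apply: gc; rewrite (ltr0_norm s0) ler0_norm // lerN2.
- rewrite in_itv/= => /andP[c0 cs]; rewrite g0 sub0r mulrN => E.
  rewrite -/(g s) -(opprK (g s - _)) opprB E opprK; apply: fin.
  by rewrite (ltr0_norm s0) ler0_norm // lerN2.
Qed.

Lemma continuous_at_sum (T : topologicalType) (I : Type) (r : seq I) (F : I -> T -> R) x :
  (forall i, {for x, continuous (F i)}) ->
  {for x, continuous (fun y => \sum_(i <- r) F i y)}.
Proof.
move=> H; elim: r => [|i r IH].
  have -> : (fun y => \sum_(i <- [::]) F i y) = cst 0 by apply/funext => y; rewrite big_nil.
  exact: cvg_cst.
have -> : (fun y => \sum_(j <- i :: r) F j y) = F i \+ (fun y => \sum_(j <- r) F j y).
  by apply/funext => y; rewrite big_cons.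
exact: continuousD.
Qed.

Section ContinuousAt.
Variables (T : topologicalType) (f g : T -> R) (x : T).
Hypotheses (cf : {for x, continuous f}) (cg : {for x, continuous g}).

Lemma cont_cst (a : R) : {for x, continuous (fun _ : T => a)}.
Proof. exact: cst_continuous. Qed.
Lemma contD : {for x, continuous (fun y => f y + g y)}.
Proof. exact: continuousD. Qed.
Lemma contN : {for x, continuous (fun y => - f y)}.
Proof. exact: continuousN. Qed.
Lemma contM : {for x, continuous (fun y => f y * g y)}.
Proof. exact: continuousM. Qed.
Lemma contZ (a : R) : {for x, continuous (fun y => a * f y)}.
Proof. by move: (@continuousM R T (cst a) f x); apply => //; exact: cst_continuous. Qed.
Lemma cont_max : {for x, continuous (fun y => Num.max (f y) (g y))}.
Proof. exact: continuous_max. Qed.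
End ContinuousAt.

Lemma contB (T : topologicalType) (f g : T -> R) x :
  {for x, continuous f} -> {for x, continuous g} -> {for x, continuous (fun y => f y - g y)}.
Proof. by move=> cf cg; apply: (contD cf (contN cg)). Qed.

Definition lincomb n (a : 'I_n -> R) (v : 'rV[R]_n) : R := \sum_j v 0 j * a j.

Lemma lincomb_linear n (a : 'I_n -> R) : linear (lincomb a).
Proof.
move=> k u v; rewrite /lincomb scaler_sumr -big_split /=; apply: eq_bigr => j _.
by rewrite !mxE mulrDl -mulrA.
Qed.
HB.instance Definition _ n (a : 'I_n -> R) :=
  GRing.isLinear.Build R 'rV[R]_n R *:%R (lincomb a) (lincomb_linear a).

Lemma lincomb_continuous n (a : 'I_n -> R) : continuous (lincomb a).
Proof.
move=> x; apply: continuous_at_sum => j; move: (@continuousM R _ (fun v : 'rV[R]_n => v 0 j) (cst (a j)) x); apply; last exact: (@cst_continuous _ _ (a j)).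
exact: coord_continuous.
Qed.

Lemma lincomb_delta n (a : 'I_n -> R) j : lincomb a (delta_mx 0 j) = a j.
Proof.
rewrite /lincomb (bigD1 j)//= big1 ?addr0; last first.
  by move=> i ij; rewrite !mxE eqxx (negPf ij) mul0r.
by rewrite !mxE !eqxx mul1r.
Qed.

(** [Ck_on] only speaks of partial derivatives, whereas the chain rule between charts needs
    differentiability; [C1_of_Ck] is the bridge. *)
Definition C1_at n (h : 'rV[R]_n -> R) (x : 'rV[R]_n) : Prop :=
  differentiable h x /\ forall j, {for x, continuous (partial j h)}.

Lemma partialE n (h : 'rV[R]_n -> R) (x : 'rV[R]_n) j :
  differentiable h x -> partial j h x = 'd h x (delta_mx 0 j).
Proof. by move=> dh; rewrite /partial deriveE. Qed.

(** Intermediate points that split an increment of several variables into one increment per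
    coordinate. *)
Definition rV_prefix n (v : 'rV[R]_n) k : 'rV[R]_n := \row_j (if (j < k)%N then v 0 j else 0).

(** The increment telescopes along the points [rV_prefix v k]. Each link moves one coordinate, and
    there [line_mean_value] and the continuity of the partial derivative at [x] give an error
    [e / n.+1%:R * |v|]. *)
Lemma C1_differentiable n (h : 'rV[R]_n -> R) (x : 'rV[R]_n) :
  (\forall y \near x, forall j, derivable h y (delta_mx 0 j)) ->
  (forall j, {for x, continuous (partial j h)}) ->
  differentiable h x.
Proof.
move=> dh ch.
have key : forall e, 0 < e -> \forall v \near (0 : 'rV[R]_n),
    `|h (v + x) - h x - lincomb (fun j => partial j h x) v| <= e * `|v|.
  move=> e e0; have n0 : 0 < e / n.+1%:R by rewrite divr_gt0.
  have /nbhs_ballP [r /= r0 Hr] : \forall y \near x, forall j, derivable h y (delta_mx 0 j) /\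
      `|partial j h y - partial j h x| <= e / n.+1%:R.
    have {}ch : \forall y \near x, forall j, `|partial j h y - partial j h x| <= e / n.+1%:R.
      apply: (@filter_forall _ _ (fun j y => `|partial j h y - partial j h x| <= e / n.+1%:R) (nbhs x)) => j.
      have /cvgrPdist_le := ch j.
      move=> /(_ _ n0); apply: filterS => y; by rewrite distrC.
    near=> y.
    have d1 : forall j, derivable h y (delta_mx 0 j) by near: y.
    have d2 : forall j, `|partial j h y - partial j h x| <= e / n.+1%:R by near: y.
    by move=> j; split.
  have nv : \forall v \near (0 : 'rV[R]_n), `|v| < r.
    by apply/nbhs_ballP; exists r => //= v; rewrite -ball_normE /ball_/= sub0r normrN.
  near=> v.
  have vr : `|v| < r by near: v.
  have stp : forall k, (k <= n)%N ->
     `|h (rV_prefix v k + x) - h x - \sum_(j < n | (j < k)%N) v 0 j * partial j h x| <= k%:R * (e / n.+1%:R * `|v|).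
    elim=> [_|k IH kn].
      have -> : rV_prefix v 0 = 0 by apply/rowP => j; rewrite !mxE ltn0.
      by rewrite add0r subrr big_pred0_eq subr0 normr0 mul0r.
    have := IH (ltnW kn); set j := Ordinal kn => {}IH.
    have -> : rV_prefix v k.+1 = rV_prefix v k + v 0 j *: delta_mx 0 j.
      apply/rowP => i; rewrite !mxE eqxx ltnS leq_eqVlt.
      have [->|ij] := eqVneq i j; first by rewrite /= eqxx ltnn add0r mulr1.
      rewrite mulr0 addr0 -val_eqE /= in ij *.
      by rewrite -[(_ == _ :> nat)]/(val i == k) (negPf ij).
    rewrite (bigD1 j) /=; last by rewrite leqnn.
    rewrite (eq_bigl (fun i : 'I_n => (i < k)%N)); last first.
      move=> i; rewrite ltnS leq_eqVlt -val_eqE /=.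
      by have [->|_] := eqVneq (val i) k; rewrite ?ltnn //= ?andbT.
    have := @line_mean_value _ h (rV_prefix v k + x) (delta_mx 0 j) (v 0 j) (partial j h x) (e / n.+1%:R).
    have Hb t : `|t| <= `|v 0 j| -> ball x r (rV_prefix v k + x + t *: delta_mx 0 j).
      move=> tv; rewrite -ball_normE /ball_/= distrC addrAC addrK.
      apply: le_lt_trans vr; apply: rV_norm_le => // i; rewrite !mxE eqxx.
      have [->|ij] := eqVneq i j; first by rewrite /= ltnn add0r mulr1 (le_trans tv)// coord_norm_le.
      rewrite mulr0 addr0; case: ifP => _; rewrite ?normr0 ?coord_norm_le //.
    move=> /(_ _)/[dup] _ L; have {}L := L (fun t ht => Hr _ (Hb t ht) j).
    rewrite (addrAC _ _ x).
    set A := h (_ + _ + _) in L *; set B := h (_ + x) in L IH *.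
    set S := \sum_(_ < _ | _) _ in IH *.
    have -> : A - h x - (v 0 j * partial j h x + S) = (A - B - v 0 j * partial j h x) + (B - h x - S) by ring.
    rewrite (le_trans (ler_normD _ _)) // -natr1 mulrDl mul1r addrC lerD //.
    by apply: (le_trans L); rewrite ler_wpM2l ?coord_norm_le // ltW.
  have := stp n (leqnn n).
  have -> : rV_prefix v n = v by apply/rowP => j; rewrite !mxE ltn_ord.
  rewrite (eq_bigl xpredT) => [H|j]; last by rewrite ltn_ord.
  apply: (le_trans H); rewrite mulrA ler_wpM2r // mulrCA ger_pMr //.
  by rewrite ler_pdivrMr // mul1r ler_nat.
by have [] := differentiable_intro (@lincomb_continuous _ _) key.
Unshelve. all: by end_near. Qed.

Lemma continuous_near_eq (T U : topologicalType) (F H : T -> U) x :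
  (\forall y \near x, F y = H y) -> {for x, continuous H} -> {for x, continuous F}.
Proof.
move=> FH cH; rewrite /prop_for /continuous_at (nbhs_singleton FH).
by apply: cvg_trans cH; apply: near_eq_cvg; apply: filterS FH => y ->.
Qed.

Definition C1_on n (U : set 'rV[R]_n) (h : 'rV[R]_n -> R) : Prop :=
  forall x, U x -> C1_at h x.

Lemma C1_of_Ck n k (U : set 'rV[R]_n) h : open U -> Ck_on k.+1 U h -> C1_on U h.
Proof.
move=> oU [_ H] x Ux.
have c j : {for x, continuous (partial j h)}.
  by have [_] := H j; case: k {H} => [|k] [+ _]; apply.
split=> //; apply: C1_differentiable => //.
have := open_nbhs_nbhs (conj oU Ux); apply: filterS => y Uy j.
by have [+ _] := H j; apply.
Qed.

Lemma near_eq_partial n (f g : 'rV[R]_n -> R) x j :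
  (\forall y \near x, f y = g y) -> partial j f x = partial j g x.
Proof. exact: near_eq_derive. Qed.

Lemma near_eq_differentiable (V W : normedModType R) (f g : V -> W) x :
  (\forall y \near x, f y = g y) -> differentiable f x -> differentiable g x.
Proof.
move=> fg df.
apply: (proj1 (@differentiable_intro V W g x ('d f x) (diff_continuous df) _)).
move=> e e0; have /diff_locallyP[_ /eqaddoP/(_ _ e0)] := df.
have sh : \forall v \near (0 : V), f (v + x) = g (v + x).
  by have := fg; rewrite (near_shift 0); apply: filterS => v /=; rewrite subr0.
apply: filter_app; apply: filterS sh => v /= E; rewrite -E -(nbhs_singleton fg).
by rewrite !fctE /cst /= opprD addrA.
Qed.

Lemma near_near (T : topologicalType) (x : T) (P : set T) :
  (\forall y \near x, P y) -> \forall y \near x, \forall z \near y, P z.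
Proof. exact: nbhs_interior. Qed.

Lemma C1_at_near n (f g : 'rV[R]_n -> R) x :
  (\forall y \near x, f y = g y) -> C1_at f x -> C1_at g x.
Proof.
move=> fg [df cf]; split; first exact: near_eq_differentiable df.
move=> j; apply: continuous_near_eq (cf j).
have := near_near fg; apply: filterS => y.
by move=> /near_eq_partial ->.
Qed.

Section C1_algebra.
Variables (n : nat) (U : set 'rV[R]_n).
Hypothesis oU : open U.
Implicit Types f g : 'rV[R]_n -> R.

Lemma near_U x : U x -> \forall y \near x, U y.
Proof. by move=> Ux; exact: (open_nbhs_nbhs (conj oU Ux)). Qed.

Lemma C1_on_intro f (df : 'I_n -> 'rV[R]_n -> R) :
  (forall x, U x -> differentiable f x) ->
  (forall x j, U x -> partial j f x = df j x) ->
  (forall x j, U x -> {for x, continuous (df j)}) -> C1_on U f.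
Proof.
move=> d E c x Ux; split; first exact: d.
by move=> j; apply: continuous_near_eq (c x j Ux); apply: filterS (near_U Ux) => y /E.
Qed.

Lemma C1_on_cont f x : C1_on U f -> U x -> {for x, continuous f}.
Proof. by move=> H /H[/differentiable_continuous]. Qed.

Lemma C1_on_cst a : C1_on U (cst a).
Proof.
apply: (@C1_on_intro _ (fun _ => cst 0)) => [x Ux|x j Ux|x j Ux].
- exact: differentiable_cst.
- by rewrite /partial derive_cst.
- exact: cst_continuous.
Qed.

Lemma partialD f g x j : differentiable f x -> differentiable g x ->
  partial j (f \+ g) x = partial j f x + partial j g x.
Proof. by move=> df dg; rewrite /partial deriveD //; exact: diff_derivable. Qed.

Lemma partialM f g x j : differentiable f x -> differentiable g x ->
  partial j (f \* g) x = f x * partial j g x + g x * partial j f x.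
Proof. by move=> df dg; rewrite /partial deriveM //; exact: diff_derivable. Qed.

Lemma C1_onD f g : C1_on U f -> C1_on U g -> C1_on U (f \+ g).
Proof.
move=> Hf Hg; apply: (@C1_on_intro _ (fun j => partial j f \+ partial j g)) => [x|x j|x j].
- by move=> Ux; have [? _] := Hf x Ux; have [? _] := Hg x Ux; exact: differentiableD.
- by move=> Ux; have [? _] := Hf x Ux; have [? _] := Hg x Ux; exact: partialD.
- by move=> Ux; have [_ ?] := Hf x Ux; have [_ ?] := Hg x Ux; exact: continuousD.
Qed.

Lemma C1_onM f g : C1_on U f -> C1_on U g -> C1_on U (f \* g).
Proof.
move=> Hf Hg.
apply: (@C1_on_intro _ (fun j => (f \* partial j g) \+ (g \* partial j f))) => [x|x j|x j] Ux;
  have [df cf] := Hf x Ux; have [dg cg] := Hg x Ux.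
- exact: differentiableM.
- exact: partialM.
- by apply: continuousD; apply: continuousM => //; exact: differentiable_continuous.
Qed.

Lemma C1_onZ a f : C1_on U f -> C1_on U (fun x => a * f x).
Proof. by move=> Hf; apply: C1_onM (C1_on_cst a) Hf. Qed.

Lemma C1_onN f : C1_on U f -> C1_on U (fun x => - f x).
Proof.
move=> Hf; have -> : (fun x => - f x) = (fun x => -1 * f x).
  by apply/funext => x; rewrite mulN1r.
exact: C1_onZ.
Qed.

Lemma C1_onB f g : C1_on U f -> C1_on U g -> C1_on U (fun x => f x - g x).
Proof. by move=> Hf Hg; exact: C1_onD (Hf) (C1_onN Hg). Qed.

Lemma C1_on_eq f g : (forall x, U x -> f x = g x) -> C1_on U f -> C1_on U g.
Proof.
move=> E H x Ux; apply: C1_at_near (H x Ux).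
by apply: filterS (near_U Ux) => y /E.
Qed.

Lemma C1_on_sum (I : Type) (r : seq I) (F : I -> 'rV[R]_n -> R) :
  (forall i, C1_on U (F i)) -> C1_on U (fun x => \sum_(i <- r) F i x).
Proof.
move=> H; elim: r => [|i r IH].
  by apply: C1_on_eq (C1_on_cst 0) => x _; rewrite big_nil.
by apply: C1_on_eq (C1_onD (H i) IH) => x _; rewrite big_cons.
Qed.

Lemma C1_on_prod (I : Type) (r : seq I) (F : I -> 'rV[R]_n -> R) :
  (forall i, C1_on U (F i)) -> C1_on U (fun x => \prod_(i <- r) F i x).
Proof.
move=> H; elim: r => [|i r IH].
  by apply: C1_on_eq (C1_on_cst 1) => x _; rewrite big_nil.
by apply: C1_on_eq (C1_onM (H i) IH) => x _; rewrite big_cons.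
Qed.

Lemma partial_comp (F : R -> R) dF f x j : is_derive (f x) (1 : R) F dF ->
  differentiable f x -> partial j (F \o f) x = dF * partial j f x.
Proof.
move=> [dF1 dF2] df; have dFd : differentiable F (f x) by apply/derivable1_diffP.
rewrite partialE; last exact: differentiable_comp.
rewrite diff_comp //= -partialE // -[X in 'd F _ X]mulr1 [LHS]linearZ /=.
by rewrite -deriveE // dF2 mulrC.
Qed.

Lemma C1_on_comp (F dF : R -> R) f :
  (forall x, U x -> is_derive (f x) (1 : R) F (dF (f x))) ->
  (forall x, U x -> {for f x, continuous dF}) ->
  C1_on U f -> C1_on U (F \o f).
Proof.
move=> HF HdF Hf.
apply: (@C1_on_intro _ (fun j => (dF \o f) \* partial j f)) => [x|x j|x j] Ux;
  have [df cf] := Hf x Ux.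
- apply: differentiable_comp => //; apply/derivable1_diffP.
  by have [] := HF x Ux.
- by apply: partial_comp => //; exact: HF.
- apply: continuousM => //; apply: continuous_comp; last exact: HdF.
  exact: differentiable_continuous.
Qed.

Lemma C1_onV f : (forall x, U x -> f x != 0) -> C1_on U f -> C1_on U (fun x => (f x)^-1).
Proof.
move=> f0 Hf; apply: (@C1_on_comp _ (fun y => - y ^- 2)) => // x Ux; have := f0 x Ux.
  move=> fx0; split; first exact: derivableV.
  by rewrite (@deriveV R R (fun y : R => y)) // derive_id [_%:A]mulr1.
move=> fx0; apply: continuousN; apply: (@continuousV _ _ (fun y : R => y ^+ 2)) => //.
  by rewrite expf_neq0.
by apply: exprn_continuous.
Qed.

Lemma C1_on_det m (A : 'rV[R]_n -> 'M[R]_m) :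
  (forall i j, C1_on U (fun x => A x i j)) -> C1_on U (fun x => \det (A x)).
Proof.
move=> H; apply: C1_on_sum => s; apply: C1_onZ; apply: C1_on_prod => i; exact: H.
Qed.

Lemma C1_on_adj m (A : 'rV[R]_n -> 'M[R]_m) i j :
  (forall i j, C1_on U (fun x => A x i j)) -> C1_on U (fun x => (\adj (A x)) i j).
Proof.
move=> H; case: m A H i j => [|m] A H i j; first by case: i.
apply: (@C1_on_eq (fun x => (-1) ^+ (j + i) * \det (row' j (col' i (A x))))).
  by move=> x _; rewrite mxE /cofactor.
apply: C1_onZ; apply: C1_on_det => k l.
by apply: C1_on_eq (H (lift j k) (lift i l)) => x _; rewrite !mxE.
Qed.

Lemma C1_on_invmx m (A : 'rV[R]_n -> 'M[R]_m) i j :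
  (forall x, U x -> A x \in unitmx) ->
  (forall i j, C1_on U (fun x => A x i j)) -> C1_on U (fun x => (invmx (A x)) i j).
Proof.
move=> u H.
apply: (@C1_on_eq (fun x => (\det (A x))^-1 * (\adj (A x)) i j)).
  by move=> x Ux; rewrite /invmx u // [in RHS]mxE.
apply: C1_onM; last exact: C1_on_adj.
by apply: C1_onV (C1_on_det H) => x /u; rewrite unitmxE unitfE.
Qed.

End C1_algebra.

Lemma differentiable_rV n m (tau : 'rV[R]_n -> 'rV[R]_m) x :
  (forall j, differentiable (fun z => tau z 0 j) x) -> differentiable tau x.
Proof.
move=> H.
have -> : tau = \sum_(j < m) (fun z => tau z 0 j *: (delta_mx 0 j : 'rV[R]_m)).
  apply/funext => z; rewrite fct_sumE; exact: row_sum_delta.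
apply: differentiable_sum => j; exact: differentiableZl.
Qed.

Lemma jacobianE n m (tau : 'rV[R]_n -> 'rV[R]_m) x i k :
  differentiable tau x -> 'J tau x i k = partial i (fun z => tau z 0 k) x.
Proof.
move=> dt; have dd : derivable tau x (delta_mx 0 i) by exact: diff_derivable.
have := deriveEjacobian (delta_mx 0 i) dt; rewrite -rowE => /rowP/(_ k).
by rewrite [RHS]mxE => <-; rewrite derive_mx // mxE.
Qed.

Definition drow n (h : 'rV[R]_n -> R) x : 'rV[R]_n := \row_j partial j h x.

Lemma diff_drow n (h : 'rV[R]_n -> R) x v : differentiable h x ->
  'd h x v = (v *m (drow h x)^T) 0 0.
Proof.
move=> dh; rewrite {1}(row_sum_delta v) linear_sum /= mxE; apply: eq_bigr => j _.
by rewrite linearZ /= !mxE partialE.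
Qed.

Lemma drow_comp n m (h : 'rV[R]_m -> R) (tau : 'rV[R]_n -> 'rV[R]_m) x :
  differentiable tau x -> differentiable h (tau x) ->
  drow (h \o tau) x = drow h (tau x) *m ('J tau x)^T.
Proof.
move=> dt dh; apply/rowP => j; rewrite mxE partialE; last exact: differentiable_comp.
rewrite diff_comp //= diff_drow //.
rewrite -(trmxK (drow h _ *m _)) trmx_mul !trmxK.
rewrite -[in LHS](deriveE _ dt) deriveEjacobian // -rowE mxE [in RHS]mxE.
by rewrite [in RHS]mxE; apply: eq_bigr => k _; rewrite !mxE.
Qed.

Lemma C1_on_chain n m (U : set 'rV[R]_n) (W : set 'rV[R]_m) (h : 'rV[R]_m -> R)
    (tau : 'rV[R]_n -> 'rV[R]_m) :
  open U -> (forall x, U x -> W (tau x)) ->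
  (forall k, C1_on U (fun x => tau x 0 k)) -> C1_on W h -> C1_on U (h \o tau).
Proof.
move=> oU UW Ht Hh.
have dt x : U x -> differentiable tau x.
  by move=> Ux; apply: differentiable_rV => k; have [] := Ht k x Ux.
have dh x : U x -> differentiable h (tau x) by move=> /UW/Hh[].
apply: (@C1_on_intro _ _ oU _ (fun j x => \sum_k partial k h (tau x) * partial j (fun z => tau z 0 k) x)).
- by move=> x Ux; apply: differentiable_comp; [exact: dt|exact: dh].
- move=> x j Ux; have /rowP/(_ j) := drow_comp (dt x Ux) (dh x Ux).
  rewrite mxE => ->; rewrite mxE; apply: eq_bigr => k _.
  by rewrite [(drow _ _) _ _]mxE [_^T _ _]mxE jacobianE //; exact: dt.
- move=> x j Ux; apply: continuous_at_sum => k; apply: continuousM.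
    apply: (@continuous_comp _ _ _ tau (partial k h)).
      exact/differentiable_continuous/dt.
    by have [_] := Hh _ (UW _ Ux); apply.
  by have [_] := Ht k x Ux; apply.
Qed.

(** A $C^1$ function that vanishes on a half-line and is positive on the other. Bumps, the Huber
    function and the truncation of weights are all built from it. *)
Definition pos2 (a : R) : R := Num.max a 0 ^+ 2.

Lemma pos2_taylor a h : `|pos2 (a + h) - pos2 a - h * (2 * Num.max a 0)| <= h ^+ 2.
Proof.
rewrite /pos2; have [a0|a0] := leP a 0; have [b0|b0] := leP (a + h) 0.
- by rewrite expr0n /= mulr0 mulr0 !subr0 normr0 sqr_ge0.
- by rewrite expr0n /= mulr0 mulr0 !subr0 ger0_norm ?sqr_ge0 // ler_sqr ?nnegrE; lra.
- by rewrite expr0n /= sub0r ler_norml; apply/andP; split; nra.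
- have -> : (a + h) ^+ 2 - a ^+ 2 - h * (2 * a) = h ^+ 2 by ring.
  by rewrite ger0_norm ?sqr_ge0.
Qed.

Lemma is_derive_quadratic (F : R -> R) (a d C : R) : 0 <= C ->
  (forall h, `|F (a + h) - F a - h * d| <= C * h ^+ 2) -> is_derive a (1 : R) F d.
Proof.
move=> C0 H.
have key : (fun h : R => h^-1 *: (F (h *: 1 + a) - F a)) @ 0^' --> d.
  apply/cvgrPdist_le => e e0; near=> h.
  have h0 : h != 0 by near: h; exact: nbhs_dnbhs_neq.
  have hh : 0 < `|h| by rewrite normr_gt0.
  have -> : d - h^-1 *: (F (h *: 1 + a) - F a) = - (h^-1 * (F (a + h) - F a - h * d)).
    by rewrite -[h^-1 *: _]/(h^-1 * _) [h%:A]mulr1 (addrC h); field.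
  rewrite normrN normrM normfV ler_pdivrMl //.
  apply: (le_trans (H h)); rewrite -(real_normK (num_real h)) expr2 mulrCA.
  rewrite ler_pM2l //.
  have : `|h| <= e / (C + 1).
    near: h; apply: nbhs_dnbhs; apply/nbhs_ballP; exists (e / (C + 1)) => /=.
      by rewrite divr_gt0 // ltr_pwDr.
    by move=> y; rewrite /ball /= sub0r normrN => /ltW.
  rewrite ler_pdivlMr ?ltr_pwDr // => ?; nra.
by split; [apply/cvg_ex; exists d | apply/cvg_lim].
Unshelve. all: by end_near. Qed.

Lemma is_derive_pos2 a : is_derive a (1 : R) pos2 (2 * Num.max a 0).
Proof.
apply: (@is_derive_quadratic _ _ _ 1) => // h; rewrite mul1r; exact: pos2_taylor.
Qed.

Lemma max0_continuous : continuous (fun a : R => 2 * Num.max a 0).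
Proof.
move=> a; apply: (@continuousM R R (cst 2) (fun a => Num.max a 0) a); first exact: cst_continuous.
by apply: continuous_max; [exact: cvg_id|exact: cst_continuous].
Qed.

End Calculus.

(** * Metrics, vector fields and functions of class C^1 *)

Section InnerProduct.
Context {R : realType} {n : nat}.
Implicit Types (A : 'M[R]_n) (u v w : 'rV[R]_n).

Definition ip A u v : R := (u *m A *m v^T) 0 0.

Lemma ipDl A u v w : ip A (u + v) w = ip A u w + ip A v w.
Proof. by rewrite /ip !mulmxDl mxE. Qed.
Lemma ipZl A a u w : ip A (a *: u) w = a * ip A u w.
Proof. by rewrite /ip -!scalemxAl mxE. Qed.
Lemma ipDr A u v w : ip A u (v + w) = ip A u v + ip A u w.
Proof. by rewrite /ip linearD /= mulmxDr mxE. Qed.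
Lemma ipZr A a u w : ip A u (a *: w) = a * ip A u w.
Proof. by rewrite /ip linearZ /= -scalemxAr mxE. Qed.
Lemma ipNl A u w : ip A (- u) w = - ip A u w.
Proof. by rewrite -scaleN1r ipZl mulN1r. Qed.
Lemma ipNr A u w : ip A u (- w) = - ip A u w.
Proof. by rewrite -scaleN1r ipZr mulN1r. Qed.
Lemma ip0l A u : ip A 0 u = 0.
Proof. by rewrite /ip !mul0mx mxE. Qed.
Lemma ip0r A u : ip A u 0 = 0.
Proof. by rewrite /ip trmx0 mulmx0 mxE. Qed.
Lemma ipC A u v : A^T = A -> ip A u v = ip A v u.
Proof.
move=> sA; rewrite /ip -[in LHS](trmxK (_ *m _ *m _)) [LHS]mxE.
by rewrite !trmx_mul trmxK sA mulmxA.
Qed.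

Definition posdef A := forall v, v != 0 -> 0 < ip A v v.

Lemma ip_ge0 A v : posdef A -> 0 <= ip A v v.
Proof. by move=> pA; have [->|/pA/ltW//] := eqVneq v 0; rewrite ip0l. Qed.

Lemma posdef_unit A : posdef A -> A \in unitmx.
Proof.
move=> pA; rewrite -row_free_unit; apply: inj_row_free => v vA.
apply/eqP; apply/negP => /negP /pA; rewrite /ip vA mul0mx mxE.
by rewrite ltxx.
Qed.

(* Expand ip A (t u - s v) (t u - s v) >= 0. *)
Lemma ip_young A u v t s : A^T = A -> posdef A ->
  2 * (t * s) * ip A u v <= t ^+ 2 * ip A u u + s ^+ 2 * ip A v v.
Proof.
move=> sA pA; have := @ip_ge0 A (t *: u - s *: v) pA.
rewrite !(ipDl, ipDr, ipNl, ipNr, ipZl, ipZr) (ipC v u sA) => ?; nra.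
Qed.

End InnerProduct.

Lemma mulmx_inv (R : realType) n (A B : 'M[R]_n) :
  A \in unitmx -> B *m A = 1%:M -> B = invmx A.
Proof. by move=> uA BA; rewrite -[B]mulmx1 -(mulmxV uA) mulmxA BA mul1mx. Qed.

Section Manifold.
Context {R : realType} {n : nat} {M : ptopologicalType} (G : riemannian R n M).
Implicit Types (c d : chart G) (x y : 'rV[R]_n) (p : M) (v h : M -> R).

Lemma chart_codP c p : chart_dom c p -> chart_cod c (chart_to c p).
Proof. by move=> cp; exists p. Qed.

Lemma chart_from_dom c x : chart_cod c x -> chart_dom c (chart_from c x).
Proof. by move=> [p cp <-]; rewrite chart_toK. Qed.

Lemma chart_fromK c x : chart_cod c x -> chart_to c (chart_from c x) = x.
Proof. by move=> [p cp <-]; rewrite chart_toK. Qed.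

Lemma chart_dom_near c p : chart_dom c p -> \forall q \near p, chart_dom c q.
Proof. by move=> cp; exact: (open_nbhs_nbhs (conj (chart_dom_open c) cp)). Qed.

Lemma chart_cod_near c x : chart_cod c x -> \forall y \near x, chart_cod c y.
Proof. by move=> cp; exact: (open_nbhs_nbhs (conj (@chart_cod_open _ _ _ _ c) cp)). Qed.

Definition overlap c d : set 'rV[R]_n := chart_cod c `&` chart_from c @^-1` chart_dom d.
Definition trans c d : 'rV[R]_n -> 'rV[R]_n := fun z => chart_to d (chart_from c z).

Lemma overlap_open c d : open (overlap c d).
Proof.
rewrite openE => x [cx dx]; apply: filterI; first exact: chart_cod_near.
exact: (chart_from_cont cx (chart_dom_near dx)).
Qed.

Lemma trans_C1 c d k : C1_on (overlap c d) (fun x => trans c d x 0 k).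
Proof. exact: (C1_of_Ck (@overlap_open c d) (chart_compat c d k 1)). Qed.

Lemma trans_diff c d x : overlap c d x -> differentiable (trans c d) x.
Proof. by move=> ox; apply: differentiable_rV => j; have [] := trans_C1 j ox. Qed.

Lemma trans_cod c d x : overlap c d x -> chart_cod d (trans c d x).
Proof. by move=> [_]; exact: chart_codP. Qed.

Lemma metric_posdef c x : chart_cod c x -> posdef (metric c x).
Proof. by move=> cx v v0; exact: metric_pos. Qed.

Lemma metric_unit c x : chart_cod c x -> metric c x \in unitmx.
Proof. by move=> /metric_posdef/posdef_unit. Qed.

Lemma metric_trans c d x : overlap c d x ->
  metric c x = 'J (trans c d) x *m metric d (trans c d x) *m ('J (trans c d) x)^T.
Proof. by move=> [? ?]; exact: metric_compat. Qed.

Lemma trans_unit c d x : overlap c d x -> 'J (trans c d) x \in unitmx.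
Proof.
move=> ox; have := metric_unit ox.1; rewrite (metric_trans ox).
by rewrite !unitmx_mul => /andP[/andP[]].
Qed.

Definition C1M v := forall c, C1_on (chart_cod c) (v \o chart_from c).

Lemma C1M_Ck k v : Ck G k.+1 v -> C1M v.
Proof. by move=> H c; apply: C1_of_Ck (H c); exact: chart_cod_open. Qed.

Lemma C1M_smooth v : smooth G v -> C1M v.
Proof. by move=> /(_ 1)/C1M_Ck. Qed.

Lemma C1M_cont v : C1M v -> continuous v.
Proof.
move=> H p; have cp := chart_atP G p; set c := chart_at G p in cp.
have [df _] := H c _ (chart_codP cp).
apply: (@continuous_near_eq _ _ _ ((v \o chart_from c) \o chart_to c)).
  by apply: filterS (chart_dom_near cp) => q cq /=; rewrite chart_toK.
apply: continuous_comp; first exact: chart_to_cont.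
exact: differentiable_continuous.
Qed.

Lemma near_trans v c d x : overlap c d x ->
  \forall y \near x, (v \o chart_from c) y = ((v \o chart_from d) \o trans c d) y.
Proof.
move=> ox; have := open_nbhs_nbhs (conj (@overlap_open c d) ox).
by apply: filterS => y [_ dy] /=; rewrite /trans chart_toK.
Qed.

Lemma near_eq_drow (f g : 'rV[R]_n -> R) x : (\forall y \near x, f y = g y) -> drow f x = drow g x.
Proof. by move=> fg; apply/rowP => j; rewrite !mxE (near_eq_partial _ fg). Qed.

Lemma drow_trans v c d x : C1M v -> overlap c d x ->
  drow (v \o chart_from c) x = drow (v \o chart_from d) (trans c d x) *m ('J (trans c d) x)^T.
Proof.
move=> Hv ox; rewrite (near_eq_drow (near_trans v ox)) drow_comp //.
  exact: trans_diff.
by have [] := Hv d _ (trans_cod ox).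
Qed.

(** A [vfield] is an arbitrary family of local expressions; this is the transformation rule, for row
    vectors, that makes it a tangent field. *)
Definition vf_compat (Y : vfield G) := forall c d x, overlap c d x ->
  Y d (trans c d x) = Y c x *m 'J (trans c d) x.
Definition vf_cont (Y : vfield G) := forall c x j, chart_cod c x ->
  {for x, continuous (fun z => Y c z 0 j)}.
Definition vf_C1 (Y : vfield G) := forall c j, C1_on (chart_cod c) (fun z => Y c z 0 j).

Lemma vf_C1_cont Y : vf_C1 Y -> vf_cont Y.
Proof. by move=> H c x j cx; exact: C1_on_cont (H c j) cx. Qed.

Lemma gradE h c x : grad (G := G) h c x = drow (h \o chart_from c) x *m invmx (metric c x).
Proof. by []. Qed.

Lemma invmx_sym c x : chart_cod c x -> (invmx (metric c x))^T = invmx (metric c x).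
Proof. by move=> cx; rewrite trmx_inv Defs.metric_sym. Qed.

(** The differential transforms by the transposed Jacobian and the inverse metric by the inverse
    congruence. The transposed factors cancel and one inverse Jacobian remains. *)
Lemma grad_compat h : C1M h -> vf_compat (grad h).
Proof.
move=> Hh c d x ox; rewrite !gradE (drow_trans Hh ox).
have uJ := trans_unit ox; have ud := metric_unit (trans_cod ox).
rewrite (metric_trans ox); set J := 'J _ _ in uJ *; set g := metric d _ in ud *.
have -> : invmx (J *m g *m J^T) = invmx J^T *m invmx g *m invmx J.
  have uT : J^T \in unitmx by rewrite unitmx_tr.
  have uA : J *m g *m J^T \in unitmx by rewrite !unitmx_mul uJ ud uT.
  apply/esym/mulmx_inv => //; by rewrite !mulmxA mulmxKV // mulmxKV // mulVmx.
have uT : J^T \in unitmx by rewrite unitmx_tr.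
by rewrite !mulmxA mulmxK // mulmxKV.
Qed.

Lemma invmx_C1 c i j : C1_on (chart_cod c) (fun x => invmx (metric c x) i j).
Proof.
apply: C1_on_invmx; first exact: chart_cod_open.
  by move=> x; exact: metric_unit.
by move=> k l; apply: (C1_of_Ck (k := 0)); [exact: chart_cod_open|exact: metric_smooth].
Qed.

Lemma grad_entry h c x j :
  grad (G := G) h c x 0 j = \sum_i partial i (h \o chart_from c) x * invmx (metric c x) i j.
Proof. by rewrite gradE mxE; apply: eq_bigr => i _; rewrite mxE. Qed.

Lemma grad_cont h : C1M h -> vf_cont (grad h).
Proof.
move=> Hh c x j cx.
have -> : (fun z => grad (G := G) h c z 0 j) = (fun z => \sum_i partial i (h \o chart_from c) z * invmx (metric c z) i j).
  by apply/funext => z; exact: grad_entry.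
apply: continuous_at_sum => i; apply: continuousM.
  by have [_] := Hh c x cx; apply.
exact: C1_on_cont (invmx_C1 i j) cx.
Qed.

Lemma grad_C1 k h : Ck G k.+2 h -> vf_C1 (grad h).
Proof.
move=> Hh c j; have oc := @chart_cod_open _ _ _ _ c.
apply: (C1_on_eq oc (f := fun z => \sum_i partial i (h \o chart_from c) z * invmx (metric c z) i j)).
  by move=> z _; rewrite grad_entry.
apply: C1_on_sum => // i; apply: C1_onM => //; last exact: invmx_C1.
by have [_ /(_ i)[_]] := Hh c; exact: C1_of_Ck.
Qed.

(* The derivative of v along Y. *)
Definition pair v (Y : vfield G) p : R :=
  let c := chart_at G p in let x := chart_to c p in
  (Y c x *m (drow (v \o chart_from c) x)^T) 0 0.

Lemma pair_trans v Y c d x : C1M v -> vf_compat Y -> overlap c d x ->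
  Y c x *m (drow (v \o chart_from c) x)^T =
  Y d (trans c d x) *m (drow (v \o chart_from d) (trans c d x))^T.
Proof. by move=> Hv HY ox; rewrite (drow_trans Hv ox) trmx_mul trmxK mulmxA -HY. Qed.

Lemma overlap_to c d p : chart_dom c p -> chart_dom d p -> overlap c d (chart_to c p).
Proof. by move=> cp dp; split; [exact: chart_codP|rewrite /= chart_toK]. Qed.

Lemma trans_to c d p : chart_dom c p -> trans c d (chart_to c p) = chart_to d p.
Proof. by move=> cp; rewrite /trans chart_toK. Qed.

Lemma pair_mxE v Y c p : C1M v -> vf_compat Y -> chart_dom c p ->
  pair v Y p = (Y c (chart_to c p) *m (drow (v \o chart_from c) (chart_to c p))^T) 0 0.
Proof.
move=> Hv HY cp; rewrite /pair.
rewrite (pair_trans Hv HY (overlap_to (chart_atP G p) cp)) trans_to //.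
exact: chart_atP.
Qed.

Lemma pairE v Y c p : C1M v -> vf_compat Y -> chart_dom c p ->
  pair v Y p = \sum_j Y c (chart_to c p) 0 j * partial j (v \o chart_from c) (chart_to c p).
Proof.
move=> Hv HY cp; rewrite (pair_mxE Hv HY cp) mxE; apply: eq_bigr => j _.
by rewrite !mxE.
Qed.

Lemma pair_cont v Y : C1M v -> vf_compat Y -> vf_cont Y -> continuous (pair v Y).
Proof.
move=> Hv HY Yc p; have cp := chart_atP G p; set c := chart_at G p in cp.
apply: (@continuous_near_eq _ _ _ ((fun x => \sum_j Y c x 0 j * partial j (v \o chart_from c) x) \o chart_to c)).
  by apply: filterS (chart_dom_near cp) => q cq /=; rewrite (pairE Hv HY cq).
apply: continuous_comp; first exact: chart_to_cont.
apply: continuous_at_sum => j; apply: continuousM; first exact: Yc (chart_codP cp).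
by have [_] := Hv c _ (chart_codP cp); apply.
Qed.

(** The carre du champ $g(\nabla_g v,\nabla_g h)$, written as the derivative of [v] along
    [grad h]. *)
Definition carre v h : M -> R := pair v (grad h).

Lemma Gam_mxE v h c p : C1M v -> C1M h -> chart_dom c p ->
  carre v h p = ip (invmx (metric c (chart_to c p))) (drow (v \o chart_from c) (chart_to c p))
                 (drow (h \o chart_from c) (chart_to c p)).
Proof.
move=> Hv Hh cp; rewrite /carre (pair_mxE Hv (grad_compat Hh) cp) gradE.
by apply: ipC; exact/invmx_sym/chart_codP.
Qed.

Lemma Gam_cont v h : C1M v -> C1M h -> continuous (carre v h).
Proof. by move=> Hv Hh; apply: pair_cont Hv (grad_compat Hh) (grad_cont Hh). Qed.

Lemma invmx_posdef c x : chart_cod c x -> posdef (invmx (metric c x)).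
Proof.
move=> cx w w0; have u := metric_unit cx.
have := @metric_pos _ _ _ G c x (w *m invmx (metric c x)) cx.
rewrite mulmxKV // trmx_mul invmx_sym // /ip mulmxA; apply.
by apply: contra_neq w0 => E; rewrite -(mulmxKV u w) E mul0mx.
Qed.

Lemma GamC v h p : C1M v -> C1M h -> carre v h p = carre h v p.
Proof.
move=> Hv Hh; have cp := chart_atP G p.
rewrite (Gam_mxE Hv Hh cp) (Gam_mxE Hh Hv cp).
by apply: ipC; exact/invmx_sym/chart_codP.
Qed.

Lemma Gam_ge0 v p : C1M v -> 0 <= carre v v p.
Proof.
by move=> Hv; rewrite (Gam_mxE Hv Hv (chart_atP G p)); exact/ip_ge0/invmx_posdef/chart_codP/chart_atP.
Qed.

(** Cauchy-Schwarz with free real parameters [t] and [s]; opposite signs give the bound from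
    below. *)
Lemma Gam_young v h p t s : C1M v -> C1M h ->
  2 * (t * s) * carre v h p <= t ^+ 2 * carre v v p + s ^+ 2 * carre h h p.
Proof.
move=> Hv Hh; have cp := chart_atP G p; rewrite !(Gam_mxE _ _ cp) //.
have := chart_codP cp.
by move=> cc; apply: ip_young; [exact: invmx_sym|exact: invmx_posdef].
Qed.

Lemma C1M_cst a : C1M (cst a).
Proof. by move=> c; apply: (C1_on_cst (@chart_cod_open _ _ _ _ c)). Qed.

Lemma C1MD v h : C1M v -> C1M h -> C1M (fun p => v p + h p).
Proof. by move=> Hv Hh c; exact: (C1_onD (@chart_cod_open _ _ _ _ c) (Hv c) (Hh c)). Qed.

Lemma C1MM v h : C1M v -> C1M h -> C1M (fun p => v p * h p).
Proof. by move=> Hv Hh c; exact: (C1_onM (@chart_cod_open _ _ _ _ c) (Hv c) (Hh c)). Qed.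

Lemma C1MZ a v : C1M v -> C1M (fun p => a * v p).
Proof. by move=> Hv; apply: (C1MM (C1M_cst a)). Qed.

Lemma C1M_sum (I : Type) (r : seq I) (F : I -> M -> R) :
  (forall i, C1M (F i)) -> C1M (fun p => \sum_(i <- r) F i p).
Proof. by move=> H c; apply: (C1_on_sum (@chart_cod_open _ _ _ _ c)) => i; exact: H. Qed.

Lemma C1M_comp (F dF : R -> R) v :
  (forall p, is_derive (v p) (1 : R) F (dF (v p))) ->
  (forall p, {for v p, continuous dF}) -> C1M v -> C1M (F \o v).
Proof.
move=> HF HdF Hv c.
by apply: (C1_on_comp (F := F) (dF := dF) (@chart_cod_open _ _ _ _ c) _ _ (Hv c)) => x _; exact: HdF.
Qed.

Lemma C1MV v : (forall p, v p != 0) -> C1M v -> C1M (fun p => (v p)^-1).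
Proof. by move=> v0 Hv c; apply: (C1_onV (@chart_cod_open _ _ _ _ c) _ (Hv c)) => x _; exact: v0. Qed.

Lemma C1M_diff v c p : C1M v -> chart_dom c p ->
  differentiable (v \o chart_from c) (chart_to c p).
Proof. by move=> Hv cp; have [] := Hv c _ (chart_codP cp). Qed.

Section PairRules.
Variables (Y : vfield G) (HY : vf_compat Y).

Lemma pairD v h p : C1M v -> C1M h -> pair (fun q => v q + h q) Y p = pair v Y p + pair h Y p.
Proof.
move=> Hv Hh; have cp := chart_atP G p; rewrite !(pairE _ HY cp) //; last exact: C1MD.
rewrite -big_split /=; apply: eq_bigr => j _; rewrite -mulrDr; congr (_ * _).
by apply: partialD; exact: C1M_diff.
Qed.

Lemma pairM v h p : C1M v -> C1M h ->
  pair (fun q => v q * h q) Y p = v p * pair h Y p + h p * pair v Y p.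
Proof.
move=> Hv Hh; have cp := chart_atP G p; rewrite !(pairE _ HY cp) //; last exact: C1MM.
rewrite !mulr_sumr -big_split /=; apply: eq_bigr => j _.
have := @partialM _ _ (v \o chart_from (chart_at G p)) (h \o chart_from (chart_at G p)) _ j (C1M_diff Hv cp) (C1M_diff Hh cp).
rewrite /= chart_toK // => E; rewrite -[partial j _ _]/(partial j (_ \* _) _) E; ring.
Qed.

Lemma pair_comp (F : R -> R) dF v p : is_derive (v p) (1 : R) F dF ->
  C1M v -> C1M (F \o v) -> pair (F \o v) Y p = dF * pair v Y p.
Proof.
move=> HF Hv HFv; have cp := chart_atP G p; rewrite !(pairE _ HY cp) //.
rewrite mulr_sumr; apply: eq_bigr => j _.
have -> : partial j ((F \o v) \o chart_from (chart_at G p)) (chart_to (chart_at G p) p) =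
   dF * partial j (v \o chart_from (chart_at G p)) (chart_to (chart_at G p) p).
  by apply: (@partial_comp _ _ F dF (v \o _)); [rewrite /= chart_toK|exact: C1M_diff].
by rewrite mulrCA.
Qed.

Lemma pair_cst a p : pair (cst a) Y p = 0.
Proof.
rewrite (pairE (C1M_cst a) HY (chart_atP G p)) big1 // => j _.
by rewrite /partial derive_cst mulr0.
Qed.

Lemma pairZ a v p : C1M v -> pair (fun q => a * v q) Y p = a * pair v Y p.
Proof. by move=> Hv; rewrite (pairM p (C1M_cst a) Hv) pair_cst mulr0 addr0. Qed.

Lemma pair_sum (I : Type) (r : seq I) (F : I -> M -> R) p : (forall i, C1M (F i)) ->
  pair (fun q => \sum_(i <- r) F i q) Y p = \sum_(i <- r) pair (F i) Y p.
Proof.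
move=> H; elim: r => [|i r IH].
  rewrite big_nil; have -> : (fun q => \sum_(i <- [::]) F i q) = cst 0.
    by apply/funext => q; rewrite big_nil.
  exact: pair_cst.
have -> : (fun q => \sum_(j <- i :: r) F j q) = (fun q => F i q + \sum_(j <- r) F j q).
  by apply/funext => q; rewrite big_cons.
by rewrite pairD ?big_cons ?IH //; exact: C1M_sum.
Qed.

Lemma pair_scale h v p : C1M h -> C1M v -> pair v (scale_vfield h Y) p = h p * pair v Y p.
Proof.
move=> Hh Hv; rewrite /pair /scale_vfield chart_toK; last exact: chart_atP.
by rewrite -scalemxAl mxE.
Qed.

Lemma scale_compat h : vf_compat (scale_vfield h Y).
Proof.
move=> c d x ox; rewrite /scale_vfield HY // -scalemxAl; congr (h _ *: _).
by rewrite /trans chart_toK //; case: ox.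
Qed.

Lemma scale_C1 h : C1M h -> vf_C1 Y -> vf_C1 (scale_vfield h Y).
Proof.
move=> Hh HYc c j; have oc := @chart_cod_open _ _ _ _ c.
by apply: (C1_on_eq oc _ (C1_onM oc (Hh c) (HYc c j))) => z _; rewrite mxE.
Qed.

End PairRules.

Lemma pair_near v h Y p : (\forall q \near p, v q = h q) -> pair v Y p = pair h Y p.
Proof.
move=> vh; rewrite /pair; have cp := chart_atP G p; set c := chart_at G p in cp *.
congr ((_ *m _^T) 0 0); apply: near_eq_drow.
have := chart_from_cont (chart_codP cp); rewrite /prop_for /continuous_at (chart_toK cp) => H.
exact: (H _ vh).
Qed.

Section Extension.
Hypothesis M_hausdorff : hausdorff_space M.

Definition ext c (F : 'rV[R]_n -> R) (k : R) p : R :=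
  if `[< chart_dom c p >] then F (chart_to c p) else k.

Lemma extE c F k p : chart_dom c p -> ext c F k p = F (chart_to c p).
Proof. by move=> cp; rewrite /ext asboolT. Qed.

Lemma chart_compact c (K : set 'rV[R]_n) : compact K -> K `<=` chart_cod c ->
  compact (chart_from c @` K).
Proof.
move=> cK KC; apply: continuous_compact => //.
by apply: continuous_in_subspaceT => x /set_mem/KC; exact: chart_from_cont.
Qed.

Lemma ext_near_out c F k (K : set 'rV[R]_n) p : compact K -> K `<=` chart_cod c ->
  (forall x, chart_cod c x -> ~ K x -> F x = k) -> ~ (chart_from c @` K) p ->
  \forall q \near p, ext c F k q = k.
Proof.
move=> cK KC HF nK.
have clK := compact_closed M_hausdorff (chart_compact cK KC).
have : nbhs p (~` (chart_from c @` K)).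
  by apply: open_nbhs_nbhs; split=> //; exact: closed_openC.
apply: filterS => q nq; rewrite /ext; case: asboolP => // cq.
apply: HF; first exact: chart_codP.
by move=> Kq; apply: nq; exists (chart_to c q) => //; rewrite chart_toK.
Qed.

(** The image of the compact set is closed because the manifold is Hausdorff, so a point outside it
    has a neighbourhood on which the extension is constant. At the other points the transition map
    and the chain rule apply. *)
Lemma C1M_ext c F k (K : set 'rV[R]_n) : compact K -> K `<=` chart_cod c ->
  (forall x, chart_cod c x -> ~ K x -> F x = k) -> C1_on (chart_cod c) F ->
  C1M (ext c F k).
Proof.
move=> cK KC HF CF d x dx.
have [Kx|nKx] := pselect ((chart_from c @` K) (chart_from d x)).
  have ox : overlap d c x by split=> //; case: Kx => y /KC cy E; rewrite /= -E; exact: chart_from_dom.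
  have H : C1_on (overlap d c) (F \o trans d c).
    apply: (C1_on_chain (@overlap_open d c) _ _ CF); first by move=> y; exact: trans_cod.
    by move=> j; exact: trans_C1.
  apply: C1_at_near (H x ox).
  have := open_nbhs_nbhs (conj (@overlap_open d c) ox).
  by apply: filterS => y [_ cy]; rewrite /= extE.
have := ext_near_out cK KC HF nKx.
move=> /(chart_from_cont dx) N.
apply: (C1_at_near _ (C1_on_cst (@chart_cod_open _ _ _ _ d) k dx)).
have {}N : \forall y \near x, ext c F k (chart_from d y) = k by exact: N.
by apply: filterS N => y /= E; rewrite E.
Qed.

End Extension.

End Manifold.

(** * Integrals of nonnegative, possibly non-measurable functions *)

(* The integral of a nonnegative, possibly non-measurable function is its lower integral. *)
Section LowerIntegral.
Local Open Scope ereal_scope.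
Context d (T : measurableType d) (R : realType) (mu : {measure set T -> \bar R}).

(** The integral of a nonnegative function is a supremum over its simple minorants, of which only
    measurability, sign and support are retained. *)
Lemma lower_integral_le (D : set T) (f : T -> \bar R) (c : \bar R) :
  (forall x, D x -> 0 <= f x) ->
  (forall h : T -> R, measurable_fun setT h -> (forall x, (0 <= h x)%R) ->
     (forall x, ~ D x -> h x = 0%R) -> (forall x, D x -> (h x)%:E <= f x) -> \int[mu]_x (h x)%:E <= c) ->
  \int[mu]_(x in D) f x <= c.
Proof.
move=> f0 H; rewrite integral_mkcond ge0_integralTE; last by move=> x; exact: erestrict_ge0.
apply: ub_ereal_sup => _ [h hf <-]; rewrite -integralT_nnsfun; apply: H => // x Dx.
  apply/eqP; rewrite eq_le fun_ge0 andbT -lee_fin; have := hf x.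
  by rewrite patchE memNset.
by have := hf x; rewrite patchE mem_set.
Qed.

Lemma le_lower_integral (D : set T) (f g : T -> \bar R) :
  (forall x, D x -> 0 <= f x) -> (forall x, D x -> f x <= g x) ->
  \int[mu]_(x in D) f x <= \int[mu]_(x in D) g x.
Proof.
move=> f0 fg.
have g0 x : D x -> 0 <= g x by move=> Dx; apply: le_trans (f0 _ Dx) (fg _ Dx).
rewrite integral_mkcond [leRHS]integral_mkcond !ge0_integralTE;
  try by move=> x; exact: erestrict_ge0.
apply: ub_ereal_sup => _ [h hf <-]; apply: ereal_sup_ubound; exists h => // x.
apply: (le_trans (hf x)); rewrite !patchE; case: ifPn => //.
by rewrite inE => /fg.
Qed.

(** A sum of simple minorants is a simple minorant of the sum; without measurability the reverse
    inequality can fail. The infinite cases are set apart because the two suprema are taken one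
    after the other by subtraction. *)
Lemma lower_integralD_ge (f g : T -> \bar R) :
  (forall x, 0 <= f x) -> (forall x, 0 <= g x) ->
  \int[mu]_x f x + \int[mu]_x g x <= \int[mu]_x (f x + g x).
Proof.
move=> f0 g0.
pose NN (u : T -> \bar R) := ereal_sup [set sintegral mu h | h in [set h : {nnsfun T >-> R} | forall x, (h x)%:E <= u x]].
have NE u : (forall x, 0 <= u x) -> \int[mu]_x u x = NN u by move=> u0; exact: ge0_integralTE.
rewrite (NE f f0) (NE g g0) (NE (fun x => f x + g x)); last by move=> x; exact: adde_ge0.
set S := NN (fun x => f x + g x).
have key (h1 h2 : {nnsfun T >-> R}) : (forall x, (h1 x)%:E <= f x) -> (forall x, (h2 x)%:E <= g x) ->
   sintegral mu h1 + sintegral mu h2 <= S.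
  move=> H1 H2; rewrite -sintegralD; apply: ereal_sup_ubound.
  by exists (add_nnsfun h1 h2) => // x /=; rewrite EFinD leeD.
have [E|gfin] := eqVneq S +oo; first by rewrite E leey.
have k1 (h2 : {nnsfun T >-> R}) : (forall x, (h2 x)%:E <= g x) -> NN f + sintegral mu h2 <= S.
  move=> H2; have h2f : sintegral mu h2 \is a fin_num.
    rewrite ge0_fin_numE ?sintegral_ge0 //; apply: (@le_lt_trans _ _ (S : \bar R)); last by rewrite ltey.
    by have := key (@nnsfun0 _ T R) h2 (fun x => f0 x) H2; rewrite sintegral0 add0e.
  rewrite -leeBrDr //; apply: ub_ereal_sup => _ [h1 H1 <-].
  by rewrite leeBrDr //; exact: key.
have Sff : NN f \is a fin_num.
  rewrite ge0_fin_numE; last by rewrite -NE //; exact: integral_ge0.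
  apply: (@le_lt_trans _ _ (S : \bar R)); last by rewrite ltey.
  by have := k1 (@nnsfun0 _ T R) (fun x => g0 x); rewrite sintegral0 adde0.
rewrite addeC -leeBrDr //; apply: ub_ereal_sup => _ [h2 H2 <-].
by rewrite leeBrDr // addeC; exact: k1.
Qed.

Lemma lower_integralZ_ge (k : R) (f : T -> \bar R) : (0 < k)%R ->
  (forall x, 0 <= f x) -> k%:E * \int[mu]_x f x <= \int[mu]_x (k%:E * f x).
Proof.
move=> k0 f0; rewrite muleC -lee_pdivlMr //.
apply: lower_integral_le => // h mh h0 _ hf.
have mE : measurable_fun setT (EFin \o h) by exact/measurable_EFinP.
have := @ge0_integralZl_EFin _ _ _ mu _ measurableT (EFin \o h) (fun x _ => h0 x) mE k (ltW k0).
rewrite lee_pdivlMr // muleC => <-.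
apply: le_lower_integral => [x _|x _]; first by rewrite mule_ge0 // lee_fin // ltW.
by rewrite lee_pmul2l // hf.
Qed.

End LowerIntegral.

(** * Translation invariance of lower integrals on the line *)

Section Translation.
Local Open Scope ereal_scope.
Context {R : realType}.
Notation la := (@lebesgue_measure R).

Lemma shift_measurable (a : R) : measurable_fun [set: R] (fun t : R => (t + a)%R).
Proof. by apply: measurable_funD => //; exact: measurable_id. Qed.

Lemma lebesgue_shift (a : R) (A : set R) : measurable A ->
  la ((fun t : R => (t + a)%R) @^-1` A) = la A.
Proof.
move=> mA; apply/esym.
apply: (@lebesgue_measure_unique R (pushforward la (fun t : R => (t + a)%R : measurableTypeR R))) mA.
  exact: shift_measurable.
move=> ? X [[x y] _ <-] /=; rewrite /pushforward.
have -> : (fun t : R => (t + a)%R) @^-1` `]x, y]%classic = `](x - a)%R, (y - a)%R]%classic.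
  by apply/seteqP; split=> t; rewrite /= !in_itv/= ltrBlDr lerBrDr.
by rewrite !lebesgue_measure_itv/= !lte_fin ltrD2r; case: ifP => // _; rewrite -!EFinB; congr (_%:E); ring.
Qed.

Lemma ge0_integral_shift_meas (a : R) (f : R -> \bar R) : measurable_fun setT f ->
  (forall t, 0 <= f t) -> \int[la]_t f (t + a)%R = \int[la]_t f t.
Proof.
move=> mf f0; pose sh (t : R) : measurableTypeR R := (t + a)%R.
have -> : \int[la]_t f (t + a)%R = \int[la]_(t in sh @^-1` setT) (f \o sh) t by rewrite preimage_setT.
rewrite -ge0_integral_pushforward //=; last exact: shift_measurable.
apply: (eq_measure_integral la); first exact: shift_measurable.
by move=> ? A mA _; exact: lebesgue_shift.
Qed.

Lemma ge0_integral_shift_le (a : R) (f : R -> \bar R) :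
  (forall t, 0 <= f t) -> \int[la]_t f (t + a)%R <= \int[la]_t f t.
Proof.
move=> f0; apply: lower_integral_le => // h mh h0 _ hf.
have mE : measurable_fun setT (EFin \o h) by exact/measurable_EFinP.
rewrite -(@ge0_integral_shift_meas (- a) _ mE (fun t => h0 t)).
apply: le_lower_integral => t _; first by rewrite lee_fin.
by have := hf (t - a)%R I; rewrite subrK.
Qed.

(** Minorants only give an inequality; applied to the inverse translation it becomes an equality. *)
Lemma ge0_integral_shift (a : R) (f : R -> \bar R) :
  (forall t, 0 <= f t) -> \int[la]_t f (t + a)%R = \int[la]_t f t.
Proof.
move=> f0; apply/eqP; rewrite eq_le ge0_integral_shift_le //=.
have := @ge0_integral_shift_le (- a) (fun t => f (t + a)%R) (fun t => f0 _).
by under eq_integral do rewrite subrK.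
Qed.

End Translation.

(** * Iterated lower integrals over R^n *)

Section IteratedIntegral.
Local Open Scope ereal_scope.
Context {R : realType}.
Notation la := (@lebesgue_measure R).

Lemma irv_ge0 n (h : 'rV[R]_n -> \bar R) : (forall x, 0 <= h x) -> 0 <= integral_rV h.
Proof.
elim: n h => [|n IH] h h0 /=; first exact: h0.
by apply: integral_ge0 => t _; apply: IH.
Qed.

Lemma le_irv n (h g : 'rV[R]_n -> \bar R) : (forall x, 0 <= h x) -> (forall x, h x <= g x) ->
  integral_rV h <= integral_rV g.
Proof.
elim: n h g => [|n IH] h g h0 hg /=; first exact: hg.
by apply: le_lower_integral => t _; [apply: irv_ge0|apply: IH].
Qed.

Lemma rowcat0 n (t : R) (x : 'rV[R]_n) :
  (row_mx (const_mx t : 'rV[R]_1) x : 'rV[R]_n.+1) 0%R (lshift n (ord0 : 'I_1) : 'I_n.+1) = t.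
Proof. by have := @row_mxEl _ 1 1 n (const_mx t : 'rV[R]_1) x 0%R ord0; rewrite [X in _ = X -> _]mxE; exact. Qed.

Lemma rowcatS n (t : R) (x : 'rV[R]_n) i :
  (row_mx (const_mx t : 'rV[R]_1) x : 'rV[R]_n.+1) 0%R (rshift 1 i : 'I_n.+1) = x 0%R i.
Proof. exact: (@row_mxEr _ 1 1 n (const_mx t : 'rV[R]_1) x 0%R i). Qed.

Lemma irv_shift n (h : 'rV[R]_n -> \bar R) (a : 'rV[R]_n) : (forall x, 0 <= h x) ->
  integral_rV (fun x => h (x + a)%R) = integral_rV h.
Proof.
elim: n h a => [|n IH] h a h0 /=; first by rewrite [a]thinmx0 addr0.
rewrite -[RHS](@ge0_integral_shift _ (a 0%R (lshift n (ord0 : 'I_1)))); last first.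
  by move=> t; exact: irv_ge0.
apply: eq_integral => t _.
rewrite -[RHS](IH _ (@rsubmx _ 1 1 n a)) //; congr (integral_rV _); apply/funext => x; congr (h _).
apply/rowP => j; rewrite mxE; case: (@split_ordP 1 n j) => i ->.
  by rewrite ord1 !rowcat0.
by rewrite !rowcatS !mxE.
Qed.

(** The slices of an iterated integral are not known to be measurable, so superadditivity stands in
    for additivity. [chart_integral] recovers an equality for bounded measurable functions supported
    in a chart. *)
Lemma irvD_ge n (f g : 'rV[R]_n -> \bar R) :
  (forall x, 0 <= f x) -> (forall x, 0 <= g x) ->
  integral_rV f + integral_rV g <= integral_rV (fun x => f x + g x).
Proof.
elim: n f g => [|n IH] f g f0 g0 //=.
apply: le_trans.
  by apply: lower_integralD_ge => t; exact: irv_ge0.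
by apply: le_lower_integral => t _; [apply: adde_ge0; exact: irv_ge0|apply: IH].
Qed.

Lemma irvZ_ge n (k : R) (f : 'rV[R]_n -> \bar R) : (0 < k)%R ->
  (forall x, 0 <= f x) -> k%:E * integral_rV f <= integral_rV (fun x => k%:E * f x).
Proof.
move=> k0; elim: n f => [|n IH] f f0 //=.
apply: le_trans.
  by apply: lower_integralZ_ge => // t; exact: irv_ge0.
apply: le_lower_integral => t _; last exact: IH.
by apply: mule_ge0; [rewrite lee_fin ltW|exact: irv_ge0].
Qed.

Lemma irv0 n : integral_rV (fun _ : 'rV[R]_n => 0) = 0.
Proof. by elim: n => //= n IH; under eq_integral do rewrite IH; exact: integral0. Qed.

Definition cube n (x0 : 'rV[R]_n) (r : R) (x : 'rV[R]_n) : Prop :=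
  forall j, (`|x 0 j - x0 0 j| <= r)%R.

Lemma irv_cube n (x0 : 'rV[R]_n) (r k : R) : (0 <= r)%R -> (0 <= k)%R ->
  integral_rV (fun x => if `[< cube x0 r x >] then k%:E else 0) = (k * (2 * r) ^+ n)%:E.
Proof.
move=> r0 k0; elim: n x0 => [|n IH] x0 /=.
  by rewrite expr0 mulr1; case: asboolP => // -[] [].
pose a : R := x0 0%R (lshift n (ord0 : 'I_1)).
rewrite (@eq_integral _ _ _ la setT (fun t => ((k * (2 * r) ^+ n)%:E * (\1_(`[(a - r)%R, (a + r)%R]%classic : set R) t)%:E))); last first.
  move=> t _; rewrite -(IH (@rsubmx _ 1 1 n x0)) indicE.
  have E x : cube x0 r (@row_mx _ 1 1 n (const_mx t) x) <-> (`|t - a| <= r)%R /\ cube (@rsubmx _ 1 1 n x0) r x.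
    split=> [H|[H1 H2] j].
      split; first by have := H (lshift n (ord0 : 'I_1)); rewrite rowcat0.
      by move=> j; have := H (rshift 1 j); rewrite rowcatS !mxE.
    case: (@split_ordP 1 n j) => i ->; first by rewrite ord1 rowcat0.
    by have := H2 i; rewrite rowcatS mxE.
  have [ti|ti] := boolP (t \in (`[(a - r)%R, (a + r)%R]%classic : set R)).
    rewrite mule1; congr (integral_rV _); apply/funext => x.
    move: ti; rewrite inE /= in_itv/= -ler_distlC distrC => ti.
    by congr (if _ then _ else _); apply/asbool_equiv_eq; rewrite E; tauto.
  rewrite mule0 -[RHS](irv0 n); congr (integral_rV _); apply/funext => x.
  case: asboolP => // /E[ta _]; exfalso; apply: (negP ti).
  by rewrite inE /= in_itv/= -ler_distlC distrC.
rewrite ge0_integralZl_EFin //; last 2 first.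
- exact/measurable_EFinP/measurable_indic.
- by rewrite mulr_ge0 // exprn_ge0 // mulr_ge0.
have -> : \int[la]_x (\1_(`[(a - r)%R, (a + r)%R]%classic : set R) x)%:E = la (`[(a - r)%R, (a + r)%R]%classic : set R).
  by rewrite integral_indic // setIT.
rewrite lebesgue_measure_itv/= lte_fin.
have -> : (a + r)%:E - (a - r)%:E = (2 * r)%:E by rewrite -EFinB; congr (_%:E); ring.
rewrite exprS; case: ltP => H; first by rewrite -EFinM; congr (_%:E); ring.
have -> : r = 0%R by apply/eqP; rewrite eq_le r0 andbT; lra.
by rewrite !mulr0 mul0r mulr0 mule0.
Qed.

End IteratedIntegral.

(** * The Riemannian volume *)

Section CompactCover.
Variables (T : ptopologicalType).

Lemma compact_nbhs_cover (K : set T) (U : T -> set T) : compact K ->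
  (forall p, K p -> nbhs p (U p)) ->
  exists s : seq T, (forall p, p \in s -> K p) /\ forall q, K q -> exists2 p, p \in s & U p q.
Proof.
move=> cK HU; move: cK; rewrite compact_cover => cK.
have [||D sD cov] := cK T K (fun p => (U p)^°).
- by move=> p _; exact: open_interior.
- by move=> p Kp; exists p => //; exact: HU.
exists (finmap.enum_fset D); split; first by move=> p pD; have := sD p pD; rewrite inE.
move=> q Kq; have [p pD Hq] := cov q Kq; exists p => //.
exact: interior_subset.
Qed.

End CompactCover.

Section ContinuousProd.
Context {R : realType}.

Lemma continuous_at_prod (T : topologicalType) (I : Type) (r : seq I) (F : I -> T -> R) x :
  (forall i, {for x, continuous (F i)}) ->
  {for x, continuous (fun y => \prod_(i <- r) F i y)}.
Proof.
move=> H; elim: r => [|i r IH].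
  have -> : (fun y => \prod_(i <- [::]) F i y) = cst 1 by apply/funext => y; rewrite big_nil.
  exact: cst_continuous.
have -> : (fun y => \prod_(j <- i :: r) F j y) = F i \* (fun y => \prod_(j <- r) F j y).
  by apply/funext => y; rewrite big_cons.
exact: continuousM.
Qed.

(* The segment from 1 to A consists of invertible matrices. *)
Lemma posdef_det_gt0 n (A : 'M[R]_n) : posdef A -> 0 < \det A.
Proof.
move=> pA; pose P (t : R) := (1 - t) *: 1%:M + t *: A.
have pP t : 0 <= t <= 1 -> \det (P t) != 0.
  move=> /andP[t0 t1]; rewrite -unitfE -unitmxE; apply: posdef_unit => v v0.
  have pv := pA v v0.
  have nv : 0 < (v *m v^T) 0 0.
    rewrite mxE; have [j vj] : exists j, v 0 j != 0.
      by apply/existsP; rewrite -negb_forall; apply: contra v0 => /forallP H; apply/eqP/rowP => j; rewrite mxE; apply/eqP.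
    rewrite (bigD1 j) //= ltr_pwDl //; first by rewrite mxE -expr2 exprn_even_gt0.
    by apply: sumr_ge0 => i _; rewrite mxE -expr2 sqr_ge0.
  rewrite /ip /P mulmxDr mulmxDl mxE -!scalemxAr -!scalemxAl mulmx1 [X in X + _]mxE [X in _ + X]mxE.
  rewrite -[(v *m A *m v^T) 0 0]/(ip A v v); have [->|tn] := eqVneq t 0; first by rewrite subr0; lra.
  have tp : 0 < t by rewrite lt_def tn.
  by rewrite ltr_wpDl ?mulr_gt0 // mulr_ge0 ?(ltW nv) // subr_ge0.
have c : continuous (fun t => \det (P t)).
  move=> t; apply: continuous_at_sum => s; apply: continuousM; first exact: cst_continuous.
  apply: continuous_at_prod => i; have Pk k : {for t, continuous (fun y => P y i k)}.
    have -> : (fun y => P y i k) = (fun y => (1 - y) * (1%:M : 'M[R]_n) i k + y * A i k).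
      by apply/funext => y; rewrite !mxE.
    apply: continuousD; apply: continuousM; try exact: cst_continuous; last exact: cvg_id.
    by apply: continuousB; [exact: cst_continuous|exact: cvg_id].
  exact: Pk.
have [//|dA] := ltP 0 (\det A).
have [|||t t01 /eqP Et] := @IVT R (fun t => \det (P t)) 0 1 0.
- exact: ler01.
- exact: continuous_subspaceT.
- rewrite /P subr0 subrr !scale1r !scale0r addr0 add0r det1.
  by rewrite ge_min le_max dA ler01 orbT.
by move: Et; rewrite (negPf (pP t _)) //; move: t01; rewrite in_itv.
Qed.

End ContinuousProd.

Section Cubes.
Context {R : realType} {n : nat}.
Implicit Types x y : 'rV[R]_n.

Lemma cubeE x r y : 0 <= r -> cube x r y <-> `|y - x| <= r.
Proof.
move=> r0; split=> [H|H j]; first by apply: rV_norm_le => // j; rewrite !mxE.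
by apply: le_trans H; have := coord_norm_le (y - x) j; rewrite !mxE.
Qed.

Lemma cube_compact x r : compact (cube x r).
Proof.
have -> : cube x r = [set v : 'rV[R]_n | forall i, `[x 0 i - r, x 0 i + r]%classic (v ord0 i)].
  by apply/seteqP; split=> v H j; have := H j; rewrite /= in_itv/= -ler_distlC distrC.
by apply: (@rV_compact R n (fun i => `[x 0 i - r, x 0 i + r]%classic)) => i; exact: segment_compact.
Qed.

Lemma cube_center x r : 0 <= r -> cube x r x.
Proof. by move=> r0 j; rewrite subrr normr0. Qed.

Lemma cube_le x r r' : r <= r' -> cube x r `<=` cube x r'.
Proof. by move=> rr y H j; apply: le_trans rr. Qed.

Lemma cube_nbhs x r : 0 < r -> nbhs x (cube x r).
Proof.
move=> r0; apply/nbhs_ballP; exists r => //= y.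
rewrite -ball_normE /ball_/= distrC => /ltW H; apply/cubeE => //; exact: ltW.
Qed.

Lemma nbhs_cube x (N : set 'rV[R]_n) : nbhs x N -> exists2 r, 0 < r & cube x r `<=` N.
Proof.
move=> /nbhs_ballP[r /= r0 H]; exists (r / 2); first by rewrite divr_gt0.
move=> y /cubeE yr; apply: H; rewrite -ball_normE /ball_/= distrC.
apply: le_lt_trans (yr _) _; first by rewrite divr_ge0 ?ltW.
by rewrite ltr_pdivrMr // mulr_natr mulr2n ltrDl.
Qed.

End Cubes.

Section Borel.
Context {R : realType} {M : ptopologicalType}.

Lemma open_borel (A : set (borel M)) : open (A : set M) -> measurable A.
Proof. by move=> oA; apply: sub_sigma_algebra. Qed.

Lemma closed_borel (A : set (borel M)) : closed (A : set M) -> measurable A.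
Proof. by move=> /closed_openC/open_borel/measurableC; rewrite setCK. Qed.

Lemma continuous_borel (f : M -> R) : continuous f -> measurable_fun setT (f : borel M -> R).
Proof.
move=> /continuousP cf; apply: (measurability _ (RGenOpens.measurableE R)) => //.
by move=> _ [_ [a [b ->] <-]]; rewrite setTI; apply: open_borel; apply: cf; exact: (@interval_open R (BRight a) (BLeft b)).
Qed.

End Borel.

Section Volume.
Context {R : realType} {n : nat} {M : ptopologicalType} (G : riemannian R n M).
Hypotheses (M_hausdorff : hausdorff_space M) (M_compact : compact [set: M]).
Variables (mu : {measure set (borel M) -> \bar R}) (mu_volume : is_volume G mu).
Implicit Types (c d : chart G) (x y : 'rV[R]_n) (p : M) (v h : M -> R).

Notation w := (vol_density (G := G)).

Lemma density_gt0 c x : chart_cod c x -> 0 < w c x.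
Proof. by move=> cx; rewrite sqrtr_gt0 posdef_det_gt0 //; exact: metric_posdef. Qed.

Lemma density_C1 c : C1_on (chart_cod c) (w c).
Proof.
have oc := @chart_cod_open _ _ _ _ c.
have H : C1_on (chart_cod c) (fun x => \det (metric c x)).
  apply: C1_on_det => // i j; apply: (C1_of_Ck (k := 0)) => //; exact: metric_smooth.
have K := @C1_on_comp R n _ oc Num.sqrt (fun t => (2 * Num.sqrt t)^-1) (fun x => \det (metric c x)).
apply: K H => x cx.
  by apply: is_derive1_sqrt; rewrite posdef_det_gt0 //; exact: metric_posdef.
apply: continuousV; last first.
  apply: (@continuousM R R (cst 2) Num.sqrt _); first exact: cst_continuous.
  exact: sqrt_continuous.
by rewrite mulf_neq0 // gt_eqF // -[Num.sqrt _]/(w c x) density_gt0.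
Qed.

Lemma density_cont c x : chart_cod c x -> {for x, continuous (w c)}.
Proof. exact: C1_on_cont (@density_C1 c). Qed.

Lemma cube_bound (f : 'rV[R]_n -> R) x r : (forall y, cube x r y -> {for y, continuous f}) ->
  exists2 B, 0 < B & forall y, cube x r y -> `|f y| <= B.
Proof.
move=> fc; have cf : {within cube x r, continuous f}.
  by apply: continuous_in_subspaceT => y /set_mem; exact: fc.
have /compact_bounded[B [_ HB]] := continuous_compact cf (@cube_compact R n x r).
exists (`|B| + 1); first by rewrite ltr_wpDl.
move=> y Hy; apply: HB; last by exists y.
by rewrite (le_lt_trans (ler_norm _)) // ltrDl.
Qed.

Definition patch_cube c x r : set (borel M) := chart_from c @` cube x r.

Lemma patch_cubeP c x r y : cube x r `<=` chart_cod c -> chart_cod c y ->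
  patch_cube c x r (chart_from c y) <-> cube x r y.
Proof.
move=> sub cy; split=> [[z zr E]|yr]; last by exists y.
by rewrite -(chart_fromK cy) -E chart_fromK //; exact: sub.
Qed.

Lemma patch_cube_to c x r p : cube x r `<=` chart_cod c -> chart_dom c p ->
  patch_cube c x r p <-> cube x r (chart_to c p).
Proof.
move=> sub cp; rewrite -(patch_cubeP sub (chart_codP cp)) chart_toK //.
Qed.

Lemma patch_cube_dom c x r : cube x r `<=` chart_cod c -> patch_cube c x r `<=` chart_dom c.
Proof. by move=> sub _ [y /sub cy <-]; exact: chart_from_dom. Qed.

Lemma patch_cube_closed c x r : cube x r `<=` chart_cod c -> closed (patch_cube c x r : set M).
Proof.
by move=> sub; apply: compact_closed => //; apply: chart_compact => //; exact: cube_compact.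
Qed.

Lemma patch_cube_measurable c x r : cube x r `<=` chart_cod c -> measurable (patch_cube c x r).
Proof. by move=> sub; apply: (@closed_borel M); exact: patch_cube_closed. Qed.

(** The doubled radius leaves room to translate a function supported in the cube of radius [r] by a
    vector of norm at most [r]. *)
Lemma chart_cube c x (N : set 'rV[R]_n) : chart_cod c x -> nbhs x N ->
  exists2 r, 0 < r & cube x (r + r) `<=` chart_cod c `&` N.
Proof.
move=> cx xN; have /nbhs_cube[r r0 H] : nbhs x (chart_cod c `&` N).
  by apply: filterI => //; exact: chart_cod_near.
by exists (r / 2); rewrite ?divr_gt0 // -splitr.
Qed.

Lemma patch_cube_nbhs c p r : chart_dom c p -> 0 < r -> cube (chart_to c p) r `<=` chart_cod c ->
  nbhs p (patch_cube c (chart_to c p) r : set M).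
Proof.
move=> cp r0 sub; have H : nbhs p (chart_to c @^-1` cube (chart_to c p) r).
  exact: chart_to_cont cp _ (cube_nbhs (chart_to c p) r0).
apply: filterS (filterI (chart_dom_near cp) H) => q [cq Hq].
exact/(patch_cube_to sub cq).
Qed.

Lemma patch_cube_fin c x r : 0 <= r -> cube x r `<=` chart_cod c -> (mu (patch_cube c x r) < +oo)%E.
Proof.
move=> r0 sub; have [B B0 HB] := @cube_bound (w c) x r (fun y yr => density_cont (sub y yr)).
rewrite (mu_volume (patch_cube_measurable sub) (patch_cube_dom sub)).
apply: (@le_lt_trans _ _ (B * (2 * r) ^+ n)%:E); last by rewrite ltey.
rewrite -(irv_cube x r0 (ltW B0)).
apply: le_irv => y; first by case: ifP => // /asboolP[cy _]; rewrite lee_fin ltW // density_gt0.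
case: asboolP => [[cy /(patch_cubeP sub cy) yr]|_]; last by case: ifP => // _; rewrite lee_fin ltW.
by rewrite asboolT // lee_fin (le_trans (ler_norm _)) // HB.
Qed.

Lemma patch_cube_gt0 c x r : 0 < r -> cube x r `<=` chart_cod c -> (0 < mu (patch_cube c x r))%E.
Proof.
move=> r0 sub.
have [B B0 HB] := @cube_bound (fun y => (w c y)^-1) x r (fun y yr => continuousV (lt0r_neq0 (density_gt0 (sub y yr))) (density_cont (sub y yr))).
rewrite (mu_volume (patch_cube_measurable sub) (patch_cube_dom sub)).
have B1 : 0 < B^-1 by rewrite invr_gt0.
apply: (@lt_le_trans _ _ (B^-1 * (2 * r) ^+ n)%:E); first by rewrite lte_fin mulr_gt0 // exprn_gt0 // mulr_gt0.
rewrite -(irv_cube x (ltW r0) (ltW B1)); apply: le_irv => y; first by case: ifP => // _; rewrite lee_fin ltW.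
case: asboolP => [yr|_]; last by case: asboolP => // -[cy _]; rewrite lee_fin ltW // density_gt0.
have cy := sub y yr; rewrite asboolT; last by split=> //; exact/(patch_cubeP sub cy).
have := HB y yr; have := density_gt0 cy; rewrite lee_fin => w0.
by rewrite ger0_norm ?invr_ge0 ?(ltW w0) // => ?; rewrite -(invrK (w c y)) lef_pV2 // posrE ?invr_gt0.
Qed.

(** [is_volume] prescribes [mu] only inside single charts; finiteness comes from a finite cover by
    cubes on which the density is bounded. *)
Lemma mu_fin : (mu setT < +oo)%E.
Proof.
have H p : exists A : set (borel M), [/\ nbhs p (A : set M), measurable A & (mu A < +oo)%E].
  have cp := chart_atP G p; have [r r0 sub] := chart_cube (chart_codP cp) (@filterT _ _ (nbhs_filter (chart_to (chart_at G p) p))).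
  have sub' : cube (chart_to (chart_at G p) p) (r + r) `<=` chart_cod (chart_at G p) by move=> y /sub[].
  have rr : 0 < r + r by rewrite addr_gt0.
  exists (patch_cube (chart_at G p) (chart_to (chart_at G p) p) (r + r)); split.
  - exact: patch_cube_nbhs.
  - exact: patch_cube_measurable.
  - by apply: patch_cube_fin => //; exact: ltW.
have [U HU] := choice H.
have [s [_ cov]] := @compact_nbhs_cover M setT U M_compact (fun p _ => let: And3 a _ _ := HU p in a).
have : exists A : set (borel M), [/\ measurable A, (mu A < +oo)%E & forall q, (exists2 p, p \in s & U p q) -> A q].
  elim: s {cov} => [|p s [A [mA fA HA]]].
    by exists set0; split=> //; [rewrite measure0|move=> q []].
  have [_ mU fU] := HU p.
  exists (U p `|` A); split; first exact: measurableU.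
    by apply: (le_lt_trans (measureU2 _ mU mA)); rewrite lte_add_pinfty.
  move=> q [z]; rewrite inE => /orP[/eqP->|zs] Hq; first by left.
  by right; apply: HA; exists z.
move=> [A [mA fA HA]]; apply: le_lt_trans fA; apply: le_measure; rewrite ?inE //.
by move=> q _; apply/HA/cov.
Qed.

Lemma mu_open_gt0 (A : set (borel M)) p : measurable A -> nbhs p (A : set M) -> (0 < mu A)%E.
Proof.
move=> mA pA; have cp := chart_atP G p; set c := chart_at G p in cp.
have HN : nbhs (chart_to c p) (chart_from c @^-1` A).
  have := chart_from_cont (chart_codP cp); rewrite /prop_for /continuous_at (chart_toK cp) => H.
  exact: H.
have [r r0 sub] := chart_cube (chart_codP cp) HN.
have sub' : cube (chart_to c p) (r + r) `<=` chart_cod c by move=> y /sub[].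
apply: lt_le_trans (patch_cube_gt0 (addr_gt0 r0 r0) sub') _.
apply: le_measure; rewrite ?inE //; first exact: patch_cube_measurable.
by move=> _ [y /sub[_ Ay] <-].
Qed.

End Volume.

Section FiniteIntegral.
Context d (T : measurableType d) (R : realType) (mu : {measure set T -> \bar R}).
Hypothesis mu_fin : (mu setT < +oo)%E.

Lemma bounded_integrable (f : T -> R) C : measurable_fun setT f -> (forall x, `|f x| <= C) ->
  mu.-integrable setT (EFin \o f).
Proof.
move=> mf fC; apply: measurable_bounded_integrable => //.
exists C; split; first exact: num_real.
by move=> N CN x _ /=; apply: le_trans (fC x) (ltW CN).
Qed.

Lemma cvg_le_bound (u : nat -> R) l C : u @ \oo --> l -> (forall k, u k <= C) -> l <= C.
Proof.
move=> H uC; rewrite -(cvg_lim _ H) //; apply: limr_le; first by apply/cvg_ex; exists l.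
exact: nearW.
Qed.

Lemma bounded_cvg_Rintegral (f_ : nat -> T -> R) (f : T -> R) C :
  (forall k, measurable_fun setT (f_ k)) -> measurable_fun setT f ->
  (forall k x, `|f_ k x| <= C) -> (forall x, f_ ^~ x @ \oo --> f x) ->
  (fun k => \int[mu]_x f_ k x) @ \oo --> \int[mu]_x f x.
Proof.
move=> mf_ mf fC fcv.
have fC' x : `|f x| <= C.
  by apply: (@cvg_le_bound (fun k => `|f_ k x|)) => //; apply: cvg_norm; exact: fcv.
have ic : mu.-integrable setT (EFin \o cst C).
  by apply: (@bounded_integrable (cst C) `|C|) => //; exact: measurable_cst.
have ig : mu.-integrable setT (EFin \o f) by exact: bounded_integrable fC'.
have [|||||_ _ H] := @dominated_convergence _ _ R mu setT measurableT (fun k x => (f_ k x)%:E) (fun x => (f x)%:E) (EFin \o cst C).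
- by move=> k; exact/measurable_EFinP.
- exact/measurable_EFinP.
- by apply: aeW => x _; apply: cvg_EFin; [exact: nearW|exact: fcv].
- exact: ic.
- by apply: aeW => x k _; rewrite lee_fin; exact: fC.
have E : (\int[mu]_x f x)%:E = (\int[mu]_x (f x)%:E)%E.
  by rewrite /Rintegral fineK //; exact: integrable_fin_num.
by rewrite -E in H; exact: fine_cvg H.
Qed.

End FiniteIntegral.

(** * Integration in a chart and integrals of partial derivatives *)

Section ChartIntegral.
Import finmap.
Context {R : realType} {n : nat} {M : ptopologicalType} (G : riemannian R n M).
Hypotheses (M_hausdorff : hausdorff_space M) (M_compact : compact [set: M]).
Variables (mu : {measure set (borel M) -> \bar R}) (mu_volume : is_volume G mu).
Implicit Types (c d : chart G) (x y : 'rV[R]_n) (p : M) (v h : M -> R).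

Notation w := (vol_density (G := G)).
Notation mu_fin := (mu_fin M_hausdorff M_compact mu_volume).

Lemma cont_bound v : continuous v -> exists2 B, 0 < B & forall p, `|v p| <= B.
Proof.
move=> vc; have /compact_bounded[B [_ HB]] := continuous_compact (continuous_subspaceT vc) M_compact.
exists (`|B| + 1); first by rewrite ltr_wpDl.
move=> p; apply: HB; last by exists p.
by rewrite (le_lt_trans (ler_norm _)) // ltrDl.
Qed.

Lemma bint v B : measurable_fun setT (v : borel M -> R) -> (forall p, `|v p| <= B) ->
  mu.-integrable setT (EFin \o (v : borel M -> R)).
Proof. by move=> mv vB; exact: (bounded_integrable mu_fin mv vB). Qed.

Lemma cint v : continuous v -> mu.-integrable setT (EFin \o (v : borel M -> R)).
Proof. by move=> vc; have [B _ vB] := cont_bound vc; apply: bint vB; exact: continuous_borel. Qed.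

Lemma irv_sum_ge (I : Type) (s : seq I) (F : I -> 'rV[R]_n -> \bar R) :
  (forall i x, (0 <= F i x)%E) ->
  (\sum_(i <- s) integral_rV (F i) <= integral_rV (fun x => \sum_(i <- s) F i x))%E.
Proof.
move=> F0; elim: s => [|i s IH].
  by rewrite big_nil; apply: irv_ge0 => x; rewrite big_nil.
rewrite big_cons; apply: (@le_trans _ _ (integral_rV (F i) + integral_rV (fun x => \sum_(i <- s) F i x))%E).
  by rewrite leeD2l.
apply: (le_trans (irvD_ge _ _)) => //; first by move=> x; exact: sume_ge0.
apply: le_irv => x; last by rewrite big_cons.
by apply: adde_ge0 => //; exact: sume_ge0.
Qed.

(** The level sets of a simple minorant with positive value lie in the chart, where [is_volume]
    computes their measure. Superadditivity of the iterated integral then collects them. *)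
Lemma chart_integral_le c (F : M -> R) : (forall p, 0 <= F p) -> (forall p, ~ chart_dom c p -> F p = 0) ->
  (\int[mu]_p (F p)%:E <= integral_rV (fun x => if `[< chart_cod c x >] then (F (chart_from c x) * w c x)%:E else 0))%E.
Proof.
move=> F0 Fd; rewrite ge0_integralTE; last by move=> p; rewrite lee_fin.
apply: ub_ereal_sup => _ [h hF <-].
pose T r x : \bar R := if `[< chart_cod c x /\ h (chart_from c x) = r >] then (r * w c x)%:E else 0%E.
have T0 r x : (0 <= T r x)%E.
  rewrite /T; case: asboolP => // -[cx <-]; rewrite lee_fin mulr_ge0 //.
  exact/ltW/density_gt0.
rewrite sintegralE fsbig_finite /=; last exact: fimfunP.
set s := finmap.enum_fset _.
have S1 : (\sum_(r <- s) (r%:E * mu (h @^-1` [set r])) <= \sum_(r <- s) integral_rV (T r))%E.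
  rewrite [leLHS]big_seq [leRHS]big_seq; apply: lee_sum => r.
  move=> rs; have : r \in fset_set (range h) by exact: rs.
  rewrite in_fset_set; last exact: fimfunP.
  move=> /set_mem[p0 _ hr].
  have [r0|r0] := leP r 0.
    have -> : r = 0 by apply/eqP; rewrite eq_le r0 -hr fun_ge0.
    by rewrite mul0e irv_ge0.
  have mA : measurable (h @^-1` [set r]) by exact: measurable_sfunP.
  have sub : h @^-1` [set r] `<=` chart_dom c.
    move=> p /= hp; apply: contrapT => ncp.
    by have := hF p; rewrite (Fd _ ncp) hp lee_fin leNgt r0.
  rewrite (mu_volume mA sub); apply: (le_trans (irvZ_ge r0 _)).
    by move=> x; case: asboolP => // -[cx _]; rewrite lee_fin; exact/ltW/density_gt0.
  apply: le_irv => x; case: asboolP => [[cx Ax]|_]; rewrite ?mule0 //.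
    by rewrite -EFinM lee_fin mulr_ge0 ?(ltW r0) //; exact/ltW/density_gt0.
  by rewrite /T asboolT -?EFinM.
apply: (le_trans S1).
apply: (le_trans (irv_sum_ge _ T0)); apply: le_irv => x; first exact: sume_ge0.
case: asboolP => cx; last first.
  by rewrite big1 // => r _; rewrite /T asboolF // => -[].
have [hs|hs] := boolP (h (chart_from c x) \in s).
  rewrite (bigD1_seq (h (chart_from c x))) //= ?finmap.fset_uniq // big1 => [|r /eqP rh].
    have hFx : h (chart_from c x) <= F (chart_from c x) by rewrite -lee_fin; exact: hF.
    by rewrite adde0 /T asboolT // lee_fin ler_wpM2r // ltW // density_gt0.
  by rewrite /T asboolF // => -[_ /esym].
rewrite big_seq big1 => [|r rs]; first by rewrite lee_fin mulr_ge0 // ltW // density_gt0.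
by rewrite /T asboolF // => -[_ E]; move: hs; rewrite E rs.
Qed.

(** One inequality is [chart_integral_le] for [F]. The other is the same lemma for [B * \1_K - F],
    since superadditivity bounds the sum of the two iterated integrals by [B * mu K]. *)
Lemma chart_integral c (K : set (borel M)) (F : M -> R) B : measurable K -> K `<=` chart_dom c ->
  measurable_fun setT (F : borel M -> R) -> 0 < B -> (forall p, 0 <= F p <= B) -> (forall p, ~ K p -> F p = 0) ->
  (\int[mu]_p (F p)%:E)%E = integral_rV (fun x => if `[< chart_cod c x >] then (F (chart_from c x) * w c x)%:E else 0%E).
Proof.
move=> mK Kc mF B0 FB FK.
have F0 p : 0 <= F p by have /andP[] := FB p.
have Fd p : ~ chart_dom c p -> F p = 0 by move=> ncp; apply: FK => /Kc.
apply/eqP; rewrite eq_le chart_integral_le //=.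
pose H p : R := B * \1_K p - F p.
have H0 p : 0 <= H p.
  rewrite /H indicE; have [pK|pK] := boolP (p \in K).
    by rewrite mulr1 subr_ge0; have /andP[] := FB p.
  by rewrite mulr0 FK ?subrr //; move=> Kp; move: pK; rewrite mem_set.
have Hd p : ~ chart_dom c p -> H p = 0.
  move=> ncp; rewrite /H Fd // indicE memNset ?mulr0 ?subrr //; by move/Kc.
have hH := chart_integral_le H0 Hd.
have mI : measurable_fun setT (fun p : borel M => B * \1_K p).
  by apply: measurable_funM => //; exact: measurable_indic.
have bI (p : borel M) : `|B * \1_K p : R| <= B.
  by rewrite ger0_norm indicE; case: (_ \in _); rewrite ?mulr1 ?mulr0 // ltW.
have bF (p : borel M) : `|F p| <= B by rewrite ger0_norm //; have /andP[] := FB p.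
have iI := bint mI bI; have iF := bint mF bF.
have muK : (mu K < +oo)%E.
  exact: (le_lt_trans (le_measure mu (mem_set mK) (mem_set measurableT) (@subsetT _ K)) mu_fin).
have iK : mu.-integrable setT (EFin \o (\1_K : borel M -> R)) 
  by apply: (@bint _ 1) => [|p]; [exact: measurable_indic|rewrite indicE; case: (_ \in _); rewrite ?normr1 ?normr0].
have EH : (\int[mu]_p (H p)%:E = B%:E * mu K - \int[mu]_p (F p)%:E)%E.
  rewrite (_ : B%:E * mu K = \int[mu]_p (B * \1_K p)%:E)%E; last first.
    under eq_integral do rewrite EFinM.
    by rewrite (integralZl measurableT iK) integral_indic // setIT.
  by rewrite -integralB_EFin.
set A := integral_rV _ in hH *.
set A' := integral_rV _.
have AA : (A' + A <= B%:E * mu K)%E.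
  apply: (le_trans (irvD_ge _ _)).
  - by move=> x; case: asboolP => // cx; rewrite lee_fin mulr_ge0 // ltW // density_gt0.
  - by move=> x; case: asboolP => // cx; rewrite lee_fin mulr_ge0 // ltW // density_gt0.
  have B1 : 0 < B^-1 by rewrite invr_gt0.
  rewrite -lee_pdivrMl // (mu_volume mK Kc); apply: (le_trans (irvZ_ge B1 _)).
    move=> x; apply: adde_ge0.
      by case: asboolP => // cx; rewrite lee_fin mulr_ge0 // ltW // density_gt0.
    by case: asboolP => // cx; rewrite lee_fin mulr_ge0 // ltW // density_gt0.
  apply: le_irv => x.
    apply: mule_ge0; first by rewrite lee_fin ltW.
    apply: adde_ge0.
      by case: asboolP => // cx; rewrite lee_fin mulr_ge0 // ltW // density_gt0.
    by case: asboolP => // cx; rewrite lee_fin mulr_ge0 // ltW // density_gt0.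
  case: asboolP => cx; last by rewrite adde0 mule0; case: asboolP => // -[/cx].
  rewrite -EFinD -EFinM -mulrDl addrC /H subrK indicE.
  have [pK|pK] := boolP (chart_from c x \in K).
    by rewrite mulr1 mulKf ?gt_eqF // asboolT //; split=> //; exact: set_mem pK.
  rewrite mulr0 mul0r mulr0; case: asboolP => // -[_] Kx.
  by move: pK; rewrite mem_set.
have fF : (\int[mu]_p (F p)%:E)%E \is a fin_num by exact: integrable_fin_num.
have fK : (B%:E * mu K)%E \is a fin_num.
  by rewrite fin_numM // ge0_fin_numE.
rewrite EH in hH.
have := le_trans (leeD2l A' hH) AA.
move: fF fK; case: (\int[mu]_p (F p)%:E)%E => //= a _; case: (B%:E * mu K)%E => //= b _.
clear AA; clearbody A'; case: A' => [a'||] //=; last by move=> _; rewrite leNye.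
by rewrite -!EFinD !lee_fin; lra.
Qed.

Lemma ext_cont c (F : 'rV[R]_n -> R) (K : set 'rV[R]_n) : compact K -> K `<=` chart_cod c ->
  (forall x, chart_cod c x -> ~ K x -> F x = 0) -> (forall x, chart_cod c x -> {for x, continuous F}) ->
  continuous (ext c F 0).
Proof.
move=> cK KC FK Fc p; have [cp|ncp] := pselect (chart_dom c p).
  apply: (@continuous_near_eq _ _ _ (F \o chart_to c)).
    by apply: filterS (chart_dom_near cp) => q cq; exact: extE.
  by apply: continuous_comp; [exact: chart_to_cont|apply: Fc; exact: chart_codP].
have nK : ~ (chart_from c @` K) p by move=> [y /KC cy E]; apply: ncp; rewrite -E; exact: chart_from_dom.
apply: (@continuous_near_eq _ _ _ (cst 0)); last exact: cst_continuous.
by apply: filterS (ext_near_out M_hausdorff cK KC FK nK).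
Qed.

Lemma cube_shift x0 r x a : cube x0 r (x - a) -> `|a| <= r -> cube x0 (r + r) x.
Proof.
move=> H ar j; have := H j; rewrite !mxE => Hj.
have aj := le_trans (coord_norm_le a j) ar.
have -> : x 0 j - x0 0 j = (x 0 j - a 0 j - x0 0 j) + a 0 j by ring.
by apply: (le_trans (ler_normD _ _)); rewrite lerD.
Qed.

Section Shift.
Variables (c : chart G) (x0 : 'rV[R]_n) (r : R).
Hypotheses (r0 : 0 < r) (sub : cube x0 (r + r) `<=` chart_cod c).

(** Division by the density turns the Riemannian integral of the extension into the Lebesgue
    integral of [z (x - a)], which does not depend on [a]. *)
Definition shifted (z : 'rV[R]_n -> R) (a : 'rV[R]_n) x : R := z (x - a) / w c x.

Lemma shifted_out (z : 'rV[R]_n -> R) a : (forall x, ~ cube x0 r x -> z x = 0) -> `|a| <= r ->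
  forall x, chart_cod c x -> ~ cube x0 (r + r) x -> shifted z a x = 0.
Proof.
move=> z0 ar x cx nx; rewrite /shifted z0 ?mul0r // => H.
exact: nx (cube_shift H ar).
Qed.

Lemma shifted_cont (z : 'rV[R]_n -> R) a : continuous z -> forall x, chart_cod c x -> {for x, continuous (shifted z a)}.
Proof.
move=> zc x cx; apply: continuousM.
  apply: (@continuous_comp _ _ _ (fun x => x - a) z); last exact: zc.
  by apply: continuousB; [exact: cvg_id|exact: cst_continuous].
apply: continuousV; last exact: density_cont.
by rewrite gt_eqF // density_gt0.
Qed.

Lemma ext_shifted_cont (z : 'rV[R]_n -> R) a : continuous z -> (forall x, ~ cube x0 r x -> z x = 0) -> `|a| <= r ->
  continuous (ext c (shifted z a) 0).
Proof.
move=> zc z0 ar; apply: (ext_cont (@cube_compact R n x0 (r + r)) sub).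
  exact: shifted_out.
exact: shifted_cont.
Qed.

Lemma integral_shift_ge0 (z : 'rV[R]_n -> R) a : continuous z -> (forall x, ~ cube x0 r x -> z x = 0) -> (forall x, 0 <= z x) ->
  `|a| <= r -> (\int[mu]_p (ext c (shifted z a) 0 p)%:E)%E = integral_rV (fun x => (z x)%:E).
Proof.
move=> zc z0 zp ar; have Fc := ext_shifted_cont zc z0 ar.
have [B B0 FB] := cont_bound Fc.
have F0 p : 0 <= ext c (shifted z a) 0 p.
  rewrite /ext; case: asboolP => // cp; rewrite /shifted divr_ge0 // ltW // density_gt0 //.
  exact: chart_codP.
rewrite (@chart_integral c (patch_cube c x0 (r + r)) _ B) //.
- rewrite -[RHS](irv_shift (- a)) => [|x]; last by rewrite lee_fin.
  congr (integral_rV _); apply/funext => x; case: asboolP => cx.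
    rewrite extE; last exact: chart_from_dom.
    by rewrite chart_fromK // /shifted divfK // gt_eqF // density_gt0.
  by rewrite z0 // => H; apply: cx; apply: sub; exact: cube_shift H ar.
- exact: patch_cube_measurable.
- exact: patch_cube_dom.
- exact: continuous_borel.
- by move=> p; rewrite F0 (le_trans (ler_norm _)).
- move=> p np; rewrite /ext; case: asboolP => // cp.
  apply: shifted_out => //; first exact: chart_codP.
  by move=> H; apply: np; apply/patch_cube_to.
Qed.

Lemma integral_shift (z : 'rV[R]_n -> R) a : continuous z -> (forall x, ~ cube x0 r x -> z x = 0) -> `|a| <= r ->
  \int[mu]_p (ext c (shifted z a) 0 p) = \int[mu]_p (ext c (shifted z 0) 0 p).
Proof.
move=> zc z0 ar.
pose zp x : R := Num.max (z x) 0; pose zn x : R := zp x - z x.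
have zpc : continuous zp by move=> x; apply: continuous_max; [exact: zc|exact: cst_continuous].
have znc : continuous zn.
  by move=> x; exact: (contB (zpc x) (zc x)).
have zp0 x : ~ cube x0 r x -> zp x = 0 by move=> /z0 E; rewrite /zp E maxxx.
have zn0 x : ~ cube x0 r x -> zn x = 0 by move=> /z0 E; rewrite /zn /zp E maxxx subrr.
have ar0 : `|0 : 'rV[R]_n| <= r by rewrite normr0 ltW.
have dec b : `|b| <= r -> \int[mu]_p (ext c (shifted z b) 0 p) =
    \int[mu]_p (ext c (shifted zp b) 0 p) - \int[mu]_p (ext c (shifted zn b) 0 p).
  move=> br; rewrite -RintegralB //; try by apply: cint; exact: ext_shifted_cont.
  apply: eq_Rintegral => p _; rewrite /ext; case: asboolP => [cp|_]; last by rewrite subr0.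
  by rewrite /shifted -mulrBl /zn; congr (_ / _); ring.
rewrite !dec // /Rintegral !integral_shift_ge0 //.
- by move=> x; rewrite /zn /zp subr_ge0 le_max lexx.
- by move=> x; rewrite /zp le_max lexx orbT.
- by move=> x; rewrite /zn /zp subr_ge0 le_max lexx.
- by move=> x; rewrite /zp le_max lexx orbT.
Qed.

Lemma partial_out (z : 'rV[R]_n -> R) j : (forall x, ~ cube x0 r x -> z x = 0) ->
  forall x, ~ cube x0 r x -> partial j z x = 0.
Proof.
move=> z0 x nx.
have clK : closed (cube x0 r) by apply: compact_closed; [exact: norm_hausdorff|exact: cube_compact].
have nb : \forall y \near x, z y = cst 0 y.
  have : nbhs x (~` cube x0 r) by apply: open_nbhs_nbhs; split=> //; exact: closed_openC.
  by apply: filterS => y /z0.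
by rewrite (near_eq_partial _ nb) /partial derive_cst.
Qed.

(** Difference quotients of [z], divided by the density, have integral zero by translation
    invariance, and they converge boundedly to minus the partial derivative divided by the
    density. *)
Lemma integral_partial z j : C1_on setT z -> (forall x, ~ cube x0 r x -> z x = 0) ->
  \int[mu]_p (ext c (fun x => partial j z x / w c x) 0 p) = 0.
Proof.
move=> zC z0.
have zc : continuous z by move=> x; apply: differentiable_continuous; have [] := zC x I.
have dc : continuous (partial j z) by move=> x; have [_] := zC x I; apply.
have dout := partial_out j z0.
have [B B0 HB] := @cube_bound R n (partial j z) x0 r (fun y _ => dc y).
have HB' x : `|partial j z x| <= B.
  by have [/HB//|/dout ->] := pselect (cube x0 r x); rewrite normr0 ltW.
have [W W0 HW] := @cube_bound R n (fun y => (w c y)^-1) x0 (r + r)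
   (fun y yr => continuousV (lt0r_neq0 (density_gt0 (sub yr))) (density_cont (sub yr))).
have sub1 : cube x0 r `<=` chart_cod c.
  by move=> y yr; apply: sub; apply: cube_le yr; rewrite lerDl ltW.
have ar0 : `|0 : 'rV[R]_n| <= r by rewrite normr0 ltW.
(* Steps of length at most [r] keep the translated support in the doubled cube, hence in the
   chart. *)
pose s k : R := r / k.+2%:R.
have s0 k : 0 < s k by rewrite divr_gt0.
have sr k : s k <= r by rewrite ler_pdivrMr // ler_peMr ?ler1n // ltW.
pose e : 'rV[R]_n := delta_mx 0 j.
have e1 : `|e| <= 1.
  by apply: rV_norm_le => // i; rewrite !mxE eqxx; case: eqP => _; rewrite ?normr1 ?normr0.
have sa k : `|s k *: e| <= r.
  by rewrite normrZ gtr0_norm // (le_trans _ (sr k)) // ler_piMr // ltW.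
pose q k x := (z (x - s k *: e) - z x) / s k.
pose f_ k p := ext c (fun x => q k x / w c x) 0 p.
have f_E k : f_ k = (fun p => (s k)^-1 * (ext c (shifted z (s k *: e)) 0 p - ext c (shifted z 0) 0 p)).
  apply/funext => p; rewrite /f_ /q /ext; case: asboolP => _; last by rewrite subr0 mulr0.
  by rewrite /shifted subr0; ring.
have f_c k : continuous (f_ k).
  rewrite f_E => p.
  exact: (contZ (contB (ext_shifted_cont zc z0 (sa k) (x := p)) (ext_shifted_cont zc z0 ar0 (x := p)))).
have qB k x : `|q k x| <= B.
  rewrite /q normrM normfV (gtr0_norm (s0 k)) ler_pdivrMr //.
  have := @line_mean_value R _ z x e (- s k) 0 B; rewrite mulr0 subr0 scaleNr normrN (gtr0_norm (s0 k)).
  apply => t _; rewrite subr0; split; last exact: HB'.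
  by apply: diff_derivable; have [] := zC (x + t *: e) I.
have f_B k p : `|f_ k p| <= B * W.
  rewrite /f_ /ext; case: asboolP => [cp|_]; last by rewrite normr0 mulr_ge0 ?ltW.
  have [Kx|nKx] := pselect (cube x0 (r + r) (chart_to c p)).
    by rewrite normrM ler_pM // HW.
  rewrite /q !z0 ?subrr ?mul0r ?normr0 ?mulr_ge0 ?ltW //.
    by move=> H; apply: nKx; apply: cube_le H; rewrite lerDl ltW.
  by move=> H; apply: nKx; exact: cube_shift H (sa k).
pose f p := - ext c (fun x => partial j z x / w c x) 0 p.
have dwc : continuous (ext c (fun x => partial j z x / w c x) 0).
  apply: (ext_cont (@cube_compact R n x0 r) sub1).
    by move=> x _ /dout ->; rewrite mul0r.
  move=> x cx; apply: continuousM; first exact: dc.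
  by apply: continuousV; [rewrite gt_eqF // density_gt0|exact: density_cont].
have fc : continuous f by move=> p; apply: continuousN; exact: dwc.
have f_cv p : f_ ^~ p @ \oo --> f p.
  rewrite /f_ /f /ext; case: asboolP => [cp|_]; last by rewrite oppr0; exact: cvg_cst.
  set x := chart_to c p; rewrite -mulNr.
  apply: cvgM; last exact: cvg_cst.
  have [dz _] := zC x I.
  have /cvgr_dnbhsP H : (fun t : R => t^-1 *: ((z \o shift x) (t *: e) - z x)) @ 0^' --> partial j z x.
    have [l Hl] := (cvg_ex _).1 (diff_derivable dz : derivable z x e).
    by rewrite /partial /derive (cvg_lim _ Hl).
  have {}H := H (fun k => - s k).
  have : (fun k => (- s k)^-1 *: ((z \o shift x) (- s k *: e) - z x)) @ \oo --> partial j z x.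
    apply: H; split=> [k|]; first by rewrite oppr_eq0 gt_eqF.
    rewrite -oppr0; apply: cvgN; rewrite /s.
    have -> : (fun k => r / k.+2%:R) = (fun k => r * [sequence harmonic k.+1]_k k) by [].
    rewrite -(mulr0 r); apply: cvgM; first exact: cvg_cst.
    by have := @cvg_harmonic R; rewrite -cvg_shiftS.
  move=> /cvgN; apply: cvg_trans; apply: near_eq_cvg; apply: nearW => k /=.
  rewrite !fctE /=; have E : - ((- s k)^-1 *: (z (- s k *: e + x) - z x)) = q k x.
      rewrite /q scaleNr (addrC _ x) -[(- s k)^-1 *: _]/((- s k)^-1 * _); field.
      by rewrite gt_eqF.
    by rewrite ?E // -E.
have H := bounded_cvg_Rintegral mu_fin (fun k => continuous_borel (f_c k)) (continuous_borel fc) f_B f_cv.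
have I0 k : \int[mu]_p f_ k p = 0.
  rewrite f_E RintegralZl //; last first.
    by apply: cint => p; exact: (contB (ext_shifted_cont zc z0 (sa k) (x := p)) (ext_shifted_cont zc z0 ar0 (x := p))).
  rewrite RintegralB //; try by apply: cint; apply: ext_shifted_cont.
  by rewrite integral_shift // subrr mulr0.
have E0 : \int[mu]_p f p = 0.
  have : (fun k => \int[mu]_p f_ k p) @ \oo --> (0 : R).
    by under eq_fun do rewrite I0; exact: cvg_cst.
  by move=> H'; apply: (cvg_unique _ H H').
have : \int[mu]_p (-1 * ext c (fun x => partial j z x / w c x) 0 p) = 0.
  by rewrite -[RHS]E0; apply: eq_Rintegral => p _; rewrite mulN1r.
by rewrite RintegralZl ?(cint dwc) // => /eqP; rewrite mulf_eq0 oppr_eq0 oner_eq0 => /eqP.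
Qed.

End Shift.

End ChartIntegral.

(** * The divergence theorem *)

Section Green.
Context {R : realType} {n : nat} {M : ptopologicalType} (G : riemannian R n M).
Hypotheses (M_hausdorff : hausdorff_space M) (M_compact : compact [set: M]).
Variables (mu : {measure set (borel M) -> \bar R}) (mu_volume : is_volume G mu).
Implicit Types (c d : chart G) (x y : 'rV[R]_n) (p : M) (v h : M -> R).

Notation w := (vol_density (G := G)).
Notation cint := (cint M_hausdorff M_compact mu_volume).

Definition bump x0 (r : R) x : R := \prod_j pos2 (r ^+ 2 - (x 0 j - x0 0 j) ^+ 2).

Lemma pos2_ge0 (a : R) : 0 <= pos2 a. Proof. exact: sqr_ge0. Qed.

Lemma bump_ge0 x0 r x : 0 <= bump x0 r x.
Proof. by apply: prodr_ge0 => j _; exact: pos2_ge0. Qed.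

Lemma bump_gt0 x0 r x : (forall j, `|x 0 j - x0 0 j| < r) -> 0 < bump x0 r x.
Proof.
move=> H; apply: prodr_gt0 => j _; have := H j => Hj.
rewrite /pos2 max_l ?exprn_gt0 // ?subr_gt0 ?subr_ge0 -(real_normK (num_real (_ - _))).
  by rewrite ltr_sqr ?nnegrE // ltW // (le_lt_trans _ Hj).
by rewrite ler_sqr ?nnegrE // ltW // (le_lt_trans _ Hj).
Qed.

Lemma bump_out x0 r x : 0 < r -> ~ cube x0 r x -> bump x0 r x = 0.
Proof.
move=> r0 nx; have [j Hj] : exists j, r < `|x 0 j - x0 0 j|.
  by apply: contrapT => H; apply: nx => j; rewrite leNgt; apply/negP => Hj; apply: H; exists j.
rewrite /bump (bigD1 j) //= /pos2 max_r ?expr0n ?mul0r //.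
rewrite subr_le0 -(real_normK (num_real (_ - _))) ler_sqr ?nnegrE //; exact: ltW.
Qed.

Lemma coord_C1 j : C1_on setT (fun x => x 0 j).
Proof.
apply: (@C1_on_intro _ _ _ openT _ (fun i _ => (i == j)%:R)) => [x _|x i _|x i _].
- exact: differentiable_coord.
- have dc := @differentiable_coord R 1 n x 0 j.
  rewrite partialE //.
  have := deriveE (delta_mx 0 i) dc; move=> <-.
  rewrite /derive; apply/cvg_lim => //.
  have E : \forall t \near (0:R)^', cst ((i == j)%:R : R) t = t^-1 *: (((fun N : 'rV[R]_n => N 0 j) \o shift x) (t *: delta_mx 0 i) - x 0 j).
    near=> t => /=; rewrite !mxE eqxx /= addrK.
    by rewrite -[_ *: _]/(_ * _) eq_sym mulKf //; near: t; exact: nbhs_dnbhs_neq.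
  have K := near_eq_cvg E.
  eapply cvg_trans; first by move: K; apply.
  exact: cvg_cst.
- exact: cst_continuous.
Unshelve. all: by end_near. Qed.

Lemma bump_C1 x0 r : C1_on setT (bump x0 r).
Proof.
apply: (C1_on_prod openT) => j.
apply: (@C1_on_comp _ _ _ openT pos2 (fun a => 2 * Num.max a 0) (fun x => r ^+ 2 - (x 0 j - x0 0 j) ^+ 2)).
- by move=> x _; exact: is_derive_pos2.
- by move=> x _; exact: max0_continuous.
apply: (C1_onB openT (C1_on_cst openT _)).
have H : C1_on setT (fun x => x 0 j - x0 0 j) := C1_onB openT (coord_C1 j) (C1_on_cst openT _).
exact: (C1_onM openT H H).
Qed.

Lemma C1_on_sub (U W : set 'rV[R]_n) f : U `<=` W -> C1_on W f -> C1_on U f.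
Proof. by move=> UW H x /UW/H. Qed.

Definition mbump c x0 r := ext c (bump x0 r) 0.

Section MBump.
Variables (c : chart G) (x0 : 'rV[R]_n) (r : R).
Hypotheses (r0 : 0 < r) (sub : cube x0 r `<=` chart_cod c).

Lemma mbump_C1 : C1M G (mbump c x0 r).
Proof.
apply: (C1M_ext M_hausdorff (@cube_compact R n x0 r) sub).
  by move=> x _; exact: bump_out.
by apply: C1_on_sub (@bump_C1 x0 r).
Qed.

Lemma mbump_ge0 p : 0 <= mbump c x0 r p.
Proof. by rewrite /mbump /ext; case: asboolP => // _; exact: bump_ge0. Qed.

Lemma mbump_out p : ~ patch_cube c x0 r p -> mbump c x0 r p = 0.
Proof.
move=> np; rewrite /mbump /ext; case: asboolP => // cp; apply: bump_out => //.
by move=> H; apply: np; apply/patch_cube_to.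
Qed.

Lemma mbump_gt0 : chart_cod c x0 -> 0 < mbump c x0 r (chart_from c x0).
Proof.
move=> cx; rewrite /mbump extE; last exact: chart_from_dom.
by rewrite chart_fromK //; apply: bump_gt0 => j; rewrite subrr normr0.
Qed.

Lemma near_out v p : (forall q, ~ patch_cube c x0 r q -> v q = 0) -> ~ patch_cube c x0 r p ->
  \forall q \near p, v q = cst 0 q.
Proof.
move=> v0 np.
have : nbhs p (~` (patch_cube c x0 r : set M)).
  apply: open_nbhs_nbhs; split=> //; apply: closed_openC.
  exact: patch_cube_closed.
by apply: filterS => q /v0.
Qed.

Lemma pair_out v (Y : vfield G) p : vf_compat Y -> (forall q, ~ patch_cube c x0 r q -> v q = 0) -> ~ patch_cube c x0 r p ->
  pair v Y p = 0.
Proof. by move=> HY v0 np; rewrite (pair_near Y (near_out v0 np)) pair_cst. Qed.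

End MBump.

Lemma Rintegral_sum0 (I : Type) (s : seq I) (F : I -> M -> R) :
  (forall i, continuous (F i)) -> (forall i, \int[mu]_p F i p = 0) ->
  \int[mu]_p (\sum_(i <- s) F i p) = 0.
Proof.
move=> Fc F0; elim: s => [|i s IH].
  under eq_Rintegral do rewrite big_nil.
  have mM : (@measurable _ (borel M)) setT by exact: measurableT.
  by rewrite (Rintegral_cst mu mM) mul0r.
under eq_Rintegral do rewrite big_cons.
rewrite RintegralD // ?F0 ?IH ?addr0 //; first exact: cint (Fc i).
by apply: cint => p; apply: continuous_at_sum => k; exact: Fc.
Qed.

(** [divergence] is evaluated at [p] in the chart [chart_at G p], which may jump with [p]; this is
    the same expression in a fixed chart. *)
Definition divc c (Y : vfield G) x : R :=
  (w c x)^-1 * \sum_(j < n) partial j (fun z => w c z * Y c z 0 j) x.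

Section Local.
Variables (Y : vfield G) (HY : vf_compat Y) (YC : vf_C1 Y).

Lemma divc_cont c x : chart_cod c x -> {for x, continuous (divc c Y)}.
Proof.
move=> cx; apply: contM.
  by apply: continuousV; [rewrite gt_eqF // density_gt0|exact: density_cont].
apply: continuous_at_sum => j.
have [_] := C1_onM (@chart_cod_open _ _ _ _ c) (density_C1 (c := c)) (@YC c j) cx; exact.
Qed.

(** The product rule for [v] times [w * Y^j], summed over [j]: each product, extended by zero, is a
    compactly supported $C^1$ function to which [integral_partial] applies. *)
Lemma green_local c x0 r v : 0 < r -> cube x0 (r + r) `<=` chart_cod c -> C1M G v ->
  (forall q, ~ patch_cube c x0 r q -> v q = 0) ->
  \int[mu]_p (v p * divc c Y (chart_to c p) + pair v Y p) = 0.
Proof.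
move=> r0 sub Hv v0.
have sub1 : cube x0 r `<=` chart_cod c.
  by move=> y yr; apply: sub; apply: cube_le yr; rewrite lerDl ltW.
have oc := @chart_cod_open _ _ _ _ c.
pose z j x := if `[< chart_cod c x >] then v (chart_from c x) * (w c x * Y c x 0 j) else 0.
have vC : C1_on (chart_cod c) (v \o chart_from c) by exact: Hv.
have wYC j : C1_on (chart_cod c) (fun z => w c z * Y c z 0 j) := C1_onM oc (density_C1 (c := c)) (@YC c j).
have z0 j x : ~ cube x0 r x -> z j x = 0.
  move=> nx; rewrite /z; case: asboolP => // cx; rewrite v0 ?mul0r //.
  by move/(patch_cubeP sub1 cx).
have zE j x : chart_cod c x -> \forall y \near x, v (chart_from c y) * (w c y * Y c y 0 j) = z j y.
  by move=> cx; apply: filterS (chart_cod_near cx) => y cy; rewrite /z asboolT.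
have zC j : C1_on setT (z j).
  move=> x _; have [cx|ncx] := pselect (chart_cod c x).
    exact: C1_at_near (zE j x cx) (C1_onM oc vC (wYC j) cx).
  apply: C1_at_near (C1_on_cst openT 0 (x := x) I).
  have clK : closed (cube x0 r) by apply: compact_closed; [exact: norm_hausdorff|exact: cube_compact].
  have : nbhs x (~` cube x0 r).
    by apply: open_nbhs_nbhs; split; [exact: closed_openC|move/sub1].
  by apply: filterS => y /z0 ->.
have Iz j := integral_partial M_hausdorff M_compact mu_volume r0 sub j (zC j) (z0 j).
rewrite -[RHS](@Rintegral_sum0 _ (enum 'I_n) (fun j => ext c (fun x => partial j (z j) x / w c x) 0)) //; last first.
  move=> j; apply: (ext_cont M_hausdorff (@cube_compact R n x0 r) sub1).
    by move=> x _ nx; rewrite (partial_out j (z0 j)) ?mul0r.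
  move=> x cx; apply: contM; first by have [_] := zC j x I; apply.
  by apply: continuousV; [rewrite gt_eqF // density_gt0|exact: density_cont].
apply: eq_Rintegral => p _; rewrite /ext.
case: asboolP => [cp|ncp]; last first.
  have np : ~ patch_cube c x0 r p by move/(patch_cube_dom sub1).
  rewrite v0 // (pair_out _ HY v0) // mul0r addr0 big1 //.
set x := chart_to c p; have cx : chart_cod c x := chart_codP cp.
rewrite big_enum /= (pairE Hv HY cp) /divc -/x mulrA !mulr_sumr -big_split /=.
apply: eq_bigr => j _.
have := @partialM _ _ (v \o chart_from c) (fun z => w c z * Y c z 0 j) x j (vC x cx).1 ((wYC j) x cx).1.
have -> : partial j (z j) x = partial j ((v \o chart_from c) \* (fun z => w c z * Y c z 0 j)) x.
  by apply: near_eq_partial; apply: filterS (zE j x cx) => y <-.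
move=> ->; rewrite /= chart_toK //; have := density_gt0 cx => w0.
by field; rewrite gt_eqF.
Qed.

Lemma Rintegral_gt0 v p : continuous v -> (forall q, 0 <= v q) -> 0 < v p -> 0 < \int[mu]_q v q.
Proof.
move=> vc v0 vp.
pose A : set (borel M) := v @^-1` `]v p / 2, +oo[%classic.
have oA : open (A : set M).
  by move: vc => /continuousP cf; apply: cf; exact: interval_open.
have mA : measurable A by exact: open_borel.
have pA : A p by rewrite /A /= in_itv/= andbT ltr_pdivrMr // mulr_natr mulr2n ltrDl.
have muA := mu_open_gt0 M_hausdorff mu_volume mA (open_nbhs_nbhs (conj oA pA)).
have mT : (@measurable _ (borel M)) setT by exact: measurableT.
have fA : mu A \is a fin_num.
  rewrite ge0_fin_numE //; apply: le_lt_trans (mu_fin M_hausdorff M_compact mu_volume).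
  by apply: le_measure; rewrite ?inE.
have mI : measurable_fun setT (\1_A : borel M -> R) by exact: measurable_indic.
have iI : mu.-integrable setT (EFin \o (\1_A : borel M -> R)).
  apply: (bint M_hausdorff M_compact mu_volume mI (B := 1)) => q.
  by rewrite indicE; case: (_ \in _); rewrite ?normr1 ?normr0.
have E : \int[mu]_q (\1_A q : R) = fine (mu A) by rewrite /Rintegral integral_indic // setIT.
apply: (@lt_le_trans _ _ (v p / 2 * fine (mu A))).
  by rewrite mulr_gt0 ?divr_gt0 // fine_gt0 // muA /= -ge0_fin_numE.
rewrite -E -RintegralZl //; apply: le_Rintegral => //.
- exact: (integrableZl _ (v p / 2) iI).
- exact: cint.
move=> q _; rewrite indicE; have [|] := boolP (q \in A).
  by rewrite inE /A /= in_itv/= andbT mulr1 => /ltW.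
by rewrite mulr0.
Qed.

(** Chart independence without differentiating the Jacobian of the transition map. Both local
    expressions satisfy the same integration by parts against a bump supported in both charts, so
    their difference has integral zero against it. Near a point where it does not vanish the
    difference has constant sign, which is contradictory. *)
Lemma divc_trans c d p : chart_dom c p -> chart_dom d p ->
  divc c Y (chart_to c p) = divc d Y (chart_to d p).
Proof.
move=> cp dp; apply/eqP; rewrite -subr_eq0; apply/negPn/negP => F0.
pose F q := divc c Y (chart_to c q) - divc d Y (chart_to d q).
have Fc q : chart_dom c q -> chart_dom d q -> {for q, continuous F}.
  move=> cq dq; apply: contB.
    apply: (@continuous_comp _ _ _ (chart_to c) (divc c Y)); first exact: chart_to_cont.
    exact/divc_cont/chart_codP.
  apply: (@continuous_comp _ _ _ (chart_to d) (divc d Y)); first exact: chart_to_cont.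
  exact/divc_cont/chart_codP.
have NF : \forall q \near p, 0 < F p * F q.
  have H : {for p, continuous (fun q => F p * F q)} by apply: contZ; exact: Fc.
  have : 0 < F p * F p by rewrite -expr2 exprn_even_gt0.
  by move=> F1; apply: (cvgr_gt _ H).
have [r' r'0 sub'] := chart_cube (chart_codP dp) (@filterT _ _ (nbhs_filter (chart_to d p))).
have {}sub' : cube (chart_to d p) (r' + r') `<=` chart_cod d by move=> y /sub'[].
have sub1' : cube (chart_to d p) r' `<=` chart_cod d.
  by move=> y yr; apply: sub'; apply: cube_le yr; rewrite lerDl ltW.
have ND := patch_cube_nbhs dp r'0 sub1'.
have N1 : nbhs p [set q | (0 < F p * F q /\ patch_cube d (chart_to d p) r' q) /\ chart_dom c q /\ chart_dom d q].
  by apply: filterI; apply: filterI => //; exact: chart_dom_near.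
have N2 : nbhs (chart_to c p) (chart_from c @^-1` [set q | (0 < F p * F q /\ patch_cube d (chart_to d p) r' q) /\ chart_dom c q /\ chart_dom d q]).
  have := chart_from_cont (chart_codP cp); rewrite /prop_for /continuous_at (chart_toK cp) => H.
  exact: (H _ N1).
have [r r0 sub] := chart_cube (chart_codP cp) N2.
have subc : cube (chart_to c p) (r + r) `<=` chart_cod c by move=> y /sub[].
have sub1 : cube (chart_to c p) r `<=` chart_cod c.
  by move=> y yr; apply: subc; apply: cube_le yr; rewrite lerDl ltW.
pose v := mbump c (chart_to c p) r.
have vC : C1M G v := mbump_C1 r0 sub1.
have vout q : ~ patch_cube c (chart_to c p) r q -> v q = 0 by exact: mbump_out.
have inN q : patch_cube c (chart_to c p) r q -> (0 < F p * F q /\ patch_cube d (chart_to d p) r' q) /\ chart_dom c q /\ chart_dom d q.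
  by move=> [y yr <-]; have [|_ ] := sub y; first by apply: cube_le yr; rewrite lerDl ltW.
have voutd q : ~ patch_cube d (chart_to d p) r' q -> v q = 0.
  by move=> nq; apply: vout => /inN[[]].
have G1 := green_local r0 subc vC vout.
have G2 := green_local r'0 sub' vC voutd.
(* The constant factor [F p] makes the integrand nonnegative whatever the sign of the difference. *)
pose W q := v q * (F p * F q).
have vc := C1M_cont vC.
have Wc : continuous W.
  move=> q; have [Pq|nPq] := pselect (patch_cube c (chart_to c p) r q).
    have [_ [cq dq]] := inN q Pq.
    by apply: contM; [exact: vc|apply: contZ; exact: Fc].
  apply: (@continuous_near_eq _ _ _ (cst 0)); last exact: cst_continuous.
  by apply: filterS (near_out sub1 vout nPq) => q' E; rewrite /W E mul0r.
have W0 q : 0 <= W q.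
  have [Pq|nPq] := pselect (patch_cube c (chart_to c p) r q); last by rewrite /W vout // mul0r.
  have [[/ltW ? _] _] := inN q Pq; rewrite mulr_ge0 //; exact: mbump_ge0.
have Wp : 0 < W p.
  rewrite mulr_gt0 //; last by rewrite -expr2 exprn_even_gt0.
  by have := mbump_gt0 r0 (chart_codP cp); rewrite chart_toK.
have := Rintegral_gt0 Wc W0 Wp.
pose Hc q := v q * divc c Y (chart_to c q) + pair v Y q.
pose Hd q := v q * divc d Y (chart_to d q) + pair v Y q.
have pc := pair_cont vC HY (vf_C1_cont YC).
have cc (e : chart G) : (forall q, patch_cube c (chart_to c p) r q -> chart_dom e q) -> continuous (fun q => v q * divc e Y (chart_to e q) + pair v Y q).
  move=> He q; have H : {for q, continuous (fun q => v q * divc e Y (chart_to e q))}; last exact: (contD H (pc q)).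
  have [Pq|nPq] := pselect (patch_cube c (chart_to c p) r q).
    apply: contM; first exact: vc.
    apply: (@continuous_comp _ _ _ (chart_to e) (divc e Y)); first exact: chart_to_cont (He q Pq).
    by apply: divc_cont; exact: chart_codP (He q Pq).
  apply: (@continuous_near_eq _ _ _ (cst 0)); last exact: cst_continuous.
  by apply: filterS (near_out sub1 vout nPq) => q' E; rewrite E mul0r.
have iHc : mu.-integrable setT (EFin \o (Hc : borel M -> R)).
  by apply: cint; apply: cc => q /inN[_ []].
have iHd : mu.-integrable setT (EFin \o (Hd : borel M -> R)).
  by apply: cint; apply: cc => q /inN[_ []].
have -> : \int[mu]_q W q = \int[mu]_q (F p * (Hc q - Hd q)).
  apply: eq_Rintegral => q _; rewrite /W /Hc /Hd /F; ring.
rewrite RintegralZl //; last exact: (integrableB _ iHc iHd).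
by rewrite RintegralB // G1 G2 subrr mulr0 ltxx.
Qed.

Lemma divergenceE c p : chart_dom c p -> divergence Y p = divc c Y (chart_to c p).
Proof. by move=> cp; rewrite -(divc_trans (chart_atP G p) cp). Qed.

Lemma divergence_cont : continuous (divergence Y).
Proof.
move=> p; have cp := chart_atP G p; set c := chart_at G p in cp.
apply: (@continuous_near_eq _ _ _ (divc c Y \o chart_to c)).
  by apply: filterS (chart_dom_near cp) => q cq; exact: divergenceE.
apply: continuous_comp; first exact: chart_to_cont.
exact/divc_cont/chart_codP.
Qed.

(** Partition of unity: finitely many bumps with positive sum [B], divided by [B], reduce the claim
    to [green_local]. *)
Lemma green v : C1M G v -> \int[mu]_p (v p * divergence Y p + pair v Y p) = 0.
Proof.
move=> Hv.
have H p : exists r, 0 < r /\ cube (chart_to (chart_at G p) p) (r + r) `<=` chart_cod (chart_at G p).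
  have [r r0 sub] := chart_cube (chart_codP (chart_atP G p)) (@filterT _ _ (nbhs_filter (chart_to (chart_at G p) p))).
  by exists r; split=> // y /sub[].
have [r Hr] := choice H.
have sub1 p : cube (chart_to (chart_at G p) p) (r p) `<=` chart_cod (chart_at G p).
  by move=> y yr; apply: (Hr p).2; apply: cube_le yr; rewrite lerDl ltW // (Hr p).1.
pose b p := mbump (chart_at G p) (chart_to (chart_at G p) p) (r p).
have bC p : C1M G (b p) := mbump_C1 (Hr p).1 (@sub1 p).
have bpp p : 0 < b p p.
  by have := mbump_gt0 (Hr p).1 (chart_codP (chart_atP G p)); rewrite chart_toK //; exact: chart_atP.
have bU p : nbhs p [set q | 0 < b p q].
  by have := C1M_cont (bC p) (x := p) => K; apply: (cvgr_gt _ K).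
have [s [_ cov]] := @compact_nbhs_cover M setT _ M_compact (fun p _ => bU p).
pose B q := \sum_(p <- s) b p q.
have b0 p q : 0 <= b p q by exact: mbump_ge0.
have B0 q : 0 < B q.
  have [p ps bpq] := cov q I; rewrite /B (big_rem p) //= ltr_pwDl //.
  by apply: sumr_ge0.
have BC : C1M G B by apply: C1M_sum.
pose u p q := v q * (B q)^-1 * b p q.
have vB : C1M G (fun q => v q * (B q)^-1).
  by apply: C1MM => //; apply: C1MV => // q; rewrite gt_eqF.
have uC p : C1M G (u p) := C1MM vB (bC p).
have vE : v = (fun q => \sum_(p <- s) u p q).
  by apply/funext => q; rewrite /u -mulr_sumr -/(B q) mulfVK // gt_eqF.
have uout p q : ~ patch_cube (chart_at G p) (chart_to (chart_at G p) p) (r p) q -> u p q = 0.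
  by move=> nq; rewrite /u /b mbump_out ?mulr0 //; exact: (Hr p).1.
rewrite -[RHS](@Rintegral_sum0 _ s (fun p q => u p q * divergence Y q + pair (u p) Y q)).
- apply: eq_Rintegral => q _; rewrite big_split /= -mulr_suml -pair_sum //.
  by rewrite {1}vE [in pair v]vE.
- move=> p q; have P := pair_cont (uC p) HY (vf_C1_cont YC) (x := q).
  exact: contD (contM (C1M_cont (uC p) (x := q)) (@divergence_cont q)) P.
- move=> p; rewrite -[RHS](green_local (Hr p).1 (Hr p).2 (uC p) (uout p)).
  apply: eq_Rintegral => q _; congr (_ + _).
  have [Pq|nPq] := pselect (patch_cube (chart_at G p) (chart_to (chart_at G p) p) (r p) q).
    rewrite (divergenceE (c := chart_at G p)) //.
    exact: (patch_cube_dom (@sub1 p) Pq).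
  by rewrite uout // !mul0r.
Qed.

End Local.

End Green.

(** * Implicit Euler steps *)

Section Bmf.
Context {R : realType} {n : nat} {M : ptopologicalType} (G : riemannian R n M).
Hypotheses (M_hausdorff : hausdorff_space M) (M_compact : compact [set: M]).
Variables (mu : {measure set (borel M) -> \bar R}) (mu_volume : is_volume G mu).
Implicit Types (p : M) (v h g : M -> R).

(** The class in which the integrands of the scheme live: it is stable under algebraic operations,
    consists of integrable functions because [mu] is finite, and contains the merely measurable
    potential [q]. *)
Definition bmf g := measurable_fun setT (g : borel M -> R) /\ exists B : R, forall p, `|g p| <= B.

Lemma bmf_cont g : continuous g -> bmf g.
Proof.
move=> gc; split; first exact: continuous_borel.
by have [B _ HB] := cont_bound M_compact gc; exists B.
Qed.

Lemma bmf_cst (a : R) : bmf (cst a).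
Proof. by split; [exact: measurable_cst|exists `|a|]. Qed.

Lemma bmfD g h : bmf g -> bmf h -> bmf (fun p => g p + h p).
Proof.
move=> [mg [A HA]] [mh [B HB]]; split; first exact: measurable_funD.
by exists (A + B) => p; rewrite (le_trans (ler_normD _ _)) ?lerD.
Qed.

Lemma bmfM g h : bmf g -> bmf h -> bmf (fun p => g p * h p).
Proof.
move=> [mg [A HA]] [mh [B HB]]; split; first exact: measurable_funM.
by exists (A * B) => p; rewrite normrM ler_pM.
Qed.

Lemma bmfZ (a : R) g : bmf g -> bmf (fun p => a * g p).
Proof. exact: bmfM (bmf_cst a). Qed.

Lemma bmfN g : bmf g -> bmf (fun p => - g p).
Proof. by move=> /(bmfZ (-1)); under eq_fun do rewrite mulN1r. Qed.

Lemma bmfB g h : bmf g -> bmf h -> bmf (fun p => g p - h p).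
Proof. by move=> Hg /bmfN; exact: bmfD. Qed.

Lemma bmfX g : bmf g -> bmf (fun p => g p ^+ 2).
Proof. by move=> Hg; exact: (bmfM Hg Hg). Qed.

Lemma bmf_sum (T : Type) (s : seq T) (F : T -> M -> R) :
  (forall i, bmf (F i)) -> bmf (fun p => \sum_(i <- s) F i p).
Proof.
move=> HF; elim: s => [|i s IH].
  by under eq_fun do rewrite big_nil; exact: bmf_cst.
by under eq_fun do rewrite big_cons; exact: bmfD.
Qed.

Lemma bmf_integrable g : bmf g -> mu.-integrable setT (EFin \o (g : borel M -> R)).
Proof. by move=> [mg [B HB]]; exact: (bint M_hausdorff M_compact mu_volume mg HB). Qed.

Lemma I_D g h : bmf g -> bmf h ->
  \int[mu]_p (g p + h p) = \int[mu]_p g p + \int[mu]_p h p.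
Proof. by move=> Hg Hh; rewrite RintegralD //; exact: bmf_integrable. Qed.

Lemma I_Z (a : R) g : bmf g -> \int[mu]_p (a * g p) = a * \int[mu]_p g p.
Proof. by move=> Hg; rewrite RintegralZl //; exact: bmf_integrable. Qed.

Lemma I_N g : bmf g -> \int[mu]_p (- g p) = - \int[mu]_p g p.
Proof. by move=> Hg; rewrite -mulN1r -I_Z //; apply: eq_Rintegral => p _; rewrite mulN1r. Qed.

Lemma I_B g h : bmf g -> bmf h ->
  \int[mu]_p (g p - h p) = \int[mu]_p g p - \int[mu]_p h p.
Proof. by move=> Hg Hh; rewrite RintegralB //; exact: bmf_integrable. Qed.

Lemma I_le g h : bmf g -> bmf h -> (forall p, g p <= h p) ->
  \int[mu]_p g p <= \int[mu]_p h p.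
Proof. by move=> Hg Hh le; apply: le_Rintegral => //; exact: bmf_integrable. Qed.

Lemma I_ge0 g : (forall p, 0 <= g p) -> 0 <= \int[mu]_p g p.
Proof. by move=> g0; apply: Rintegral_ge0. Qed.

Lemma I_eq g h : (forall p, g p = h p) -> \int[mu]_p g p = \int[mu]_p h p.
Proof. by move=> E; apply: eq_Rintegral => p _. Qed.

Lemma I_sum (T : Type) (s : seq T) (F : T -> M -> R) : (forall i, bmf (F i)) ->
  \int[mu]_p (\sum_(i <- s) F i p) = \sum_(i <- s) \int[mu]_p F i p.
Proof.
move=> HF; elim: s => [|i s IH].
  rewrite big_nil; under eq_Rintegral do rewrite big_nil.
  have mM : (@measurable _ (borel M)) setT by exact: measurableT.
  by rewrite (Rintegral_cst mu mM) mul0r.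
rewrite big_cons -IH -I_D //; last exact: bmf_sum.
by apply: I_eq => p; rewrite big_cons.
Qed.

Lemma I_norm g : bmf g -> `|\int[mu]_p g p| <= \int[mu]_p `|g p|.
Proof. by move=> Hg; apply: le_normr_Rintegral => //; exact: bmf_integrable. Qed.

End Bmf.

(** * A $C^1$ substitute for the absolute value *)

Section Huber.
Context {R : realType}.
Variable k : R.
Hypothesis k0 : 0 < k.

(** The Huber function: [a ^+ 2 / (2 * k)] for [|a| <= k] and [|a| - k / 2] beyond. It is
    nonnegative with slope at most 1 in absolute value, so composing with it restores the sign
    without increasing the Dirichlet energy. *)
Definition huber (a : R) := (2 * k)^-1 * (a ^+ 2 - pos2 (a - k) - pos2 (- a - k)).
Definition dhuber (a : R) := k^-1 * (a - Num.max (a - k) 0 + Num.max (- a - k) 0).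

Lemma huber_der (a : R) : is_derive a (1 : R) huber (dhuber a).
Proof.
have d1 : is_derive a (1 : R) (fun a => a - k : R) 1 by apply: is_derive_eq; rewrite subr0.
have d2 : is_derive a (1 : R) (fun a => - a - k : R) (-1) by apply: is_derive_eq; rewrite subr0.
have p1 := @is_derive1_comp R pos2 (fun a => a - k) a _ _ (is_derive_pos2 (a - k)) d1.
have p2 := @is_derive1_comp R pos2 (fun a => - a - k) a _ _ (is_derive_pos2 (- a - k)) d2.
have s1 : is_derive a (1 : R) (fun a => a ^+ 2 : R) (2 * a).
  by apply: is_derive_eq; rewrite /GRing.scale /=; ring.
have := is_deriveZ (2 * k)^-1 (is_deriveB (is_deriveB s1 p1) p2).
move=> H; apply: (is_derive_eq H).
rewrite /dhuber /GRing.scale /=; field; exact: lt0r_neq0.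
Qed.

Lemma dhuber_cont : continuous dhuber.
Proof.
move=> a.
have i : {for a, continuous (fun a : R => a)} by exact: id.
have mk := @cst_continuous R R k a.
have c1 : {for a, continuous (fun a => Num.max (a - k) 0)}.
  exact: (cont_max (contB i mk) (@cst_continuous R R 0 a)).
have c2 : {for a, continuous (fun a => Num.max (- a - k) 0)}.
  exact: (cont_max (contB (contN i) mk) (@cst_continuous R R 0 a)).
exact: (contZ (contD (contB i c1) c2)).
Qed.

Lemma dhuber_le1 a : dhuber a ^+ 2 <= 1.
Proof.
rewrite /dhuber exprMn -(ler_pM2l (exprn_gt0 2 k0)) mulrA -exprMn divff ?lt0r_neq0 // expr1n mul1r mulr1.
by case: (lerP (a - k) 0) => ?; case: (lerP (- a - k) 0) => ?; nra.
Qed.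

Lemma huberE a : [/\ 0 <= huber a, `|a| - k / 2 <= huber a & huber a <= `|a|].
Proof.
have kE : huber a * (2 * k) = a ^+ 2 - pos2 (a - k) - pos2 (- a - k).
  by rewrite /huber mulrC mulrA divff ?mul1r //; apply: lt0r_neq0; rewrite mulr_gt0.
have k2 : 0 < 2 * k by rewrite mulr_gt0.
have := sqr_ge0 (a - k); have := sqr_ge0 (a + k); have := sqr_ge0 k; move: kE; rewrite /pos2.
have kk : k / 2 * (2 * k) = k ^+ 2 by field.
have [a0|a0] := ger0P a; case: (lerP (a - k) 0) => ?; case: (lerP (- a - k) 0) => ? E ? ? ?;
  by split; rewrite -(ler_pM2r k2) ?mulrBl ?kk E; nra.
Qed.

(** As the target [a] is nonnegative, replacing [c] by [|c|] brings it no farther from [a], and the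
    smoothing moves it by at most [k / 2] more. *)
Lemma huber_dist (a c B : R) : k <= 1 -> 0 <= a -> `|c - a| <= B ->
  (huber c - a) ^+ 2 <= (c - a) ^+ 2 + k * (B + 1).
Proof.
move=> k1 a0 B1; have [b0 b1 b2] := huberE c; move: (huber c) b0 b1 b2 => b b0 b1 b2.
have y : `|b - a| <= `|c - a| + k / 2.
  by move: b1 b2; case: (ger0P c) => ?; case: (ger0P (c - a)) => ? ? ?; rewrite ler_norml; apply/andP; split; lra.
rewrite -[(b - a) ^+ 2]real_normK ?num_real // -[(c - a) ^+ 2]real_normK ?num_real //.
have x0 := normr_ge0 (c - a); have y0 := normr_ge0 (b - a).
move: (`|b - a|) (`|c - a|) y B1 x0 y0 => y x yx xB x0 y0.
apply: (@le_trans _ _ ((x + k / 2) ^+ 2)); first by rewrite ler_sqr ?nnegrE // addr_ge0 // divr_ge0 // ltW.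
have := ler_wpM2l (ltW k0) xB; have := ler_wpM2l (ltW k0) k1; lra.
Qed.

End Huber.

(** * Almost minimising steps and their energy estimates *)

Section Rothe.
Context {R : realType} {n : nat} {M : ptopologicalType} (G : riemannian R n M).
Hypotheses (M_hausdorff : hausdorff_space M) (M_compact : compact [set: M]).
Variables (mu : {measure set (borel M) -> \bar R}) (mu_volume : is_volume G mu).
Implicit Types (p : M) (v h g u w : M -> R).
Variables (f : M -> R) (fC : Ck G 3 f) (q : M -> R) (Q eps : R).
Hypotheses (mq : measurable_fun setT (q : borel M -> R)) (qQ : forall p, `|q p| <= Q).
Hypothesis eps0 : 0 < eps.

Notation Gam := (carre G).
Notation C1M := (C1M G).
Notation bmf := (@bmf R M).
Notation IntD := (I_D M_hausdorff M_compact mu_volume).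
Notation IntB := (I_B M_hausdorff M_compact mu_volume).
Notation IntZ := (I_Z M_hausdorff M_compact mu_volume).
Notation Int_le := (I_le M_hausdorff M_compact mu_volume).

Lemma f_C1 : C1M f. Proof. exact: C1M_Ck fC. Qed.
Lemma X_C1 : vf_C1 (grad f (G := G)). Proof. exact: grad_C1 fC. Qed.
Lemma X_compat : vf_compat (grad f (G := G)). Proof. exact: grad_compat f_C1. Qed.

Lemma Q_ge0 : 0 <= Q. Proof. exact: le_trans (qQ point). Qed.
Lemma q_bmf : bmf q. Proof. by split=> //; exists Q. Qed.

Lemma C1_bmf v : C1M v -> bmf v.
Proof. by move=> Hv; apply: bmf_cont => //; exact: C1M_cont Hv. Qed.

Lemma Gam_bmf v h : C1M v -> C1M h -> bmf (Gam v h).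
Proof. by move=> Hv Hh; apply: bmf_cont => //; exact: Gam_cont. Qed.

Lemma GamDl v h g p : C1M v -> C1M h -> C1M g ->
  Gam (fun p => v p + h p) g p = Gam v g p + Gam h g p.
Proof. by move=> Hv Hh Hg; rewrite /carre pairD //; exact: grad_compat. Qed.

Lemma GamZl (a : R) v g p : C1M v -> C1M g -> Gam (fun p => a * v p) g p = a * Gam v g p.
Proof. by move=> Hv Hg; rewrite /carre pairZ //; exact: grad_compat. Qed.

Lemma GamMl v h g p : C1M v -> C1M h -> C1M g ->
  Gam (fun p => v p * h p) g p = v p * Gam h g p + h p * Gam v g p.
Proof. by move=> Hv Hh Hg; rewrite /carre pairM //; exact: grad_compat. Qed.

Lemma Gam_sq v h (s : R) p : C1M v -> C1M h ->
  Gam (fun p => v p + s * h p) (fun p => v p + s * h p) p =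
  Gam v v p + 2 * s * Gam v h p + s ^+ 2 * Gam h h p.
Proof.
move=> Hv Hh; have Hs := C1MZ s Hh; have Ha := C1MD Hv Hs.
rewrite GamDl // GamZl // (GamC p Hv Ha) (GamC p Hh Ha) !GamDl // !GamZl // (GamC p Hh Hv).
ring.
Qed.

Lemma Gam_comp2 (F dF : R -> R) v p : (forall p, is_derive (v p) 1 F (dF (v p))) ->
  (forall p, {for v p, continuous dF}) -> C1M v ->
  Gam (F \o v) (F \o v) p = dF (v p) ^+ 2 * Gam v v p.
Proof.
move=> HF HdF Hv; have HFv := C1M_comp HF HdF Hv.
rewrite /carre (pair_comp (grad_compat HFv) (HF p)) // -/(carre G v (F \o v) p) GamC //.
by rewrite /carre (pair_comp (grad_compat Hv) (HF p)) // expr2 mulrA.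
Qed.

Lemma GamM_le v g p : C1M v -> C1M g ->
  Gam (fun p => v p * g p) (fun p => v p * g p) p <= 2 * (v p ^+ 2 * Gam g g p + g p ^+ 2 * Gam v v p).
Proof.
move=> Hv Hg; have Hvg := C1MM Hv Hg.
rewrite GamMl // (GamC p Hv Hvg) (GamC p Hg Hvg) !GamMl // (GamC p Hg Hv).
have := Gam_young p (v p) (g p) Hg Hv; rewrite (GamC p Hg Hv); lra.
Qed.

(* Makes the generator symmetric: eps lap v + grad f . grad v = eps wt^-1 div (wt grad v). *)
Definition wt p : R := expR (eps^-1 * f p).

Lemma wt_gt0 p : 0 < wt p. Proof. exact: expR_gt0. Qed.

Lemma wt_C1 : C1M wt.
Proof.
apply: (@C1M_comp _ _ _ G expR expR (fun p => eps^-1 * f p)).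
- by move=> p; exact: continuous_expR.
- exact: C1MZ f_C1.
Qed.

Lemma pair_wt (Y : vfield G) p : vf_compat Y -> pair wt Y p = wt p * eps^-1 * pair f Y p.
Proof.
move=> HY; rewrite (@pair_comp _ _ _ _ _ HY expR (expR (eps^-1 * f p)) (fun p => eps^-1 * f p)) //; last 2 first.
- exact: C1MZ f_C1.
- exact: wt_C1.
by rewrite pairZ ?mulrA //; exact: f_C1.
Qed.

(** The density of the step functional: a minimiser [v] of its integral would solve
    $(v-w)/dt=\varepsilon\Delta_g v+\nabla_g\mathfrak f\cdot\nabla_g v$. *)
Definition Jd (dt : R) w v p : R :=
  (2 * dt)^-1 * ((v p - w p) ^+ 2 * wt p) + eps / 2 * (Gam v v p * wt p).
(** [El_def] and [Nn] are the first and second variations: along [v + s h] the density [Jd] grows by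
    [s * El_def + s ^+ 2 / 2 * Nn]. *)
Definition El_def (dt : R) w v h p : R :=
  dt^-1 * ((v p - w p) * h p * wt p) + eps * (Gam v h p * wt p).
Definition Nn (dt : R) h p : R :=
  dt^-1 * (h p ^+ 2 * wt p) + eps * (Gam h h p * wt p).
(** The potential is treated explicitly, through the source; the functional then stays nonnegative
    and convex whatever the sign of [q]. *)
Definition src_def (dt : R) u p : R := (1 + dt * q p) * u p.

(* An almost minimiser of class C^1: exact solutions of the implicit Euler step would call for
   elliptic regularity, and the defect dt ^+ 4 disappears in the limit. *)
Definition step (dt : R) u v := [/\ C1M v, (forall p, 0 <= v p) &
  forall v', C1M v' -> \int[mu]_p Jd dt (src_def dt u) v p <= \int[mu]_p Jd dt (src_def dt u) v' p + dt ^+ 4].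

Lemma Jd_bmf dt w v : bmf w -> C1M v -> bmf (Jd dt w v).
Proof.
move=> Hw Hv; have mC := C1_bmf wt_C1; apply: bmfD; apply: bmfZ; apply: bmfM => //.
  by apply: bmfX; apply: bmfB => //; exact: C1_bmf.
exact: Gam_bmf.
Qed.

Lemma El_bmf dt w v h : bmf w -> C1M v -> C1M h -> bmf (El_def dt w v h).
Proof.
move=> Hw Hv Hh; have mC := C1_bmf wt_C1; apply: bmfD; apply: bmfZ; apply: bmfM => //.
  by apply: bmfM; [apply: bmfB => //|]; exact: C1_bmf.
exact: Gam_bmf.
Qed.

Lemma Nn_bmf dt h : C1M h -> bmf (Nn dt h).
Proof.
move=> Hh; have mC := C1_bmf wt_C1; apply: bmfD; apply: bmfZ; apply: bmfM => //.
  by apply: bmfX; exact: C1_bmf.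
exact: Gam_bmf.
Qed.

Lemma src_bmf dt u : bmf u -> bmf (src_def dt u).
Proof. move=> Hu; apply: bmfM => //; apply: bmfD; [exact: bmf_cst|exact: bmfZ q_bmf]. Qed.

Lemma Jd_ge0 dt w v p : 0 < dt -> C1M v -> 0 <= Jd dt w v p.
Proof.
move=> dt0 Hv; have := wt_gt0 p; have := Gam_ge0 p Hv => g0 m0.
by rewrite /Jd; do ?[exact: sqr_ge0|exact: ltW|exact: ler0n|apply: addr_ge0|apply: mulr_ge0|rewrite invr_ge0].
Qed.

(** A competitor within [dt ^+ 4 / 2] of the infimum is composed with the Huber function. The source
    is nonnegative because [dt * Q <= 1], so by [huber_dist] the composition costs at most another
    [dt ^+ 4 / 2]. *)
Lemma step_exists dt u : 0 < dt -> dt * Q <= 1 -> C1M u -> (forall p, 0 <= u p) ->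
  exists v, step dt u v.
Proof.
move=> dt0 dtQ Hu u0; set w := src_def dt u.
have Hw : bmf w := src_bmf dt (C1_bmf Hu).
have w0 p : 0 <= w p.
  rewrite /w /src_def mulr_ge0 //; have := qQ p; rewrite ler_norml => /andP[? _]; nra.
pose S := [set \int[mu]_p Jd dt w v p | v in [set v | C1M v]].
have S0 : S !=set0 by exists (\int[mu]_p Jd dt w u p); exists u.
have hS : has_inf S.
  split=> //; exists 0 => _ [v Hv <-]; apply: I_ge0 => p; exact: Jd_ge0.
have dt4 : 0 < dt ^+ 4 / 2 by rewrite divr_gt0 // exprn_gt0.
have [_ [v1 Hv1 <-] lt1] := inf_adherent dt4 hS.
have inf_le v' : C1M v' -> inf S <= \int[mu]_p Jd dt w v' p.
  by move=> Hv'; apply: ge_inf; [exact: hS.2|exists v'].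
have [_ [B HB]] : bmf (fun p => v1 p - w p) by apply: bmfB => //; exact: C1_bmf.
have B0 : 0 <= B by exact: le_trans (HB point).
have Hm := C1_bmf wt_C1.
pose mm := \int[mu]_p wt p.
have mm0 : 0 <= mm by apply: I_ge0 => p; rewrite ltW // wt_gt0.
pose D := (B + 1) * (mm + 1).
have D0 : 0 < D by rewrite /D; nra.
(* Chosen so that [k <= 1] and [k * D <= dt ^+ 5]; after division by [2 * dt] the loss is at most
   [dt ^+ 4 / 2]. *)
pose k := dt ^+ 5 / (D + dt ^+ 5).
have d5 : 0 < dt ^+ 5 by rewrite exprn_gt0.
have k0 : 0 < k by rewrite divr_gt0 // addr_gt0.
have k1 : k <= 1 by rewrite ler_pdivrMr ?addr_gt0 // mul1r lerDr ltW.
have kD : k * D <= dt ^+ 5.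
  have -> : k * D = dt ^+ 5 * (D / (D + dt ^+ 5)) by rewrite /k; ring.
  by rewrite ler_piMr ?ltW // ltr_pdivrMr ?addr_gt0 // mul1r ltrDl.
exists (huber k \o v1); split.
- by apply: C1M_comp Hv1 => p; [exact: huber_der|exact: dhuber_cont].
- by move=> p; have [] := huberE k0 (v1 p).
have Hv : C1M (huber k \o v1) by apply: C1M_comp Hv1 => p; [exact: huber_der|exact: dhuber_cont].
move=> v' Hv'.
have pt p : Jd dt w (huber k \o v1) p <= Jd dt w v1 p + (2 * dt)^-1 * (k * (B + 1)) * wt p.
  rewrite /Jd (@Gam_comp2 _ (dhuber k) v1 p (fun p => @huber_der _ _ k0 (v1 p)) (fun p => @dhuber_cont _ k (v1 p)) Hv1).
  have := dhuber_le1 k0 (v1 p); have := Gam_ge0 p Hv1; have := wt_gt0 p.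
  move: (dhuber k (v1 p) ^+ 2) (Gam v1 v1 p) (wt p) => d2 g m m0 g0 d1.
  have e1 : eps / 2 * (d2 * g * m) <= eps / 2 * (g * m).
    apply: ler_wpM2l; first by rewrite divr_ge0 // ltW.
    by apply: ler_wpM2r; [exact: ltW|rewrite ler_piMl].
  have B1 : `|v1 p - w p| <= B := HB p.
  have e2 : ((huber k \o v1) p - w p) ^+ 2 <= (v1 p - w p) ^+ 2 + k * (B + 1).
    exact: (huber_dist k0 k1 (w0 p) B1).
  have e3 : (2 * dt)^-1 * (((huber k \o v1) p - w p) ^+ 2 * m) <= (2 * dt)^-1 * (((v1 p - w p) ^+ 2 + k * (B + 1)) * m).
    by rewrite ler_wpM2l ?invr_ge0 ?ler_wpM2r // ltW // mulr_gt0.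
  move: e3; rewrite mulrDl mulrDr -!mulrA; lra.
have H1 := Int_le (Jd_bmf dt Hw Hv) (bmfD (Jd_bmf dt Hw Hv1) (bmfZ _ Hm)) pt.
apply: le_trans H1 _; rewrite IntD; [|exact: Jd_bmf|exact: bmfZ].
rewrite IntZ // -/mm.
have kD' : (2 * dt)^-1 * (k * (B + 1)) * mm <= dt ^+ 4 / 2.
  have -> : (2 * dt)^-1 * (k * (B + 1)) * mm = (k * ((B + 1) * mm)) / (2 * dt) by ring.
  rewrite ler_pdivrMr ?mulr_gt0 //.
  have -> : dt ^+ 4 / 2 * (2 * dt) = dt ^+ 5 by field.
  by apply: le_trans kD; rewrite ler_pM2l // /D; nra.
move: lt1 kD' (inf_le v' Hv'); rewrite -/w.
move: (inf S) (\int[mu]_p Jd dt w v1 p) (\int[mu]_p Jd dt w v' p) (_ * mm) (dt ^+ 4).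
by move=> a b c d e /ltW H1 H2 H3; apply: le_trans (lerD H1 H2) _; rewrite -addrA -splitr lerD2r.
Qed.

Lemma quad_disc (s0 L N : R) : 0 <= s0 -> 0 <= N ->
  (forall s, 0 <= s0 + s * L + s ^+ 2 / 2 * N) -> L ^+ 2 <= 2 * s0 * N.
Proof.
move=> s00; rewrite le_eqVlt => /orP[/eqP<-|N0] H.
  have [->|L0] := eqVneq L 0; first by rewrite expr0n mulr0.
  have := H (- (s0 + 1) / L); rewrite divfK //; lra.
have := H (- L / N).
have -> : s0 + - L / N * L + (- L / N) ^+ 2 / 2 * N = s0 - L ^+ 2 / (2 * N).
  by field; exact: lt0r_neq0.
rewrite subr_ge0 ler_pdivrMr ?mulr_gt0 //; lra.
Qed.

(** Almost minimality along [v + s h] says that a quadratic polynomial in [s] never goes below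
    [- dt ^+ 4]; the claim bounds its discriminant. *)
Lemma step_EL dt u v h : 0 < dt -> C1M u -> step dt u v -> C1M h ->
  (\int[mu]_p El_def dt (src_def dt u) v h p) ^+ 2 <= 2 * dt ^+ 4 * \int[mu]_p Nn dt h p.
Proof.
move=> dt0 Hu [Hv v0 Jv] Hh; have Hw := src_bmf dt (C1_bmf Hu).
have J1 := Jd_bmf dt Hw Hv; have E1 := El_bmf dt Hw Hv Hh; have N1 := Nn_bmf dt Hh.
apply: quad_disc => [||s].
- by rewrite exprn_ge0 // ltW.
- apply: I_ge0 => p; have := wt_gt0 p; have := Gam_ge0 p Hh => g0 m0.
  by rewrite /Nn; do ?[exact: sqr_ge0|exact: ltW|exact: ler0n|apply: addr_ge0|apply: mulr_ge0|rewrite invr_ge0].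
have := Jv _ (C1MD Hv (C1MZ s Hh)).
rewrite (@I_eq _ _ mu (Jd dt _ (fun p => v p + s * h p)) (fun p => Jd dt (src_def dt u) v p + (s * El_def dt (src_def dt u) v h p + s ^+ 2 / 2 * Nn dt h p))).
  rewrite IntD //; last by apply: bmfD; exact: bmfZ.
  rewrite [X in _ <= _ + X + _]IntD ?(IntZ s) ?(IntZ (s ^+ 2 / 2)) //; try exact: bmfZ.
  by rewrite -addrA lerDl [X in 0 <= X -> _]addrC addrA.
move=> p; rewrite /Jd Gam_sq // /El_def /Nn; field; exact: lt0r_neq0.
Qed.

Definition En_def u := \int[mu]_p (eps / 2 * (Gam u u p * wt p)).
Definition Ws_def u := \int[mu]_p (u p ^+ 2 * wt p).
(** The factor [1 / 8] lets the increment term of [step_energy] absorb that of [Ws_step]: for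
    [dt <= 1], [(1 + dt^-1) / 8 <= (4 * dt)^-1]. *)
Definition Phi u := En_def u + Ws_def u / 8.

Lemma Ws_bmf u : bmf u -> bmf (fun p => u p ^+ 2 * wt p).
Proof. by move=> Hu; apply: bmfM; [exact: bmfX|exact: C1_bmf wt_C1]. Qed.

Lemma En_bmf u : C1M u -> bmf (fun p => eps / 2 * (Gam u u p * wt p)).
Proof. by move=> Hu; apply: bmfZ; apply: bmfM; [exact: Gam_bmf|exact: C1_bmf wt_C1]. Qed.

Lemma En_ge0 u : C1M u -> 0 <= En_def u.
Proof.
move=> Hu; apply: I_ge0 => p; have := wt_gt0 p; have := Gam_ge0 p Hu => g0 m0.
by do ?[exact: sqr_ge0|exact: ltW|exact: ler0n|apply: addr_ge0|apply: mulr_ge0|rewrite invr_ge0].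
Qed.

Lemma Ws_ge0 u : 0 <= Ws_def u.
Proof. by apply: I_ge0 => p; rewrite mulr_ge0 ?sqr_ge0 ?ltW ?wt_gt0. Qed.

(** Comparison with the competitor [v' := u], for which the only cost besides the energy of [u]
    comes from the potential in the source. *)
Lemma step_energy dt u v : 0 < dt -> C1M u -> step dt u v ->
  (4 * dt)^-1 * Ws_def (v \- u) + En_def v <= En_def u + dt * Q ^+ 2 * Ws_def u + dt ^+ 4.
Proof.
move=> dt0 Hu [Hv v0 Jv]; have Hw := src_bmf dt (C1_bmf Hu).
have bu := C1_bmf Hu; have bv := C1_bmf Hv.
have b1 := Ws_bmf (bmfB bv bu); have b2 := Ws_bmf bu.
have b3 := En_bmf Hv; have b4 := En_bmf Hu.
have J1 := Jd_bmf dt Hw Hv; have J2 := Jd_bmf dt Hw Hu.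
have A1 : (4 * dt)^-1 * Ws_def (v \- u) + En_def v <= \int[mu]_p (Jd dt (src_def dt u) v p + dt / 2 * Q ^+ 2 * (u p ^+ 2 * wt p)).
  rewrite /Ws_def /En_def -IntZ // -IntD //; last exact: bmfZ.
  apply: Int_le; [by apply: bmfD => //; exact: bmfZ|by apply: bmfD => //; exact: bmfZ|].
  move=> p; rewrite /Jd /= addrAC lerD2r.
  have qq : q p ^+ 2 <= Q ^+ 2 by rewrite -(real_normK (num_real (q p))) ler_sqr ?nnegrE ?Q_ge0.
  have -> : dt / 2 * Q ^+ 2 * (u p ^+ 2 * wt p) = (4 * dt)^-1 * (2 * (dt * Q * u p) ^+ 2 * wt p).
    by field; exact: lt0r_neq0.
  have -> : (2 * dt)^-1 * ((v p - src_def dt u p) ^+ 2 * wt p) = (4 * dt)^-1 * (2 * (v p - src_def dt u p) ^+ 2 * wt p).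
    by field; exact: lt0r_neq0.
  rewrite -mulrDr ler_pM2l ?invr_gt0 ?mulr_gt0 // -mulrDl ler_pM2r ?wt_gt0 //.
  have e1 : (dt * q p * u p) ^+ 2 <= (dt * Q * u p) ^+ 2.
    rewrite !exprMn ler_wpM2r ?sqr_ge0 // ler_wpM2l ?sqr_ge0 //.
  have -> : v p - u p = (v p - src_def dt u p) + dt * q p * u p by rewrite /src_def; ring.
  move: (v p - src_def dt u p) (dt * q p * u p) e1 => a b; have := sqr_ge0 (a - b); nra.
apply: le_trans A1 _; rewrite IntD //; last exact: bmfZ.
rewrite IntZ //; have := Jv u Hu.
have A2 : \int[mu]_p Jd dt (src_def dt u) u p <= En_def u + dt / 2 * Q ^+ 2 * Ws_def u.
  rewrite /Ws_def /En_def -IntZ // -IntD //; last exact: bmfZ.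
  apply: Int_le => //; first by apply: bmfD => //; exact: bmfZ.
  move=> p; rewrite /Jd addrC lerD2l.
  have qq : q p ^+ 2 <= Q ^+ 2 by rewrite -(real_normK (num_real (q p))) ler_sqr ?nnegrE ?Q_ge0.
  have -> : (2 * dt)^-1 * ((u p - src_def dt u p) ^+ 2 * wt p) = dt / 2 * q p ^+ 2 * (u p ^+ 2 * wt p).
    by rewrite /src_def; field; exact: lt0r_neq0.
  apply: ler_wpM2r; first by rewrite mulr_ge0 ?sqr_ge0 // ltW ?wt_gt0.
  by apply: ler_wpM2l => //; rewrite divr_ge0 // ltW.
rewrite -/(Ws_def u).
have -> : dt * Q ^+ 2 * Ws_def u = dt / 2 * Q ^+ 2 * Ws_def u + dt / 2 * Q ^+ 2 * Ws_def u by field.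
move: (dt / 2 * Q ^+ 2 * Ws_def u) (En_def u) (\int[mu]_p Jd dt (src_def dt u) v p) (\int[mu]_p Jd dt (src_def dt u) u p) (dt ^+ 4) A2.
by move=> *; lra.
Qed.

Lemma Ws_step dt u v : 0 < dt -> bmf u -> bmf v ->
  Ws_def v <= (1 + dt) * Ws_def u + (1 + dt^-1) * Ws_def (v \- u).
Proof.
move=> dt0 bu bv; have b1 := Ws_bmf (bmfB bv bu); have b2 := Ws_bmf bu.
rewrite /Ws_def -!IntZ // -IntD //; try exact: bmfZ.
apply: Int_le; [exact: Ws_bmf|by apply: bmfD; exact: bmfZ|].
move=> p /=; rewrite [X in _ <= X + _]mulrA [X in _ <= _ + X]mulrA -mulrDl ler_pM2r ?wt_gt0 // -subr_ge0.
have -> : (1 + dt) * u p ^+ 2 + (1 + dt^-1) * (v p - u p) ^+ 2 - v p ^+ 2 = dt^-1 * (dt * u p - (v p - u p)) ^+ 2.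
  by field; exact: lt0r_neq0.
by rewrite mulr_ge0 ?sqr_ge0 // invr_ge0 ltW.
Qed.

Definition Kg : R := 1 + 8 * Q ^+ 2.

(** The added 1 absorbs the defect [dt ^+ 4 <= dt], so that the estimate becomes a pure growth
    factor and can be iterated. *)
Lemma Phi_step dt u v : 0 < dt -> dt <= 1 -> C1M u -> step dt u v ->
  Phi v + 1 <= (1 + Kg * dt) * (Phi u + 1).
Proof.
move=> dt0 dt1 Hu S; have [Hv _ _] := S.
have := step_energy dt0 Hu S; have := Ws_step dt0 (C1_bmf Hu) (C1_bmf Hv).
have := Ws_ge0 (v \- u); have := Ws_ge0 u; have := En_ge0 Hu.
have d4 : dt ^+ 4 <= dt by rewrite exprS; apply: ler_piMr; [exact: ltW|apply: exprn_ile1 => //; exact: ltW].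
have d1 : 1 + dt^-1 <= 2 * dt^-1 by rewrite mulr_natl mulr2n lerD2r invf_ge1.
have -> : (4 * dt)^-1 = dt^-1 / 4 by field; exact: lt0r_neq0.
rewrite /Phi /Kg; move: (En_def u) (En_def v) (Ws_def u) (Ws_def v) (Ws_def (v \- u)) (sqr_ge0 Q) d4 d1.
move: (dt ^+ 4) (Q ^+ 2) (dt^-1) => d4 Q2 di eu ev wu wv D Q20 Hd4 Hdi eu0 wu0 D0 H1 H2.
have H3 : (1 + di) * D <= 2 * di * D by rewrite ler_wpM2r.
have := mulr_ge0 Q20 (ltW dt0); have := mulr_ge0 (mulr_ge0 Q20 (ltW dt0)) eu0; have := mulr_ge0 (ltW dt0) eu0.
move: Q20 Hd4 eu0 wu0 D0 H1 H2 H3 dt0; move=> *; lra.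
Qed.

Definition rothe dt u0 (u : nat -> M -> R) := u 0%N = u0 /\ forall k, step dt (u k) (u k.+1).

Lemma rothe_exists dt u0 : 0 < dt -> dt * Q <= 1 -> C1M u0 -> (forall p, 0 <= u0 p) ->
  exists u : nat -> M -> R, rothe dt u0 u.
Proof.
move=> dt0 dtQ H0 u00.
have H u : exists v, C1M u /\ (forall p, 0 <= u p) -> step dt u v.
  have [[Hu H1]|] := pselect (C1M u /\ (forall p, 0 <= u p)); last by exists u.
  by have [v Sv] := step_exists dt0 dtQ Hu H1; exists v.
have [F HF] := choice H.
exists (fun k => iter k F u0); split=> // k.
have : C1M (iter k F u0) /\ forall p, 0 <= iter k F u0 p.
  by elim: k => [//|k IH]; have [? ? _] := HF _ IH.
exact: HF.
Qed.

Section Estimates.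
Variables (u0 : M -> R) (u0C : C1M u0) (u0_ge0 : forall p, 0 <= u0 p).
Variable S : R.
Hypothesis S0 : 0 <= S.

Section Scheme.
Variables (dt : R) (u : nat -> M -> R).
Hypotheses (dt0 : 0 < dt) (dt1 : dt <= 1) (Hu : rothe dt u0 u).

Lemma rothe_C1 k : C1M (u k).
Proof. by have [E St] := Hu; case: k => [|k]; [rewrite E|have [] := St k]. Qed.

Lemma rothe_ge0 k p : 0 <= u k p.
Proof. by have [E St] := Hu; case: k => [|k]; [rewrite E|have [] := St k]. Qed.

Definition KPhi := expR (Kg * S) * (Phi u0 + 1).

Lemma Kg_ge0 : 0 <= Kg. Proof. by rewrite /Kg; have := sqr_ge0 Q; lra. Qed.

Lemma Phi_ge0 v : C1M v -> 0 <= Phi v.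
Proof. by move=> Hv; rewrite addr_ge0 ?En_ge0 // divr_ge0 ?Ws_ge0. Qed.

Lemma rothe_Phi k : k%:R * dt <= S -> Phi (u k) <= KPhi.
Proof.
move=> kS; have H : Phi (u k) + 1 <= (1 + Kg * dt) ^+ k * (Phi u0 + 1).
  elim: k {kS} => [|k IH]; first by rewrite (proj1 Hu) expr0 mul1r.
  apply: le_trans (Phi_step dt0 dt1 (rothe_C1 k) (proj2 Hu k)) _.
  rewrite exprS -mulrA ler_wpM2l // addr_ge0 // mulr_ge0 ?Kg_ge0 //; exact: ltW.
apply: (@le_trans _ _ (Phi (u k) + 1)); first by rewrite lerDl.
apply: le_trans H _; rewrite /KPhi; apply: ler_wpM2r.
  by apply: addr_ge0 => //; exact: Phi_ge0.
apply: (@le_trans _ _ (expR (Kg * dt) ^+ k)).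
  apply: lerXn2r; rewrite ?nnegrE ?expR_ge0 ?expR_ge1Dx //.
  by rewrite addr_ge0 // mulr_ge0 ?Kg_ge0 // ltW.
rewrite -expRM_natl ler_expR mulrCA; apply: ler_wpM2l => //; exact: Kg_ge0.
Qed.

Lemma rothe_Ws k : k%:R * dt <= S -> Ws_def (u k) <= 8 * KPhi.
Proof. by move=> /rothe_Phi; rewrite /Phi; have := En_ge0 (rothe_C1 k); lra. Qed.

Definition KD := En_def u0 + S * (8 * Q ^+ 2 * KPhi + 1).

(** Summing [step_energy] telescopes the Dirichlet energies and leaves the squared increments. *)
Lemma rothe_D k : k%:R * dt <= S ->
  \sum_(i < k) Ws_def (u i.+1 \- u i) <= 4 * dt * KD.
Proof.
move=> kS.
have H j : j%:R * dt <= S ->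
  (4 * dt)^-1 * \sum_(i < j) Ws_def (u i.+1 \- u i) + En_def (u j) <= En_def u0 + j%:R * dt * (8 * Q ^+ 2 * KPhi + 1).
  elim: j => [|j IH] jS; first by rewrite big_ord0 (proj1 Hu) mulr0 add0r !mul0r addr0.
  have jS' : j%:R * dt <= S by apply: le_trans jS; rewrite ler_wpM2r ?ler_nat // ltW.
  have d4 : dt ^+ 4 <= dt by rewrite exprS; apply: ler_piMr; [exact: ltW|apply: exprn_ile1 => //; exact: ltW].
  set C := 8 * Q ^+ 2 * KPhi in IH *.
  have e1 : dt * Q ^+ 2 * Ws_def (u j) <= dt * C.
    have -> : dt * C = dt * Q ^+ 2 * (8 * KPhi) by rewrite /C; ring.
    by apply: ler_wpM2l; [rewrite mulr_ge0 ?sqr_ge0 // ltW|exact: rothe_Ws].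
  move: (IH jS') (step_energy dt0 (rothe_C1 j) (proj2 Hu j)) d4 e1; clear IH.
  rewrite big_ord_recr -[j.+1%:R]natr1 /=.
  move: (\sum_(i < j) Ws_def (u i.+1 \- u i)) (Ws_def (u j.+1 \- u j)) (En_def (u j.+1)) (En_def (u j)) (En_def u0).
  move: (dt * Q ^+ 2 * Ws_def (u j)) (dt ^+ 4) (C) (j%:R : R) ((4 * dt)^-1).
  by move=> *; lra.
have := H k kS; have := En_ge0 (rothe_C1 k).
have e2 : k%:R * dt * (8 * Q ^+ 2 * KPhi + 1) <= S * (8 * Q ^+ 2 * KPhi + 1).
  apply: ler_wpM2r kS; apply: addr_ge0 => //; apply: mulr_ge0; first by rewrite mulr_ge0 ?sqr_ge0.
  by apply: mulr_ge0; [exact: expR_ge0|apply: addr_ge0 => //; exact: Phi_ge0].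
move=> E0 H'; rewrite -ler_pdivrMl ?mulr_gt0 // /KD.
apply: (@le_trans _ _ (En_def u0 + k%:R * dt * (8 * Q ^+ 2 * KPhi + 1))); last by rewrite lerD2l.
by apply: le_trans H'; rewrite lerDl.
Qed.

(** Cauchy-Schwarz over the [k] increments, then [rothe_D]: uniformly in [dt], the scheme is Hoelder
    continuous of exponent 1/2 in time with values in weighted $L^2$. *)
Lemma rothe_modulus j k : (j + k)%:R * dt <= S ->
  Ws_def (u (j + k)%N \- u j) <= 4 * KD * (k%:R * dt).
Proof.
move=> kS; have bu i := C1_bmf (rothe_C1 i).
have A : Ws_def (u (j + k)%N \- u j) <= k%:R * \sum_(i < k) Ws_def (u (j + i).+1 \- u (j + i)%N).
  rewrite /Ws_def -(I_sum M_hausdorff M_compact mu_volume) //; last by move=> i; apply: Ws_bmf; exact: bmfB.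
  rewrite -IntZ; last by apply: bmf_sum => i; apply: Ws_bmf; exact: bmfB.
  apply: Int_le.
  - by apply: Ws_bmf; exact: bmfB.
  - by apply: bmfZ; apply: bmf_sum => i; apply: Ws_bmf; exact: bmfB.
  move=> p /=; rewrite -mulr_suml mulrA; apply: ler_wpM2r; first by rewrite ltW ?wt_gt0.
  elim: k {kS} => [|k IH]; first by rewrite addn0 subrr expr0n mul0r.
  rewrite big_ord_recr /= addnS.
  have [->|k0] := posnP k; first by rewrite addn0 big_ord0 add0r mul1r.
  set a := u (j + k).+1 p - u (j + k)%N p; set s := \sum_(i < k) _ in IH *.
  have -> : u (j + k).+1 p - u j p = (u (j + k)%N p - u j p) + a by rewrite /a; ring.
  move: IH; move: (u (j + k)%N p - u j p) => b IH.
  have k0' : 0 < (k%:R : R) by rewrite ltr0n.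
  rewrite -natr1 mulrDl mul1r mulrDr.
  have : 2 * a * b <= k%:R * a ^+ 2 + s.
    rewrite -(ler_pM2l k0'); have := sqr_ge0 (k%:R * a - b); nra.
  nra.
apply: le_trans A _.
have -> : 4 * KD * (k%:R * dt) = k%:R * (4 * dt * KD) by ring.
rewrite ler_wpM2l //; apply: le_trans (rothe_D kS).
rewrite big_split_ord /= lerDr; apply: sumr_ge0 => i _; exact: Ws_ge0.
Qed.

End Scheme.
End Estimates.
End Rothe.

(** * Estimates along the Euler scheme *)

Lemma weight_arith (R : realType) (B e W E : R) : 0 <= B -> 0 <= e -> 0 <= W -> 0 <= E ->
  B * W + 2 * (B * e * W + 2 * B * E) <= B * (12 + 16 * e) * (E + W / 8).
Proof.
move=> B0 e0 W0 E0; have := mulr_ge0 B0 W0; have := mulr_ge0 B0 E0.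
by have := mulr_ge0 e0 (mulr_ge0 B0 E0); lra.
Qed.

(** The pointwise inequality of [weighted_step]: [a], [w], [r] stand for the new value, the source
    and the weight, [x] and [y] for [Gam v v] and [Gam rho v], [z] and [t] for the drift derivatives
    of [v] and [rho], and [sr] for [Gam rho rho / rho]. *)
Lemma weight_arith2 (R : realType) (e a w r x y z t sr dt C1 : R) :
  0 <= (a - w) ^+ 2 * r ->
  0 <= dt * (e * (a ^+ 2 * sr) / 2 + 2 * e * (r * x + a * y)) ->
  a ^+ 2 * (r - dt * (e / 2 * sr - t) - dt * C1 * r) <=
  w ^+ 2 * r + (2 * ((a - w) * (r * a)) + dt * (2 * e * (r * x + a * y)) - 2 * dt * (r * a * z)) +
  dt * (r * a * z + a * (r * z + a * t) - C1 * (r * a * a)).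
Proof. by move=> *; lra. Qed.

Section RotheTests.
Context {R : realType} {n : nat} {M : ptopologicalType} (G : riemannian R n M).
Hypotheses (M_hausdorff : hausdorff_space M) (M_compact : compact [set: M]).
Variables (mu : {measure set (borel M) -> \bar R}) (mu_volume : is_volume G mu).
Implicit Types (p : M) (v h g : M -> R).
Variables (f : M -> R) (fC : Ck G 3 f) (q : M -> R) (Q eps : R).
Hypotheses (mq : measurable_fun setT (q : borel M -> R)) (qQ : forall p, `|q p| <= Q).
Hypothesis eps0 : 0 < eps.

Notation Gam := (carre G).
Notation C1M := (C1M G).
Notation X := (grad f (G := G)).
Notation IntD := (I_D M_hausdorff M_compact mu_volume).
Notation IntB := (I_B M_hausdorff M_compact mu_volume).
Notation IntN := (I_N M_hausdorff M_compact mu_volume).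
Notation IntZ := (I_Z M_hausdorff M_compact mu_volume).
Notation Int_le := (I_le M_hausdorff M_compact mu_volume).
Notation wt := (wt f eps).
Notation Ws := (Ws_def mu f eps).
Notation En := (En_def G mu f eps).
Notation Phi := (Phi G mu f eps).
Notation step := (step G mu f q eps).
Notation El := (El_def G f eps).
Notation src := (src_def q).
Notation C1_bmf := (C1_bmf M_compact).
Notation Gam_bmf := (Gam_bmf M_compact).
Notation wtC := (wt_C1 fC eps).

Let fC1 := f_C1 fC.
Let qB := q_bmf mq qQ.
Let XC := X_C1 fC.
Let Xc := X_compat fC.

(** With [c := 2 * (Ws h + 2 * En h)], [step_EL] gives a square at most [c * dt ^+ 2], and
    [c <= (1 + c) ^+ 2] avoids a square root. *)
Lemma EL_bound dt u v h : 0 < dt -> dt <= 1 -> C1M u -> step dt u v -> C1M h ->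
  `|\int[mu]_p El dt (src dt u) v h p| <= (1 + 2 * (Ws h + 2 * En h)) * dt.
Proof.
move=> dt0 dt1 Hu S Hh; have := step_EL M_hausdorff M_compact mu_volume fC mq qQ eps0 dt0 Hu S Hh.
have mB := C1_bmf wtC; have hB := C1_bmf Hh.
have b1 : bmf (fun p => h p ^+ 2 * wt p) by apply: bmfM => //; exact: bmfX.
have b2 : bmf (fun p => Gam h h p * wt p) by apply: bmfM => //; exact: Gam_bmf.
have -> : \int[mu]_p Nn G f eps dt h p = dt^-1 * Ws h + 2 * En h.
  rewrite /Nn IntD ?IntZ //; try exact: bmfZ.
  by rewrite /En_def IntZ //; congr (_ + _); field.
have W0 := Ws_ge0 mu f eps h; have E0 := En_ge0 mu f eps0 Hh.
move: (Ws h) (En h) (\int[mu]_p El _ _ _ _ p) W0 E0 => W E L W0 E0 H.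
have C0 : 0 <= 2 * (W + 2 * E) by rewrite mulr_ge0 // addr_ge0 // mulr_ge0.
have di : dt * dt^-1 = 1 by rewrite divff // lt0r_neq0.
have H2 : 2 * dt ^+ 4 * (dt^-1 * W + 2 * E) <= 2 * (W + 2 * E) * dt ^+ 2.
  have -> : 2 * dt ^+ 4 * (dt^-1 * W + 2 * E) = 2 * dt ^+ 2 * (dt * (dt * dt^-1) * W + 2 * (dt * dt) * E) by ring.
  rewrite di mulr1 mulrAC; apply: ler_wpM2r; first by rewrite sqr_ge0.
  have : dt * dt <= 1 by rewrite mulr_ile1 // ltW.
  move=> d2; have := ler_wpM2r W0 dt1; have := ler_wpM2r E0 d2; lra.
rewrite -ler_sqr ?nnegrE //; last by rewrite mulr_ge0 ?addr_ge0 // ltW.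
rewrite real_normK ?num_real //; apply: le_trans H _; apply: le_trans H2 _.
rewrite exprMn; apply: ler_wpM2r; first by rewrite sqr_ge0.
by move: (2 * (W + 2 * E)) C0 => c c0; have := sqr_ge0 c; lra.
Qed.

(** Test functions are divided by [wt]: differentiating the quotient produces exactly the transport
    term of the unweighted equation. *)
Lemma Gam_div_wt v g p : C1M v -> C1M g ->
  eps * (Gam v (fun p => g p * (wt p)^-1) p * wt p) = eps * Gam v g p - g p * pair v X p.
Proof.
move=> Hv Hg; have m0 p' : wt p' != 0 by rewrite gt_eqF // wt_gt0.
have Hi : C1M (fun p => (wt p)^-1) by exact: C1MV wtC.
have Hh := C1MM Hg Hi.
have E : (fun p => g p * (wt p)^-1 * wt p) = g by apply/funext => p'; rewrite mulfVK.
have := GamMl p Hh wtC Hv; rewrite E (GamC p wtC Hv) (GamC p Hh Hv) (GamC p Hg Hv) => ->.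
have -> : Gam v wt p = wt p * eps^-1 * pair v X p.
  rewrite (GamC p Hv wtC) /carre (pair_wt fC eps p (grad_compat Hv)).
  by rewrite -/(carre G f v p) GamC.
have := m0 p; move: (wt p) (pair v X p) (Gam _ _ p) (g p) => m a b c mp.
by field; rewrite mp gt_eqF.
Qed.

Definition adj0 h p : R := - divergence (scale_vfield h X) p + eps * laplacian G h p.

Section WeakStep.
Variables (k : nat) (h : M -> R) (hC : Ck G k.+2 h).
Let hC1 := C1M_Ck hC.

Lemma adj0_bmf : bmf (adj0 h).
Proof.
apply: bmfD.
  apply: bmfN; apply: bmf_cont => //.
  by apply: (divergence_cont M_hausdorff M_compact mu_volume); [exact: scale_compat|exact: scale_C1].
apply: bmfZ; apply: bmf_cont => //.
by apply: (divergence_cont M_hausdorff M_compact mu_volume); [exact: grad_compat|exact: grad_C1 hC].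
Qed.

Lemma green_adj0 v : C1M v ->
  \int[mu]_p (eps * Gam v h p - h p * pair v X p) = - \int[mu]_p (v p * adj0 h p).
Proof.
move=> Hv; have vB := C1_bmf Hv; have hB := C1_bmf hC1.
have G1 := green M_hausdorff M_compact mu_volume (grad_compat hC1) (grad_C1 hC) Hv.
have G2 := green M_hausdorff M_compact mu_volume (scale_compat Xc h) (scale_C1 hC1 XC) Hv.
have d1 : bmf (divergence (grad h (G := G))).
  apply: bmf_cont => //; apply: (divergence_cont M_hausdorff M_compact mu_volume); [exact: grad_compat|exact: grad_C1 hC].
have d2 : bmf (divergence (scale_vfield h X)).
  apply: bmf_cont => //; apply: (divergence_cont M_hausdorff M_compact mu_volume); [exact: scale_compat|exact: scale_C1].
have g1 : bmf (Gam v h) by exact: Gam_bmf.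
have g2 : bmf (pair v X) by apply: bmf_cont => //; apply: pair_cont => //; exact: vf_C1_cont.
have g3 : bmf (pair v (scale_vfield h X)).
  by apply: bmf_cont => //; apply: pair_cont => //; [exact: scale_compat|apply: vf_C1_cont; exact: scale_C1].
have b1 := bmfD (bmfM vB d1) g1; have b2 := bmfD (bmfM vB d2) g3.
have E : eps * \int[mu]_p (v p * divergence (grad h (G := G)) p + Gam v h p) - \int[mu]_p (v p * divergence (scale_vfield h X) p + pair v (scale_vfield h X) p) = 0.
  by rewrite G1 G2 mulr0 subr0.
have b3 : bmf (fun p => v p * adj0 h p) by apply: bmfM => //; exact: adj0_bmf.
have b4 : bmf (fun p => eps * Gam v h p - h p * pair v X p) by apply: bmfB; [exact: bmfZ|exact: bmfM].
apply/eqP; rewrite -subr_eq0 opprK -IntD //; apply/eqP; rewrite -[RHS]E -IntZ // -IntB //; last exact: bmfZ.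
apply: I_eq => p; rewrite pair_scale // /adj0 /laplacian; ring.
Qed.

(** The Euler-Lagrange bound with test function [h / wt]. A consistency error of order [dt ^+ 2] per
    step adds up to order [dt] over a bounded time. *)
Lemma weak_step : exists2 K : R, 0 <= K & forall dt u v, 0 < dt -> dt <= 1 -> C1M u -> step dt u v ->
  `|\int[mu]_p (v p * h p) - \int[mu]_p (u p * h p) -
    dt * (\int[mu]_p (q p * u p * h p) + \int[mu]_p (v p * adj0 h p))| <= K * dt ^+ 2.
Proof.
pose g p := h p * (wt p)^-1.
have m0 p' : wt p' != 0 by rewrite gt_eqF // wt_gt0.
have gC : C1M g by apply: C1MM => //; exact: C1MV wtC.
exists (1 + 2 * (Ws g + 2 * En g)).
  rewrite addr_ge0 // mulr_ge0 // addr_ge0 ?Ws_ge0 // mulr_ge0 //; exact: En_ge0.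
move=> dt u v dt0 dt1 Hu S; have [Hv _ _] := S.
have := EL_bound dt0 dt1 Hu S gC; move: (1 + _) => K.
have vB := C1_bmf Hv; have uB := C1_bmf Hu; have hB := C1_bmf hC1.
have g2 : bmf (pair v X) by apply: bmf_cont => //; apply: pair_cont => //; exact: vf_C1_cont.
have b3 : bmf (fun p => v p * adj0 h p) by apply: bmfM => //; exact: adj0_bmf.
have b1 := bmfM vB hB; have b2 := bmfM uB hB; have b5 := bmfM (bmfM qB uB) hB.
have b4 : bmf (fun p => eps * Gam v h p - h p * pair v X p).
  by apply: bmfB; [apply: bmfZ; exact: Gam_bmf|exact: bmfM].
have -> : \int[mu]_p El dt (src dt u) v g p = dt^-1 * (\int[mu]_p (v p * h p) - \int[mu]_p (u p * h p) -
    dt * (\int[mu]_p (q p * u p * h p) + \int[mu]_p (v p * adj0 h p))).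
  rewrite mulrDr mulrN mulrA mulVf ?gt_eqF // mul1r opprD addrA -green_adj0 // mulrBr -!IntZ // -!IntB //; try by [exact: bmfZ|apply: bmfB => //; exact: bmfZ].
  rewrite -IntD //; last by apply: bmfB => //; apply: bmfB; exact: bmfZ.
  apply: I_eq => p; rewrite /El_def Gam_div_wt // /g /src_def; congr (_ + _).
  by field; rewrite m0 gt_eqF.
rewrite normrM gtr0_norm ?invr_gt0 // ler_pdivrMl // => H; apply: le_trans H _.
by rewrite mulrCA expr2.
Qed.

End WeakStep.

Lemma Ck_cst k (a : R) : Ck G k (cst a).
Proof.
move=> c; rewrite /comp.
suff H : forall (b : R), Ck_on k (chart_cod c) (fun _ : 'rV[R]_n => b) by exact: H.
elim: k => [|k IH] b; (split; first by move=> x _; exact: cst_continuous) => //.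
move=> j; split; first by move=> x _; exact: derivable_cst.
have -> : partial j (fun _ : 'rV[R]_n => b) = (fun _ => 0); last exact: IH.
by apply/funext => x; rewrite /partial derive_cst.
Qed.

Lemma expR_inv (x : R) : 0 <= x -> x <= 2^-1 -> expR (- (2 * x)) <= 1 - x.
Proof.
move=> x0 x1; rewrite expRN -div1r ler_pdivrMr ?expR_gt0 //.
apply: le_trans (ler_wpM2l _ (expR_ge1Dx (2 * x))); last lra.
by have := mulr_ge0 x0 (_ : 0 <= 2^-1 - x); rewrite subr_ge0 => /(_ x1); lra.
Qed.

(** The mass decays at a rate controlled by [Q + CA], up to the accumulated consistency error. The
    exponential comes from [1 - x >= exp (- 2 x)] for small [x], which is why [(Q + CA) * dt] is
    kept below 1/2. *)
Lemma mass_bound CA : 0 <= CA -> (forall p, `|adj0 (cst 1) p| <= CA) -> forall S, 0 <= S ->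
  exists2 K : R, 0 <= K & forall dt u0 u, 0 < dt -> dt <= 1 -> (Q + CA) * dt <= 2^-1 -> C1M u0 -> (forall p, 0 <= u0 p) ->
  rothe G mu f q eps dt u0 u -> forall k, k%:R * dt <= S ->
  expR (- (2 * ((Q + CA) * S))) * \int[mu]_p u0 p - S * K * dt <= \int[mu]_p u k p.
Proof.
move=> CA0 HA S S0; have [K K0 HK] := weak_step (Ck_cst 2 1); exists K => //.
move=> dt u0 u dt0 dt1 Bdt u0C u00 Hu k kS.
have Q0 := Q_ge0 qQ; have B0 : 0 <= Q + CA by rewrite addr_ge0.
have uC i := rothe_C1 u0C Hu i; have u_ge0 i := rothe_ge0 u00 Hu i.
have I0 i : 0 <= \int[mu]_p u i p by apply: I_ge0.
have St i : (1 - (Q + CA) * dt) * \int[mu]_p u i p - K * dt ^+ 2 <= \int[mu]_p u i.+1 p.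
  have uB := C1_bmf (uC i); have vB := C1_bmf (uC i.+1).
  have := HK dt (u i) (u i.+1) dt0 dt1 (uC i) (proj2 Hu i).
  have -> : \int[mu]_p (u i.+1 p * cst 1 p) = \int[mu]_p u i.+1 p by apply: I_eq => p; rewrite mulr1.
  have -> : \int[mu]_p (u i p * cst 1 p) = \int[mu]_p u i p by apply: I_eq => p; rewrite mulr1.
  have e1 : - (Q * \int[mu]_p u i p) <= \int[mu]_p (q p * u i p * cst 1 p).
    rewrite -mulNr -IntZ //; apply: Int_le; [exact: bmfZ|apply: bmfM; [exact: bmfM|exact: bmf_cst]|].
    by move=> p; rewrite /= mulr1 ler_wpM2r //; have := qQ p; rewrite ler_norml => /andP[].
  have e2 : - (CA * \int[mu]_p u i.+1 p) <= \int[mu]_p (u i.+1 p * adj0 (cst 1) p).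
    rewrite -mulNr -IntZ //; apply: Int_le; [exact: bmfZ|apply: bmfM => //; exact: adj0_bmf (Ck_cst 2 1)|].
    by move=> p; rewrite mulrC ler_wpM2l //; have := HA p; rewrite ler_norml => /andP[].
  move: e1 e2 (I0 i) (I0 i.+1); move: (\int[mu]_p u i p) (\int[mu]_p u i.+1 p).
  move: (\int[mu]_p (q p * u i p * cst 1 p)) (\int[mu]_p (u i.+1 p * adj0 (cst 1) p)) => a b x y e1 e2 x0 y0.
  rewrite ler_norml => /andP[H _].
  have H1 : x - dt * (Q * x) - dt * (CA * y) - K * dt ^+ 2 <= y.
    have := ler_wpM2l (ltW dt0) e1; have := ler_wpM2l (ltW dt0) e2; lra.
  (* The adjoint term involves the new mass [y]. Either [y <= x] and it is bounded by the old mass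
     [x], or the mass has increased and the claim is immediate. *)
  have [yx|/ltW xy] := lerP y x.
    have : dt * (CA * y) <= dt * (CA * x) by rewrite !ler_wpM2l // ltW.
    lra.
  have : 0 <= K * dt ^+ 2 by rewrite mulr_ge0 ?sqr_ge0.
  have : 0 <= (Q + CA) * dt * x by rewrite !mulr_ge0 // ltW.
  lra.
have H i : (1 - (Q + CA) * dt) ^+ i * \int[mu]_p u 0%N p - i%:R * (K * dt ^+ 2) <= \int[mu]_p u i p.
  elim: i => [|i IH]; first by rewrite mul0r subr0 mul1r.
  apply: le_trans (St i); have r0 : 0 <= 1 - (Q + CA) * dt by lra.
  have r1 : 1 - (Q + CA) * dt <= 1 by rewrite gerBl mulr_ge0 // ltW.
  have := ler_wpM2l r0 IH.
  have : (1 - (Q + CA) * dt) * (i%:R * (K * dt ^+ 2)) <= i%:R * (K * dt ^+ 2).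
    by rewrite ler_piMl // !mulr_ge0 // ltW.
  rewrite (exprS _ i) -[i.+1%:R]natr1; move: (1 - (Q + CA) * dt) (K * dt ^+ 2) (i%:R : R) => a b c.
  move: (\int[mu]_p u i p) (\int[mu]_p u 0%N p) (_ ^+ i) => *; lra.
apply: le_trans (H k); rewrite (proj1 Hu); apply: lerB.
  apply: ler_wpM2r; first by apply: I_ge0.
  have x0 : 0 <= (Q + CA) * dt by rewrite mulr_ge0 // ltW.
  apply: (@le_trans _ _ (expR (- (2 * ((Q + CA) * dt))) ^+ k)).
    rewrite -expRM_natl ler_expR mulrN lerN2 mulrCA ler_wpM2l // mulrCA ler_wpM2l //.
  by apply: lerXn2r; rewrite ?nnegrE ?expR_ge0 ?expR_inv //; lra.
have -> : k%:R * (K * dt ^+ 2) = k%:R * dt * (K * dt) by ring.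
by rewrite -[S * K * dt]mulrA ler_wpM2r // mulr_ge0 // ltW.
Qed.

(** For [rho] equal to $e^{-2W/\varepsilon}$ this is $\frac{2}{\varepsilon}\rho\,(|\nabla
    W|^2+\nabla\mathfrak f\cdot\nabla W)$, the Hamiltonian of the weight. *)
Definition Hrho (rho : M -> R) p := eps / 2 * Gam rho rho p / rho p - pair rho X p.

Lemma Hrho_bmf rho : C1M rho -> (forall p, 0 < rho p) -> bmf (Hrho rho).
Proof.
move=> rC r0; apply: bmfB; last by apply: bmf_cont => //; apply: pair_cont => //; exact: vf_C1_cont.
apply: bmfM; first by apply: bmfZ; exact: Gam_bmf.
by apply: C1_bmf; apply: C1MV => // p; rewrite gt_eqF.
Qed.

(** The test function is [rho * v / wt]. Young's inequality absorbs the cross term in [Gam rho v]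
    into [rho * Gam v v] at the cost of the quadratic part of [Hrho]. The transport term is
    integrated by parts, which leaves its drift part and the divergence of the field. *)
Lemma weighted_step (rho : M -> R) B C1 dt u v : 0 < dt -> dt <= 1 -> C1M u -> step dt u v ->
  C1M rho -> (forall p, 0 < rho p) -> 0 <= C1 -> (forall p, `|divergence X p| <= C1) ->
  (forall p, (rho p / wt p) ^+ 2 <= B) ->
  (forall p, Gam (fun p => rho p / wt p) (fun p => rho p / wt p) p <= B) ->
  \int[mu]_p (v p ^+ 2 * (rho p - dt * Hrho rho p - dt * C1 * rho p)) <=
  (1 + dt * Q) ^+ 2 * \int[mu]_p (u p ^+ 2 * rho p) +
  2 * dt ^+ 2 * (1 + 2 * (B * (12 + 16 * eps) * Phi v)).
Proof.
move=> dt0 dt1 Hu S rC r0 C10 HC HB1 HB2; have [Hv v0 _] := S.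
have m0 p' : wt p' != 0 by rewrite gt_eqF // wt_gt0.
have iC : C1M (fun p => (wt p)^-1) by exact: C1MV wtC.
pose g p := rho p / wt p.
have gC : C1M g by exact: C1MM.
have zC := C1MM rC Hv.
pose h p := rho p * v p * (wt p)^-1.
have hC : C1M h by exact: C1MM.
have hE : h = (fun p => v p * g p) by apply/funext => p; rewrite /h /g; ring.
have vB := C1_bmf Hv; have uB := C1_bmf Hu; have rB := C1_bmf rC; have mB := C1_bmf wtC.
have B0 : 0 <= B by apply: le_trans (HB1 point); rewrite sqr_ge0.
have W0 := Ws_ge0 mu f eps v; have E0 := En_ge0 mu f eps0 Hv.
have bW : bmf (fun p => v p ^+ 2 * wt p) by apply: bmfM => //; exact: bmfX.
have bE : bmf (fun p => eps / 2 * (Gam v v p * wt p)) by apply: bmfZ; apply: bmfM => //; exact: Gam_bmf.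
have Wh : Ws h <= B * Ws v.
  rewrite /Ws_def -IntZ //; apply: Int_le; [by apply: bmfM => //; apply: bmfX; exact: C1_bmf|exact: bmfZ|].
  move=> p; rewrite mulrA; apply: ler_wpM2r; first by rewrite ltW ?wt_gt0.
  by rewrite hE exprMn mulrC; apply: ler_wpM2r; [rewrite sqr_ge0|exact: HB1].
have Eh : En h <= B * eps * Ws v + 2 * B * En v.
  rewrite /Ws_def /En_def -!IntZ // -IntD //; try exact: bmfZ.
  apply: Int_le; [by apply: bmfZ; apply: bmfM => //; exact: Gam_bmf|by apply: bmfD; exact: bmfZ|].
  move=> p; have := GamM_le p Hv gC; rewrite -hE => H.
  have H1 : Gam h h p <= 2 * (v p ^+ 2 * B + B * Gam v v p).
    apply: le_trans H _; rewrite ler_wpM2l // lerD //; first by rewrite ler_wpM2l ?sqr_ge0 //; exact: HB2.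
    by rewrite ler_wpM2r ?Gam_ge0 //; exact: HB1.
  have -> : B * eps * (v p ^+ 2 * wt p) + 2 * B * (eps / 2 * (Gam v v p * wt p)) = eps / 2 * (2 * (v p ^+ 2 * B + B * Gam v v p) * wt p).
    by field.
  by rewrite ler_wpM2l ?divr_ge0 ?(ltW eps0) // ler_wpM2r // ltW ?wt_gt0.
have L1 := EL_bound dt0 dt1 Hu S hC.
have L2 : \int[mu]_p El dt (src dt u) v h p <= (1 + 2 * (B * (12 + 16 * eps) * Phi v)) * dt.
  apply: le_trans (ler_norm _) _; apply: le_trans L1 _; rewrite ler_wpM2r ?(ltW dt0) // lerD2l ler_wpM2l //.
  apply: le_trans (lerD Wh (ler_wpM2l _ Eh)) _ => //.
  exact: weight_arith (ltW eps0) _ _.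
have z2C : C1M (fun p => rho p * v p * v p) := C1MM zC Hv.
have pB : bmf (pair (fun p => rho p * v p * v p) X).
  by apply: bmf_cont => //; apply: pair_cont => //; exact: vf_C1_cont.
have dB : bmf (divergence X) by apply: bmf_cont => //; apply: (divergence_cont M_hausdorff M_compact mu_volume).
have Gz := green M_hausdorff M_compact mu_volume Xc XC z2C.
have Hz : \int[mu]_p (pair (fun p => rho p * v p * v p) X p) <= C1 * \int[mu]_p (rho p * v p * v p).
  have E : \int[mu]_p (pair (fun p => rho p * v p * v p) X p) = - \int[mu]_p (rho p * v p * v p * divergence X p).
    by apply/eqP; rewrite -subr_eq0 opprK addrC -IntD ?Gz //; apply: bmfM => //; exact: C1_bmf.
  rewrite E -IntN -?IntZ; [|exact: C1_bmf|by apply: bmfM => //; exact: C1_bmf].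
  apply: Int_le; [by apply: bmfN; apply: bmfM => //; exact: C1_bmf|by apply: bmfZ; exact: C1_bmf|].
  move=> p; rewrite -mulrN mulrC; apply: ler_wpM2r; first by rewrite !mulr_ge0 // ltW.
  by have := HC p; rewrite ler_norml lerNl => /andP[].
have wB : bmf (src dt u) by exact: src_bmf.
have elB : bmf (El dt (src dt u) v h) by exact: El_bmf.
have HrB := Hrho_bmf rC r0.
have b1 : bmf (fun p => v p ^+ 2 * (rho p - dt * Hrho rho p - dt * C1 * rho p)).
  by apply: bmfM; [exact: bmfX|apply: bmfB; [apply: bmfB => //; exact: bmfZ|exact: bmfZ]].
have b2 : bmf (fun p => (src dt u p) ^+ 2 * rho p) by apply: bmfM => //; exact: bmfX.
have b3 := C1_bmf z2C.
have b4 := bmfM (bmfX uB) rB.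
have pt p : v p ^+ 2 * (rho p - dt * Hrho rho p - dt * C1 * rho p) <=
   (src dt u p) ^+ 2 * rho p + (2 * dt) * El dt (src dt u) v h p + dt * (pair (fun p => rho p * v p * v p) X p - C1 * (rho p * v p * v p)).
  rewrite /El_def /h Gam_div_wt // pairM // pairM // (GamC p Hv zC) GamMl // /Hrho.
  have Y := Gam_young p (rho p) (- (v p / 2)) Hv rC; rewrite (GamC p Hv rC) in Y.
  have {}Y : eps * (v p ^+ 2 * (Gam rho rho p / rho p)) / 2 + 2 * eps * (rho p * Gam v v p + v p * Gam rho v p) >= 0.
    have -> : eps * (v p ^+ 2 * (Gam rho rho p / rho p)) / 2 + 2 * eps * (rho p * Gam v v p + v p * Gam rho v p) =
      2 * eps / rho p * (rho p ^+ 2 * Gam v v p + (- (v p / 2)) ^+ 2 * Gam rho rho p - 2 * (rho p * - (v p / 2)) * Gam rho v p).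
      by field; rewrite gt_eqF.
    by rewrite mulr_ge0 ?subr_ge0 // divr_ge0 ?mulr_ge0 // ltW.
  have ww : (v p - src dt u p) ^+ 2 * rho p >= 0 by rewrite mulr_ge0 ?sqr_ge0 // ltW.
  have mp := m0 p; have dn : dt != 0 by rewrite gt_eqF.
  have -> : 2 * dt * (dt^-1 * ((v p - src dt u p) * (rho p * v p / wt p) * wt p) +
     (eps * (rho p * Gam v v p + v p * Gam rho v p) - rho p * v p * pair v X p)) =
     2 * ((v p - src dt u p) * (rho p * v p)) + dt * (2 * eps * (rho p * Gam v v p + v p * Gam rho v p)) - 2 * dt * (rho p * v p * pair v X p).
    by field; rewrite mp dn.
  have := ler_wpM2l (ltW dt0) Y; rewrite mulr0.
  move: ww; move: (src dt u p) (v p) (rho p) (Gam v v p) (Gam rho v p) (pair v X p) (pair rho X p) (Gam rho rho p) => w a r x y z t s.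
  by rewrite -[eps / 2 * s / r]mulrA; exact: weight_arith2.
have HI := Int_le b1 (bmfD (bmfD b2 (bmfZ (2 * dt) elB)) (bmfZ dt (bmfB pB (bmfZ C1 b3)))) pt.
apply: le_trans HI _.
rewrite IntD; [|by apply: bmfD => //; exact: bmfZ|by apply: bmfZ; apply: bmfB => //; exact: bmfZ].
rewrite IntD ?(IntZ (2 * dt)) ?(IntZ dt) //; try by [exact: bmfZ|apply: bmfB => //; exact: bmfZ].
rewrite IntB ?(IntZ C1) //; last exact: bmfZ.
have e1 : \int[mu]_p ((src dt u p) ^+ 2 * rho p) <= (1 + dt * Q) ^+ 2 * \int[mu]_p (u p ^+ 2 * rho p).
  rewrite -IntZ //; apply: Int_le => //; first exact: bmfZ.
  move=> p; rewrite mulrA; apply: ler_wpM2r; first exact: ltW.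
  rewrite /src_def exprMn; apply: ler_wpM2r; first by rewrite sqr_ge0.
  have := qQ p; rewrite ler_norml => /andP[q1 q2].
  rewrite -subr_ge0; have -> : (1 + dt * Q) ^+ 2 - (1 + dt * q p) ^+ 2 = (dt * (Q - q p)) * (2 + dt * (Q + q p)) by ring.
  by apply: mulr_ge0; [|apply: addr_ge0 => //]; apply: mulr_ge0; rewrite ?(ltW dt0) ?subr_ge0 // -lerBlDl sub0r.
have e2 := ler_wpM2l (ltW dt0) Hz.
have e3 : 2 * dt * \int[mu]_p El dt (src dt u) v h p <= 2 * dt * ((1 + 2 * (B * (12 + 16 * eps) * Phi v)) * dt).
  by rewrite ler_wpM2l // mulr_ge0 // ltW.
have -> : 2 * dt ^+ 2 * (1 + 2 * (B * (12 + 16 * eps) * Phi v)) = 2 * dt * ((1 + 2 * (B * (12 + 16 * eps) * Phi v)) * dt) by ring.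
rewrite mulrBr -[leRHS]addr0; apply: lerD; [exact: lerD|by rewrite subr_le0].
Qed.

(** A discrete Gronwall argument. The last hypothesis says that the next weight is dominated, up to
    the factor [1 - c1 * dt], by the expression on the left of [weighted_step]; it is the place
    where a Hamilton-Jacobi inequality enters. *)
Lemma weighted_iter (rho : nat -> M -> R) B C1 c1 S dt u0 u k0 J : 0 < dt -> dt <= 1 ->
  C1M u0 -> (forall p, 0 <= u0 p) -> rothe G mu f q eps dt u0 u -> 0 <= S -> (k0 + J)%:R * dt <= S ->
  0 <= c1 -> c1 * dt <= 2^-1 -> 0 <= C1 -> (forall p, `|divergence X p| <= C1) ->
  (forall i, (i <= J)%N -> [/\ C1M (rho i), forall p, 0 < rho i p,
    forall p, (rho i p / wt p) ^+ 2 <= B &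
    forall p, Gam (fun p => rho i p / wt p) (fun p => rho i p / wt p) p <= B]) ->
  (forall i p, (i < J)%N -> (1 - c1 * dt) * rho i.+1 p <= rho i p - dt * Hrho (rho i) p - dt * C1 * rho i p) ->
  \int[mu]_p (u (k0 + J)%N p ^+ 2 * rho J p) <=
  expR (2 * (Q + c1) * S) * (\int[mu]_p (u k0 p ^+ 2 * rho 0%N p) +
    2 * S * (1 + 2 * (B * (12 + 16 * eps) * KPhi G mu f Q eps u0 S)) * dt).
Proof.
move=> dt0 dt1 u0C u00 Hu S0 kS c10 c1dt C10 HC Hr Hs.
have Q0 := Q_ge0 qQ; have uC i := rothe_C1 u0C Hu i.
have B0 : 0 <= B by have [_ _ /(_ point) H _] := Hr 0%N (leq0n _); apply: le_trans H; rewrite sqr_ge0.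
set E := 1 + 2 * _.
have E0 : 0 <= E.
  have KP0 : 0 <= KPhi G mu f Q eps u0 S.
    by apply: mulr_ge0; [exact: expR_ge0|apply: addr_ge0 => //; exact: Phi_ge0].
  by rewrite addr_ge0 // mulr_ge0 // mulr_ge0 // mulr_ge0 // addr_ge0 // mulr_ge0 // ltW.
pose I i := \int[mu]_p (u (k0 + i)%N p ^+ 2 * rho i p).
pose b := expR (2 * (Q + c1) * dt).
have b1 : 1 <= b by rewrite -expR0 ler_expR !mulr_ge0 ?addr_ge0 // ltW.
have I0 i : (i <= J)%N -> 0 <= I i.
  by move=> iJ; have [_ r0 _ _] := Hr i iJ; apply: I_ge0 => p; rewrite mulr_ge0 ?sqr_ge0 // ltW.
have dE : 0 <= 2 * dt ^+ 2 * E by apply: mulr_ge0 => //; apply: mulr_ge0 => //; exact: sqr_ge0.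
have St i : (i < J)%N -> I i.+1 <= b * (I i + 2 * dt ^+ 2 * E).
  move=> iJ; have [rC r0 rB1 rB2] := Hr i (ltnW iJ); have [rC' r0' _ _] := Hr i.+1 iJ.
  have Sp := (proj2 Hu (k0 + i)%N); rewrite -addnS in Sp.
  have W := weighted_step dt0 dt1 (uC _) Sp rC r0 C10 HC rB1 rB2.
  have uB := bmfX (C1_bmf (uC (k0 + i.+1)%N)).
  have W1 : (1 - c1 * dt) * I i.+1 <= (1 + dt * Q) ^+ 2 * I i + 2 * dt ^+ 2 * E.
    apply: (@le_trans _ _ (\int[mu]_p (u (k0 + i.+1)%N p ^+ 2 * (rho i p - dt * Hrho (rho i) p - dt * C1 * rho i p)))).
      rewrite /I -IntZ; last by apply: bmfM => //; exact: C1_bmf.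
      apply: Int_le.
      - by apply: bmfZ; apply: bmfM => //; exact: C1_bmf.
      - apply: bmfM => //; apply: bmfB; last by apply: bmfZ; exact: C1_bmf.
        by apply: bmfB; [exact: C1_bmf|apply: bmfZ; exact: Hrho_bmf].
      by move=> p; rewrite mulrCA ler_wpM2l ?sqr_ge0 //; exact: Hs.
    apply: le_trans W _; rewrite lerD2l; apply: ler_wpM2l.
      by apply: mulr_ge0 => //; exact: sqr_ge0.
    rewrite lerD2l; apply: ler_wpM2l => //; apply: ler_wpM2l.
      by rewrite mulr_ge0 // addr_ge0 // mulr_ge0 // ltW.
    apply: (rothe_Phi M_hausdorff M_compact mu_volume fC mq qQ eps0 u0C dt0 dt1 Hu).
    by apply: le_trans kS; rewrite ler_wpM2r ?(ltW dt0) // ler_nat leq_add2l.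
  have x0 : 0 <= c1 * dt by rewrite mulr_ge0 // ltW.
  have e1 := ler_wpM2r (I0 _ iJ) (expR_inv x0 c1dt).
  have e2 : (1 + dt * Q) ^+ 2 <= expR (2 * (dt * Q)).
    rewrite expRM_natl; apply: lerXn2r; rewrite ?nnegrE ?expR_ge0 ?expR_ge1Dx //.
    by rewrite addr_ge0 // mulr_ge0 // ltW.
  have e3 := ler_wpM2r (I0 _ (ltnW iJ)) e2.
  have bE : b = expR (2 * (c1 * dt)) * expR (2 * (dt * Q)) by rewrite /b -expRD; congr expR; ring.
  have e4 : 1 <= expR (2 * (dt * Q)) by rewrite -expR0 ler_expR !mulr_ge0 // ltW.
  have e5 : I i.+1 <= expR (2 * (c1 * dt)) * ((1 + dt * Q) ^+ 2 * I i + 2 * dt ^+ 2 * E).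
    rewrite mulrC -ler_pdivrMr ?expR_gt0 // -expRN mulrC; exact: le_trans e1 W1.
  apply: le_trans e5 _; rewrite bE -[leRHS]mulrA; apply: ler_wpM2l; first exact: expR_ge0.
  rewrite [leRHS]mulrDr; apply: lerD => //.
  by rewrite -[leLHS]mul1r; apply: ler_wpM2r.
have H i : (i <= J)%N -> I i <= b ^+ i * (I 0%N + i%:R * (2 * dt ^+ 2 * E)).
  elim: i => [|i IH] iJ; first by rewrite expr0 mul1r mul0r addr0.
  apply: le_trans (St i iJ) _; rewrite (exprS _ i) -[leRHS]mulrA; apply: ler_wpM2l; first exact: expR_ge0.
  apply: le_trans (lerD (IH (ltnW iJ)) (lexx _)) _.
  have -> : I 0%N + i.+1%:R * (2 * dt ^+ 2 * E) = (I 0%N + i%:R * (2 * dt ^+ 2 * E)) + 2 * dt ^+ 2 * E.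
    by rewrite -[i.+1%:R]natr1; move: (2 * dt ^+ 2 * E) (I 0%N) => a c; ring.
  rewrite [leRHS]mulrDr lerD2l -[leLHS]mul1r.
  by apply: ler_wpM2r => //; exact: exprn_ege1.
have := H J (leqnn J); rewrite /I addn0 => HJ; apply: le_trans HJ _.
have JS : J%:R * dt <= S by apply: le_trans kS; rewrite ler_wpM2r ?(ltW dt0) // ler_nat leq_addl.
have I00 := I0 0%N (leq0n _); rewrite /I addn0 in I00.
apply: ler_pM.
- by rewrite exprn_ge0 // expR_ge0.
- by rewrite addr_ge0 // mulr_ge0.
- rewrite /b -expRM_natl ler_expR mulrCA ler_wpM2l // mulr_ge0 // addr_ge0 //.
- rewrite lerD2l; have -> : J%:R * (2 * dt ^+ 2 * E) = (J%:R * dt) * (2 * E * dt) by ring.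
  have -> : 2 * S * E * dt = S * (2 * E * dt) by ring.
  by rewrite ler_wpM2r // !mulr_ge0 // ltW.
Qed.

End RotheTests.

(** * Weak limits along an ultrafilter *)

Section Ulim.
Context {R : realType}.
Variables (U : set_system nat) (UU : UltraFilter U) (Uoo : \oo `<=` U).
Implicit Types a b : nat -> R.

Definition bdd a := exists B : R, forall j, `|a j| <= B.

(** Along an ultrafilter every bounded sequence converges, so all times and all test functions are
    treated at once, with no extraction of subsequences, and the limit is linear and monotone in the
    sequence. *)
Definition ulim a : R := lim (a @ U).

(** The limit is the supremum of the reals that lie below the sequence along [U]; the ultrafilter
    decides on which side of each level the sequence is. *)
Lemma ulim_exists a : bdd a -> exists l : R, a @ U --> l.
Proof.
move=> [B HB]; pose S := [set x : R | U [set j | x <= a j]].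
have UP : ProperFilter U by exact: ultra_proper.
have S0 : S !=set0.
  by exists (- B); rewrite /S /=; apply: filterS filterT => j _ /=; have := HB j; rewrite ler_norml => /andP[].
have SB : ubound S B.
  move=> x Sx; have [j xj] := filter_ex Sx; apply: le_trans xj _.
  by have := HB j; rewrite ler_norml => /andP[].
exists (sup S); apply/cvgrPdist_le => e e0; rewrite /nbhs /=.
have hS : has_sup S by split=> //; exists B.
have [x Sx lx] := sup_adherent e0 hS.
have nS : U [set j | a j < sup S + e].
  have [//|] := in_ultra_setVsetC [set j | a j < sup S + e] UU.
  move=> H; have : S (sup S + e) by apply: filterS H => j /= /negP; rewrite -leNgt.
  by move=> /(ub_le_sup hS.2); rewrite gerDl leNgt e0.
apply: filterS (filterI Sx nS) => j [/= H1 /ltW H2].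
by rewrite ler_norml; apply/andP; split; lra.
Qed.

Lemma ucvg a : bdd a -> a @ U --> ulim a.
Proof.
have UP : ProperFilter U by exact: ultra_proper.
by move=> /ulim_exists[l H]; rewrite /ulim (cvg_lim _ H).
Qed.

Lemma ulimE a (l : R) : a @ U --> l -> ulim a = l.
Proof. by have UP : ProperFilter U := ultra_proper; move=> H; exact: cvg_lim. Qed.

Lemma bddD a b : bdd a -> bdd b -> bdd (fun j => a j + b j).
Proof. by move=> [A HA] [B HB]; exists (A + B) => j; rewrite (le_trans (ler_normD _ _)) ?lerD. Qed.

Lemma bddZ (c : R) a : bdd a -> bdd (fun j => c * a j).
Proof. by move=> [A HA]; exists (`|c| * A) => j; rewrite normrM ler_wpM2l. Qed.

Lemma bdd_cst (c : R) : bdd (fun=> c). Proof. by exists `|c|. Qed.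

Lemma ulimD a b : bdd a -> bdd b -> ulim (fun j => a j + b j) = ulim a + ulim b.
Proof. by have UP : ProperFilter U := ultra_proper; move=> /ucvg Ha /ucvg Hb; apply: ulimE; exact: cvgD. Qed.

Lemma ulimZ (c : R) a : bdd a -> ulim (fun j => c * a j) = c * ulim a.
Proof. by have UP : ProperFilter U := ultra_proper; move=> /ucvg Ha; apply: ulimE; apply: cvgM => //; exact: cvg_cst. Qed.

Lemma ulim_cst (c : R) : ulim (fun=> c) = c.
Proof. by have UP : ProperFilter U := ultra_proper; apply: ulimE; exact: cvg_cst. Qed.

Lemma ulim_le_near a b : bdd a -> bdd b -> U [set j | a j <= b j] -> ulim a <= ulim b.
Proof.
have UP : ProperFilter U := ultra_proper; move=> /ucvg Ha /ucvg Hb H; apply: ler_lim => //.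
Qed.

Lemma ulim_le a b : bdd a -> bdd b -> (forall j, a j <= b j) -> ulim a <= ulim b.
Proof.
have UP : ProperFilter U := ultra_proper.
by move=> Ha Hb H; apply: ulim_le_near => //; apply: filterS filterT => j _ /=.
Qed.

Lemma ulim_cvg a (l : R) : a @ \oo --> l -> ulim a = l.
Proof. by move=> H; apply: ulimE => A /H; exact: Uoo. Qed.

Lemma ulim_norm a (c : R) : bdd a -> (forall j, `|a j| <= c) -> `|ulim a| <= c.
Proof.
move=> Ha Hc; rewrite ler_norml; apply/andP; split.
  rewrite -(ulim_cst (- c)); apply: ulim_le => //; first exact: bdd_cst.
  by move=> j; have := Hc j; rewrite ler_norml => /andP[].
rewrite -(ulim_cst c); apply: ulim_le => //; first exact: bdd_cst.
by move=> j; have := Hc j; rewrite ler_norml => /andP[].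
Qed.

End Ulim.

Lemma sum_ind_nat {R : realType} (K n : nat) : \sum_(k < K) ((k < n)%N%:R : R) = (minn K n)%:R.
Proof.
elim: K => [|K IH]; first by rewrite big_ord0 min0n.
rewrite big_ord_recr /= IH -natrD; congr _%:R.
have [Kn|nK] := ltnP K n; first by rewrite (minn_idPl Kn) addn1.
by rewrite (minn_idPr (leqW nK)) addn0.
Qed.

Lemma mem_setb (T : Type) (P : T -> bool) x : (x \in [set y | P y]) = P x.
Proof. by apply/idP/idP; rewrite inE. Qed.

(** * Weak limits of bounded sequences in L^2 *)

Section WeakLimit.
Context {R : realType} {n : nat} {M : ptopologicalType} (G : riemannian R n M).
Hypotheses (M_hausdorff : hausdorff_space M) (M_compact : compact [set: M]).
Variables (mu : {measure set (borel M) -> \bar R}) (mu_volume : is_volume G mu).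
Variables (U : set_system nat) (UU : UltraFilter U).
Implicit Types (p : M) (g h d : M -> R).

Notation bmf := (@bmf R M).
Notation ulim := (ulim U).
Notation IntD := (I_D M_hausdorff M_compact mu_volume).
Notation IntB := (I_B M_hausdorff M_compact mu_volume).
Notation IntZ := (I_Z M_hausdorff M_compact mu_volume).
Notation Int_le := (I_le M_hausdorff M_compact mu_volume).
Notation bmf_int := (bmf_integrable M_hausdorff M_compact mu_volume).

Definition intb d := mu.-integrable setT (EFin \o (d : borel M -> R)).

Lemma bmf_indic (A : set (borel M)) : measurable A -> bmf (\1_A : M -> R).
Proof.
move=> mA; split; first exact: measurable_indic.
by exists 1 => p; rewrite indicE; case: (_ \in _); rewrite ?normr1 ?normr0.
Qed.

Lemma intbM d g : intb d -> bmf g -> intb (fun p => d p * g p).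
Proof.
move=> Hd [mg [B HB]].
have mT : (@measurable _ (borel M)) setT by exact: measurableT.
have bg : [bounded (g : borel M -> R) x | x in (setT : set (borel M))].
  by exists B; split; [exact: num_real|move=> x Bx y _; apply: le_trans (HB y) (ltW Bx)].
exact: (integrableMl mT Hd mg bg).
Qed.

Lemma IfD d h : intb d -> intb h -> \int[mu]_p (d p + h p) = \int[mu]_p d p + \int[mu]_p h p.
Proof. by move=> *; rewrite RintegralD. Qed.

Lemma IfZ (c : R) d : intb d -> \int[mu]_p (c * d p) = c * \int[mu]_p d p.
Proof. by move=> *; rewrite RintegralZl. Qed.

Lemma IfB d h : intb d -> intb h -> \int[mu]_p (d p - h p) = \int[mu]_p d p - \int[mu]_p h p.
Proof. by move=> *; rewrite RintegralB. Qed.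

Lemma intbZ (c : R) d : intb d -> intb (fun p => c * d p).
Proof. by move=> Hd; have := integrableZl measurableT c Hd. Qed.

Lemma intbB d h : intb d -> intb h -> intb (fun p => d p - h p).
Proof. by move=> Hd Hh; have := integrableB measurableT Hd Hh. Qed.

(* Layer cake: g >= 0 is within 1/N of the average of the indicators of the sets {g >= (k+1)/N}. *)
Lemma bmf_approx g (e : R) : 0 < e -> bmf g ->
  exists s : seq (R * set (borel M)), (forall c, List.In c s -> measurable c.2) /\
    forall p, `|g p - \sum_(c <- s) c.1 * \1_(c.2) p| <= e.
Proof.
move=> e0 [mg [B HB]].
pose x p := e^-1 * (g p + B).
have x0 p : 0 <= x p.
  by rewrite mulr_ge0 ?invr_ge0 ?(ltW e0) //; have := HB p; rewrite ler_norml => /andP[? _]; lra.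
pose K := Num.truncn (e^-1 * (2 * B)).
have xK p : (Num.truncn (x p) <= K)%N.
  apply: le_truncn; rewrite ler_wpM2l ?invr_ge0 ?(ltW e0) //.
  by have := HB p; rewrite ler_norml => /andP[_ ?]; lra.
pose A k : set (borel M) := [set p : borel M | k.+1%:R <= x p].
have mA k : measurable (A k).
  have mx : measurable_fun setT (x : borel M -> R).
    by apply: measurable_funM => //; apply: measurable_funD.
  have -> : A k = (x : borel M -> R) @^-1` `[(k.+1)%:R, +oo[%classic.
    by apply/seteqP; split=> p /=; rewrite in_itv /= andbT.
  by rewrite -[X in measurable X]setTI; apply: mx => //; exact: measurable_itv.
exists ((- B, setT) :: [seq (e, A (nat_of_ord k)) | k <- enum 'I_K]); split.
  move=> c [<-|]; first exact: measurableT.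
  move=> /List.in_map_iff[k [<- _]]; exact: mA.
move=> p; rewrite big_cons big_map big_enum /= indicT mulr1.
have -> : \sum_(k < K) e * \1_(A k) p = e * (Num.truncn (x p))%:R.
  rewrite -mulr_sumr; congr (_ * _).
  rewrite -[in RHS](minn_idPr (xK p)) -sum_ind_nat; apply: eq_bigr => k _.
  by rewrite indicE /A mem_setb truncn_ge_nat.
have /andP[t1 t2] := truncn_itv (x0 p).
have gE : g p = e * x p - B by rewrite /x mulrA divff ?gt_eqF // mul1r addrK.
rewrite gE ler_norml; have := ler_wpM2l (ltW e0) t1; have := ler_wpM2l (ltW e0) (ltW t2).
by rewrite -natr1 mulrDr mulr1 => *; apply/andP; split; lra.
Qed.

(** With [dK] the function [d] cut to zero where [|d| > K], testing against [dK * rho] gives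
    [dK ^+ 2 * rho] on the left and, by Young's inequality, at most half of itself plus half of
    [beta] on the right. Monotone convergence in [K] removes the cut, which is there because [d] is
    only known to be integrable. *)
Lemma weak_lsc d (b : nat -> M -> R) (beta : nat -> R) (rho : M -> R) :
  intb d -> (forall j, bmf (b j)) -> bmf rho -> (forall p, 0 <= rho p) -> bdd beta ->
  (forall g, bmf g -> bdd (fun j => \int[mu]_p (b j p * g p))) ->
  (forall g, bmf g -> \int[mu]_p (d p * g p) = ulim (fun j => \int[mu]_p (b j p * g p))) ->
  (forall j, \int[mu]_p (b j p ^+ 2 * rho p) <= beta j) ->
  (\int[mu]_p ((d p ^+ 2 * rho p)%:E : \bar R) <= (ulim beta)%:E)%E.
Proof.
move=> Hd Hb Hr r0 Hbeta bd Hw Hbb.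
have md : measurable_fun setT (d : borel M -> R) by apply/measurable_EFinP; move/integrableP: Hd => [].
pose A (K : nat) : set (borel M) := [set p : borel M | `|d p| <= K%:R].
have mA K : measurable (A K).
  have mn : measurable_fun setT (fun p : borel M => `|d p|) by exact: measurableT_comp.
  have -> : A K = (fun p : borel M => `|d p|) @^-1` `]-oo, K%:R]%classic.
    by apply/seteqP; split=> p /=; rewrite in_itv.
  by rewrite -[X in measurable X]setTI; apply: mn => //; exact: measurable_itv.
pose dK K p := d p * \1_(A K) p.
have AE K p : \1_(A K) p = (`|d p| <= K%:R)%R%:R :> R by rewrite indicE /A mem_setb.
have dKb K : bmf (dK K).
  split; first by apply: measurable_funM => //; exact: measurable_indic.
  exists K%:R => p; rewrite /dK normrM AE; case: (boolP (`|d p| <= K%:R)) => H; rewrite ?normr1 ?mulr1 ?normr0 ?mulr0 //.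
have dd K p : d p * dK K p = dK K p ^+ 2.
  by rewrite /dK AE; case: (_ <= _); rewrite ?mulr1 ?mulr0 ?expr0n ?expr2 //.
have S1 K : \int[mu]_p (dK K p ^+ 2 * rho p) <= ulim beta.
  have gB : bmf (fun p => dK K p * rho p) by exact: bmfM.
  have dB : bmf (fun p => dK K p ^+ 2 * rho p) by apply: bmfM => //; exact: bmfX.
  have E : \int[mu]_p (dK K p ^+ 2 * rho p) = ulim (fun j => \int[mu]_p (b j p * (dK K p * rho p))).
    by rewrite -Hw //; apply: I_eq => p; rewrite mulrA dd.
  have : ulim (fun j => \int[mu]_p (b j p * (dK K p * rho p))) <=
     ulim (fun j => 2^-1 * beta j + 2^-1 * \int[mu]_p (dK K p ^+ 2 * rho p)).
    apply: ulim_le => //; first exact: bd.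
      by apply: bddD; [exact: bddZ|exact: bdd_cst].
    move=> j; apply: (@le_trans _ _ (2^-1 * \int[mu]_p (b j p ^+ 2 * rho p) + 2^-1 * \int[mu]_p (dK K p ^+ 2 * rho p))); last first.
      by rewrite lerD2r ler_wpM2l.
    have bB : bmf (fun p => b j p ^+ 2 * rho p) by apply: bmfM => //; exact: bmfX.
    rewrite -!IntZ // -IntD; try exact: bmfZ.
    apply: Int_le; [exact: bmfM|by apply: bmfD; exact: bmfZ|move=> p].
    have := mulr_ge0 (r0 p) (sqr_ge0 (b j p - dK K p)).
    by move: (b j p) (dK K p) (rho p) => x y z; lra.
  rewrite (ulimD UU) //; [|exact: bddZ|exact: bdd_cst].
  by rewrite (ulimZ UU) // (ulim_cst UU) // -E; move: (\int[mu]_p _) (ulim beta) => x y; lra.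
have mT : (@measurable _ (borel M)) setT by exact: measurableT.
pose F K (p : borel M) : \bar R := (dK K p ^+ 2 * rho p)%:E.
have mF K : measurable_fun setT (F K).
  by apply/measurable_EFinP; have [] := bmfM (bmfX (dKb K)) Hr.
have F0 K p : setT p -> (0 <= F K p)%E by move=> _; rewrite lee_fin mulr_ge0 ?sqr_ge0.
have ndF p : setT p -> nondecreasing_seq (F ^~ p).
  move=> _ K L KL; rewrite /F lee_fin ler_wpM2r // /dK !AE.
  have [dK'|_] := lerP `|d p| K%:R; last by rewrite mulr0 expr0n sqr_ge0.
  by rewrite (le_trans dK') // ler_nat.
have cF p : F ^~ p @ \oo --> ((d p ^+ 2 * rho p)%:E : \bar R).
  apply: cvg_near_cst; near=> K; rewrite /F /dK AE.
  have -> : `|d p| <= K%:R; last by rewrite mulr1.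
  by near: K; exact: nbhs_infty_ger.
have := @cvg_monotone_convergence _ _ _ mu _ mT _ mF F0 ndF.
have -> : (\int[mu]_x (limn (F ^~ x)) = \int[mu]_p ((d p ^+ 2 * rho p)%:E : \bar R))%E.
  by apply: eq_integral => p _; apply: cvg_lim => //; exact: cF.
move=> cvI; rewrite -(cvg_lim _ cvI) //; apply: lime_le; first by apply/cvg_ex; eexists; exact: cvI.
apply: nearW => K; have := S1 K; rewrite -lee_fin.
by rewrite /Rintegral fineK // integrable_fin_num //; exact: bmf_int (bmfM (bmfX (dKb K)) Hr).
Unshelve. all: by end_near. Qed.

Section Existence.
Variables (a : nat -> M -> R) (B : R).
Hypotheses (Ha : forall j, bmf (a j)) (HB : forall j, \int[mu]_p (a j p ^+ 2) <= B).

(** Cauchy-Schwarz with a free parameter. A small [t] makes the part not involving [g] negligible;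
    countable additivity and absolute continuity of the limit both follow from this. *)
Lemma young_int j g (t : R) : 0 < t -> bmf g ->
  `|\int[mu]_p (a j p * g p)| <= t / 2 * B + (2 * t)^-1 * \int[mu]_p (g p ^+ 2).
Proof.
move=> t0 Hg; have g2 := bmfX Hg; have a2 := bmfX (Ha j).
have H (h : M -> R) : bmf h -> (forall p, h p ^+ 2 = g p ^+ 2) -> \int[mu]_p (a j p * h p) <= t / 2 * B + (2 * t)^-1 * \int[mu]_p (g p ^+ 2).
  move=> Hh hg; apply: (@le_trans _ _ (t / 2 * \int[mu]_p (a j p ^+ 2) + (2 * t)^-1 * \int[mu]_p (g p ^+ 2))); last first.
    by rewrite lerD2r ler_wpM2l // divr_ge0 // ltW.
  rewrite -!IntZ // -IntD; try exact: bmfZ.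
  apply: Int_le; [exact: bmfM|by apply: bmfD; exact: bmfZ|move=> p].
  rewrite -hg -subr_ge0.
  have -> : t / 2 * a j p ^+ 2 + (2 * t)^-1 * h p ^+ 2 - a j p * h p = (2 * t)^-1 * (t * a j p - h p) ^+ 2.
    by field; exact: lt0r_neq0.
  by rewrite mulr_ge0 ?sqr_ge0 // invr_ge0 mulr_ge0 // ltW.
rewrite ler_norml; apply/andP; split; last exact: H.
rewrite lerNl -(I_N M_hausdorff M_compact mu_volume) //; last exact: bmfM.
have := H (fun p => - g p) (bmfN Hg) (fun p => sqrrN _).
by under eq_Rintegral do rewrite mulrN.
Qed.

Lemma weak_bdd g : bmf g -> bdd (fun j => \int[mu]_p (a j p * g p)).
Proof. by move=> Hg; eexists => j; exact: (@young_int j g 1). Qed.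

Definition wnu (A : set (borel M)) : R := ulim (fun j => \int[mu]_p (a j p * \1_A p)).

Definition msr (A : set (borel M)) : R := \int[mu]_p (\1_A p : R).

Lemma msrE A : measurable A -> mu A = (msr A)%:E.
Proof.
move=> mA; have iA := bmf_int (bmf_indic mA).
by rewrite /msr /Rintegral fineK ?integrable_fin_num // integral_indic // setIT.
Qed.

Lemma wnu_young g (t : R) : 0 < t -> bmf g ->
  `|ulim (fun j => \int[mu]_p (a j p * g p))| <= t / 2 * B + (2 * t)^-1 * \int[mu]_p (g p ^+ 2).
Proof. by move=> t0 Hg; apply: ulim_norm => //; [exact: weak_bdd|move=> j; exact: young_int]. Qed.

Lemma B_ge0 : 0 <= B. Proof. by apply: le_trans (HB 0%N); apply: I_ge0 => p; exact: sqr_ge0. Qed.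

Lemma ulim_lin (s : seq (R * (M -> R))) : (forall c, List.In c s -> bmf c.2) ->
  ulim (fun j => \int[mu]_p (a j p * \sum_(c <- s) c.1 * c.2 p)) =
  \sum_(c <- s) c.1 * ulim (fun j => \int[mu]_p (a j p * c.2 p)).
Proof.
elim: s => [|c s IH] Hs.
  rewrite big_nil -[RHS](ulim_cst UU 0); congr ulim; apply/funext => j.
  have mT : (@measurable _ (borel M)) setT by exact: measurableT.
  by under eq_Rintegral do rewrite big_nil mulr0; rewrite (Rintegral_cst mu mT) mul0r.
have bs : bmf (fun p => \sum_(c <- s) c.1 * c.2 p).
  have : forall c, List.In c s -> bmf c.2 by move=> c' Hc'; apply: Hs; right.
  elim: s {IH Hs} => [|c' s IH] Hs; first by under eq_fun do rewrite big_nil; exact: bmf_cst.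
  under eq_fun do rewrite big_cons; apply: bmfD; first by apply: bmfZ; apply: Hs; left.
  by apply: IH => c'' ?; apply: Hs; right.
have bc : bmf c.2 by apply: Hs; left.
rewrite big_cons -IH; last by move=> c' Hc'; apply: Hs; right.
rewrite -(ulimZ UU c.1 (weak_bdd bc)) -(ulimD UU (bddZ c.1 (weak_bdd bc)) (weak_bdd bs)).
congr ulim; apply/funext => j; rewrite -IntZ -?IntD; try by repeat first [exact: Ha|exact: bc|exact: bs|apply: bmfZ|apply: bmfM].
by apply: I_eq => p; rewrite big_cons; ring.
Qed.

(** The tail [g] is an indicator, so its square integral is the measure of the tail, which tends to
    0; [wnu_young] with [t] proportional to [e] concludes. *)
Lemma wnu_sigma (F : (set (borel M))^nat) : (forall i, measurable (F i)) -> trivIset setT F ->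
  measurable (\bigcup_k F k) ->
  (fun k => \sum_(i < k) wnu (F i)) @ \oo --> wnu (\bigcup_k F k).
Proof.
move=> mF tF mU; apply/cvgrPdist_le => e e0; have B0 := B_ge0.
pose t := e / (B + 1); have B1 : 0 < B + 1 by rewrite ltr_wpDl.
have t0 : 0 < t by rewrite divr_gt0.
have cm : (fun k => \sum_(i < k) msr (F i)) @ \oo --> msr (\bigcup_k F k).
  have := @measure_semi_sigma_additive _ _ _ mu F mF tF mU; rewrite msrE //.
  under eq_fun do (rewrite big_mkord; under eq_bigr do rewrite msrE //; rewrite sumEFin).
  by move=> /fine_cvg.
have near1 : \forall k \near \oo, `|msr (\bigcup_k F k) - \sum_(i < k) msr (F i)| <= e * t.
  by move/cvgrPdist_le : cm; apply; rewrite mulr_gt0.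
apply: filterS near1 => k Hk.
pose g p : R := \1_(\bigcup_k F k) p - \sum_(i < k) \1_(F i) p.
have gB : bmf g.
  by apply: bmfB; [exact: bmf_indic|apply: bmf_sum => i; exact: bmf_indic].
have g2 p : g p ^+ 2 = g p.
  rewrite /g; have [[i ik Fi]|nF] := pselect (exists2 i, (i < k)%N & F i p).
    rewrite (bigD1 (Ordinal ik)) //= big1 ?addr0; last first.
      move=> i' ii'; rewrite indicE memNset // => Fi'; apply: (negP ii'); apply/eqP/val_inj => /=.
      by apply: (tF i' i) => //; exists p.
    by rewrite !indicE !mem_set // ?subrr ?expr0n //; exists i.
  rewrite big1 ?subr0; last by move=> i _; rewrite indicE memNset // => Fi; apply: nF; exists i.
  by rewrite indicE; case: (_ \in _); rewrite ?expr1n ?expr0n.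
have Ig : \int[mu]_p (g p ^+ 2) = msr (\bigcup_k F k) - \sum_(i < k) msr (F i).
  under eq_Rintegral do rewrite g2.
  rewrite /g IntB; [|exact: bmf_indic|by apply: bmf_sum => i; exact: bmf_indic].
  by rewrite (I_sum M_hausdorff M_compact mu_volume) // => i; exact: bmf_indic.
have E : wnu (\bigcup_k F k) - \sum_(i < k) wnu (F i) = ulim (fun j => \int[mu]_p (a j p * g p)).
  have := @ulim_lin ((1, (\1_(\bigcup_k F k) : M -> R)) :: [seq (-1, (\1_(F (nat_of_ord i)) : M -> R)) | i <- enum 'I_k]).
  rewrite big_cons big_map big_enum /= mul1r -sumrN => H.
  rewrite (eq_bigr (fun i : 'I_k => -1 * wnu (F i))); last by move=> i _; rewrite mulN1r.
  rewrite -H; last first.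
    by move=> c [<-|/List.in_map_iff[i [<- _]]] /=; exact: bmf_indic.
  congr ulim; apply/funext => j; apply: I_eq => p; congr (_ * _).
  by rewrite big_cons big_map big_enum /= mul1r /g -sumrN; congr (_ + _); apply: eq_bigr => i _; rewrite mulN1r.
rewrite E; apply: le_trans (wnu_young t0 gB) _; rewrite Ig.
have H1 : t / 2 * B <= e / 2.
  have -> : t / 2 * B = (e / 2) * (B / (B + 1)) by rewrite /t; ring.
  by rewrite ler_piMr ?divr_ge0 ?(ltW e0) // ler_pdivrMr // mul1r lerDl.
have H2 : (2 * t)^-1 * (msr (\bigcup_k F k) - \sum_(i < k) msr (F i)) <= e / 2.
  have -> : e / 2 = (2 * t)^-1 * (e * t) by field; exact: lt0r_neq0.
  apply: ler_wpM2l; first by rewrite invr_ge0 mulr_ge0 // ltW.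
  by move: Hk; rewrite ler_norml => /andP[_].
by rewrite [leRHS](splitr e); exact: lerD.
Qed.

(** The limits on indicators form a charge dominated by [mu], and the weak limit is its
    Radon-Nikodym density. General test functions are uniform limits of simple ones by
    [bmf_approx]. *)
Lemma weak_exists : exists2 v : M -> R, intb v &
  forall g, bmf g -> \int[mu]_p (v p * g p) = ulim (fun j => \int[mu]_p (a j p * g p)).
Proof.
have mT : (@measurable _ (borel M)) setT by exact: measurableT.
pose nuc (A : set (borel M)) : \bar R := (wnu A)%:E.
have nuc0 : nuc set0 = 0%E.
  rewrite /nuc /wnu -[0%E]/(0%:E); congr EFin; rewrite -[RHS](ulim_cst UU 0); congr ulim; apply/funext => j.
  by under eq_Rintegral do rewrite indic0 mulr0; rewrite (Rintegral_cst mu mT) mul0r.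
have nucf A : measurable A -> nuc A \is a fin_num by [].
have nucs : semi_sigma_additive nuc.
  move=> F mF tF mU; rewrite /nuc.
  under eq_fun do rewrite sumEFin big_mkord.
  by apply: cvg_EFin; [near=> k|exact: wnu_sigma].
pose nu : {charge set (borel M) -> \bar R} := HB.pack nuc (isCharge.Build _ _ _ nuc nuc0 nucf nucs).
have fmu : fin_num_fun mu by move=> A mA; rewrite msrE.
have sf : sigma_finite setT mu by apply: fin_num_fun_sigma_finite; [rewrite measure0|exact: fmu].
pose H1 := isFinite.Build _ _ _ _ fmu.
pose H2 := isSFinite.Build _ _ _ _ (sfinite_measure_sigma_finite sf).
pose H3 := isSigmaFinite.Build _ _ _ _ sf.
pose mu' : {finite_measure set (borel M) -> \bar R} := HB.pack_for (FiniteMeasure.type (borel M) R) (Measure.sort mu) H1 H2 H3.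
have dom : nu `<< mu'.
  move=> N HN A mA AN; have mu0 : mu A = 0%E by exact: HN.
  have m0 : msr A = 0 by have := msrE mA; rewrite mu0 => -[].
  have Ab := bmf_indic mA.
  rewrite /= /nuc -[0%E]/(0%:E); congr EFin; apply/eqP; rewrite -normr_eq0 eq_le normr_ge0 andbT.
  apply/ler_addgt0Pr => e e0; rewrite add0r; have B0 := B_ge0; have B1 : 0 < B + 1 by rewrite ltr_wpDl.
  have t0 : 0 < e / (B + 1) by rewrite divr_gt0.
  apply: le_trans (wnu_young t0 Ab) _.
  have -> : \int[mu]_p (\1_A p ^+ 2) = msr A.
    by apply: I_eq => p; rewrite indicE; case: (_ \in _); rewrite ?expr1n ?expr0n.
  rewrite m0 mulr0 addr0.
  have -> : e / (B + 1) / 2 * B = e * (B / (2 * (B + 1))) by field; exact: lt0r_neq0.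
  by rewrite ler_piMr ?(ltW e0) // ler_pdivrMr ?mulr_gt0 // mul1r; lra.
have fi := Radon_Nikodym_integrable dom.
have ff p : Radon_Nikodym nu mu' p \is a fin_num by exact: Radon_Nikodym_fin_num.
set f := Radon_Nikodym nu mu' in fi ff.
have fE : EFin \o (fine \o f) = f by apply/funext => p; rewrite /= fineK.
exists (fine \o f) => [|g Hg]; first by rewrite /intb fE.
have vi : intb (fine \o f) by rewrite /intb fE.
have ind A : measurable A -> \int[mu]_p ((fine \o f) p * \1_A p) = wnu A.
  move=> mA; have : (nu A = \int[mu']_(x in A) f x)%E by exact: Radon_Nikodym_integral.
  rewrite /= /nuc integral_mkcond => H; rewrite /Rintegral.
  suff -> : (\int[mu]_x ((fine \o f) x * \1_A x)%:E = (wnu A)%:E)%E by [].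
  rewrite H; apply: eq_integral => p _; rewrite patchE indicE; case: ifP => pA; rewrite /= ?mulr1 ?fineK ?mulr0 //.
have v1 : intb (fun p => `|(fine \o f) p|).
  exact: (integrable_norm vi).
pose V := \int[mu]_p `|(fine \o f) p|.
have V0 : 0 <= V by apply: I_ge0 => p.
pose C := V + (2^-1 * B + 2^-1 * msr setT).
have m0 : 0 <= msr setT by apply: I_ge0 => p; rewrite indicE.
have B0 := B_ge0.
apply/eqP; rewrite -subr_eq0 -normr_eq0 eq_le normr_ge0 andbT.
apply/ler_addgt0Pr => e e0; rewrite add0r.
have C1 : 0 < C + 1 by rewrite /C; lra.
have [s [ms Hs]] := @bmf_approx g (e / (C + 1)) (divr_gt0 e0 C1) Hg.
pose gs p := \sum_(c <- s) c.1 * \1_(c.2) p.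
pose s' := [seq (c.1, \1_(c.2) : M -> R) | c <- s].
have gsE : gs = (fun p => \sum_(c <- s') c.1 * c.2 p) by apply/funext => p; rewrite /gs big_map.
have bs' c : List.In c s' -> bmf c.2.
  by move=> /List.in_map_iff[c' [<- Hc']]; apply: bmf_indic; exact: ms.
have gsb : bmf gs.
  rewrite gsE; elim: s' bs' {gsE} => [|c s' IH] Hs'; first by under eq_fun do rewrite big_nil; exact: bmf_cst.
  under eq_fun do rewrite big_cons; apply: bmfD; first by apply: bmfZ; apply: Hs'; left.
  by apply: IH => c'' ?; apply: Hs'; right.
have Egs : \int[mu]_p ((fine \o f) p * gs p) = ulim (fun j => \int[mu]_p (a j p * gs p)).
  rewrite gsE ulim_lin // /s' big_map /gs.
  elim: s ms {Hs gs s' gsE bs' gsb} => [|c s IH] ms.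
    by rewrite big_nil; under eq_Rintegral do rewrite big_nil mulr0; rewrite (Rintegral_cst mu mT) mul0r.
  rewrite !big_cons /= -/(wnu c.2) -ind; last by apply: ms; left.
  rewrite -IH; last by move=> c' ?; apply: ms; right.
  have b1 : bmf (\1_(c.2) : M -> R) by apply: bmf_indic; apply: ms; left.
  have b2 : bmf (fun p => \sum_(c <- s) c.1 * \1_(c.2) p).
    have : forall c, List.In c s -> measurable c.2 by move=> c' ?; apply: ms; right.
    elim: s {IH ms} => [|c' s IH] ms; first by under eq_fun do rewrite big_nil; exact: bmf_cst.
    under eq_fun do rewrite big_cons; apply: bmfD; first by apply: bmfZ; apply: bmf_indic; apply: ms; left.
    by apply: IH => c'' ?; apply: ms; right.
  rewrite -IfZ; last exact: intbM.
  have b3 : bmf (fun p => \sum_(c0 <- [seq (c0.1, \1_(c0.2) : M -> R) | c0 <- s]) c0.1 * c0.2 p).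
    by under eq_fun do rewrite big_map.
  rewrite -IfD; [|by apply: intbZ; exact: intbM|exact: intbM].
  by apply: I_eq => p; rewrite !big_cons /=; ring.
have gd : bmf (fun p => g p - gs p) by exact: bmfB.
have -> : \int[mu]_p ((fine \o f) p * g p) - ulim (fun j => \int[mu]_p (a j p * g p)) =
  \int[mu]_p ((fine \o f) p * (g p - gs p)) - ulim (fun j => \int[mu]_p (a j p * (g p - gs p))).
  have -> : (fun j => \int[mu]_p (a j p * (g p - gs p))) = (fun j => \int[mu]_p (a j p * g p) + (-1) * \int[mu]_p (a j p * gs p)).
    apply/funext => j; rewrite mulN1r -IntB; try exact: bmfM.
    by apply: I_eq => p; rewrite mulrBr.
  rewrite (ulimD UU (weak_bdd Hg) (bddZ (-1) (weak_bdd gsb))) (ulimZ UU (-1) (weak_bdd gsb)).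
  rewrite -Egs mulN1r.
  have -> : \int[mu]_p ((fine \o f) p * (g p - gs p)) = \int[mu]_p ((fine \o f) p * g p) - \int[mu]_p ((fine \o f) p * gs p).
    by rewrite -IfB; [apply: I_eq => p; rewrite mulrBr|exact: intbM..].
  by move: (\int[mu]_p _) (\int[mu]_p _) (ulim _) => x y z; ring.
set r := e / (C + 1) in Hs; have r0 : 0 < r by exact: divr_gt0.
have e1 : `|\int[mu]_p ((fine \o f) p * (g p - gs p))| <= r * V.
  apply: le_trans (le_normr_Rintegral _ _) _ => //; first exact: (intbM vi gd).
  rewrite /V -IfZ //; apply: le_Rintegral => //.
  - exact: (integrable_norm (intbM vi gd)).
  - exact: intbZ.
  by move=> p _; rewrite normrM mulrC ler_wpM2r //; exact: Hs.
have e2 : `|ulim (fun j => \int[mu]_p (a j p * (g p - gs p)))| <= r * (2^-1 * B + 2^-1 * msr setT).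
  apply: le_trans (wnu_young r0 gd) _; rewrite mulrDr; apply: lerD; first by rewrite mulrA.
  have -> : r * (2^-1 * msr setT) = (2 * r)^-1 * (r ^+ 2 * msr setT) by field; exact: lt0r_neq0.
  apply: ler_wpM2l; first by rewrite invr_ge0 mulr_ge0 // ltW.
  have iT : bmf (\1_[set: borel M] : M -> R) by exact: bmf_indic.
  rewrite /msr -(IntZ (r ^+ 2) iT); apply: Int_le; [exact: bmfX|exact: bmfZ|move=> p].
  rewrite indicT mulr1 -[leLHS](real_normK (num_real _)) ler_sqr ?nnegrE ?(ltW r0) //; exact: Hs.
apply: le_trans (ler_normB _ _) _; apply: le_trans (lerD e1 e2) _.
rewrite -mulrDr -/C /r mulrAC ler_pdivrMr // ler_wpM2l ?(ltW e0) // lerDl //.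
Unshelve. all: by end_near. Qed.

End Existence.
End WeakLimit.

(** * Existence of nonnegative weak solutions *)

Section Lnorm2.
Context d (T : measurableType d) (R : realType) (mu : {measure set T -> \bar R}).

Lemma Lnorm2_sq (f : T -> R) : (Lnorm mu 2%:E (EFin \o f) ^+ 2 = \int[mu]_x ((f x ^+ 2)%:E : \bar R))%E.
Proof.
have := @poweR_Lnorm _ _ _ mu (EFin \o f) 2%R.
rewrite pnatr_eq0 /= => /(_ isT).
have -> : (\int[mu]_x (`|(f x)%:E| `^ 2) = \int[mu]_x ((f x ^+ 2)%:E : \bar R))%E.
  by apply: eq_integral => x _; rewrite /= powR_mulrn // real_normK ?num_real.
move=> <-; have := Lnorm_ge0 mu 2%:E (EFin \o f).
case: (Lnorm mu 2%:E (EFin \o f)) => [r|_|] //.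
  by rewrite lee_fin => r0; rewrite /= powR_mulrn // -EFin_expe.
by rewrite poweRyr // expe2 mulyy.
Qed.

Lemma Lnorm2_le (f : T -> R) (e : R) : 0 <= e ->
  (\int[mu]_x ((f x ^+ 2)%:E : \bar R) <= (e ^+ 2)%:E)%E -> (Lnorm mu 2%:E (EFin \o f) <= e%:E)%E.
Proof.
move=> e0; rewrite -Lnorm2_sq; have := Lnorm_ge0 mu 2%:E (EFin \o f).
case: (Lnorm mu 2%:E (EFin \o f)) => [r|_|] //.
by rewrite lee_fin => r0; rewrite -EFin_expe !lee_fin ler_sqr ?nnegrE.
Qed.

Lemma Lnorm2_lty (f : T -> R) : (\int[mu]_x ((f x ^+ 2)%:E : \bar R) < +oo)%E ->
  (Lnorm mu 2%:E (EFin \o f) < +oo)%E.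
Proof.
rewrite -Lnorm2_sq; have := Lnorm_ge0 mu 2%:E (EFin \o f).
by case: (Lnorm mu 2%:E (EFin \o f)) => [r|_|]; rewrite ?ltry // expe2 mulyy.
Qed.

Lemma Lfun2_intro (f : T -> R) : measurable_fun setT f ->
  (\int[mu]_x ((f x ^+ 2)%:E : \bar R) < +oo)%E -> f \in Lfun mu 2%:E.
Proof. by move=> mf If; rewrite inE; apply/andP; split; rewrite inE //=; exact: Lnorm2_lty. Qed.

End Lnorm2.

Lemma step_arith (R : realType) (d x y z w a b Y Z B : R) : 0 < d -> `|z - b| <= Y + Z -> `|w - a| <= Y + Z ->
  `|x - y - d * (z + w)| <= B -> `|x - y - d * (a + b)| <= B + d * (Y + Y + (Z + Z)).
Proof.
move=> d0 H1 H2 H3.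
have -> : x - y - d * (a + b) = (x - y - d * (z + w)) + d * ((z - b) + (w - a)) by ring.
apply: le_trans (ler_normD _ _) _; apply: lerD => //; rewrite normrM gtr0_norm //.
apply: ler_wpM2l; first exact: ltW.
apply: le_trans (ler_normD _ _) _; apply: le_trans (lerD H1 H2) _.
by rewrite le_eqVlt; apply/orP; left; apply/eqP; ring.
Qed.

Lemma is_derive_quad (R : realType) (G : R -> R) (t l d : R) : 0 < d ->
  (forall e, 0 < e -> exists2 r, 0 < r & forall x, `|x - t| < r -> `|G x - G t - (x - t) * l| <= e * `|x - t|) ->
  is_derive t (1 : R) G l.
Proof.
move=> d0 H.
have cv : (h^-1 *: ((G \o shift t) (h *: (1 : R)) - G t)) @[h --> (0:R)^'] --> l.
  apply/cvgrPdist_le => e e0; have [r r0 Hr] := H e e0.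
  near=> h; have h0 : h != 0 by near: h; exact: nbhs_dnbhs_neq.
  have hr : `|h| < r by near: h; apply: dnbhs0_lt.
  have := Hr (h + t); rewrite addrK => /(_ hr); rewrite /GRing.scale /= mulr1 => H1.
  have -> : l - h^-1 * (G (h + t) - G t) = - (h^-1 * (G (h + t) - G t - h * l)).
    by field.
  by rewrite normrN normrM normfV ler_pdivrMl ?normr_gt0 // [leRHS]mulrC.
apply: DeriveDef; first by apply/cvg_ex; exists l.
exact: cvg_lim cv.
Unshelve. all: by end_near. Qed.

Section Solution.
Context {R : realType} {n : nat} {M : ptopologicalType} (G : riemannian R n M).
Hypotheses (M_hausdorff : hausdorff_space M) (M_compact : compact [set: M]).
Variables (mu : {measure set (borel M) -> \bar R}) (mu_volume : is_volume G mu).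
Implicit Types (p : M) (v h g : M -> R).
Variables (f : M -> R) (fC : Ck G 3 f) (q : M -> R) (Q eps : R).
Hypotheses (mq : measurable_fun setT (q : borel M -> R)) (qQ : forall p, `|q p| <= Q).
Hypothesis eps0 : 0 < eps.
Variables (u0 : M -> R) (u0C : C1M G u0) (u0_ge0 : forall p, 0 <= u0 p).
Variables (U : set_system nat) (UU : UltraFilter U) (Uoo : \oo `<=` U).
Variables (dt : nat -> R) (u : nat -> nat -> M -> R).
Hypotheses (dt0 : forall j, 0 < dt j) (dt1 : forall j, dt j <= 1) (dt_cvg : dt @ \oo --> (0 : R)).
Hypothesis Hu : forall j, rothe G mu f q eps (dt j) u0 (u j).

Notation bmf := (@bmf R M).
Notation ulim := (ulim U).
Notation IntD := (I_D M_hausdorff M_compact mu_volume).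
Notation IntB := (I_B M_hausdorff M_compact mu_volume).
Notation IntZ := (I_Z M_hausdorff M_compact mu_volume).
Notation Int_le := (I_le M_hausdorff M_compact mu_volume).
Notation Ws := (Ws_def mu f eps).
Notation KPhi := (KPhi G mu f Q eps u0).
Notation KD := (KD G mu f Q eps u0).
Notation intb := (@intb R M mu).

Definition kk (t : R) j := Num.truncn (t / dt j).
(** Piecewise constant interpolation of the scheme. For negative times [kk] is 0, so the
    interpolation is the initial datum there. *)
Definition uu (t : R) j := u j (kk t j).

Lemma kk_le t j : 0 <= t -> (kk t j)%:R * dt j <= t.
Proof.
move=> t0; have /andP[H _] := truncn_itv (divr_ge0 t0 (ltW (dt0 j))).
by rewrite -ler_pdivlMr.
Qed.

Lemma kk_gt t j : t < (kk t j)%:R * dt j + dt j.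
Proof.
rewrite -{2}[dt j]mul1r -mulrDl natr1 -ltr_pdivrMr //; exact: truncnS_gt.
Qed.

Lemma kk_mono s t j : s <= t -> (kk s j <= kk t j)%N.
Proof. by move=> st; apply: le_truncn; rewrite ler_wpM2r // invr_ge0 ltW. Qed.

Lemma kk_neg t j : t <= 0 -> kk t j = 0%N.
Proof.
move=> t0; apply/eqP; rewrite -leqn0; have := kk_mono j t0.
by rewrite {2}/kk mul0r truncn0.
Qed.

Lemma kk0 j : kk 0 j = 0%N. Proof. exact: kk_neg. Qed.

Lemma u_C1 j k : C1M G (u j k). Proof. exact (rothe_C1 u0C (Hu j) k). Qed.
Lemma u_bmf j k : bmf (u j k). Proof. exact (C1_bmf M_compact (u_C1 j k)). Qed.

Lemma wt_lb : exists2 m0 : R, 0 < m0 & forall g, bmf g -> m0 * \int[mu]_p (g p ^+ 2) <= Ws g.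
Proof.
have wC := wt_C1 fC eps.
have iC : C1M G (fun p => (wt f eps p)^-1) by apply: C1MV => // p; rewrite gt_eqF // wt_gt0.
have [B B0 HB] := cont_bound M_compact (C1M_cont iC).
exists B^-1 => [|g Hg]; first by rewrite invr_gt0.
rewrite -IntZ; last exact: bmfX.
apply: Int_le; [by apply: bmfZ; exact: bmfX|by apply: Ws_bmf|move=> p].
rewrite mulrC ler_wpM2l ?sqr_ge0 // -[leRHS]invrK lef_pV2 ?posrE // ?invr_gt0 ?wt_gt0 //.
exact: le_trans (ler_norm _) (HB p).
Qed.

Lemma L2_bound (S : R) : 0 <= S -> exists2 C : R, 0 <= C &
  forall j k, k%:R * dt j <= S -> \int[mu]_p (u j k p ^+ 2) <= C.
Proof.
move=> S0; have [m0 m00 Hm] := wt_lb.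
exists (m0^-1 * (8 * KPhi S)) => [|j k kS].
  rewrite mulr_ge0 ?invr_ge0 ?(ltW m00) // mulr_ge0 // mulr_ge0 ?expR_ge0 // addr_ge0 //; exact: Phi_ge0.
rewrite ler_pdivlMl //; apply: le_trans (Hm _ (u_bmf j k)) _.
exact: (rothe_Ws M_hausdorff M_compact mu_volume fC mq qQ eps0 u0C (dt0 j) (dt1 j) (Hu j)).
Qed.

Lemma L2_modulus (S : R) : 0 <= S -> exists2 C : R, 0 <= C &
  forall j i k, (i <= k)%N -> k%:R * dt j <= S ->
  \int[mu]_p ((u j k p - u j i p) ^+ 2) <= C * ((k - i)%:R * dt j).
Proof.
move=> S0; have [m0 m00 Hm] := wt_lb; exists (m0^-1 * (4 * KD S)).
  rewrite mulr_ge0 ?invr_ge0 ?(ltW m00) // mulr_ge0 // addr_ge0 ?En_ge0 // mulr_ge0 // addr_ge0 //.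
  apply: mulr_ge0; first by rewrite mulr_ge0 ?sqr_ge0.
  by apply: mulr_ge0; [exact: expR_ge0|apply: addr_ge0 => //; exact: Phi_ge0].
move=> j i k ik kS; rewrite -mulrA ler_pdivlMl //.
apply: le_trans (Hm _ (bmfB (u_bmf j k) (u_bmf j i))) _.
have := @rothe_modulus _ _ _ _ M_hausdorff M_compact _ mu_volume _ fC _ _ _ mq qQ eps0 _ u0C S _ _ (dt0 j) (dt1 j) (Hu j) i (k - i)%N.
by rewrite subnKC //; apply.
Qed.

Lemma uu_L2 t : exists2 C : R, 0 <= C & forall j, \int[mu]_p (uu t j p ^+ 2) <= C.
Proof.
have [t0|t0] := lerP 0 t.
  by have [C C0 HC] := L2_bound t0; exists C => // j; apply: HC; exact: kk_le.
have [C C0 HC] := L2_bound (lexx 0); exists C => // j; apply: HC.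
by rewrite kk_neg ?mul0r // ltW.
Qed.

Lemma uu_bdd t g : bmf g -> bdd (fun j => \int[mu]_p (uu t j p * g p)).
Proof.
move=> Hg; have [C _ HC] := uu_L2 t.
by apply: (weak_bdd M_hausdorff M_compact mu_volume _ HC Hg) => j; exact: u_bmf.
Qed.

(** The limit is taken at each time separately; continuity in time is recovered afterwards from the
    uniform modulus. *)
Lemma limit_exists : exists v : R -> M -> R, forall t, intb (v t) /\
  forall g, bmf g -> \int[mu]_p (v t p * g p) = ulim (fun j => \int[mu]_p (uu t j p * g p)).
Proof.
have H t : exists v : M -> R, intb v /\ forall g, bmf g -> \int[mu]_p (v p * g p) = ulim (fun j => \int[mu]_p (uu t j p * g p)).
  have [C _ HC] := uu_L2 t.
  by have [v ? ?] := weak_exists M_hausdorff M_compact mu_volume UU (fun j => u_bmf j (kk t j)) HC; exists v.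
by have [v Hv] := choice H; exists v.
Qed.

Section Limit.
Variable v : R -> M -> R.
Hypothesis vI : forall t, intb (v t).
Hypothesis vE : forall t g, bmf g ->
  \int[mu]_p (v t p * g p) = ulim (fun j => \int[mu]_p (uu t j p * g p)).

Lemma v_meas t : measurable_fun setT (v t : borel M -> R).
Proof. by apply/measurable_EFinP; move/integrableP: (vI t) => []. Qed.

Lemma v_lsc t (rho : M -> R) (beta : nat -> R) : bmf rho -> (forall p, 0 <= rho p) -> bdd beta ->
  (forall j, \int[mu]_p (uu t j p ^+ 2 * rho p) <= beta j) ->
  (\int[mu]_p ((v t p ^+ 2 * rho p)%:E : \bar R) <= (ulim beta)%:E)%E.
Proof.
move=> Hr r0 Hb H; apply: (weak_lsc M_hausdorff M_compact mu_volume UU (vI t) _ Hr r0 Hb _ _ H).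
- by move=> j; exact: u_bmf.
- by move=> g; exact: uu_bdd.
- exact: vE.
Qed.

Lemma v_L2 t : (v t : borel M -> R) \in Lfun mu 2%:E.
Proof.
have [C C0 HC] := uu_L2 t.
apply: Lfun2_intro; first exact: v_meas.
have H : forall j, \int[mu]_p (uu t j p ^+ 2 * cst 1 p) <= C.
  by move=> j; apply: le_trans (HC j); under eq_Rintegral do rewrite mulr1.
have := @v_lsc t (cst 1) (fun=> C) (bmf_cst 1) (fun=> ler01) (bdd_cst C) H.
have -> : (\int[mu]_p ((v t p ^+ 2 * cst 1 p)%:E : \bar R) = \int[mu]_p ((v t p ^+ 2)%:E : \bar R))%E.
  by apply: eq_integral => p _; rewrite mulr1.
by move=> H'; apply: le_lt_trans H' _; exact: ltry.
Qed.

(** Rounding the times to the grid costs at most one step, whence the extra [dt j], which disappears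
    in the limit. *)
Lemma uu_mod (S : R) : 0 <= S -> exists2 C : R, 0 <= C & forall j s t, 0 <= s -> s <= t -> t <= S ->
  \int[mu]_p ((uu t j p - uu s j p) ^+ 2) <= C * (t - s + dt j).
Proof.
move=> S0; have [C C0 HC] := L2_modulus S0; exists C => // j s t s0 st tS.
have t0 := le_trans s0 st.
apply: le_trans (HC j _ _ (kk_mono j st) _) _; first by apply: le_trans tS; exact: kk_le.
rewrite ler_wpM2l // natrB ?kk_mono // mulrBl; have := kk_le j t0; have := kk_gt s j; lra.
Qed.

Lemma v_mod (S : R) : 0 <= S -> exists2 C : R, 0 <= C & forall s t, 0 <= s -> s <= t -> t <= S ->
  (\int[mu]_p (((v t p - v s p) ^+ 2)%:E : \bar R) <= (C * (t - s))%:E)%E.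
Proof.
move=> S0; have [C C0 HC] := uu_mod S0; exists C => // s t s0 st tS.
have bb j : bmf (fun p => uu t j p - uu s j p) by apply: bmfB; exact: u_bmf.
have bd : bdd (fun j => C * (t - s + dt j)).
  by apply: bddZ; exists (t - s + 1) => j; rewrite ger0_norm ?lerD2l // addr_ge0 ?subr_ge0 // ltW.
have E g : bmf g -> (fun j => \int[mu]_p ((uu t j p - uu s j p) * g p)) =
    (fun j => \int[mu]_p (uu t j p * g p) + -1 * \int[mu]_p (uu s j p * g p)).
  move=> Hg; apply/funext => j; rewrite mulN1r -IntB; try by apply: bmfM => //; exact: u_bmf.
  by apply: I_eq => p; rewrite mulrBl.
have := @weak_lsc _ _ _ _ M_hausdorff M_compact _ mu_volume _ UU (fun p => v t p - v s p) (fun j p => uu t j p - uu s j p)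
   (fun j => C * (t - s + dt j)) (cst 1) (intbB (vI t) (vI s)) bb (bmf_cst 1) (fun=> ler01) bd.
have -> : ulim (fun j => C * (t - s + dt j)) = C * (t - s).
  apply: (ulim_cvg UU Uoo); rewrite -[X in _ --> C * X]addr0; apply: cvgM; first exact: cvg_cst.
  by apply: cvgD => //; exact: cvg_cst.
under eq_integral do rewrite mulr1; apply.
- by move=> g Hg; rewrite E //; apply: bddD; [|apply: bddZ]; exact: uu_bdd.
- move=> g Hg; rewrite E // (ulimD UU (uu_bdd t Hg) (bddZ (-1) (uu_bdd s Hg))) (ulimZ UU (-1) (uu_bdd s Hg)) -!vE // mulN1r.
  rewrite -IfB; [|exact: (intbM (vI t) Hg)|exact: (intbM (vI s) Hg)].
  by apply: I_eq => p; rewrite mulrBl.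
- move=> j; under eq_Rintegral do rewrite mulr1; exact: HC.
Qed.

Lemma v_cont t : 0 <= t ->
  Lnorm mu 2%:E (fun p : borel M => (v s p - v t p)%:E) @[s --> within [set s | 0 <= s] (nbhs t)] --> 0%E.
Proof.
move=> t0; have t10 : 0 <= t + 1 by rewrite addr_ge0.
have [C C0 HC] := v_mod t10.
have H (e : R) : 0 < e -> \forall s \near within [set s | 0 <= s] (nbhs t), (Lnorm mu 2%:E (fun p : borel M => (v s p - v t p)%:E) <= e%:E)%E.
  move=> e0; have d0 : 0 < Num.min 1 (e ^+ 2 / (C + 1)).
    by rewrite lt_min ltr01 divr_gt0 ?exprn_gt0 // ltr_wpDl.
  have : \forall s \near nbhs t, `|t - s| < Num.min 1 (e ^+ 2 / (C + 1)) by exact: cvgr_dist_lt.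
  rewrite /within /=; apply: filterS => s; rewrite lt_min => /andP[s1 sC] s0.
  apply: (Lnorm2_le (f := fun p : borel M => v s p - v t p) (ltW e0)).
  have Ce r : 0 <= r -> r < e ^+ 2 / (C + 1) -> C * r <= e ^+ 2.
    by move=> r0; rewrite ltr_pdivlMr ?ltr_wpDl // => H; apply: le_trans (ltW H); rewrite mulrC ler_wpM2l // lerDl.
  have [st|/ltW ts] := lerP s t.
    have -> : (\int[mu]_p (((v s p - v t p) ^+ 2)%:E : \bar R) = \int[mu]_p (((v t p - v s p) ^+ 2)%:E : \bar R))%E.
      by apply: eq_integral => p _; rewrite -sqrrN opprB.
    apply: le_trans (HC s t s0 st _) _; first by rewrite lerDl.
    by rewrite lee_fin Ce ?subr_ge0 // -[t - s]ger0_norm ?subr_ge0.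
  rewrite distrC ger0_norm ?subr_ge0 // in s1 sC.
  apply: le_trans (HC t s t0 ts _) _; first by rewrite -lerBlDl ltW.
  by rewrite lee_fin Ce ?subr_ge0.
apply/fine_cvgP; split.
  apply: filterS (H 1 ltr01) => s Hs; rewrite ge0_fin_numE ?Lnorm_ge0 //; exact: le_lt_trans Hs (ltry _).
apply/cvgrPdist_le => e e0; apply: filterS (H e e0) => s Hs.
rewrite sub0r normrN /= ger0_norm ?fine_ge0 ?Lnorm_ge0 //.
by rewrite -lee_fin fineK // ge0_fin_numE ?Lnorm_ge0 //; exact: le_lt_trans Hs (ltry _).
Qed.

(** Lower semicontinuity applied to the zero sequence: at time 0 the interpolation is [u0], so
    [v 0 - u0] pairs to zero with every test function. *)
Lemma v_init : {ae mu, forall p, v 0 p = u0 p}.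
Proof.
have u0b := C1_bmf M_compact u0C.
have u0i : intb u0 := bmf_integrable M_hausdorff M_compact mu_volume u0b.
have := @weak_lsc _ _ _ _ M_hausdorff M_compact _ mu_volume _ UU (fun p => v 0 p - u0 p) (fun j p => 0)
   (fun j => 0) (cst 1) (intbB (vI 0) u0i) (fun=> bmf_cst 0) (bmf_cst 1) (fun=> ler01) (bdd_cst 0).
rewrite (ulim_cst UU).
have z g : \int[mu]_p (0 * g p) = 0.
  have mM : (@measurable _ (borel M)) setT by exact: measurableT.
  by under eq_Rintegral do rewrite mul0r; rewrite (Rintegral_cst mu mM) mul0r.
have u00 j : uu 0 j = u0 by rewrite /uu kk0; have [] := Hu j.
have H1 g : bmf g -> bdd (fun _ : nat => \int[mu]_p (0 * g p)) by move=> _; rewrite z; exact: bdd_cst.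
have H2 g : bmf g -> \int[mu]_p ((v 0 p - u0 p) * g p) = ulim (fun _ : nat => \int[mu]_p (0 * g p)).
  move=> Hg; rewrite z (ulim_cst UU).
  have -> : \int[mu]_p ((v 0 p - u0 p) * g p) = \int[mu]_p (v 0 p * g p) - \int[mu]_p (u0 p * g p).
    rewrite -IfB; [|exact: (intbM (vI 0) Hg)|exact: (intbM u0i Hg)].
    by apply: I_eq => p; rewrite mulrBl.
  rewrite vE //; under eq_fun do rewrite u00.
  by rewrite (ulim_cst UU) subrr.
have H3 (j : nat) : \int[mu]_p ((0:R) ^+ 2 * cst 1 p) <= 0.
  by under eq_Rintegral do rewrite expr0n /=; rewrite (z (cst 1)).
move=> /(_ H1 H2 H3) H.
have E : (\int[mu]_p (`|((v 0 p - u0 p) ^+ 2)%:E| : \bar R) = 0)%E.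
  apply/eqP; rewrite eq_le; apply/andP; split; last exact: integral_ge0.
  apply: le_trans H; rewrite le_eqVlt; apply/orP; left; apply/eqP.
  by apply: eq_integral => p _; rewrite mulr1 /= ger0_norm ?sqr_ge0.
have mf : measurable_fun setT (fun p : borel M => ((v 0 p - u0 p) ^+ 2)%:E : \bar R).
  apply/measurable_EFinP; apply: measurable_funX; apply: measurable_funB; [exact: v_meas|by have [] := u0b].
have /(ae_eq_integral_abs mu measurableT mf) := E.
apply: filterS => p /(_ I) /= [] /eqP; rewrite sqrf_eq0 subr_eq0 => /eqP; exact.
Qed.

Section Weak.
Variables (h : M -> R) (hC : Ck G 2 h).
Let hC1 := C1M_Ck hC.
Let hB : bmf h := C1_bmf M_compact hC1.
Let A0 := adj0 G f eps h.
Let A0B : bmf A0 := adj0_bmf M_hausdorff M_compact mu_volume fC eps hC.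
Let qh p := q p * h p.
Let qhB : bmf qh := bmfM (q_bmf mq qQ) hB.
Let AA p := A0 p + qh p.
Let AAB : bmf AA := bmfD A0B qhB.

Lemma young0 (a g : M -> R) (th : R) : 0 < th -> bmf a -> bmf g ->
  `|\int[mu]_p (a p * g p)| <= th / 2 * \int[mu]_p (a p ^+ 2) + (2 * th)^-1 * \int[mu]_p (g p ^+ 2).
Proof. by move=> t0 Ha Hg; exact: (young_int M_hausdorff M_compact mu_volume (fun=> Ha) (fun=> lexx _) 0%N). Qed.

(** Over a short time the pairing with [AA] hardly moves, so the pairing with [h] grows with a
    nearly constant slope frozen at step [i]. The number [th] is a Young parameter: a large [th]
    makes [D / th] small, after which a short time makes the other term small. *)
Lemma step_est (S : R) : 0 <= S -> exists C D K : R, [/\ 0 <= C, 0 <= D, 0 <= K &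
  forall j i k th, (i <= k)%N -> k%:R * dt j <= S -> 0 < th ->
  `|\int[mu]_p (u j k p * AA p) - \int[mu]_p (u j i p * AA p)| <= th * C * ((k - i)%:R * dt j) + D / th /\
  `|\int[mu]_p (u j k p * h p) - \int[mu]_p (u j i p * h p) - (k - i)%:R * dt j * \int[mu]_p (u j i p * AA p)| <=
   (k - i)%:R * dt j * (th * C * ((k - i)%:R * dt j) + D / th + K * dt j)].
Proof.
move=> S0; have [C C0 HC] := L2_modulus S0.
have [K K0 HK] := weak_step M_hausdorff M_compact mu_volume fC mq qQ eps0 hC.
have I0 g : 0 <= \int[mu]_p (g p ^+ 2) by apply: I_ge0 => p; exact: sqr_ge0.
pose D := \int[mu]_p (A0 p ^+ 2) + \int[mu]_p (qh p ^+ 2) + \int[mu]_p (AA p ^+ 2).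
have D0 : 0 <= D by rewrite !addr_ge0.
exists C, D, K; split=> // j i k th ik kS th0.
have dif a b g : bmf g -> \int[mu]_p (u j a p * g p) - \int[mu]_p (u j b p * g p) = \int[mu]_p ((u j a p - u j b p) * g p).
  by move=> Hg; rewrite -IntB; [apply: I_eq => p; rewrite mulrBl|apply: bmfM => //; exact: u_bmf..].
have est g l : bmf g -> \int[mu]_p (g p ^+ 2) <= D -> (i <= l)%N -> (l <= k)%N ->
    `|\int[mu]_p ((u j l p - u j i p) * g p)| <= th / 2 * (C * ((k - i)%:R * dt j)) + (2 * th)^-1 * D.
  move=> Hg gD il lk; apply: le_trans (young0 th0 (bmfB (u_bmf j l) (u_bmf j i)) Hg) _.
  apply: lerD; apply: ler_wpM2l => //; rewrite ?invr_ge0 ?mulr_ge0 ?(ltW th0) //.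
  apply: le_trans (HC j i l il _) _; first by apply: le_trans kS; rewrite ler_wpM2r ?ler_nat // ltW.
  by rewrite ler_wpM2l // ler_wpM2r ?ler_nat ?leq_sub2r // ltW.
have thD : (2 * th)^-1 * D + (2 * th)^-1 * D = D / th by field; exact: lt0r_neq0.
split.
  rewrite dif //; apply: le_trans (est _ k AAB _ ik (leqnn k)) _; first by rewrite /D; have := I0 A0; have := I0 qh; lra.
  have : 0 <= th / 2 * (C * ((k - i)%:R * dt j)) by rewrite !mulr_ge0 ?(ltW th0) ?(ltW (dt0 j)) ?invr_ge0.
  have : 0 <= (2 * th)^-1 * D by rewrite mulr_ge0 // invr_ge0 mulr_ge0 // ltW.
  lra.
set X := th * C * ((k - i)%:R * dt j) + D / th + K * dt j.
have St l : (i <= l)%N -> (l < k)%N ->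
   `|\int[mu]_p (u j l.+1 p * h p) - \int[mu]_p (u j l p * h p) - dt j * \int[mu]_p (u j i p * AA p)| <= dt j * X.
  move=> il lk.
  have := HK (dt j) _ _ (dt0 j) (dt1 j) (u_C1 j l) (proj2 (Hu j) l).
  have -> : \int[mu]_p (q p * u j l p * h p) = \int[mu]_p (u j l p * qh p) by apply: I_eq => p; rewrite /qh; ring.
  have E1 := dif l i _ qhB; have E2 := dif l.+1 i _ A0B.
  have e1 := est _ l qhB _ il (ltnW lk); have e2 := est _ l.+1 A0B _ (leqW il) lk.
  have {}e1 := e1 _; have {}e2 := e2 _.
  have {e1} /e1 e1 : \int[mu]_p (qh p ^+ 2) <= D by rewrite /D; have := I0 A0; have := I0 AA; lra.
  have {e2} /e2 e2 : \int[mu]_p (A0 p ^+ 2) <= D by rewrite /D; have := I0 qh; have := I0 AA; lra.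
  rewrite -E1 in e1; rewrite -E2 in e2.
  have -> : \int[mu]_p (u j i p * AA p) = \int[mu]_p (u j i p * A0 p) + \int[mu]_p (u j i p * qh p).
    rewrite -IntD; [|by apply: bmfM => //; exact: u_bmf..].
    by apply: I_eq => p; rewrite mulrDr.
  move: e1 e2; rewrite -/A0 /X -thD.
  move: (\int[mu]_p (u j l.+1 p * h p)) (\int[mu]_p (u j l p * h p)) (\int[mu]_p (u j l p * qh p)) (\int[mu]_p (u j l.+1 p * A0 p)).
  have Yth : th / 2 * (C * ((k - i)%:R * dt j)) + th / 2 * (C * ((k - i)%:R * dt j)) = th * C * ((k - i)%:R * dt j) by field.
  move=> x y z w e1 e2 H; apply: le_trans (step_arith (dt0 j) e1 e2 H) _.
  by rewrite Yth le_eqVlt; apply/orP; left; apply/eqP; ring.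
have X0 : 0 <= X.
  rewrite /X !addr_ge0 // ?divr_ge0 ?mulr_ge0 ?(ltW th0) ?(ltW (dt0 j)) //.
have tel m : (i + m <= k)%N -> `|\int[mu]_p (u j (i + m)%N p * h p) - \int[mu]_p (u j i p * h p) - m%:R * dt j * \int[mu]_p (u j i p * AA p)| <= m%:R * dt j * X.
  elim: m => [|m IH] mk; first by rewrite addn0 subrr !mul0r subr0 normr0.
  have e1 := St (i + m)%N (leq_addr _ _); rewrite -addnS in e1; have {}e1 := e1 mk.
  have mk' : (i + m <= k)%N by apply: leq_trans mk; rewrite leq_add2l.
  have := lerD e1 (IH mk') => H; rewrite -[m.+1%:R]natr1 !mulrDl !mul1r [leRHS]addrC.
  apply: le_trans H; apply: le_trans (ler_normD _ _); rewrite le_eqVlt; apply/orP; left; apply/eqP; congr (`|_|).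
  by ring.
have := tel (k - i)%N; rewrite subnKC //; apply; exact: leqnn.
Qed.

Definition GG t := \int[mu]_p (v t p * h p).
Definition FF t := \int[mu]_p (v t p * AA p).

Lemma cvgU (a : nat -> R) (l : R) : a @ \oo --> l -> a @ U --> l.
Proof. by move=> H A /H; exact: Uoo. Qed.

Lemma GG_est (S : R) : 0 <= S -> exists C D : R, [/\ 0 <= C, 0 <= D &
  forall s t th, 0 <= s -> s <= t -> t <= S -> 0 < th ->
  `|FF t - FF s| <= th * C * (t - s) + D / th /\
  `|GG t - GG s - (t - s) * FF s| <= (t - s) * (th * C * (t - s) + D / th)].
Proof.
move=> S0; have UP : ProperFilter U := ultra_proper.
have [C [D [K [C0 D0 K0 H]]]] := step_est S0; exists C, D; split=> // s t th s0 st tS th0.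
have t0 := le_trans s0 st.
pose r j := (kk t j - kk s j)%:R * dt j.
have rc : r @ \oo --> t - s.
  apply/cvgrPdist_le => e e0; have := dt_cvg; move/cvgrPdist_le => /(_ e e0).
  apply: filterS => j; rewrite sub0r normrN gtr0_norm // => He; apply: le_trans He.
  rewrite /r natrB ?kk_mono // mulrBl ler_norml.
  have := kk_le j t0; have := kk_gt s j; have := kk_le j s0; have := kk_gt t j.
  by move: ((kk t j)%:R * dt j) ((kk s j)%:R * dt j) (dt j) => a b c *; apply/andP; split; lra.
have rU := cvgU rc; have dU := cvgU dt_cvg.
have cF x : (fun j => \int[mu]_p (uu x j p * AA p)) @ U --> FF x.
  by rewrite /FF vE //; apply: ucvg; exact: uu_bdd.
have cG x : (fun j => \int[mu]_p (uu x j p * h p)) @ U --> GG x.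
  by rewrite /GG vE //; apply: ucvg; exact: uu_bdd.
have kS j : (kk t j)%:R * dt j <= S by apply: le_trans tS; exact: kk_le.
have cB : (fun j => th * C * r j + D / th) @ U --> th * C * (t - s) + D / th.
  by apply: cvgD; [apply: cvgM => //; exact: cvg_cst|exact: cvg_cst].
split.
  apply: (ler_cvg_to (cvg_norm (cvgB (cF t) (cF s))) cB).
  by apply: nearW => j; have [] := H j _ _ th (kk_mono j st) (kS j) th0.
have c1 : (fun j => r j * (th * C * r j + D / th + K * dt j)) @ U --> (t - s) * (th * C * (t - s) + D / th + K * 0).
  by apply: cvgM => //; apply: cvgD => //; apply: cvgM => //; exact: cvg_cst.
rewrite mulr0 addr0 in c1.
apply: (ler_cvg_to (cvg_norm (cvgB (cvgB (cG t) (cG s)) (cvgM rU (cF s)))) c1).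
by apply: nearW => j; have [_] := H j _ _ th (kk_mono j st) (kS j) th0.
Qed.

(** The expansion in [GG_est] is around the earlier time. Going backwards in time, it is recentred
    with the bound on [FF], which doubles the error. *)
Lemma two_sided (S : R) : 0 <= S -> exists C D : R, [/\ 0 <= C, 0 <= D &
  forall s t th, 0 <= s -> s <= S -> 0 <= t -> t <= S -> 0 < th ->
  `|FF t - FF s| <= th * C * `|t - s| + D / th /\
  `|GG t - GG s - (t - s) * FF s| <= 2 * (`|t - s| * (th * C * `|t - s| + D / th))].
Proof.
move=> S0; have [C [D [C0 D0 H]]] := GG_est S0; exists C, D; split=> // s t th s0 sS t0 tS th0.
have B0 r : 0 <= r -> 0 <= r * (th * C * r + D / th).
  by move=> r0; rewrite mulr_ge0 // addr_ge0 ?divr_ge0 ?mulr_ge0 // ltW.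
have [st|ts] := orP (le_total s t).
  have [h1 h2] := H s t th s0 st tS th0; rewrite [`|t - s|]ger0_norm ?subr_ge0 //; split=> //.
  by apply: le_trans h2 _; rewrite mulr_natl mulr2n lerDl B0 ?subr_ge0.
have [h1 h2] := H t s th t0 ts sS th0; rewrite [`|t - s|]distrC [`|s - t|]ger0_norm ?subr_ge0 //; split; first by rewrite distrC.
have -> : GG t - GG s - (t - s) * FF s = - (GG s - GG t - (s - t) * FF t) + (s - t) * (FF s - FF t) by ring.
apply: le_trans (ler_normD _ _) _; rewrite normrN mulr_natl mulr2n; apply: lerD => //.
by rewrite normrM ger0_norm ?subr_ge0 // ler_wpM2l ?subr_ge0.
Qed.

Lemma choose_th (C D e : R) : 0 <= C -> 0 <= D -> 0 < e -> exists th r : R, [/\ 0 < th, 0 < r &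
  forall x, 0 <= x -> x < r -> 2 * (th * C * x + D / th) <= e].
Proof.
move=> C0 D0 e0; have D1 : 0 < D + 1 by rewrite ltr_wpDl.
have C1 : 0 < C + 1 by rewrite ltr_wpDl.
pose th := 4 * (D + 1) / e; have th0 : 0 < th by rewrite divr_gt0 // mulr_gt0.
have th4 : 0 < 4 * th * (C + 1) by apply: mulr_gt0 => //; apply: mulr_gt0.
exists th, (e / (4 * th * (C + 1))); split=> //; first exact: divr_gt0.
move=> x x0; rewrite (ltr_pdivlMr _ _ th4) => xr.
have e1 : D / th <= e / 4.
  have -> : D / th = e / 4 * (D / (D + 1)) by rewrite /th; field; rewrite !gt_eqF.
  by rewrite ler_piMr ?divr_ge0 ?(ltW e0) // ler_pdivrMr // mul1r lerDl.
have : 0 <= th * x by rewrite mulr_ge0 // ltW.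
by move: xr e1; lra.
Qed.

Lemma GG_der (t : R) : 0 < t -> is_derive t (1 : R) GG (FF t).
Proof.
move=> t0; have t1 : 0 <= t + 1 by rewrite addr_ge0 // ltW.
have [C [D [C0 D0 H]]] := two_sided t1.
apply: (@is_derive_quad _ _ _ _ 1) => // e e0.
have [th [r [th0 r0 Hr]]] := choose_th C0 D0 e0.
exists (Num.min r (Num.min t 1)); first by rewrite !lt_min r0 t0 ltr01.
move=> x; rewrite !lt_min => /and3P[xr xt x1].
have x0 : 0 <= x by move: xt; rewrite ltr_norml => /andP[? _]; lra.
have tS : t <= t + 1 by rewrite lerDl.
have xS : x <= t + 1 by move: x1; rewrite ltr_norml => /andP[_ ?]; lra.
have [_ H2] := H t x th (ltW t0) tS x0 xS th0.
apply: le_trans H2 _; rewrite mulrCA mulrC; apply: ler_wpM2r => //.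
by apply: Hr.
Qed.

Lemma FF_cont t : {within `[0, t], continuous FF}.
Proof.
apply/subspace_continuousP => x /=; rewrite in_itv /= => /andP[x0 xt].
have t0 := le_trans x0 xt; have [C [D [C0 D0 H]]] := two_sided t0.
apply/cvgrPdist_le => e e0; have [th [r [th0 r0 Hr]]] := choose_th C0 D0 e0.
have : \forall y \near nbhs x, `|x - y| < r by exact: cvgr_dist_lt.
rewrite /within /=; apply: filterS => y xy; rewrite in_itv /= => /andP[y0 yt].
have [H1 _] := H y x th y0 yt x0 xt th0; apply: le_trans H1 _.
apply: le_trans (Hr _ _ xy) => //; rewrite mulr_natl mulr2n lerDl.
by rewrite addr_ge0 ?divr_ge0 ?mulr_ge0 // ltW.
Qed.

Lemma GG_right : GG x @[x --> 0^'+] --> GG 0.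
Proof.
have [C [D [C0 D0 H]]] := two_sided ler01.
pose L := `|FF 0| + 2 * (C + D).
have L0 : 0 <= L by rewrite addr_ge0 // mulr_ge0 // addr_ge0.
apply/cvgrPdist_le => e e0; near=> x.
have x0 : 0 < x by near: x; exact: nbhs_right_gt.
have x1 : x <= 1 by near: x; apply: nbhs_right_le.
have xe : x <= e / (L + 1) by near: x; apply: nbhs_right_le; rewrite divr_gt0 // ltr_wpDl.
have [_ H2] := H 0 x 1 (lexx _) ler01 (ltW x0) x1 ltr01.
rewrite subr0 mul1r divr1 (gtr0_norm x0) in H2.
rewrite distrC; apply: (@le_trans _ _ (x * (L + 1))); last by rewrite -ler_pdivlMr // ltr_wpDl.
have -> : GG x - GG 0 = (GG x - GG 0 - x * FF 0) + x * FF 0 by ring.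
apply: le_trans (ler_normD _ _) _; rewrite [`|x * _|]normrM gtr0_norm //.
apply: le_trans (lerD H2 (lexx _)) _.
have : x * (C * x) <= x * C by rewrite ler_wpM2l ?(ltW x0) // ler_piMr.
by rewrite /L; move: (`|FF 0|) => a; have := ltW x0; lra.
Unshelve. all: by end_near. Qed.

Lemma weak_eq t : 0 <= t ->
  \int[mu]_p (v t p * h p) = \int[mu]_p (u0 p * h p) +
    \int[@lebesgue_measure R]_(s in `[0, t]) \int[mu]_p (v s p * AA p).
Proof.
have G0 : GG 0 = \int[mu]_p (u0 p * h p).
  rewrite /GG vE //; have -> : (fun j => \int[mu]_p (uu 0 j p * h p)) = (fun=> \int[mu]_p (u0 p * h p)).
    by apply/funext => j; rewrite /uu kk0; have [->] := Hu j.
  exact: ulim_cst.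
rewrite le_eqVlt => /orP[/eqP <-|t0].
  by rewrite -[LHS]/(GG 0) G0 set_itv1 Rintegral_set1 addr0.
have cG x : 0 < x -> {for x, continuous GG}.
  move=> x0; have D := GG_der x0; apply: differentiable_continuous.
  by apply/derivable1_diffP; exact: ex_derive.
have := @continuous_FTC2 R FF GG 0 t t0 (@FF_cont t).
have dG : derivable_oo_LRcontinuous GG 0 t.
  split.
  - by move=> x; rewrite in_itv /= => /andP[x0 _]; have D := GG_der x0; exact: ex_derive.
  - exact: GG_right.
  - by apply: cvg_at_left_filter; exact: cG.
move=> /(_ dG) E; rewrite -G0 /Rintegral -/(FF _).
have -> : (\int[lebesgue_measure]_(x in `[0%R, t]) (FF x)%:E = (GG t)%:E - (GG 0)%:E)%E.
  apply: E => x; rewrite in_itv /= => /andP[x0 _].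
  by rewrite derive1E; have D := GG_der x0; rewrite derive_val.
by rewrite -EFinB /= addrC subrK.
Qed.

End Weak.

Lemma limit_weak_solution : @weak_solution R n M G mu f q eps u0 v.
Proof.
split.
- by move=> t _; exact: v_L2.
- by move=> t t0; exact: v_cont.
- exact: v_init.
- move=> h Hh t t0; rewrite (weak_eq (Hh 2%N) t0); congr (_ + _).
  apply: eq_Rintegral => s _; apply: I_eq => p; congr (_ * _).
  by rewrite /adj0 /adjoint_op; ring.
Qed.

End Limit.
End Solution.

(** * Paths and their action *)

Lemma lebesgue_integral_shift (R : realType) (a : R) (f : R -> \bar R) :
  (\int[@lebesgue_measure R]_t f (t + a)%R = \int[@lebesgue_measure R]_t f t)%E.
Proof.
rewrite integralE [RHS]integralE; congr (_ - _)%E.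
  rewrite -[RHS](ge0_integral_shift a); last exact: funepos_ge0.
  by apply: eq_integral => t _; rewrite !funeposE.
rewrite -[RHS](ge0_integral_shift a); last exact: funeneg_ge0.
by apply: eq_integral => t _; rewrite !funenegE.
Qed.

Lemma Rintegral_shift (R : realType) (a b s : R) (v : R -> R) :
  \int[@lebesgue_measure R]_(r in `[b, s]) v (r - a) = \int[@lebesgue_measure R]_(r in `[b - a, s - a]) v r.
Proof.
rewrite /Rintegral; congr (fine _); rewrite integral_mkcond [in RHS]integral_mkcond.
rewrite -[RHS](@lebesgue_integral_shift _ (- a)); apply: eq_integral => r _.
rewrite /patch; congr (if _ then _ else _); apply/idP/idP; rewrite !inE /= !in_itv /= => /andP[]; lra.
Qed.

Lemma bounded_itv_integrable (R : realType) (v : R -> R) (K a b : R) :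
  measurable_fun setT v -> (forall s, `|v s| <= K) ->
  (@lebesgue_measure R).-integrable `[a, b] (EFin \o v).
Proof.
move=> mv Kv; apply: measurable_bounded_integrable => //.
- exact: (compact_finite_measure (@segment_compact _ _ _)).
- exact: measurable_funTS.
- exists K; split; first exact: num_real.
  by move=> x Kx r _; exact: le_trans (Kv r) (ltW Kx).
Qed.

Lemma nbhs_shift (R : realType) (a s : R) (P Q : set R) : (forall r, P (r - a) -> Q r) ->
  nbhs (s - a) P -> nbhs s Q.
Proof.
move=> PQ sP; have sc : {for s, continuous (fun r : R => r - a)}.
  by apply: cvgB; [exact: cvg_id|exact: cvg_cst].
exact: filterS PQ (sc _ sP).
Qed.

(** * Lower integrals compared up to null sets *)

Section LowerIntegralAE.
Context d (T : measurableType d) (R : realType) (mu : {measure set T -> \bar R}).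
Local Open Scope ereal_scope.

Lemma lower_subset_integral (A B : set T) (f : T -> \bar R) : (forall x, B x -> 0 <= f x) ->
  A `<=` B -> \int[mu]_(x in A) f x <= \int[mu]_(x in B) f x.
Proof.
move=> f0 AB; rewrite integral_mkcond [leRHS]integral_mkcond.
apply: le_lower_integral => x _; first by apply: erestrict_ge0 => y Ay; apply: f0; exact: AB.
rewrite /patch; case: ifPn => [|_]; first by rewrite inE => /AB Bx; rewrite mem_set.
by case: ifPn => // /[!inE]; exact: f0.
Qed.

Lemma le_lower_integral_ae (D N : set T) (g f : T -> \bar R) : measurable D ->
  measurable_fun D g -> (forall x, D x -> 0 <= g x) -> (forall x, D x -> 0 <= f x) ->
  measurable N -> mu N = 0 -> (forall x, D x -> ~ N x -> g x <= f x) ->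
  \int[mu]_(x in D) g x <= \int[mu]_(x in D) f x.
Proof.
move=> mD mg g0 f0 mN N0 gf.
rewrite (@ge0_negligible_integral _ _ _ mu D N) //.
apply: (@le_trans _ _ (\int[mu]_(x in D `\` N) f x)).
  by apply: le_lower_integral => x [Dx Nx]; [exact: g0|exact: gf].
by apply: lower_subset_integral => // x [].
Qed.

(** A measurable minorant is split along the measurable set [A]; this gives subadditivity over the
    two pieces although [f], [g] and [h] are not assumed measurable. *)
Lemma lower_integral_split (D A B N : set T) (f g h : T -> \bar R) :
  measurable A -> measurable N -> mu N = 0 ->
  (forall x, D x -> 0 <= f x) -> (forall x, A x -> 0 <= g x) -> (forall x, B x -> 0 <= h x) ->
  (forall x, D x -> ~ N x -> A x -> f x <= g x) ->
  (forall x, D x -> ~ N x -> ~ A x -> B x /\ f x <= h x) ->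
  \int[mu]_(x in D) f x <= \int[mu]_(x in A) g x + \int[mu]_(x in B) h x.
Proof.
move=> mA mN N0 f0 g0 h0 HA HB; apply: lower_integral_le => // k mk k0 kD kf.
have mE : measurable_fun setT (EFin \o k) by exact/measurable_EFinP.
have mC : measurable (~` A) by exact: measurableC.
have k0' x : 0 <= (k x)%:E by rewrite lee_fin.
rewrite -(setUv A) ge0_integral_setU //; [|by rewrite setUv|exact/disj_setPCl].
apply: leeD.
  apply: (@le_lower_integral_ae A N) => // [|x Ax Nx]; first exact: measurable_funTS.
  by have [Dx|/kD->] := pselect (D x); [exact: le_trans (kf _ Dx) (HA _ Dx Nx Ax)|exact: g0].
apply: (@le_trans _ _ (\int[mu]_(x in ~` A) (h \_ B) x)).
  apply: (@le_lower_integral_ae (~` A) N) => // [|x _|x Ax Nx].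
  - exact: measurable_funTS.
  - exact: erestrict_ge0.
  - have [Dx|/kD->] := pselect (D x); last exact: erestrict_ge0.
    by have [Bx fh] := HB _ Dx Nx Ax; rewrite /patch mem_set //; exact: le_trans (kf _ Dx) fh.
rewrite [leRHS]integral_mkcond; apply: lower_subset_integral => // x _; exact: erestrict_ge0.
Qed.
End LowerIntegralAE.

Section Paths.
Context {R : realType} {n : nat} {M : ptopologicalType} (G : riemannian R n M).
Variable X : vfield G.
Hypothesis X_compat : vf_compat X.
Notation la := (@lebesgue_measure R).
Implicit Types (c : chart G) (g : R -> M).

Definition aint g s : R := norm_sq (chart_at G (g s)) (chart_to (chart_at G (g s)) (g s))
  (velocity G g s - X (chart_at G (g s)) (chart_to (chart_at G (g s)) (g s))).

Lemma aint_ge0 g s : 0 <= aint g s.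
Proof. by apply: ip_ge0; apply: metric_posdef; apply: chart_codP; exact: chart_atP. Qed.

(** The action integrand reads the velocity in a chart that changes with the point. Where the path
    is differentiable it may be computed in any fixed chart, by the chain rule and the
    transformation of the metric. *)
Lemma aint_chart c g s w : chart_dom c (g s) -> {for s, continuous g} ->
  is_derive s (1 : R) (chart_to c \o g) w ->
  aint g s = norm_sq c (chart_to c (g s)) (w - X c (chart_to c (g s))).
Proof.
move=> cs gs dg; set d := chart_at G (g s); have ds := chart_atP G (g s); rewrite -/d in ds.
have os := overlap_to cs ds; set x := chart_to c (g s) in os *.
have xd : trans c d x = chart_to d (g s) by exact: trans_to.
have dg' : differentiable (chart_to c \o g) s by apply/derivable1_diffP; case: dg.
have dt : differentiable (trans c d) ((chart_to c \o g) s) by exact: trans_diff.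
have vE : velocity G g s = w *m 'J (trans c d) x.
  rewrite /velocity derive1E -/d.
  have -> : 'D_1 (fun r => chart_to d (g r)) s = 'D_1 (trans c d \o (chart_to c \o g)) s.
    apply: near_eq_derive; near=> r => /=; rewrite trans_to //.
    by near: r; apply: gs; exact: chart_dom_near.
  rewrite deriveE; last exact: differentiable_comp.
  have dw : 'd (chart_to c \o g) s 1 = w by rewrite -deriveE // derive_val.
  by rewrite diff_comp //= dw /jacobian mul_rV_lin1.
rewrite /aint -/d -xd vE (X_compat os) -mulmxBl /norm_sq (metric_trans os) trmx_mul.
by rewrite !mulmxA.
Unshelve. all: end_near.
Qed.

(** An action bound with a witness path, without the factor [1 / 4]. Such bounds concatenate
    directly, and the infimum is taken only later, in [Dr]. *)
Definition reach x y t a := exists g, [/\ W1oo_path G t g, g 0 = x, g t = y &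
  (action X t g <= a%:E)%E].

Lemma reach_action_dist x y t a : reach x y t a -> (action_dist X x y t <= (a / 4)%:E)%E.
Proof.
move=> [g [Wg g0 gt ga]]; rewrite /action_dist mulrC EFinM.
apply: lee_wpmul2l; first by rewrite lee_fin invr_ge0.
apply: le_trans ga; apply: ereal_inf_lbound; by exists g.
Qed.

Lemma reach_ge0 x y t a : reach x y t a -> 0 <= a.
Proof.
move=> [g [_ _ _]]; rewrite -lee_fin; apply: le_trans; apply: integral_ge0 => s _.
by rewrite lee_fin; exact: (aint_ge0 g s).
Qed.

Lemma reach_le x y t a b : a <= b -> reach x y t a -> reach x y t b.
Proof. by move=> ab [g [? ? ? ga]]; exists g; split=> //; apply: le_trans ga _; rewrite lee_fin. Qed.

Section Line.
Variables (c0 : chart G) (x0 w : 'rV[R]_n) (t B : R).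
Hypotheses (t_gt0 : 0 < t) (line_in : forall s, s \in `[0, t] -> chart_cod c0 (x0 + s *: w)).
Hypothesis lineB : forall s, s \in `[0, t] ->
  norm_sq c0 (x0 + s *: w) (w - X c0 (x0 + s *: w)) <= B.
Let g s := chart_from c0 (x0 + s *: w).

Let lineC : continuous (fun s : R => x0 + s *: w).
Proof.
move=> s; apply: cvgD; first exact: cvg_cst.
by apply: cvgZr_tmp; exact: cvg_id.
Qed.

Let gC s : s \in `[0, t] -> {for s, continuous g}.
Proof. by move=> st; apply: continuous_comp; [exact: lineC|exact: (chart_from_cont (line_in st))]. Qed.

Let g_near s : s \in `[0, t] -> \forall r \near s, chart_cod c0 (x0 + r *: w).
Proof. by move=> st; exact: (lineC (chart_cod_near (line_in st))). Qed.

Lemma line_action : (action X t g <= (t * B)%:E)%E.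
Proof.
rewrite /action; have -> : (t * B)%:E = (\int[la]_(s in `[0%R, t]) B%:E)%E.
  by rewrite integral_cst //= lebesgue_measure_itv /= lte_fin t_gt0 oppr0 adde0 -EFinM mulrC.
apply: le_lower_integral => s st; rewrite lee_fin; first exact: aint_ge0.
rewrite (_ : norm_sq _ _ _ = aint g s) //.
have E : chart_to c0 (g s) = x0 + s *: w by rewrite chart_fromK //; exact: line_in.
suff dg : is_derive s (1 : R) (chart_to c0 \o g) w.
  by rewrite (@aint_chart c0 g s w) ?E; [exact: lineB|exact/chart_from_dom/line_in|exact: gC].
apply: (@near_eq_is_derive _ _ _ (fun s : R => x0 + s *: w)) => //.
  by apply: filterS (g_near st) => r /= rc; rewrite /g chart_fromK.
have := @is_derive_line _ _ _ (@id 'rV[R]_n) x0 w s (@derivable_id _ _ _ _); rewrite derive_id; exact.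
Qed.

(** In another chart the path is the image of a line under a transition map. Its derivative is
    continuous on the compact interval and is extended by zero to a bounded measurable function on
    the whole line. *)
Lemma line_W1oo : W1oo_path G t g.
Proof.
split; first by apply: continuous_in_subspaceT => s /set_mem; exact: gC.
move=> c a b a0 ab bt cd j.
pose F s := chart_to c (g s) 0 j.
pose h z := trans c0 c z 0 j.
have ot s : s \in `[a, b] -> overlap c0 c (x0 + s *: w).
  move=> sab; split; last exact: (cd s sab).
  by apply: line_in; move: sab; rewrite !in_itv /= => /andP[? ?]; apply/andP; split; lra.
pose dF s := (w *m (drow h (x0 + s *: w))^T) 0 0.
have FD s : s \in `[a, b] -> is_derive s (1 : R) F (dF s).
  move=> sab; have [dh _] := trans_C1 j (ot s sab).
  by rewrite /dF -diff_drow // -deriveE //; exact: (is_derive_line (diff_derivable dh)).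
have dFC s : s \in `[a, b] -> {for s, continuous dF}.
  move=> sab; rewrite /dF.
  have -> : (fun s => (w *m (drow h (x0 + s *: w))^T) 0 0) =
            (fun s => \sum_k w 0 k * partial k h (x0 + s *: w)).
    by apply/funext => r; rewrite mxE; apply: eq_bigr => k _; rewrite !mxE.
  apply: continuous_at_sum => k; apply: contM; first exact: cont_cst.
  have [_ dk] := trans_C1 j (ot s sab).
  by apply: (@continuous_comp _ _ _ (fun s : R => x0 + s *: w) (partial k h)); [exact: lineC|exact: dk].
have dFC' : {within `[a, b], continuous dF}.
  by apply: continuous_in_subspaceT => s /set_mem; exact: dFC.
exists (dF \_ `[a, b]); split.
- apply/(measurable_restrictT _ _).1 => //; exact: subspace_continuous_measurable_fun.
- have [K [_ /(_ (K + 1))HK]] := compact_bounded (continuous_compact dFC' (@segment_compact _ a b)).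
  exists (Num.max (K + 1) 0) => s; rewrite /patch; case: ifPn => [sab|_]; last first.
    by rewrite normr0 le_max lexx orbT.
  by rewrite le_max HK ?ltrDl //; exists s => //; exact/set_mem.
- move=> s sab; have /andP[as_ sb] : a <= s <= b by move: sab; rewrite in_itv.
  have -> : \int[la]_(r in `[a, s]) (dF \_ `[a, b]) r = \int[la]_(r in `[a, s]) dF r.
    apply: eq_Rintegral => r /set_mem /=; rewrite in_itv /= => /andP[ar rs].
    by rewrite patchE mem_set //= in_itv /= ar (le_trans rs sb).
  have [<-|as'] := eqVneq a s.
    by rewrite set_itv1 Rintegral_set1 addr0.
  have lt : a < s by rewrite lt_neqAle as'.
  rewrite /Rintegral (@continuous_FTC2 _ dF F) //=.
  + by rewrite /F; lra.
  + apply: continuous_subspaceW dFC' => r /=; rewrite !in_itv /= => /andP[-> rs] /=; exact: le_trans sb.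
  + have Fc r : r \in `[a, s] -> {for r, continuous F}.
      rewrite in_itv /= => /andP[ar rs]; have [] := FD r; first by rewrite in_itv /= ar (le_trans rs sb).
      by move=> /derivable1_diffP/differentiable_continuous.
    split.
    * move=> r; rewrite in_itv /= => /andP[ar rs]; have [] // := FD r.
      by rewrite in_itv /= (ltW ar) (le_trans (ltW rs) sb).
    * by apply: cvg_at_right_filter; apply: Fc; rewrite in_itv /= lexx.
    * by apply: cvg_at_left_filter; apply: Fc; rewrite in_itv /= lexx andbT.
  + move=> r; rewrite in_itv /= => /andP[ar rs]; rewrite derive1E; have := FD r.
    by rewrite in_itv /= (ltW ar) (le_trans (ltW rs) sb) => /(_ isT) ?; rewrite derive_val.
Qed.

Lemma reach_line : reach (chart_from c0 x0) (chart_from c0 (x0 + t *: w)) t (t * B).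
Proof.
exists g; split; [exact: line_W1oo|by rewrite /g scale0r addr0|by []|exact: line_action].
Qed.
End Line.

Lemma aint_near g h s : (\forall r \near s, g r = h r) -> aint g s = aint h s.
Proof.
move=> gh; have gs : g s = h s by exact: nbhs_singleton gh.
have vE : velocity G g s = velocity G h s.
  rewrite /velocity !derive1E gs.
  by apply: near_eq_derive; apply: filterS gh => r ->.
by rewrite /aint vE gs.
Qed.

Lemma aint_shift g a s : aint (fun r => g (r - a)) s = aint g (s - a).
Proof.
have vE : velocity G (fun r => g (r - a)) s = velocity G g (s - a).
  rewrite /velocity !derive1E /derive.
  pose k r := chart_to (chart_at G (g (s - a))) (g r).
  have E : (fun h : R => h^-1 *: (((fun r => k (r - a)) \o shift s) (h *: 1) - k (s - a))) =
           (fun h : R => h^-1 *: ((k \o shift (s - a)) (h *: 1) - k (s - a))).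
    by apply/funext => h; rewrite /= addrA.
  exact: (congr1 (fun F : R -> 'rV[R]_n => lim (F @ 0^')) E).
by rewrite /aint vE.
Qed.

Section Concat.
Variables (g1 g2 : R -> M) (t1 t2 : R).
Hypotheses (t1_gt0 : 0 < t1) (t2_gt0 : 0 < t2) (g12 : g2 0 = g1 t1).
Hypotheses (W1 : W1oo_path G t1 g1) (W2 : W1oo_path G t2 g2).
Let g s := if s <= t1 then g1 s else g2 (s - t1).

Let gl s : s <= t1 -> g s = g1 s. Proof. by rewrite /g => ->. Qed.
Let gr s : t1 <= s -> g s = g2 (s - t1).
Proof.
move=> t1s; rewrite /g; case: ifPn => // st1.
have -> : s = t1 by apply/le_anti/andP.
by rewrite subrr g12.
Qed.

(** The integrands agree except at the junction, where the velocity may not exist; a single point is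
    negligible. *)
Lemma concat_action : (action X (t1 + t2) g <= action X t1 g1 + action X t2 g2)%E.
Proof.
have -> : action X t2 g2 = (\int[la]_(s in `[t1, (t1 + t2)%R]) (aint g2 (s - t1))%:E)%E.
  rewrite [RHS]integral_mkcond -[RHS](@lebesgue_integral_shift _ t1) /action integral_mkcond.
  apply: eq_integral => s _; rewrite /patch addrK /=.
  congr (if _ then _ else _); apply/idP/idP; rewrite !inE /= !in_itv /= => /andP[? ?];
  apply/andP; split; lra.
rewrite /action; apply: (@lower_integral_split _ _ _ la _ _ _ [set t1]) => //.
- exact: lebesgue_measure_set1.
- by move=> s _; rewrite lee_fin; exact: (aint_ge0 g s).
- by move=> s _; rewrite lee_fin; exact: (aint_ge0 g1 s).
- by move=> s _; rewrite lee_fin; exact: aint_ge0.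
- move=> s _ /eqP nt; rewrite /= in_itv /= => /andP[s0 st]; rewrite lee_fin.
  have lt : s < t1 by rewrite lt_neqAle nt.
  rewrite le_eqVlt; apply/orP; left; apply/eqP; apply: (@aint_near g g1).
  by apply: filterS (lt_nbhsl lt) => r /ltW; exact: gl.
- move=> s; rewrite /= !in_itv /= => /andP[s0 st] /eqP nt ns.
  have lt : t1 < s by rewrite ltNge; apply/negP => le1; apply: ns; rewrite s0.
  split; first by rewrite (ltW lt).
  rewrite lee_fin -aint_shift le_eqVlt; apply/orP; left; apply/eqP.
  apply: (@aint_near g (fun r => g2 (r - t1))).
  by apply: filterS (lt_nbhsr lt) => r /ltW; exact: gr.
Qed.

Lemma concat_cont : {within `[0, t1 + t2], continuous g}.
Proof.
have -> : `[0, t1 + t2]%classic = `[0, t1]%classic `|` `[t1, t1 + t2]%classic.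
  apply/seteqP; split => s; rewrite /= !in_itv /=; last first.
    by move: t1_gt0 t2_gt0 => ? ?; move=> [] /andP[? ?]; apply/andP; split; lra.
  by move=> /andP[s0 s1]; have [] := orP (le_total s t1) => st; [left|right]; apply/andP; split; lra.
apply: withinU_continuous; try exact: interval_closed.
  apply: subspace_eq_continuous W1.1 => s /set_mem /=; rewrite in_itv /= => /andP[_ st].
  exact: (esym (gl st)).
apply: (@subspace_eq_continuous _ _ _ (fun s => g2 (s - t1))).
  by move=> s /set_mem /=; rewrite in_itv /= => /andP[st _]; exact: (esym (gr st)).
apply/subspace_continuousP => s /= sI.
have sI' : `[0, t2]%classic (s - t1).
  by move: sI; rewrite /= !in_itv /= => /andP[? ?]; apply/andP; split; lra.
have C2 := (subspace_continuousP _ _).1 W2.1 _ sI'.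
apply: (@cvg_comp _ _ _ (fun s => s - t1) g2 _ (within `[0, t2] (nbhs (s - t1)))) => //.
move=> U /=; rewrite /within /= => HU.
apply: (nbhs_shift _ HU) => r /= Hr; rewrite in_itv /= => /andP[? ?]; apply: Hr.
by rewrite in_itv /=; apply/andP; split; lra.
Qed.

Lemma concat_W1oo : W1oo_path G (t1 + t2) g.
Proof.
split; first exact: concat_cont.
move=> c a b a0 ab bt cd j.
have left_v b' : b' <= b -> b' <= t1 -> a <= b' -> exists v : R -> R,
    [/\ measurable_fun [set: R] v, exists K : R, forall s : R, `|v s| <= K &
     forall s, s \in `[a, b'] -> chart_to c (g s) 0 j = chart_to c (g a) 0 j + \int[la]_(r in `[a, s]) v r].
  move=> b'b b't ab'.
  have [s|v [mv Kv vE]] := W1.2 c a b' a0 ab' b't _ j.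
    rewrite in_itv /= => /andP[as_ sb]; rewrite -(gl (le_trans sb b't)); apply: cd.
    by rewrite in_itv /= as_ (le_trans sb).
  exists v; split=> // s sab; rewrite (gl (le_trans ab' b't)) gl; first exact: vE.
  by move: sab; rewrite in_itv /= => /andP[_ sb]; exact: le_trans b't.
have right_v a' : a <= a' -> t1 <= a' -> a' <= b -> exists v : R -> R,
    [/\ measurable_fun [set: R] v, exists K : R, forall s : R, `|v s| <= K &
     forall s, s \in `[a', b] -> chart_to c (g s) 0 j = chart_to c (g a') 0 j + \int[la]_(r in `[a', s]) v r].
  move=> aa' ta' a'b.
  have [||| s|v [mv [K Kv] vE]] := W2.2 c (a' - t1) (b - t1) _ _ _ _ j; try lra.
    rewrite in_itv /= => /andP[as_ sb]; have := cd (s + t1); rewrite gr; last lra.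
    by rewrite addrK; apply; rewrite in_itv /=; apply/andP; split; lra.
  exists (fun r => v (r - t1)); split.
  - by apply: measurableT_comp => //; exact: shift_measurable.
  - by exists K => s.
  - move=> s; rewrite in_itv /= => /andP[as_ sb]; rewrite (gr ta') (gr (le_trans ta' as_)).
    rewrite vE; last by rewrite in_itv /=; apply/andP; split; lra.
    by rewrite Rintegral_shift.
have [bt1|/ltW bt1] := leP b t1; first exact: left_v.
have [at1|/ltW at1] := leP t1 a; first exact: right_v.
have [v1 [mv1 [K1 Kv1] v1E]] := left_v t1 bt1 (lexx _) at1.
have [v2 [mv2 [K2 Kv2] v2E]] := right_v t1 at1 (lexx _) bt1.
(* The interval straddles the junction: the two densities are glued at [t1], and the integral is
   split there. *)
pose v r := if r <= t1 then v1 r else v2 r.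
have mv : measurable_fun [set: R] v.
  by apply: measurable_fun_ifT => //; apply: measurable_fun_ler => //; exact: measurable_id.
have Kv s : `|v s| <= Num.max K1 K2.
  by rewrite /v; case: ifP => _; rewrite le_max ?Kv1 ?Kv2 ?orbT.
exists v; split => //; first by exists (Num.max K1 K2).
have EL s : s <= t1 -> \int[la]_(r in `[a, s]) v r = \int[la]_(r in `[a, s]) v1 r.
  move=> st; apply: eq_Rintegral => r /set_mem /=; rewrite in_itv /= => /andP[_ rs].
  by rewrite /v (le_trans rs st).
move=> s; rewrite in_itv /= => /andP[as_ sb].
have [st|/ltW st] := leP s t1; first by rewrite EL // v1E // in_itv /= as_.
have iv : la.-integrable `[a, s] (EFin \o v) by exact: bounded_itv_integrable mv Kv.
have st' : s \in `[t1, b] by rewrite in_itv /= st.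
have t1ab : t1 \in `[a, t1] by rewrite in_itv /= at1 lexx.
rewrite (v2E _ st') (v1E _ t1ab) -addrA -(EL t1) //; congr (_ + _).
have E := @Rintegral_itvB _ v (BLeft a) (BRight s) t1 iv at1 st.
have E2 : \int[la]_(r in `[t1, s]) v2 r = \int[la]_(r in `]t1, s]) v r.
  rewrite -(@Rintegral_itv_obnd_cbnd _ t1 (BRight s) v2) //; last first.
    apply: (@integrableS _ _ _ la `[t1, s]) => //; first exact: subset_itv_oc_cc.
    exact: bounded_itv_integrable mv2 Kv2.
  apply: eq_Rintegral => r /set_mem /=; rewrite in_itv /= => /andP[tr _].
  by rewrite /v leNgt tr.
by rewrite E2 -E addrC subrK.
Qed.
End Concat.

Lemma reach_cat x y z t1 t2 a b : 0 < t1 -> 0 < t2 ->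
  reach x y t1 a -> reach y z t2 b -> reach x z (t1 + t2) (a + b).
Proof.
move=> t1_gt0 t2_gt0 [g1 [W1 g10 g1t A1]] [g2 [W2 g20 g2t A2]].
have g12 : g2 0 = g1 t1 by rewrite g20.
exists (fun s => if s <= t1 then g1 s else g2 (s - t1)); split.
- exact: concat_W1oo.
- by rewrite (ltW t1_gt0).
- by rewrite gerDl leNgt t2_gt0 /= addrC addKr.
- apply: le_trans; first exact: (concat_action _ g12).
  by rewrite EFinD; exact: leeD.
Qed.

End Paths.

(** * Positivity of the distance *)

Lemma ip_CS (R : realType) n (A : 'M[R]_n) u v : A^T = A -> posdef A ->
  ip A u v ^+ 2 <= ip A u u * ip A v v.
Proof.
move=> sA pA; have [->|v0] := eqVneq v 0; first by rewrite !ip0r mulr0 expr0n.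
have vv := pA _ v0; have := ip_young u v (ip A v v) (ip A u v) sA pA.
move=> H; rewrite -(ler_pM2l vv); move: (ip A v v) (ip A u v) (ip A u u) H => a b c H.
have -> : a * b ^+ 2 = 2 * (a * b) * b - b ^+ 2 * a by ring.
have -> : a * (c * a) = a ^+ 2 * c by ring.
lra.
Qed.

(** Cauchy-Schwarz against the vector dual to the coordinate [j], whose squared norm is the diagonal
    entry of the inverse metric. *)
Lemma coord_sq_le (R : realType) n (A : 'M[R]_n) (w : 'rV[R]_n) j : A^T = A -> posdef A ->
  w 0 j ^+ 2 <= invmx A j j * ip A w w.
Proof.
move=> sA pA; have uA := posdef_unit pA.
pose u : 'rV[R]_n := delta_mx 0 j *m invmx A.
have sI : (invmx A)^T = invmx A by rewrite trmx_inv sA.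
have wu : ip A w u = w 0 j.
  by rewrite /ip trmx_mul sI mulmxA mulmxK // trmx_delta -colE mxE.
have uu : ip A u u = invmx A j j.
  by rewrite /ip /u trmx_mul sI mulmxA mulmxKV // trmx_delta -rowE -colE !mxE.
by rewrite -wu -uu mulrC; exact: ip_CS.
Qed.

Lemma itv_len (R : realType) (s b : R) : s <= b -> fine (@lebesgue_measure R `[s, b]%classic) = b - s.
Proof.
rewrite lebesgue_measure_itv /= lte_fin le_eqVlt => /orP[/eqP->|->] //.
by rewrite ltxx subrr.
Qed.

Section Drift.
Context {R : realType} {n : nat} {M : ptopologicalType} (G : riemannian R n M).
Variable X : vfield G.
Hypotheses (X_compat : vf_compat X) (X_cont : vf_cont X).
Notation la := (@lebesgue_measure R).
Implicit Types (c : chart G) (g : R -> M).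

(** Lebesgue differentiation: the primitives of the coordinate densities are differentiable almost
    everywhere, so off a null set the action integrand is computed from the densities. The two
    endpoints join the null set because the derivative is two-sided. *)
Lemma W1oo_ae c t g s b (j0 : 'I_n) : W1oo_path G t g -> 0 <= s -> s <= b -> b <= t ->
  (forall r, r \in `[s, b] -> chart_dom c (g r)) ->
  exists v : 'I_n -> R -> R, [/\ forall j, measurable_fun setT (v j),
    forall j, exists K, forall r, `|v j r| <= K,
    forall j, chart_to c (g b) 0 j - chart_to c (g s) 0 j = \int[la]_(r in `[s, b]) v j r &
    exists N : set R, [/\ measurable N, la N = 0%E & forall r, r \in `[s, b] -> ~ N r ->
      aint X g r = norm_sq c (chart_to c (g r)) (\row_j v j r - X c (chart_to c (g r)))]].
Proof.
move=> Wg s0 sb bt cd.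
have [v0 Hv0] := choice (fun j => Wg.2 c s b s0 sb bt cd j).
pose v j := v0 j \_ `[s, b].
have vr j r : r \in `[s, b] -> v j r = v0 j r by move=> rI; rewrite /v patchE mem_set.
have vE j r : r \in `[s, b] -> chart_to c (g r) 0 j = chart_to c (g s) 0 j + \int[la]_(q in `[s, r]) v j q.
  move=> rI; have [_ _ ->] := Hv0 j; last exact: rI; congr (_ + _).
  apply: eq_Rintegral => q /set_mem /=; rewrite in_itv /= => /andP[sq qr]; rewrite vr //.
  by move: rI; rewrite !in_itv /= sq => /andP[_]; exact: le_trans.
have mv j : measurable_fun setT (v j).
  have [m _ _] := Hv0 j; apply/(measurable_restrictT _ _).1 => //; exact: measurable_funTS.
have Kv j : exists K, forall r, `|v j r| <= K.
  have [_ [K HK] _] := Hv0 j; exists K => r; rewrite /v patchE; case: ifP => _ //.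
  by rewrite normr0; exact: le_trans (HK r).
have iv j : la.-integrable setT (EFin \o v j).
  have [K HK] := Kv j; have := bounded_itv_integrable s b (mv j) HK.
  move/(integrable_mkcond _ _).1 => /(_ (measurable_itv _)); congr (la.-integrable _ _).
  by apply/funext => r; rewrite /patch /=; case: ifP => // rI; rewrite /v patchE rI.
have ftc : {ae la, forall r, forall j, s < r ->
    is_derive r (1 : R) (fun q => \int[la]_(p in `[s, q]) v j p) (v j r)}.
  have aej j : {ae la, forall r, s < r ->
      is_derive r (1 : R) (fun q => \int[la]_(p in `[s, q]) v j p) (v j r)}.
    have iy y : la.-integrable [set` Interval (BLeft s) (BRight y)] (EFin \o v j).
      by apply: integrableS (iv j).
    have := FTC1 iy (open_integrable_locally openT (iv j)).
    apply: filterS; first exact: (ae_filter_ringOfSetsType la).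
    move=> r H sr; have [] := H _; first by rewrite lte_fin.
    by rewrite derive1E => d1 d2; exact: (DeriveDef d1 d2).
  have aeF := ae_filter_ringOfSetsType la.
  have := @filter_forall _ 'I_n _ _ aeF aej.
  apply: filterS => r H j; exact: H.
have [N [mN N0 subN]] := ftc.
exists v; split => //.
  move=> j; rewrite (vE j b) ?in_itv /= ?sb ?lexx //; lra.
exists (N `|` ([set s] `|` [set b])); split.
- by apply: measurableU => //; apply: measurableU.
- have sb0 : la ([set s] `|` [set b]) = 0%E.
    by rewrite measureU0 //; exact: lebesgue_measure_set1.
  by rewrite measureU0 //; exact: measurableU.
move=> r rI Nr; have /andP[sr rb] : s <= r <= b by move: rI; rewrite in_itv.
have sr' : s < r by rewrite lt_neqAle sr andbT; apply/eqP => E; apply: Nr; right; left.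
have rb' : r < b by rewrite lt_neqAle rb andbT; apply/eqP => E; apply: Nr; right; right.
have Hd j : is_derive r (1 : R) (fun q => \int[la]_(p in `[s, q]) v j p) (v j r).
  by apply: contrapT => H; apply: Nr; left; apply: subN => /(_ j sr').
have nearI : \forall q \near r, q \in `[s, b].
  near=> q; rewrite in_itv /=; apply/andP; split; apply: ltW; near: q; [exact: lt_nbhsr|exact: lt_nbhsl].
have gr : {for r, continuous g}.
  have oI : open (`]s, b[%classic : set R) by exact: interval_open.
  have gI : {within `]s, b[, continuous g}.
    apply: continuous_subspaceW Wg.1 => q /=; rewrite !in_itv /= => /andP[sq qb].
    by rewrite (le_trans s0 (ltW sq)) (le_trans (ltW qb) bt).
  move: gI; rewrite continuous_open_subspace // => /(_ r); apply.
  by rewrite inE /= in_itv /= sr' rb'.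
apply: aint_chart => //; first exact: cd.
have Hj j : is_derive r (1 : R) (fun q => chart_to c (g q) 0 j) (v j r).
  apply: (@near_eq_is_derive _ _ _ (fun q => chart_to c (g s) 0 j + \int[la]_(p in `[s, q]) v j p)) => //.
    by apply: filterS nearI => q qI; rewrite (vE j q qI).
  by rewrite -[v j r]add0r; apply: is_deriveD.
have dM : derivable (chart_to c \o g) r 1.
  by apply/derivable_mxP => i j; rewrite ord1; case: (Hj j).
split => //; rewrite derive_mx //; apply/matrixP => i j; rewrite !mxE ord1.
by have [_ <-] := Hj j.
Unshelve. all: end_near.
Qed.

(** The coordinate velocity of the path differs from the field by a function whose square integral
    is at most [B0 * al]. The inequality [z <= eta / 2 + z ^+ 2 / (2 * eta)] turns this into a bound
    on the displacement, with [eta] free. *)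
Lemma path_drift c t g al s b eta B0 K (y : R -> R) j : W1oo_path G t g ->
  (action X t g <= al%:E)%E -> 0 <= s -> s <= b -> b <= t ->
  (forall r, r \in `[s, b] -> chart_dom c (g r)) -> 0 < eta -> 0 < B0 ->
  (forall r, r \in `[s, b] -> forall w : 'rV[R]_n, w 0 j ^+ 2 <= B0 * norm_sq c (chart_to c (g r)) w) ->
  {within `[s, b], continuous y} ->
  (forall r, r \in `[s, b] -> `|X c (chart_to c (g r)) 0 j - y r| <= K) ->
  `|chart_to c (g b) 0 j - chart_to c (g s) 0 j - \int[la]_(r in `[s, b]) y r| <=
     (b - s) * (K + eta / 2) + B0 * al / (2 * eta).
Proof.
move=> Wg Ag s0 sb bt cd eta0 B00 HB yc HK.
have [v [mv Kv -> [N [mN N0 HN]]]] := W1oo_ae j Wg s0 sb bt cd.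
have mI : measurable (`[s, b]%classic : set (measurableTypeR R)) by [].
pose A r := X c (chart_to c (g r)) 0 j.
have Ac : {within `[s, b], continuous A}.
  apply/subspace_continuousP => r /= rI; have cr := cd r rI.
  have gs : {within `[s, b], continuous g}.
    apply: continuous_subspaceW Wg.1 => q /=; rewrite !in_itv /= => /andP[sq qb].
    by rewrite (le_trans s0 sq) (le_trans qb bt).
  have gr := (subspace_continuousP _ _).1 gs _ rI.
  have XC : {for g r, continuous (fun p => X c (chart_to c p) 0 j)}.
    apply: (@continuous_comp _ _ _ (chart_to c) (fun z => X c z 0 j)); first exact: chart_to_cont.
    exact (@X_cont _ _ j (chart_codP cr)).
  exact: cvg_comp gr XC.
have cI : compact (`[s, b]%classic : set R) by exact: segment_compact.
have iA : la.-integrable `[s, b] (EFin \o A) by exact: continuous_compact_integrable.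
have iy : la.-integrable `[s, b] (EFin \o y) by exact: continuous_compact_integrable.
have [Kj HKj] := Kv j.
have iv : la.-integrable `[s, b] (EFin \o v j) by exact: bounded_itv_integrable (mv j) HKj.
have mA : measurable_fun `[s, b] A by exact: subspace_continuous_measurable_fun.
have [KA [_ HKA]] := compact_bounded (continuous_compact Ac cI).
pose h r := (v j r - A r) ^+ 2.
have mh : measurable_fun `[s, b] h.
  by apply: measurable_funX; apply: measurable_funB => //; exact: measurable_funTS.
have ih : la.-integrable `[s, b] (EFin \o h).
  apply: measurable_bounded_integrable => //; first exact: compact_finite_measure.
  exists ((Kj + (KA + 1)) ^+ 2); split; first exact: num_real.
  move=> x Kx r rI; apply: ltW; apply: le_lt_trans Kx; rewrite /h normrX.
  apply: lerXn2r; rewrite ?nnegrE //; first by apply: le_trans (normr_ge0 (v j r - A r)) _;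
    apply: le_trans (ler_normB _ _) _; apply: lerD => //; apply: HKA; [rewrite ltrDl|exists r].
  by apply: le_trans (ler_normB _ _) _; apply: lerD => //; apply: HKA; [rewrite ltrDl|exists r].
have intH : \int[la]_(r in `[s, b]) h r <= B0 * al.
  rewrite -lee_fin /Rintegral fineK; last exact: integrable_fin_num.
  rewrite EFinM -lee_pdivrMl //.
  rewrite -(ge0_integralZl_EFin _ mI) //; last 3 first.
  - by move=> r _; rewrite lee_fin sqr_ge0.
  - exact/measurable_EFinP.
  - by rewrite invr_ge0 ltW.
  apply: le_trans Ag; rewrite /action.
  apply: (@le_trans _ _ (\int[la]_(r in `[s, b]) (aint X g r)%:E)%E).
    apply: (@le_lower_integral_ae _ _ _ la _ N) => //.
    - by apply/measurable_EFinP; apply: measurable_funM => //; exact: measurable_cst.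
    - by move=> r _; rewrite lee_fin mulr_ge0 ?sqr_ge0 // invr_ge0 ltW.
    - by move=> r _; rewrite lee_fin; exact: aint_ge0.
    - move=> r rI Nr; rewrite -EFinM lee_fin ler_pdivrMl // (HN r rI Nr).
      by have := HB r rI (\row_j v j r - X c (chart_to c (g r))); rewrite !mxE.
  apply: lower_subset_integral => [r _|r]; first by rewrite lee_fin; exact: (aint_ge0 X g r).
  by rewrite /= !in_itv /= => /andP[? ?]; apply/andP; split; [exact: le_trans s0 _|exact: le_trans bt].
have ivy : la.-integrable `[s, b] (EFin \o (fun r => v j r - y r)).
  by have := integrableB mI iv iy; exact.
rewrite -RintegralB //; apply: le_trans (le_normr_Rintegral mI ivy) _.
have cst_int a : \int[la]_(r in `[s, b]) a = (b - s) * a.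
  rewrite Rintegral_cst // mulrC; congr (_ * _).
  exact: itv_len.
have ic a : la.-integrable `[s, b] (EFin \o (fun=> a)).
  exact: (@bounded_itv_integrable _ (fun=> a) `|a|).
apply: (@le_trans _ _ (\int[la]_(r in `[s, b]) ((K + eta / 2) + (2 * eta)^-1 * h r))).
  apply: le_Rintegral => //; [| |].
  - by have := integrable_norm ivy; exact.
  - have := integrableD mI (ic (K + eta / 2)) (integrableZl mI (2 * eta)^-1 ih); exact.
  - move=> r rI; have := HK r rI; rewrite /h -/(A r).
    have := ler_normD (v j r - A r) (A r - y r); rewrite addrA subrK.
    have : `|v j r - A r| <= eta / 2 + (2 * eta)^-1 * (v j r - A r) ^+ 2.
      rewrite -(real_normK (num_real (v j r - A r))).
      move: `|v j r - A r| => z; rewrite -subr_ge0.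
      have -> : eta / 2 + (2 * eta)^-1 * z ^+ 2 - z = (2 * eta)^-1 * (eta - z) ^+ 2.
        by field; rewrite gt_eqF.
      by rewrite mulr_ge0 ?sqr_ge0 // invr_ge0 mulr_ge0 // ltW.
    lra.
rewrite RintegralD //; last by have := integrableZl mI (2 * eta)^-1 ih; exact.
rewrite cst_int RintegralZl // lerD2l mulrC ler_pM2r //.
by rewrite invr_gt0 mulr_gt0.
Qed.
End Drift.

(** Continuous induction on a segment. The hypothesis at [r] transports [P] across [r] from a nearby
    earlier point, so applied at the supremum of the good times it shows that this supremum is
    attained and equal to [T]. *)
Lemma real_induction (R : realType) (P : R -> Prop) (T : R) : 0 <= T -> P 0 ->
  (forall r, 0 <= r -> r <= T -> exists2 h, 0 < h & forall s1 s2, 0 <= s1 -> s1 <= s2 -> s2 <= T ->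
     r - h <= s1 -> s2 <= r + h -> P s1 -> P s2) -> forall r, 0 <= r -> r <= T -> P r.
Proof.
move=> T0 P0 step; pose E := [set s | [/\ 0 <= s, s <= T & forall s', 0 <= s' -> s' <= s -> P s']].
have E0 : E 0 by split => // s' s0 s0'; have -> : s' = 0 by apply/le_anti/andP.
have hE : has_sup E by split; [exists 0|exists T => s []].
have s0 : 0 <= sup E by apply: ub_le_sup E0; case: hE.
have sT : sup E <= T by apply: ge_sup; [exists 0|move=> s []].
have [h h0 H] := step _ s0 sT.
have [s1 [s10 s1T Ps1] ls1] := sup_adherent h0 hE.
have s1s : s1 <= sup E by apply: ub_le_sup; [case: hE|split].
pose m := Num.min T (sup E + h).
have Em : E m.
  split; rewrite /m; first by rewrite le_min T0 addr_ge0 // ltW.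
    by rewrite ge_min lexx.
  move=> s' s'0; rewrite le_min => /andP[s'T s'h].
  have [|/ltW] := leP s' s1; first exact: Ps1.
  by move=> s1s'; apply: (H s1) => //; [exact: ltW|exact: Ps1].
have ms : m <= sup E by apply: ub_le_sup Em; case: hE.
have Tm : m = T.
  by move: ms; rewrite /m; case: (leP T (sup E + h)) => // _; rewrite gerDl leNgt h0.
by move=> r r0 rT; case: Em => _ _; apply => //; rewrite Tm.
Qed.

Lemma continuous_within_comp (S U V : topologicalType) (k : S -> U) (g : U -> V) (A : set U) (u : S) :
  (forall v, A (k v)) -> {for u, continuous k} ->
  g @ within A (nbhs (k u)) --> g (k u) -> {for u, continuous (g \o k)}.
Proof.
move=> kA kc gc W HW; have HW' := kc _ (gc _ HW).
change (nbhs u (fun v => A (k v) -> W (g (k v)))) in HW'.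
change (nbhs u (fun v => W (g (k v)))).
by apply: filterS HW' => v Hv; exact: (Hv (kA v)).
Qed.

Lemma near_comp (T U : topologicalType) (f : T -> U) (x : T) (P : set U) (Q : set T) :
  {for x, continuous f} -> nbhs (f x) P -> (forall y, P (f y) -> Q y) -> nbhs x Q.
Proof. by move=> fc HP PQ; exact: filterS PQ (fc _ HP). Qed.

Lemma near_le (R : realType) (T : topologicalType) (f : T -> R) (x : T) (a : R) :
  {for x, continuous f} -> f x < a -> \forall y \near x, f y <= a.
Proof.
move=> fc lt; have H := fc _ (lt_nbhsl lt); change (nbhs x (fun y => f y < a)) in H.
by apply: filterS H => y /ltW.
Qed.

(** * Paths of small action near an integral curve *)

Section Tube.
Context {R : realType} {n : nat} {M : ptopologicalType} (G : riemannian R n M).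
Hypothesis M_hausdorff : hausdorff_space M.
Variable X : vfield G.
Hypotheses (X_compat : vf_compat X) (X_C1 : vf_C1 X).
Let X_cont := vf_C1_cont X_C1.
Notation la := (@lebesgue_measure R).
Implicit Types (c : chart G) (g : R -> M).

(** A path is only continuous within its time interval. Clamping the time to [[0, t]], a minimum
    being written as the opposite of a maximum, makes it continuous on the line. *)
Lemma path_clamp t g : 0 <= t -> {within `[0, t], continuous g} ->
  continuous (fun u => g (Num.max 0 (- Num.max (- t) (- u)))).
Proof.
move=> t0 /subspace_continuousP gc u.
set k := fun u : R => Num.max 0 (- Num.max (- t) (- u)).
have kI v : `[0, t]%classic (k v).
  rewrite /= in_itv /= /k le_max lexx /= ge_max t0 /= lerNl.
  by rewrite le_max lexx.
have kc : {for u, continuous k}.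
  by apply: cont_max; [exact: cont_cst|apply: contN; apply: cont_max; [exact: cont_cst|apply: contN; exact: cvg_id]].
exact: (continuous_within_comp kI kc (gc _ (kI u))).
Qed.

Lemma clampE (t u : R) : 0 <= u -> u <= t -> Num.max 0 (- Num.max (- t) (- u)) = u.
Proof. by move=> u0 ut; rewrite (max_r (x := - t)) ?lerN2 // opprK max_r. Qed.

(** The mean value bound needs the points [z + t *: (y - z)] for [t] between -1 and 1, hence the
    cube of triple radius. *)
Lemma C1_lipschitz c x r : 0 < r -> cube x (3 * r) `<=` chart_cod c ->
  exists2 L, 0 < L & forall j y z, cube x r y -> cube x r z ->
    `|X c y 0 j - X c z 0 j| <= L * `|y - z|.
Proof.
move=> r0 sub.
have H j : exists L, 0 < L /\ forall y z, cube x r y -> cube x r z ->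
    `|X c y 0 j - X c z 0 j| <= L * `|y - z|.
  pose h y := X c y 0 j.
  have /choice[B HB] k : exists B, 0 < B /\ forall y, cube x (3 * r) y -> `|partial k h y| <= B.
    have [|B B0 HB] := @cube_bound _ _ (partial k h) x (3 * r); last by exists B.
    by move=> y /sub cy; have [_ H] := X_C1 j cy; exact: H.
  exists (\sum_k B k + 1); split.
    by rewrite ltr_wpDl // sumr_ge0 // => k _; have [/ltW] := HB k.
  move=> y z ry rz.
  have H t : `|t| <= `|1 : R| -> derivable h (z + t *: (y - z)) (y - z) /\
      `|'D_(y - z) h (z + t *: (y - z)) - 0| <= \sum_k B k * `|y - z|.
    rewrite normr1 => t1.
    have zt : cube x (3 * r) (z + t *: (y - z)).
      move=> k; rewrite !mxE; have := ry k; have := rz k.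
      move: (z 0 k) (y 0 k) (x 0 k) => a b e ha hb.
      have -> : a + t * (b - a) - e = (a - e) + t * ((b - e) - (a - e)) by ring.
      apply: le_trans (ler_normD _ _) _; rewrite normrM.
      have : `|b - e - (a - e)| <= 2 * r by apply: le_trans (ler_normB _ _) _; lra.
      have : 0 <= `|b - e - (a - e)| by [].
      move: `|b - e - (a - e)| (normr_ge0 t) => w t0 w0 wr.
      have : `|t| * w <= 1 * (2 * r) by apply: ler_pM.
      lra.
    have [dh _] := X_C1 j (sub _ zt); split; first exact: diff_derivable.
    rewrite subr0 deriveE // diff_drow // mxE.
    apply: le_trans (ler_norm_sum _ _ _) _; apply: ler_sum => k _.
    rewrite normrM mulrC; apply: ler_pM => //; last exact: coord_norm_le.
    by rewrite !mxE; have [_] := HB k; apply.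
  have := line_mean_value H; rewrite scale1r (addrC z) subrK mulr0 subr0 normr1 mulr1.
  move=> {}H; apply: le_trans H _; rewrite -mulr_suml; apply: ler_wpM2r => //.
  by rewrite lerDl.
have [L HL] := choice H.
exists (\sum_j L j + 1); first by rewrite ltr_wpDl // sumr_ge0 // => k _; have [/ltW] := HL k.
move=> j y z ry rz; have [Lj0 {}H] := HL j; apply: le_trans (H _ _ ry rz) _.
apply: ler_wpM2r => //; rewrite (bigD1 j) //= -addrA lerDl addr_ge0 // sumr_ge0 // => k _.
by have [/ltW] := HL k.
Qed.

Lemma metric_coord_bound c x r : cube x r `<=` chart_cod c ->
  exists2 B, 0 < B & forall j y (w : 'rV[R]_n), cube x r y -> w 0 j ^+ 2 <= B * norm_sq c y w.
Proof.
move=> sub.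
have H j : exists L, 0 < L /\ forall y, cube x r y -> invmx (metric c y) j j <= L.
  have [|B B0 HB] := @cube_bound _ _ (fun y => invmx (metric c y) j j) x r.
    by move=> y /sub cy; exact: (@C1_on_cont _ _ _ _ _ (@invmx_C1 _ _ _ G c j j) cy).
  by exists B; split=> // y ry; exact: le_trans (ler_norm _) (HB _ ry).
have [L HL] := choice H.
exists (\sum_j L j + 1); first by rewrite ltr_wpDl // sumr_ge0 // => k _; have [/ltW] := HL k.
move=> j y w ry; have cy := sub _ ry.
apply: le_trans (coord_sq_le w j (Defs.metric_sym cy) (metric_posdef cy)) _.
apply: ler_wpM2r; first by apply: ip_ge0; exact: metric_posdef.
have [_ {}H] := HL j; apply: le_trans (H _ ry) _.
rewrite (bigD1 j) //= -addrA lerDl addr_ge0 // sumr_ge0 // => k _.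
by have [/ltW] := HL k.
Qed.

Section Curve.
Variable psi : R -> M.
Hypotheses (psi_cont : continuous psi) (psi_der : forall c s, chart_dom c (psi s) ->
  is_derive s (1 : R) (fun r => chart_to c (psi r)) (X c (chart_to c (psi s)))).

Lemma curve_FTC c (a s b : R) j : s <= b -> (forall r, r \in `[s, b] -> chart_dom c (psi (r - a))) ->
  {within `[s, b], continuous (fun r => X c (chart_to c (psi (r - a))) 0 j)} /\
  \int[la]_(r in `[s, b]) X c (chart_to c (psi (r - a))) 0 j =
    chart_to c (psi (b - a)) 0 j - chart_to c (psi (s - a)) 0 j.
Proof.
move=> sb cd; pose F r := chart_to c (psi (r - a)) 0 j.
pose dF r := X c (chart_to c (psi (r - a))) 0 j.
have sc r : {for r, continuous (fun r : R => r - a)} by apply: cvgB; [exact: cvg_id|exact: cvg_cst].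
have pc r : {for r, continuous (fun r => psi (r - a))}.
  by apply: (continuous_comp (sc r)); exact: psi_cont.
have zc r : r \in `[s, b] -> {for r, continuous (fun r => chart_to c (psi (r - a)))}.
  by move=> rI; apply: (continuous_comp (pc r)); exact: chart_to_cont (cd r rI).
have dFc r : r \in `[s, b] -> {for r, continuous dF}.
  move=> rI; apply: (@continuous_comp _ _ _ (fun r => chart_to c (psi (r - a))) (fun z => X c z 0 j)).
    exact: zc.
  exact (@X_cont _ _ j (chart_codP (cd r rI))).
have dFC : {within `[s, b], continuous dF} by apply: continuous_in_subspaceT => r /set_mem; exact: dFc.
split=> //; move: sb; rewrite le_eqVlt => /orP[/eqP->|sb].
  by rewrite set_itv1 Rintegral_set1 subrr.
have FD r : r \in `[s, b] -> is_derive r (1 : R) F (dF r).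
  move=> rI; have [d1 d2] := psi_der (cd r rI).
  have E : (fun h : R => h^-1 *: ((F \o shift r) (h *: 1) - F r)) =
           (fun h : R => h^-1 *: (((fun q => chart_to c (psi q) 0 j) \o shift (r - a)) (h *: 1) - chart_to c (psi (r - a)) 0 j)).
    by apply/funext => h; rewrite /F /= addrA.
  have d3 : derivable (fun q => chart_to c (psi q) 0 j) (r - a) 1 by move/derivable_mxP: d1; exact.
  split; rewrite /derivable /derive E; first exact: d3.
  by rewrite /dF -d2 derive_mx // mxE.
have Fc r : r \in `[s, b] -> {for r, continuous F}.
  by move=> /FD[+ _] => /derivable1_diffP/differentiable_continuous.
rewrite /Rintegral (@continuous_FTC2 _ dF F) //=.
- split.
  + by move=> r rI; have [] := FD r (subset_itv_oo_cc rI).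
  + by apply: cvg_at_right_filter; apply: Fc; rewrite in_itv /= lexx ltW.
  + by apply: cvg_at_left_filter; apply: Fc; rewrite in_itv /= lexx ltW.
- by move=> r rI; have [_ <-] := FD r (subset_itv_oo_cc rI); rewrite derive1E.
Qed.

Variables (c : chart G) (xp : 'rV[R]_n) (rho0 L B0 rho s1 t al : R) (g : R -> M).
Hypotheses (rho0_gt0 : 0 < rho0) (sub : cube xp (rho0 + rho0) `<=` chart_cod c).
Hypotheses (L_gt0 : 0 < L) (lipX : forall j y z, cube xp (rho0 + rho0) y -> cube xp (rho0 + rho0) z ->
    `|X c y 0 j - X c z 0 j| <= L * `|y - z|).
Hypotheses (B0_gt0 : 0 < B0) (coordB : forall j y (w : 'rV[R]_n), cube xp (rho0 + rho0) y ->
  w 0 j ^+ 2 <= B0 * norm_sq c y w).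
Hypotheses (rho_gt0 : 0 < rho) (rho_le : rho <= rho0) (s1_ge0 : 0 <= s1).
Hypotheses (Wg : W1oo_path G t g) (Ag : (action X t g <= al%:E)%E) (alB : B0 * al <= rho ^+ 2 / 16).
(** Both curves are read backwards, from time [t] for [g] and from time 0 for [psi]. *)
Let near_psi q r := [/\ chart_dom c (g (t - r)), chart_dom c (psi (- r)),
  cube xp rho0 (chart_to c (psi (- r))) & `|chart_to c (g (t - r)) - chart_to c (psi (- r))| <= q].
Let e r := chart_to c (g (t - r)) - chart_to c (psi (- r)).

(** A bootstrap: closeness [rho] implies closeness [3 / 4 * rho]. The budget is [rho / 4] at the
    start, [rho / 4] for the Lipschitz variation of the field, and [rho / 8] for each of the two
    terms that [path_drift] produces with [eta := rho / 4]. *)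
Lemma tube_improve r : s1 <= r -> r <= t -> r - s1 <= 1 -> (r - s1) * L <= 1 / 4 ->
  `|e s1| <= rho / 4 -> (forall u, s1 <= u -> u <= r -> near_psi rho u) ->
  near_psi (3 / 4 * rho) r.
Proof.
move=> s1r rt rs1 rsL es1 H.
have [cg cp cc _] := H r s1r (lexx _).
have [cg1 cp1 _ _] := H s1 (lexx _) s1r.
split=> //; apply: rV_norm_le => [|j]; first by rewrite mulr_ge0 // ltW.
have tu u : u \in `[t - r, t - s1] -> s1 <= t - u <= r by rewrite in_itv /= => /andP[? ?]; apply/andP; split; lra.
have incube u : u \in `[t - r, t - s1] -> [/\ chart_dom c (g u), chart_dom c (psi (u - t)),
    cube xp (rho0 + rho0) (chart_to c (g u)), cube xp (rho0 + rho0) (chart_to c (psi (u - t))) &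
    `|chart_to c (g u) - chart_to c (psi (u - t))| <= rho].
  move=> /tu /andP[u1 u2]; have := H _ u1 u2; rewrite /near_psi subKr opprB => -[? ? pc nr].
  split=> //; last by apply: cube_le pc; rewrite lerDl ltW.
  move=> k; apply: le_trans (_ : _ <= rho + rho0) _; last by rewrite lerD2r.
  have := pc k; have := le_trans (coord_norm_le _ k) nr; rewrite !mxE.
  move: (chart_to c (g u) 0 k) (chart_to c (psi (u - t)) 0 k) (xp 0 k) => a b d h1 h2.
  have -> : a - d = (a - b) + (b - d) by ring.
  by apply: le_trans (ler_normD _ _) (lerD _ _).
have [Fc FE] := @curve_FTC c t (t - r) (t - s1) j (lerB (lexx t) s1r) (fun u uI => let: And5 _ H _ _ _ := incube u uI in H).
have tr0 : 0 <= t - r by rewrite subr_ge0.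
have ts : t - s1 <= t by rewrite gerBl.
have := @path_drift _ _ _ _ _ X_compat X_cont c t g al (t - r) (t - s1) (rho / 4) B0 (L * rho) _ j
  Wg Ag tr0 (lerB (lexx t) s1r) ts _ _ B0_gt0 _ Fc.
rewrite FE => /(_ _ _ _ _)D.
have r4 : 0 < rho / 4 by rewrite divr_gt0.
have {}D := D (fun u uI => let: And5 H _ _ _ _ := incube u uI in H) r4
  (fun u uI w => coordB j w (let: And5 _ _ H _ _ := incube u uI in H)).
have {}D := D (fun u uI => let: And5 _ _ h1 h2 h3 := incube u uI in
  le_trans (lipX j h1 h2) (ler_wpM2l (ltW L_gt0) h3)).
have := le_trans (coord_norm_le (e s1) j) es1.
rewrite /e !mxE in D *.
have E1 : t - s1 - t = - s1 by ring. have E2 : t - r - t = - r by ring.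
have E3 : t - s1 - (t - r) = r - s1 by ring.
rewrite E1 E2 E3 in D; move: D.
set a := chart_to c (g (t - s1)) 0 j; set b := chart_to c (g (t - r)) 0 j.
set a' := chart_to c (psi (- s1)) 0 j; set b' := chart_to c (psi (- r)) 0 j.
move=> D h1.
have -> : b - b' = (a - a') - (a - b - (a' - b')) by ring.
apply: le_trans (ler_normB _ _) _.
have D1 : (r - s1) * (L * rho + rho / 4 / 2) <= rho / 4 + rho / 8.
  have -> : (r - s1) * (L * rho + rho / 4 / 2) = ((r - s1) * L) * rho + (r - s1) * (rho / 8) by field.
  apply: lerD; first by apply: le_trans (ler_wpM2r (ltW rho_gt0) rsL) _; lra.
  by rewrite -[leRHS]mul1r ler_wpM2r // divr_ge0 // ltW.
have D2 : B0 * al / (2 * (rho / 4)) <= rho / 8.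
  rewrite ler_pdivrMr; last by rewrite mulr_gt0 // divr_gt0.
  by apply: le_trans alB _; rewrite expr2; lra.
move: (le_trans D (lerD D1 D2)) h1.
lra.
Qed.

Lemma near_psi_cube q r : q <= rho0 -> near_psi q r -> cube xp (rho0 + rho0) (chart_to c (g (t - r))).
Proof.
move=> q0 [_ _ pc nr] k; have := pc k; have := le_trans (coord_norm_le _ k) nr; rewrite !mxE.
move: (chart_to c (g (t - r)) 0 k) (chart_to c (psi (- r)) 0 k) (xp 0 k) => a b d h1 h2.
have -> : a - d = (a - b) + (b - d) by ring.
by apply: le_trans (ler_normD _ _) (lerD (le_trans h1 q0) h2).
Qed.

Lemma near_psi_le q q' r : q <= q' -> near_psi q r -> near_psi q' r.
Proof. by move=> qq [? ? ? ?]; split=> //; exact: le_trans qq. Qed.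

Lemma tube r1 : s1 <= r1 -> r1 <= t -> r1 - s1 <= 1 -> (r1 - s1) * L <= 1 / 4 ->
  (forall r, s1 <= r -> r <= r1 -> chart_dom c (psi (- r)) /\ cube xp rho0 (chart_to c (psi (- r)))) ->
  near_psi (rho / 4) s1 -> forall r, s1 <= r -> r <= r1 -> near_psi (3 / 4 * rho) r.
Proof.
move=> s1r1 r1t rs1 rsL Hpsi N1.
pose P w := forall u, s1 <= u -> u <= s1 + w -> near_psi (3 / 4 * rho) u.
suff HP : forall w, 0 <= w -> w <= r1 - s1 -> P w.
  by move=> r r1' r2; apply: (HP (r - s1)); rewrite ?subr_ge0 ?lerD2r // addrC subrK.
have t0 : 0 <= t by exact: le_trans s1_ge0 (le_trans s1r1 r1t).
have q34 : 3 / 4 * rho <= rho by move: rho_gt0 => ?; lra.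
have q14 : rho / 4 <= 3 / 4 * rho by move: rho_gt0 => ?; lra.
apply: real_induction; first by rewrite subr_ge0.
  move=> u u1; rewrite addr0 => u2; have -> : u = s1 by apply/le_anti/andP.
  exact: near_psi_le q14 N1.
move=> w0 w00 w01; set u0 := s1 + w0.
have u0I : s1 <= u0 /\ u0 <= r1 by rewrite /u0; split; move: w00 w01; lra.
pose gh u := g (Num.max 0 (- Num.max (- t) (- (t - u)))).
have ghE u : s1 <= u -> u <= r1 -> gh u = g (t - u).
  move=> u1 u2; rewrite /gh clampE // ?subr_ge0 ?gerBl; first exact: le_trans r1t.
  exact: le_trans u1.
have ghc : continuous gh.
  move=> u; apply: (@continuous_comp _ _ _ (fun u => t - u) (fun u => g (Num.max 0 (- Num.max (- t) (- u))))).
    by apply: cvgB; [exact: cvg_cst|exact: cvg_id].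
  exact: (path_clamp t0 Wg.1).
have psc : continuous (fun u => psi (- u)).
  by move=> u; apply: (@continuous_comp _ _ _ (fun u : R => - u) psi); [apply: cvgN; exact: cvg_id|exact: psi_cont].
have [[u01 u02] [pd0 pc0]] := (u0I, Hpsi _ u0I.1 u0I.2).
have eC : chart_dom c (gh u0) -> {for u0, continuous (fun u => `|chart_to c (gh u) - chart_to c (psi (- u))|)}.
  move=> gd; apply: (@continuous_comp _ _ _ (fun u => chart_to c (gh u) - chart_to c (psi (- u))) (fun z => `|z|)); last exact: norm_continuous.
  apply: cvgB.
    by apply: (@continuous_comp _ _ _ gh (chart_to c)); [exact: ghc|exact: chart_to_cont].
  by apply: (@continuous_comp _ _ _ (fun u => psi (- u)) (chart_to c)); [exact: psc|exact: chart_to_cont].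
(* If the bound holds at [u0], the weaker one with [rho] holds nearby by continuity and
   [tube_improve] restores it. If it fails at [u0], it fails at all nearby times of the interval,
   and the induction hypothesis there is contradictory. *)
have [T0|nT0] := pselect (near_psi (3 / 4 * rho) u0).
  have [gd _ _ nr] := T0; rewrite -ghE // in gd; rewrite -ghE // in nr.
  have : \forall u \near u0, chart_dom c (gh u) /\ `|chart_to c (gh u) - chart_to c (psi (- u))| <= rho.
    apply: filterI; first exact: (ghc _ _ (chart_dom_near gd)).
    have lt : `|chart_to c (gh u0) - chart_to c (psi (- u0))| < rho.
      by apply: le_lt_trans nr _; move: rho_gt0 => ?; lra.
    exact: (near_le (eC gd) lt).
  move=> /nbhs_ballP[h /= h0 Hh]; exists (h / 2); first by rewrite divr_gt0.
  move=> v1 v2 v10 v12 v2T lo hi Pv1 u.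
  have Hrho u' : s1 <= u' -> u' <= s1 + v2 -> near_psi rho u'.
    move=> u'1 u'2; have [u'v|/ltW vu'] := leP u' (s1 + v1).
      exact: near_psi_le q34 (Pv1 _ u'1 u'v).
    have u'r1 : u' <= r1 by move: u'2 v2T; lra.
    have [pd pc] := Hpsi _ u'1 u'r1.
    have [|gd' nr'] := Hh u'; last by rewrite /near_psi -ghE.
    rewrite /ball /= /u0 ltr_distlC; apply/andP; split; move: h0 lo hi vu' u'2; lra.
  move=> u1 u2; have ur1 : u <= r1 by move: u2 v2T; lra.
  apply: tube_improve => //.
  - exact: le_trans ur1 r1t.
  - by apply: le_trans rs1; rewrite lerD2r.
  - by apply: le_trans rsL; apply: ler_wpM2r; [exact: ltW|rewrite lerD2r].
  - by case: N1.
  - by move=> u' u'1 u'2; apply: Hrho => //; exact: le_trans u2.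
have : \forall u \near u0, s1 <= u -> u <= r1 -> ~ near_psi (3 / 4 * rho) u.
  have [gp|ngp] := pselect (patch_cube c xp (rho0 + rho0) (gh u0)).
    have gd : chart_dom c (gh u0) by exact: patch_cube_dom gp.
    have lt : 3 / 4 * rho < `|chart_to c (gh u0) - chart_to c (psi (- u0))|.
      by rewrite ltNge; apply/negP => le; apply: nT0; rewrite /near_psi -ghE.
    apply: (near_comp (eC gd) (lt_nbhsr lt)) => u lt' u1 u2 [_ _ _].
    by rewrite -ghE // leNgt lt'.
  have oC : open (~` patch_cube c xp (rho0 + rho0)) by rewrite openC; exact: patch_cube_closed.
  apply: (near_comp (ghc u0) (open_nbhs_nbhs (conj oC ngp))) => u np u1 u2 N; apply: np; rewrite ghE //.
  have [gd _ _ _] := N; exists (chart_to c (g (t - u))); last by rewrite chart_toK.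
  by apply: near_psi_cube N; exact: le_trans rho_le.
move=> /nbhs_ballP[h /= h0 Hh]; exists (h / 2); first by rewrite divr_gt0.
move=> v1 v2 v10 v12 v2T lo hi Pv1; exfalso.
apply: (Hh (s1 + v1)).
- rewrite /ball /= /u0 ltr_distlC; apply/andP; split; move: h0 lo hi v12; lra.
- by rewrite lerDl.
- by move: v12 v2T; lra.
- by apply: Pv1; rewrite ?lerDl.
Qed.
End Curve.
Section PosDist.
Variables (psi : R -> M) (F : set M) (T : R).
Hypotheses (psi_cont : continuous psi) (psi_der : forall c s, chart_dom c (psi s) ->
  is_derive s (1 : R) (fun r => chart_to c (psi r)) (X c (chart_to c (psi s)))).
Hypotheses (Fcl : closed F) (T_ge0 : 0 <= T) (psiF : forall r, 0 <= r -> r <= T -> ~ F (psi (- r))).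
Let path_to t al g := [/\ W1oo_path G t g, g t = psi 0 & (action X t g <= al%:E)%E].

(** The two induction statements, uniform in the length [t] of the path. Closeness at backward time
    [r] says nothing of earlier backward times, so avoidance [Q] is carried along with closeness
    [S]. *)
Let S r := forall V, nbhs (psi (- r)) V -> exists2 al, 0 < al &
  forall t g, r <= t -> path_to t al g -> V (g (t - r)).
Let Q r := exists2 al, 0 < al & forall r' t g, 0 <= r' -> r' <= r -> r' <= t -> path_to t al g -> ~ F (g (t - r')).

Let path_to_le t al al' g : al <= al' -> path_to t al g -> path_to t al' g.
Proof. by move=> le [W g0 A]; split=> //; apply: le_trans A _; rewrite lee_fin. Qed.

Lemma avoid_near_flow : exists2 al, 0 < al & forall t g, 0 <= t -> t <= T -> path_to t al g -> ~ F (g 0).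
Proof.
suff [_ [al al0 H]] : S T /\ Q T.
  by exists al => // t g t0 tT pt; have := H t t g t0 tT (lexx _) pt; rewrite subrr.
suff H : forall r, 0 <= r -> r <= T -> S r /\ Q r by exact: H.
apply: real_induction => //.
  split; first by move=> V HV; exists 1 => // t g _ [_ gt _]; rewrite subr0 gt; apply: nbhs_singleton; rewrite oppr0 in HV.
  exists 1 => // r' t g r'0 r'0' _ [_ gt _].
  have -> : r' = 0 by apply/le_anti/andP.
  by rewrite subr0 gt; have := psiF (lexx _) T_ge0; rewrite oppr0.
move=> r0 r00 r0T; set p := psi (- r0).
have cp := chart_atP G p; set c := chart_at G p in cp; set xp := chart_to c p.
have cxp : chart_cod c xp by exact: chart_codP.
have HN : nbhs xp (chart_from c @^-1` (~` F)).
  apply: (chart_from_cont cxp); rewrite /xp chart_toK //.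
  by apply: open_nbhs_nbhs; split; [rewrite openC|exact: psiF].
have [rho1 rho10 sub1] := chart_cube cxp HN.
pose rho0 := rho1 / 3.
have rho00 : 0 < rho0 by rewrite divr_gt0.
have r30 : 3 * (rho0 + rho0) = rho1 + rho1 by rewrite /rho0; field.
have sub3 : cube xp (3 * (rho0 + rho0)) `<=` chart_cod c by rewrite r30 => y /sub1[].
have sub2 : cube xp (rho0 + rho0) `<=` chart_cod c `&` chart_from c @^-1` (~` F).
  move=> y ry; apply: sub1; apply: cube_le ry; rewrite /rho0; lra.
have sub : cube xp (rho0 + rho0) `<=` chart_cod c by move=> y /sub2[].
have [L L0 lipX] := C1_lipschitz (addr_gt0 rho00 rho00) sub3.
have [B0 B00 coordB] := metric_coord_bound sub.
have psc : continuous (fun u => psi (- u)).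
  by move=> u; apply: (@continuous_comp _ _ _ (fun u : R => - u) psi); [apply: cvgN; exact: cvg_id|exact: psi_cont].
have : \forall r \near r0, chart_dom c (psi (- r)) /\ cube xp rho0 (chart_to c (psi (- r))).
  apply: filterI; first exact: (psc _ _ (chart_dom_near cp)).
  exact: (psc _ _ (chart_to_cont cp (cube_nbhs xp rho00))).
move=> /nbhs_ballP[h1 /= h10 Hh1].
(* Times within [h] of [r0] span an interval of length at most [2 * h], hence at most 1 and at most
   [1 / (4 * L)], as [tube] requires. *)
pose h := Num.min (h1 / 2) (Num.min (1 / 2) (8 * L)^-1).
have h_gt0 : 0 < h by rewrite !lt_min !divr_gt0 //= invr_gt0 mulr_gt0.
have hh1 : h <= h1 / 2 by rewrite ge_min lexx.
have hh2 : h <= 1 / 2 by rewrite !ge_min lexx orbT.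
have hhL : h * L <= 1 / 8.
  have : h <= (8 * L)^-1 by rewrite !ge_min lexx !orbT.
  by rewrite invfM -ler_pdivlMr //; move=> H; apply: le_trans H _; rewrite div1r.
exists h => // s1 s2 s10 s12 s2T lo hi [S1 Q1].
have Hpsi r : s1 <= r -> r <= s2 -> chart_dom c (psi (- r)) /\ cube xp rho0 (chart_to c (psi (- r))).
  by move=> r1 r2; apply: Hh1; rewrite /ball /= ltr_distlC; apply/andP; split; move: lo hi r1 r2 hh1 h10; lra.
have [cs1 xs1] := Hpsi s1 (lexx _) s12.
have tubeS rho : 0 < rho -> rho <= rho0 -> exists2 al, 0 < al & forall t g r, s1 <= r -> r <= s2 -> r <= t ->
    path_to t al g -> chart_dom c (g (t - r)) /\ `|chart_to c (g (t - r)) - chart_to c (psi (- r))| <= rho.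
  move=> rho_gt0 rho_le.
  have V1 : nbhs (psi (- s1)) (fun q => chart_dom c q /\ `|chart_to c q - chart_to c (psi (- s1))| <= rho / 4).
    apply: filterI; first exact: chart_dom_near.
    have rho4 : 0 < rho / 4 by rewrite divr_gt0.
    apply: (near_comp (chart_to_cont cs1) (cube_nbhs (chart_to c (psi (- s1))) rho4)) => q /cubeE.
    by apply; exact: ltW.
  have [a1 a10 H1] := S1 _ V1.
  exists (Num.min a1 (rho ^+ 2 / 16 / B0)); first by rewrite lt_min a10 !divr_gt0 // exprn_gt0.
  set al := Num.min _ _; move=> t g r s1r rs2 rt pt.
  have alB : B0 * al <= rho ^+ 2 / 16 by rewrite mulrC -ler_pdivlMr // ge_min lexx orbT.
  have al1 : al <= a1 by rewrite ge_min lexx.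
  have [gd1 e1] := H1 t g (le_trans s1r rt) (path_to_le al1 pt).
  have [Wg gt Ag] := pt.
  have rs1 : r - s1 <= 2 * h by move: lo hi rs2; lra.
  have [||||gd _ _ nr] := tube psi_cont psi_der rho00 sub L0 lipX B00 coordB rho_gt0 rho_le s10 Wg Ag alB s1r rt _ _ _ _ s1r (lexx r).
  - by move: rs1 hh2; lra.
  - apply: le_trans (_ : 2 * h * L <= _); first by rewrite ler_wpM2r // ltW.
    by rewrite -mulrA; move: hhL; lra.
  - by move=> u u1 u2; apply: Hpsi => //; exact: le_trans rs2.
  - by split=> //.
  split=> //; apply: le_trans nr _; move: rho_gt0; lra.
split.
  move=> V HV; have [cs2 xs2] := Hpsi s2 s12 (lexx _).
  have cz2 := chart_codP cs2.
  have : nbhs (chart_to c (psi (- s2))) (chart_from c @^-1` V).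
    by apply: (chart_from_cont cz2); rewrite chart_toK.
  move=> /nbhs_cube[rho' rho'0 HV'].
  have [||al al0 H] := tubeS (Num.min rho' rho0); [by rewrite lt_min rho'0|by rewrite ge_min lexx orbT|].
  exists al => // t g s2t pt; have [gd nr] := H t g s2 s12 (lexx _) s2t pt.
  rewrite -(chart_toK gd); apply: HV'; apply/cubeE; first exact: ltW.
  by apply: le_trans nr _; rewrite ge_min lexx.
have [a1 a10 H1] := Q1; have [a2 a20 H2] := tubeS rho0 rho00 (lexx _).
exists (Num.min a1 a2); first by rewrite lt_min a10.
move=> r' t g r'0 r's2 r't pt.
have [r's1|/ltW s1r'] := leP r' s1.
  by apply: H1 => //; apply: path_to_le pt; rewrite ge_min lexx.
have [|gd nr] := H2 t g r' s1r' r's2 r't; first by apply: path_to_le pt; rewrite ge_min lexx orbT.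
have [_ xs] := Hpsi r' s1r' r's2.
rewrite -(chart_toK gd); have [] // := sub2 (chart_to c (g (t - r'))).
move=> k; have := xs k; have := le_trans (coord_norm_le _ k) nr; rewrite !mxE.
move: (chart_to c (g (t - r')) 0 k) (chart_to c (psi (- r')) 0 k) (xp 0 k) => a b d b1 b2.
have -> : a - d = (a - b) + (b - d) by ring.
exact: le_trans (ler_normD _ _) (lerD b1 b2).
Qed.
End PosDist.
End Tube.

(** * The truncated action distance *)

Lemma ip_norm_le (R : realType) n (A : 'M[R]_n) (u v : 'rV[R]_n) B : (forall i j, `|A i j| <= B) ->
  `|ip A u v| <= (n * n)%:R * B * (`|u| * `|v|).
Proof.
move=> HB; rewrite /ip mxE.
have -> : (n * n)%:R * B * (`|u| * `|v|) = \sum_(j < n) \sum_(i < n) (B * (`|u| * `|v|)).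
  by rewrite !sumr_const !card_ord -mulrnA -[RHS]mulr_natl mulrA.
apply: le_trans (ler_norm_sum _ _ _) _; apply: ler_sum => j _.
rewrite !mxE mulr_suml; apply: le_trans (ler_norm_sum _ _ _) _; apply: ler_sum => i _.
rewrite !normrM; have hu := coord_norm_le u i; have hv := coord_norm_le v j; have hA := HB i j.
have -> : `|u 0 i| * `|A i j| * `|v 0 j| = `|A i j| * (`|u 0 i| * `|v 0 j|) by ring.
by apply: ler_pM => //; exact: ler_pM.
Qed.

Section Distance.
Context {R : realType} {n : nat} {M : ptopologicalType} (G : riemannian R n M).
Hypotheses (M_hausdorff : hausdorff_space M) (M_compact : compact [set: M]).
Variable X : vfield G.
Hypotheses (X_compat : vf_compat X) (X_C1 : vf_C1 X).
Let X_cont := vf_C1_cont X_C1.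
Implicit Types (c : chart G).

Lemma fin_bound (F : 'I_n -> R -> Prop) : (forall j B B', B <= B' -> F j B -> F j B') ->
  (forall j, exists B, F j B) -> exists2 B, 0 < B & forall j, F j B.
Proof.
move=> mono /choice[B HB]; exists (\sum_j `|B j| + 1); first by rewrite ltr_wpDl // sumr_ge0.
move=> j; apply: mono (HB j); apply: le_trans (ler_norm _) _.
by rewrite (bigD1 j) //= -addrA lerDl addr_ge0 // sumr_ge0.
Qed.

Lemma metric_bound c x r : cube x r `<=` chart_cod c ->
  exists2 B, 0 < B & forall i j y, cube x r y -> `|metric c y i j| <= B.
Proof.
move=> sub.
have mono (F : 'rV[R]_n -> R) B B' : B <= B' -> (forall y, cube x r y -> F y <= B) -> forall y, cube x r y -> F y <= B'.
  by move=> BB' H y ry; exact: le_trans (H y ry) BB'.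
have [|i|B B0 HB] := @fin_bound (fun i B => forall j y, cube x r y -> `|metric c y i j| <= B).
- by move=> i B B' BB' H j y ry; exact: le_trans (H j y ry) BB'.
- have [|j|B B0 HB] := @fin_bound (fun j B => forall y, cube x r y -> `|metric c y i j| <= B).
  + by move=> j B B'; exact: mono.
  + have [|B B0 HB] := @cube_bound _ _ (fun y => metric c y i j) x r; last by exists B.
    by move=> y /sub cy; have [H _] := metric_smooth c i j 0; exact: H.
  + by exists B.
- by exists B => // i j y; exact: HB.
Qed.

Lemma vf_bound c x r : 0 <= r -> cube x r `<=` chart_cod c ->
  exists2 B, 0 < B & forall y, cube x r y -> `|X c y| <= B.
Proof.
move=> r0 sub.
have [|j|B B0 HB] := @fin_bound (fun j B => forall y, cube x r y -> `|X c y 0 j| <= B).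
- by move=> j B B' BB' H y ry; exact: le_trans (H y ry) BB'.
- have [|B B0 HB] := @cube_bound _ _ (fun y => X c y 0 j) x r; last by exists B.
  by move=> y /sub cy; exact (@X_cont _ _ j cy).
- by exists B => // y ry; apply: rV_norm_le => [|j]; [exact: ltW|exact: HB].
Qed.

Lemma cube_convex (x : 'rV[R]_n) r y z s : cube x r y -> cube x r z -> 0 <= s -> s <= 1 ->
  cube x r (y + s *: (z - y)).
Proof.
move=> ry rz s0 s1 k; rewrite !mxE; have := ry k; have := rz k.
move: (z 0 k) (y 0 k) (x 0 k) => a b e ha hb.
have -> : b + s * (a - b) - e = (1 - s) * (b - e) + s * (a - e) by ring.
have s1' : 0 <= 1 - s by rewrite subr_ge0.
apply: le_trans (ler_normD _ _) _; rewrite !normrM (ger0_norm s0) (ger0_norm s1').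
by have := ler_wpM2l s0 ha; have := ler_wpM2l s1' hb; lra.
Qed.

Lemma reach_cube c x0 r y z t B : cube x0 r `<=` chart_cod c -> cube x0 r y -> cube x0 r z -> 0 < t ->
  (forall q, cube x0 r q -> norm_sq c q (t^-1 *: (z - y) - X c q) <= B) ->
  reach X (chart_from c y) (chart_from c z) t (t * B).
Proof.
move=> sub ry rz t0 HB.
have seg s : s \in `[0, t] -> cube x0 r (y + s *: (t^-1 *: (z - y))).
  rewrite in_itv /= => /andP[s0 st]; rewrite scalerA; apply: cube_convex => //.
    by rewrite divr_ge0 // ltW.
  by rewrite ler_pdivrMr // mul1r.
have -> : chart_from c z = chart_from c (y + t *: (t^-1 *: (z - y))).
  by rewrite scalerA divff ?gt_eqF // scale1r addrC subrK.
apply: reach_line => // s sI; [exact/sub/seg|exact/HB/seg].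
Qed.

Lemma local_reach (p : M) : exists2 U, nbhs p U & forall t, 0 < t -> exists K, forall a b, U a -> U b -> reach X a b t K.
Proof.
have cp := chart_atP G p; set c := chart_at G p in cp; set xp := chart_to c p.
have [r r0 sub2] := chart_cube (chart_codP cp) (@filterT _ (nbhs xp) _).
have sub : cube xp r `<=` chart_cod c by move=> y ry; have [] := sub2 y (cube_le (ler_wpDr (ltW r0) (lexx _)) ry).
exists (patch_cube c xp r); first exact: patch_cube_nbhs.
move=> t t0; have [Bm Bm0 HBm] := metric_bound sub; have [BX BX0 HBX] := vf_bound (ltW r0) sub.
pose V := t^-1 * (r + r) + BX.
exists (t * ((n * n)%:R * Bm * (V * V))) => a b [y ry <-] [z rz <-].
apply: (reach_cube sub) => // q rq; apply: le_trans (ler_norm _) _.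
apply: le_trans (ip_norm_le _ _ (fun i j => HBm i j q rq)) _.
apply: ler_wpM2l; first by rewrite mulr_ge0 // ltW.
have HV : `|t^-1 *: (z - y) - X c q| <= V.
  apply: le_trans (ler_normB _ _) _; apply: lerD; last exact: HBX.
  rewrite normrZ gtr0_norm ?invr_gt0 //; apply: ler_wpM2l; first by rewrite invr_ge0 ltW.
  have -> : z - y = (z - xp) - (y - xp) by rewrite opprB addrA subrK.
  by apply: le_trans (ler_normB _ _) _; apply: lerD; apply/cubeE => //; exact: ltW.
by apply: ler_pM.
Qed.

Hypothesis M_connected : connected [set: M].

(** The points reached from [w] in arbitrarily short time form a nonempty open and closed set.
    Shortness lets a further path of length [T / 2] be appended within time [T], and compactness
    makes the action bound uniform. *)
Lemma reach_all (w : set M) T : w !=set0 -> 0 < T ->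
  exists K, forall y, exists x t, [/\ w x, 0 < t, t <= T & reach X x y t K].
Proof.
move=> [x0 wx0] T0.
pose A := [set p | forall t0, 0 < t0 -> exists x t K, [/\ w x, 0 < t, t <= t0 & reach X x p t K]].
have Astep (U : set M) : (forall t, 0 < t -> exists K, forall a b, U a -> U b -> reach X a b t K) ->
    forall a b, U a -> U b -> A a -> A b.
  move=> HU a b Ua Ub Aa t0 t00; have t20 : 0 < t0 / 2 by rewrite divr_gt0.
  have [x [t [K [wx t0' tt0 HK]]]] := Aa _ t20; have [K' HK'] := HU _ t20.
  exists x, (t + t0 / 2), (K + K'); split=> //; [by rewrite addr_gt0|lra|].
  exact: reach_cat HK (HK' _ _ Ua Ub).
have AT : A = setT.
  apply: M_connected.
  - exists x0 => t0 t00; have [U pU HU] := local_reach x0; have [K HK] := HU _ t00.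
    by exists x0, t0, K; split=> //; apply: HK; exact: nbhs_singleton pU.
  - exists A; last by rewrite setTI.
    rewrite openE => p Ap; have [U pU HU] := local_reach p.
    have Up := nbhs_singleton pU.
    by apply: filterS pU => q Uq; exact: (Astep U HU p q Up Uq Ap).
  - exists A; last by rewrite setTI.
    move=> p clA; have [U pU HU] := local_reach p; have [q [Aq Uq]] := clA _ pU.
    exact: (Astep U HU q p Uq (nbhs_singleton pU) Aq).
have T20 : 0 < T / 2 by rewrite divr_gt0.
have H (p : M) : exists UK : set M * R, nbhs p UK.1 /\ forall y, UK.1 y -> exists x t, [/\ w x, 0 < t, t <= T & reach X x y t UK.2].
  have [U pU HU] := local_reach p; have Up := nbhs_singleton pU.
  have : A p by rewrite AT. move=> /(_ _ T20)[x [t [K [wx t0 tT HK]]]]; have [K' HK'] := HU _ T20.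
  exists (U, K + K'); split=> // y Uy; exists x, (t + T / 2); split=> //; [by rewrite addr_gt0|lra|].
  exact: reach_cat HK (HK' _ _ Up Uy).
have [UK HUK] := choice H.
have [s [_ cov]] := @compact_nbhs_cover M setT (fun p => (UK p).1) M_compact (fun p _ => (HUK p).1).
exists (\sum_(p <- s) `|(UK p).2|) => y; have [p ps Up] := cov y I.
have [x [t [wx t0 tT HK]]] := (HUK p).2 y Up; exists x, t; split=> //.
apply: reach_le HK; apply: le_trans (ler_norm _) _.
rewrite (big_rem p) //= lerDl; apply: sumr_ge0 => q _; exact: normr_ge0.
Qed.

(* The action distance truncated at K, which keeps it real-valued. *)
Definition Dr K x y t : R := inf [set a : R | a = K \/ 0 <= a /\ reach X x y t (4 * a)].

Lemma Dr_has_inf K x y t : 0 <= K -> has_inf [set a : R | a = K \/ 0 <= a /\ reach X x y t (4 * a)].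
Proof. by move=> K0; split; [exists K; left|exists 0 => a [->|[]]]. Qed.

Lemma Dr_ge0 K x y t : 0 <= K -> 0 <= Dr K x y t.
Proof. by move=> K0; apply: lb_le_inf; [exists K; left|move=> a [->|[]]]. Qed.

Lemma Dr_le K x y t : 0 <= K -> Dr K x y t <= K.
Proof. by move=> K0; apply: ge_inf; [case: (Dr_has_inf x y t K0)|left]. Qed.

Lemma Dr_reach K x y t a : 0 <= K -> reach X x y t a -> Dr K x y t <= a / 4.
Proof.
move=> K0 H; apply: ge_inf; first by case: (Dr_has_inf x y t K0).
right; split; first by rewrite divr_ge0 // (reach_ge0 H).
by have -> : 4 * (a / 4) = a by field.
Qed.

Lemma Dr_triangle K x y z s t : 0 <= K -> 0 < s -> 0 < t ->
  Dr K x z (s + t) <= Dr K x y s + Dr K y z t.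
Proof.
move=> K0 s0 t0; rewrite -lerBlDr; apply: lb_le_inf; first by exists K; left.
move=> a [->|[a0 Ha]]; first by rewrite lerBlDr; apply: le_trans (Dr_le _ _ _ K0) _; rewrite lerDl Dr_ge0.
rewrite lerBlDl -lerBlDr; apply: lb_le_inf; first by exists K; left.
move=> b [->|[b0 Hb]]; first by rewrite lerBlDr; apply: le_trans (Dr_le _ _ _ K0) _; rewrite lerDl.
rewrite lerBlDr; apply: le_trans (Dr_reach K0 (reach_cat s0 t0 Ha Hb)) _.
by rewrite -mulrDr mulrC mulKf // addrC.
Qed.

Lemma Dr_lb K x y t (e : R) : 0 <= K -> e <= K ->
  (e%:E <= action_dist X x y t)%E -> e <= Dr K x y t.
Proof.
move=> K0 eK H; apply: lb_le_inf; first by exists K; left.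
move=> a [->//|[a0 Ha]]; rewrite -lee_fin; apply: le_trans H _.
apply: le_trans (reach_action_dist Ha) _.
by rewrite mulrC mulKf.
Qed.

Variables (w : set M) (T : R).
Hypotheses (w_open : open w) (w_ne : w !=set0) (T_gt0 : 0 < T).

(** Finiteness makes the supremum a real number, to which losses can be subtracted. This is where
    connectedness enters. *)
Lemma action_dist_set_fin : exists K : R, (action_dist_set X T (closure w) <= K%:E)%E.
Proof.
have [K HK] := reach_all w_ne T_gt0; exists (K / 4); apply: ub_ereal_sup => _ [y _ <-].
have [x [t [wx t0 tT H]]] := HK y; apply: le_trans (reach_action_dist H).
by apply: ereal_inf_lbound; exists x, t; split=> //; [exact: subset_closure|exact: ltW].
Qed.

(** The failure of (GCC) with time [T + 2] gives a trajectory whose endpoint [psi 0] realises a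
    positive distance: a path of length at most [T] and action at most [al] ending there cannot
    start in the closure. *)
Lemma action_dist_set_gt0 (phi : R -> M -> M) : is_flow X phi -> ~ GCC phi (closure w) ->
  (0 < action_dist_set X T (closure w))%E.
Proof.
move=> flow nG.
have [x0 Hx0] : exists x, forall t, 0 < t -> t < T + 2 -> ~ closure w (phi (- t) x).
  apply: contrapT => H; apply: nG; exists (T + 2); first by rewrite addr_gt0.
  move=> x; apply: contrapT => Hx; apply: H; exists x => t t0 tT Ft.
  by apply: Hx; exists t.
(* (GCC) only concerns positive backward times. The shift by 1 sends the backward times of [[0, T]]
   into [[1, T + 1]], inside [(0, T + 2)]. *)
pose psi s := phi (s - 1) x0.
have sc r : {for r, continuous (fun r : R => r - 1)} by apply: cvgB; [exact: cvg_id|exact: cvg_cst].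
have [_ phc phd] := flow x0.
have psi_cont : continuous psi.
  by move=> s; apply: (@continuous_comp _ _ _ (fun s : R => s - 1) (fun s => phi s x0)); [exact: sc|exact: phc].
have psi_der c s : chart_dom c (psi s) ->
    is_derive s (1 : R) (fun r => chart_to c (psi r)) (X c (chart_to c (psi s))).
  move=> cd; have [d1 d2] := phd c (s - 1) cd.
  have E : (fun h : R => h^-1 *: (((fun r => chart_to c (psi r)) \o shift s) (h *: 1) - chart_to c (psi s))) =
           (fun h : R => h^-1 *: (((fun r => chart_to c (phi r x0)) \o shift (s - 1)) (h *: 1) - chart_to c (phi (s - 1) x0))).
    by apply/funext => h; rewrite /psi /= addrA.
  by split; rewrite /derivable /derive E.
have [al al0 Hal] := avoid_near_flow M_hausdorff X_compat X_C1 psi_cont psi_der (@closed_closure _ w) (ltW T_gt0)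
  (fun r r0 rT => eq_ind _ (fun u => ~ closure w (phi u x0)) (Hx0 (r + 1) (ltr_wpDl r0 ltr01) (ler_ltD rT (ltr1n _ 2))) _ (opprD r 1)).
apply: (@lt_le_trans _ _ (al / 4)%:E); first by rewrite lte_fin divr_gt0.
apply: ereal_sup_ge; exists (ereal_inf [set z | exists x t, [/\ closure w x, 0 <= t, t <= T & z = action_dist X x (psi 0) t]]).
  by exists (psi 0).
apply: le_ereal_inf_tmp => _ [x [t [wx t0 tT ->]]].
rewrite /action_dist mulrC EFinM; apply: lee_wpmul2l; first by rewrite lee_fin invr_ge0.
apply: le_ereal_inf_tmp => _ [g [Wg g0 gt] <-]; rewrite leNgt; apply/negP => lt.
by apply: (Hal t g t0 tT); [split=> //; exact: ltW|rewrite g0].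
Qed.

End Distance.

(** * Weights *)

Section Truncation.
Context {R : realType}.
Variable K : R.
Hypothesis K_gt0 : 0 < K.

(* A C^1 function equal to a for a <= K and constant for a >= K + 1. *)
Definition trunc (a : R) := a - 2^-1 * pos2 (a - K) + 2^-1 * pos2 (a - (K + 1)).
Definition trunc' (a : R) := 1 - Num.max (a - K) 0 + Num.max (a - (K + 1)) 0.

Lemma trunc'_itv a : 0 <= trunc' a <= 1.
Proof.
rewrite /trunc'; case: (leP (a - K) 0) => h1; case: (leP (a - (K + 1)) 0) => h2;
apply/andP; split; move: h1 h2; lra.
Qed.

Lemma trunc'_out a : K + 1 <= a -> trunc' a = 0.
Proof. by move=> Ka; rewrite /trunc' !max_l; lra. Qed.

Lemma trunc_out a : K + 1 <= a -> trunc a = K + 2^-1.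
Proof. by move=> Ka; rewrite /trunc /pos2 !max_l; lra. Qed.

Lemma trunc_le a : trunc a <= a.
Proof.
rewrite /trunc /pos2; case: (leP (a - K) 0) => h1; case: (leP (a - (K + 1)) 0) => h2;
rewrite ?expr0n /=; move: h1 h2; rewrite ?expr2; nra.
Qed.

Lemma trunc_id a : a <= K -> trunc a = a.
Proof. by move=> aK; rewrite /trunc /pos2 !max_r ?expr0n /=; lra. Qed.

Lemma trunc_ge a : K <= a -> K <= trunc a.
Proof.
move=> Ka; rewrite /trunc /pos2 (max_l (x := a - K)); last lra.
case: (leP (a - (K + 1)) 0) => h2; rewrite ?expr0n /=; move: Ka h2; rewrite ?expr2; nra.
Qed.

Lemma trunc_taylor a h : `|trunc (a + h) - trunc a - h * trunc' a| <= h ^+ 2.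
Proof.
have := pos2_taylor (a - K) h; have := pos2_taylor (a - (K + 1)) h.
rewrite /trunc /trunc' !(addrAC a h); move: (pos2 _) (pos2 _) (pos2 _) (pos2 _) => p1 p2 p3 p4.
move: (Num.max _ _) (Num.max _ _) => m1 m2; rewrite !ler_norml => /andP[? ?] /andP[? ?].
apply/andP; split; lra.
Qed.

Lemma is_derive_trunc a : is_derive a (1 : R) trunc (trunc' a).
Proof. by apply: (@is_derive_quadratic _ _ _ _ 1) => // h; rewrite mul1r; exact: trunc_taylor. Qed.

Lemma trunc'_cont : continuous trunc'.
Proof.
move=> a.
have H : {for a, continuous (fun a => 1 - Num.max (a - K) 0 + Num.max (a - (K + 1)) 0)}.
  apply: contD; first apply: contB; first exact: cont_cst.
    by apply: cont_max; [apply: contB; [exact: cvg_id|exact: cont_cst]|exact: cont_cst].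
  by apply: cont_max; [apply: contB; [exact: cvg_id|exact: cont_cst]|exact: cont_cst].
exact: H.
Qed.
End Truncation.

(** * Calculus for quadratic weights *)

Section Quadratic.
Context {R : realType} {n : nat}.
Variables (A : 'M[R]_n) (y : 'rV[R]_n) (k : R).
Hypothesis A_sym : A^T = A.
Let h x := k * ip A (x - y) (x - y).

Lemma quad_diff x : differentiable h x /\ drow h x = (2 * k) *: ((x - y) *m A).
Proof.
pose a := (2 * k) *: ((x - y) *m A).
have [||dh dE] := @differentiable_intro R _ _ h x (lincomb (fun j => a 0 j)).
- exact: lincomb_continuous.
- move=> e e0; pose B := \sum_i \sum_j `|A i j|.
  have HB i j : `|A i j| <= B.
    rewrite /B (bigD1 i) //= (bigD1 j) //= -addrA lerDl addr_ge0 ?sumr_ge0 // => i' _.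
    exact: sumr_ge0.
  have B0 : 0 <= B by apply: sumr_ge0 => i _; exact: sumr_ge0.
  pose C := `|k| * ((n * n)%:R * B) + 1.
  have C0 : 0 < C by rewrite /C ltr_wpDl // !mulr_ge0.
  have : \forall v \near (0 : 'rV[R]_n), `|v| <= e / C.
    have [|d d0 Hd] := @nbhs_cube _ n (0 : 'rV[R]_n) (fun v => `|v| <= e / C); last first.
    + by apply: filterS (cube_nbhs (0 : 'rV[R]_n) d0) => v /Hd.
    + have eC : 0 < e / C by rewrite divr_gt0.
      by apply: filterS (cube_nbhs (0 : 'rV[R]_n) eC) => v /(cubeE _ _ (ltW eC)); rewrite subr0.
  apply: filterS => v vC.
  have -> : h (v + x) - h x - lincomb (fun j => a 0 j) v = k * ip A v v.
    have -> : lincomb (fun j => a 0 j) v = 2 * k * ip A v (x - y).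
      rewrite (ipC _ _ A_sym) /ip mxE /lincomb mulr_sumr; apply: eq_bigr => j _.
      by rewrite /a mxE [v^T _ _]mxE; ring.
    have E : v + x - y = v + (x - y) by rewrite addrA.
    by rewrite /h E; move: (x - y) => u; rewrite ipDl 2!ipDr (ipC u v A_sym); ring.
  rewrite normrM; apply: le_trans (_ : `|k| * ((n * n)%:R * B * (`|v| * `|v|)) <= _).
    by apply: ler_wpM2l => //; exact: ip_norm_le.
  rewrite !mulrA; apply: ler_wpM2r => //.
  apply: (@le_trans _ _ (C * `|v|)); last by rewrite mulrC -ler_pdivlMr.
  by apply: ler_wpM2r => //; rewrite /C mulrA lerDl.
split=> //; apply/rowP => j; rewrite mxE partialE // dE.
exact: lincomb_delta.
Qed.

Lemma quad_C1 (U : set 'rV[R]_n) : open U -> C1_on U h.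
Proof.
move=> oU; apply: (C1_on_intro oU (df := fun j x => 2 * k * \sum_i (x 0 i - y 0 i) * A i j)).
- by move=> x _; have [] := quad_diff x.
- move=> x j _; have [_ /rowP/(_ j)] := quad_diff x; rewrite mxE => ->.
  by rewrite !mxE; congr (_ * _); apply: eq_bigr => i _; rewrite !mxE.
- move=> x j _; apply: contZ; apply: continuous_at_sum => i.
  apply: contM; last exact: cont_cst.
  by apply: contB; [exact: coord_continuous|exact: cont_cst].
Qed.
End Quadratic.

(* [a], [e], [f] stand for N(v), N(v, b), N(b): [N(v)/D] is convex along the motion. *)
Lemma quad_over_lin_convex (R : realType) (a e f D h : R) : 0 < D - h -> 0 < D ->
  0 <= a / D ^+ 2 + 2 * e / D + f ->
  h * (2 * e / D + a / D ^+ 2) <= (a + 2 * h * e + h ^+ 2 * f) / (D - h) - a / D.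
Proof.
move=> Dh D0 H; rewrite -subr_ge0.
have -> : (a + 2 * h * e + h ^+ 2 * f) / (D - h) - a / D - h * (2 * e / D + a / D ^+ 2) =
   h ^+ 2 * (a / D ^+ 2 + 2 * e / D + f) / (D - h).
  by field; rewrite !gt_eqF.
by apply: divr_ge0; [apply: mulr_ge0 => //; exact: sqr_ge0|exact: ltW].
Qed.

(** A crude Lipschitz bound in time; it serves to make the square of an increment, the error term of
    [trunc_taylor], of order [h ^+ 2]. *)
Lemma quad_over_lin_lip (R : realType) (a e f D h V : R) : 0 <= h -> 0 < D - h -> 0 < D ->
  `|a| <= V -> `|e| <= V -> `|f| <= V -> h <= 1 ->
  forall sig, 0 < sig -> sig <= D - h -> sig <= 1 ->
  `|(a + 2 * h * e + h ^+ 2 * f) / (D - h) - a / D| <= h * (4 * V / sig ^+ 2).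
Proof.
move=> h0 Dh D0 aV eV fV h1 sig s0 sD s1.
have V0 : 0 <= V by apply: le_trans aV.
have sD' : sig <= D by apply: le_trans sD _; rewrite gerBl.
have -> : (a + 2 * h * e + h ^+ 2 * f) / (D - h) - a / D = h * ((2 * e + h * f + a / D) / (D - h)).
  by field; rewrite !gt_eqF.
rewrite normrM (ger0_norm h0); apply: ler_wpM2l => //.
rewrite normrM normfV (gtr0_norm Dh) ler_pdivrMr //.
have aD : `|a / D| <= V / sig.
  rewrite normrM normfV (gtr0_norm D0); apply: ler_pM => //; rewrite ?invr_ge0 ?(ltW D0) //.
  by rewrite lef_pV2.
have VV : V <= V / sig by rewrite ler_pdivlMr // ler_piMr.
have hf : `|h * f| <= V.
  by rewrite normrM (ger0_norm h0) -[leRHS]mul1r; apply: ler_pM.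
have e2 : `|2 * e| <= 2 * V by rewrite normrM (ger0_norm (ler0n _ 2)) ler_wpM2l.
apply: (@le_trans _ _ (4 * V / sig)).
  apply: le_trans (ler_normD _ _) _; apply: le_trans (lerD (ler_normD _ _) (lexx _)) _.
  by move: (lerD (lerD e2 hf) aD) VV; rewrite -mulrA; move: (V / sig) => w; lra.
have -> : 4 * V / sig ^+ 2 * (D - h) = 4 * V / sig * ((D - h) / sig) by field; rewrite gt_eqF.
rewrite ler_peMr //; first by rewrite !mulr_ge0 // invr_ge0 ltW.
by rewrite ler_pdivlMr // mul1r.
Qed.

(** The condition [lam * (1 + kap) <= 1 - kap] frees a fraction [kap] of the quadratic term, which
    absorbs through Young's inequality the oscillation of the field. Here [al] is the squared
    gradient of the weight and [NVe] pairs the displacement with that oscillation. *)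
Lemma gain_bound (R : realType) (al lam kap D NV NVe Ne eta : R) : 0 < kap -> kap <= 1 -> 0 < D ->
  0 <= lam -> lam <= 1 -> lam * (1 + kap) <= 1 - kap -> 0 <= NV -> 0 <= Ne -> Ne <= eta * kap ->
  - (2 * (kap * D) * NVe) <= kap ^+ 2 * NV + D ^+ 2 * Ne ->
  al <= lam ^+ 2 / (4 * D ^+ 2) * ((1 + kap) * NV) ->
  al - lam / (2 * D) * NVe <= lam * (NV / (4 * D ^+ 2)) + eta.
Proof.
move=> k0 k1 D0 l0 l1 lk NV0 Ne0 Nek HY Hal.
have D20 : 0 < D ^+ 2 by rewrite exprn_gt0.
have h1 : al <= lam * (1 - kap) * (NV / (4 * D ^+ 2)).
  apply: le_trans Hal _.
  have -> : lam ^+ 2 / (4 * D ^+ 2) * ((1 + kap) * NV) = lam * (lam * (1 + kap)) * (NV / (4 * D ^+ 2)).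
    by field; rewrite gt_eqF.
  apply: ler_wpM2r; first by rewrite divr_ge0 // mulr_ge0 // ltW.
  exact: ler_wpM2l.
have h2 : - (NVe / (2 * D)) <= kap * (NV / (4 * D ^+ 2)) + eta / 4.
  have kD : 0 < 4 * (kap * D ^+ 2) by rewrite !mulr_gt0.
  rewrite -(ler_pM2l kD).
  have -> : 4 * (kap * D ^+ 2) * - (NVe / (2 * D)) = - (2 * (kap * D) * NVe) by field; rewrite gt_eqF.
  apply: le_trans HY _.
  have -> : 4 * (kap * D ^+ 2) * (kap * (NV / (4 * D ^+ 2)) + eta / 4) = kap ^+ 2 * NV + D ^+ 2 * (eta * kap).
    by field; rewrite gt_eqF.
  by rewrite lerD2l; apply: ler_wpM2l => //; exact: ltW.
have eta0 : 0 <= eta by rewrite -(pmulr_lge0 _ k0); apply: le_trans Nek.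
have h3 := ler_wpM2l l0 h2.
have -> : lam / (2 * D) * NVe = lam * (NVe / (2 * D)) by rewrite mulrAC mulrA.
have h4 : lam * (eta / 4) <= eta / 4 by rewrite -[leRHS]mul1r ler_wpM2r // divr_ge0.
move: h1 h3 h4; move: (NV / (4 * D ^+ 2)) (NVe / (2 * D)) => x z.
have -> : lam * (1 - kap) * x = lam * x - lam * kap * x by ring.
have -> : lam * (kap * x + eta / 4) = lam * kap * x + lam * (eta / 4) by ring.
rewrite mulrN; lra.
Qed.

Lemma reach_radius (R : realType) (k a z : R) : 0 < k -> k <= 1 / 8 -> 0 <= a -> 0 <= z ->
  (1 - k) * a <= 4 * (1 + k) ^+ 2 * z -> a <= 8 * z.
Proof.
move=> k0 k8 a0 z0 H.
have h1 : 7 / 8 * a <= (1 - k) * a by apply: ler_wpM2r => //; lra.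
have kk : (1 + k) ^+ 2 <= (9 / 8) ^+ 2 by apply: lerXn2r; rewrite ?nnegrE; lra.
have := ler_wpM2r z0 kk; rewrite -mulrA in H; move: ((1 + k) ^+ 2 * z) H => p H.
rewrite (_ : (9 / 8) ^+ 2 = 81 / 64 :> R); last by field.
lra.
Qed.

(** * The weight of a short time step *)

Section Weight.
Context {R : realType} {n : nat} {M : ptopologicalType} (G : riemannian R n M).
Hypotheses (M_hausdorff : hausdorff_space M) (M_compact : compact [set: M]).
Variable X : vfield G.
Hypotheses (X_compat : vf_compat X).
Variables (c : chart G) (xz : 'rV[R]_n) (r K kap eta tau Av B0 : R).
Let g0 := metric c xz.
Let b := X c xz.
Let N u := ip g0 u u.
Let lam := (1 - kap) / (1 + kap).
Let sig := kap * tau.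
Let y s := xz + (tau - s) *: b.
Let D s := tau - s + sig.
(* Up to the losses lam and sig, which absorb the oscillation over the cube, the action of the
   straight line from x to the centre in time tau - s, metric and field being frozen at the centre. *)
Let phi s x := lam / (4 * D s) * ip g0 (x - y s) (x - y s).
Hypotheses (r_gt0 : 0 < r) (sub : cube xz r `<=` chart_cod c) (K_gt0 : 0 < K).
Hypotheses (kap_gt0 : 0 < kap) (kap_le : kap <= 1 / 8) (eta_gt0 : 0 < eta) (tau_gt0 : 0 < tau) (tau_le1 : tau <= 1).
Hypotheses (H1a : forall z w, cube xz r z -> N w <= (1 + kap) * norm_sq c z w)
  (H1b : forall z w, cube xz r z -> norm_sq c z w <= (1 + kap) * N w)
  (H2 : forall z, cube xz r z -> N (b - X c z) <= eta * kap)
  (B0_gt0 : 0 < B0) (H3 : forall w, `|w| ^+ 2 <= B0 * N w)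
  (H4 : N b <= 4 * Av) (H5 : B0 * (8 * (K + 1) * tau) <= (r / 2) ^+ 2) (H6 : tau * `|b| <= r / 2).

Let cxz : chart_cod c xz. Proof. by apply: sub; apply: cube_center; exact: ltW. Qed.
Let g0S : g0^T = g0. Proof. exact: Defs.metric_sym. Qed.
Let g0P : posdef g0. Proof. exact: metric_posdef. Qed.
Let N_ge0 u : 0 <= N u. Proof. exact: ip_ge0. Qed.
Let lam_bounds : [/\ 0 < lam, lam <= 1 & lam * (1 + kap) = 1 - kap].
Proof.
have k1 : 0 < 1 + kap by rewrite addr_gt0.
have k2 : 0 < 1 - kap by move: kap_le; lra.
split; first by rewrite divr_gt0.
  by rewrite ler_pdivrMr // mul1r; move: kap_gt0; lra.
by rewrite divfK // gt_eqF.
Qed.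
Let sig_gt0 : 0 < sig. Proof. by rewrite mulr_gt0. Qed.
Let D_ge s : s <= tau -> sig <= D s. Proof. by move=> st; rewrite /D lerDr subr_ge0. Qed.
Let D_gt0 s : s <= tau -> 0 < D s. Proof. by move=> /D_ge; exact: lt_le_trans. Qed.
Let D_le s : 0 <= s -> D s <= (1 + kap) * tau.
Proof. by move=> s0; rewrite /D /sig mulrDl mul1r lerD2r gerBl. Qed.

Let phi_ge0 s x : s <= tau -> 0 <= phi s x.
Proof.
by move=> st; have [l0 _ _] := lam_bounds; rewrite mulr_ge0 ?N_ge0 // divr_ge0 ?ltW // mulr_gt0 // D_gt0.
Qed.

Lemma phi_N s x : 0 <= s -> s <= tau -> phi s x < K + 1 -> N (x - y s) <= 8 * (K + 1) * tau.
Proof.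
move=> s0 st; have [l0 l1 lk] := lam_bounds; have D0 := D_gt0 st.
rewrite /phi -/(N _) => H.
have {}H : lam * N (x - y s) <= 4 * ((1 + kap) * tau) * (K + 1).
  have : lam * N (x - y s) < 4 * D s * (K + 1).
    by rewrite -ltr_pdivrMl ?mulr_gt0 // mulrA (mulrC _ lam).
  move=> /ltW H'; apply: le_trans H' _; apply: ler_wpM2r; first by rewrite addr_ge0 // ltW.
  by rewrite ler_wpM2l // D_le.
have k1 : 0 < 1 + kap by rewrite addr_gt0.
have {}H : (1 - kap) * N (x - y s) <= 4 * (1 + kap) ^+ 2 * (tau * (K + 1)).
  have -> : (1 - kap) * N (x - y s) = (1 + kap) * (lam * N (x - y s)) by rewrite -lk; ring.
  apply: le_trans (ler_wpM2l (ltW k1) H) _.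
  by rewrite le_eqVlt; apply/orP; left; apply/eqP; ring.
have tK : 0 <= tau * (K + 1) by rewrite mulr_ge0 ?ltW // addr_gt0.
rewrite (_ : 8 * (K + 1) * tau = 8 * (tau * (K + 1))); last ring.
exact: (reach_radius kap_gt0 kap_le (N_ge0 _) tK H).
Qed.

(** [H5] bounds the distance to the moving centre [y s] and [H6] the displacement of that centre,
    each by [r / 2]. Outside the cube the truncation is therefore constant, and the weight extends
    to the whole manifold. *)
Lemma phi_cube s x : 0 <= s -> s <= tau -> phi s x < K + 1 -> cube xz r x.
Proof.
move=> s0 st /(phi_N s0 st) H; apply/cubeE; first exact: ltW.
have : `|x - y s| <= r / 2.
  rewrite -(@ler_pXn2r _ 2) ?nnegrE ?divr_ge0 ?(ltW r_gt0) //.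
  by apply: le_trans (H3 _) (le_trans _ H5); rewrite ler_wpM2l // ltW.
have : `|(tau - s) *: b| <= r / 2.
  rewrite normrZ ger0_norm ?subr_ge0 //; apply: le_trans H6; apply: ler_wpM2r => //.
  by rewrite gerBl.
have -> : x - xz = (x - y s) + (tau - s) *: b by rewrite /y opprD addrA subrK.
move=> h1 h2; apply: le_trans (ler_normD _ _) _; apply: le_trans (lerD h2 h1) _.
by rewrite -splitr.
Qed.

Definition weightF s : 'rV[R]_n -> R := trunc K \o phi s.
Definition weight s : M -> R := ext c (weightF s) (K + 2^-1).

Let phi_C1 s : C1_on (chart_cod c) (phi s).
Proof. by apply: quad_C1 => //; exact: chart_cod_open. Qed.

Let F_C1 s : C1_on (chart_cod c) (weightF s).
Proof.
apply: (@C1_on_comp _ _ _ _ _ (trunc' K)).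
- exact: chart_cod_open.
- by move=> x _; exact: is_derive_trunc.
- by move=> x _; exact: trunc'_cont.
- exact: phi_C1.
Qed.

Lemma weight_C1 s : 0 <= s -> s <= tau -> C1M G (weight s).
Proof.
move=> s0 st; apply: (@C1M_ext _ _ _ _ M_hausdorff c _ _ (cube xz r)) => //; first exact: cube_compact.
move=> x _ nx; apply: trunc_out; rewrite leNgt; apply/negP => lt; apply: nx; exact: phi_cube lt.
Qed.

Let weight_drow s p : s <= tau -> chart_dom c p ->
  drow (weight s \o chart_from c) (chart_to c p) =
  (trunc' K (phi s (chart_to c p)) * (lam / (2 * D s))) *: ((chart_to c p - y s) *m g0).
Proof.
move=> st cp; have cx := chart_codP cp; set x := chart_to c p in cx *.
have -> : drow (weight s \o chart_from c) x = drow (weightF s) x.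
  apply: near_eq_drow; apply: filterS (chart_cod_near cx) => z cz /=.
  by rewrite /weight extE ?chart_fromK //; exact: chart_from_dom.
have [dq Eq] := quad_diff (y s) (lam / (4 * D s)) g0S x.
apply/rowP => j; rewrite mxE (partial_comp j (is_derive_trunc K (phi s x))) //.
move/rowP: Eq => /(_ j); rewrite mxE => ->; rewrite [LHS]/= [in RHS]mxE [in LHS]mxE mulrA.
by congr (_ * _ * _); field; rewrite gt_eqF // D_gt0.
Qed.

Lemma weight_out s p : 0 <= s -> s <= tau -> ~ (chart_dom c p /\ cube xz r (chart_to c p)) ->
  weight s p = K + 2^-1.
Proof.
move=> s0 st H; rewrite /weight; have [cp|ncp] := pselect (chart_dom c p); last by rewrite /ext asboolF.
rewrite extE //; apply: trunc_out; rewrite leNgt; apply/negP => lt; apply: H; split=> //.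
exact: phi_cube lt.
Qed.

Let Nquad a e : N (a + e) = N a + 2 * ip g0 a e + N e.
Proof. by rewrite /N ipDl 2!ipDr (ipC e a g0S); ring. Qed.

Let N_young a e : N (a + e) <= (1 + kap) * N a + (1 + kap^-1) * N e.
Proof.
have := ip_young a e kap 1 g0S g0P; rewrite -/(N a) -/(N e) mulr1 expr1n mul1r => H.
rewrite Nquad; have : 2 * ip g0 a e <= kap * N a + kap^-1 * N e.
  rewrite -(ler_pM2l kap_gt0); have -> : kap * (kap * N a + kap^-1 * N e) = kap ^+ 2 * N a + N e.
    by field; rewrite gt_eqF.
  by rewrite mulrA (mulrC kap).
lra.
Qed.

Let inv_metric_le z v : cube xz r z -> ip (invmx (metric c z)) (v *m g0) (v *m g0) <= (1 + kap) * N v.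
Proof.
move=> rz; have cz := sub rz; have gS := Defs.metric_sym cz; have uz := metric_unit cz.
have iS : (invmx (metric c z))^T = invmx (metric c z) by exact: invmx_sym.
set S := ip _ _ _; pose w := v *m g0 *m invmx (metric c z).
have S1 : S = ip g0 w v by rewrite /S /ip trmx_mul g0S !mulmxA.
have S2 : S = norm_sq c z w by rewrite /S /norm_sq /w !trmx_mul iS g0S mulmxKV // !mulmxA.
have S0 : 0 <= S by rewrite S2; apply: ip_ge0; exact: metric_posdef.
have := ip_CS w v g0S g0P; rewrite -S1 -/(N w) -/(N v) => CS.
have Nw : N w <= (1 + kap) * S by rewrite S2; exact: H1a.
move: S0; rewrite le_eqVlt => /orP[/eqP <-|S0]; first by rewrite mulr_ge0 // addr_ge0 // ltW.
rewrite -(ler_pM2l S0); apply: le_trans (le_trans _ (ler_wpM2r (N_ge0 v) Nw)) _; first by rewrite -expr2.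
by rewrite le_eqVlt; apply/orP; left; apply/eqP; ring.
Qed.

(** [dphi] is the exact time derivative of [phi], as the derivative of [y] is [- b] and that of [D]
    is -1; [al] is the squared gradient of [phi] in the true metric. *)
Let dphi s x := lam / 4 * (2 * ip g0 (x - y s) b / D s + N (x - y s) / D s ^+ 2).
Let al s x := lam ^+ 2 / (4 * D s ^+ 2) * ip (invmx (metric c x)) ((x - y s) *m g0) ((x - y s) *m g0).

Let Gam_weight s p : 0 <= s -> s <= tau -> chart_dom c p ->
  carre G (weight s) (weight s) p = trunc' K (phi s (chart_to c p)) ^+ 2 * al s (chart_to c p).
Proof.
move=> s0 st cp; have Wc := weight_C1 s0 st.
rewrite (Gam_mxE Wc Wc cp) weight_drow // ipZl ipZr /al; field.
by rewrite gt_eqF // D_gt0.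
Qed.

Let pair_weight s p : 0 <= s -> s <= tau -> chart_dom c p ->
  pair (weight s) X p = trunc' K (phi s (chart_to c p)) *
    (lam / (2 * D s) * ip g0 (chart_to c p - y s) (X c (chart_to c p))).
Proof.
move=> s0 st cp; have Wc := weight_C1 s0 st.
rewrite (pair_mxE Wc X_compat cp) weight_drow // linearZ /= -scalemxAr.
have E u w : ip g0 u w = (w *m (u *m g0)^T) 0 0.
  by rewrite (ipC _ _ g0S) /ip trmx_mul g0S mulmxA.
by rewrite E [LHS]mxE [RHS]mulrA.
Qed.

Let al_le s x : cube xz r x -> al s x <= lam ^+ 2 / (4 * D s ^+ 2) * ((1 + kap) * N (x - y s)).
Proof.
move=> rx; apply: ler_wpM2l; last exact: inv_metric_le.
by rewrite divr_ge0 ?sqr_ge0 // mulr_ge0 // sqr_ge0.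
Qed.

Let al_ge0 s x : cube xz r x -> 0 <= al s x.
Proof.
move=> rx; apply: mulr_ge0; first by rewrite divr_ge0 ?sqr_ge0 // mulr_ge0 // sqr_ge0.
by apply: ip_ge0; apply: invmx_posdef; exact: sub.
Qed.

(** The Hamilton-Jacobi inequality in continuous time. The slope of the truncation lies in [[0, 1]]
    and occurs squared in the gradient term only, so the truncation can only help. *)
Let weight_gain s p : 0 <= s -> s <= tau -> chart_dom c p -> cube xz r (chart_to c p) ->
  carre G (weight s) (weight s) p + pair (weight s) X p <=
  trunc' K (phi s (chart_to c p)) * dphi s (chart_to c p) + eta.
Proof.
move=> s0 st cp rx; rewrite Gam_weight // pair_weight //; set x := chart_to c p in rx *.
have /andP[t0 t1] := trunc'_itv K (phi s x); have [l0 l1 lk] := lam_bounds.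
have D0 := D_gt0 st; set tt := trunc' K _ in t0 t1 *.
have Y := ip_young (- (x - y s)) (b - X c x) kap (D s) g0S g0P.
rewrite ipNl ipNl ipNr opprK -/(N (x - y s)) -/(N (b - X c x)) mulrN in Y.
have k1 : kap <= 1 by apply: le_trans kap_le _; lra.
have lk' : lam * (1 + kap) <= 1 - kap by rewrite lk.
have := gain_bound kap_gt0 k1 D0 (ltW l0) l1 lk' (N_ge0 _) (N_ge0 _) (H2 rx) Y (al_le s rx).
rewrite ipDr ipNr mulrBr opprB => H.
have {}H : al s x + lam / (2 * D s) * ip g0 (x - y s) (X c x) <= dphi s x + eta.
  have -> : dphi s x = lam * (N (x - y s) / (4 * D s ^+ 2)) + lam / (2 * D s) * ip g0 (x - y s) b.
    by rewrite /dphi; field; rewrite gt_eqF.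
  by move: H; lra.
have A0 := al_ge0 s rx.
have h1 : tt ^+ 2 * al s x <= tt * al s x by rewrite expr2 -mulrA -[leRHS]mul1r; apply: ler_wpM2r => //; exact: mulr_ge0.
have h2 := ler_wpM2l t0 H.
have h3 : tt * eta <= eta by rewrite -[leRHS]mul1r; apply: ler_wpM2r => //; exact: ltW.
by rewrite !mulrDr in h2 *; move: h1 h2 h3; lra.
Qed.

Let Bg := \sum_i \sum_j `|g0 i j|.
Let V := (n * n)%:R * Bg * ((2 * r + `|b|) * (2 * r + `|b|)).

Let g0_entry i j : `|g0 i j| <= Bg.
Proof.
rewrite /Bg (bigD1 i) //= (bigD1 j) //= -addrA lerDl addr_ge0 ?sumr_ge0 // => i' _.
exact: sumr_ge0.
Qed.

Let Bg_ge0 : 0 <= Bg. Proof. by apply: sumr_ge0 => i _; exact: sumr_ge0. Qed.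

Let ip_V u w : `|u| <= 2 * r + `|b| -> `|w| <= 2 * r + `|b| -> `|ip g0 u w| <= V.
Proof.
move=> hu hw; apply: le_trans (ip_norm_le _ _ g0_entry) _.
by apply: ler_wpM2l; [rewrite mulr_ge0|exact: ler_pM].
Qed.

Let v_le s x : 0 <= s -> s <= tau -> cube xz r x -> `|x - y s| <= 2 * r + `|b|.
Proof.
move=> s0 st /(cubeE _ _ (ltW r_gt0)) rx; rewrite /y opprD addrA.
apply: le_trans (ler_normB _ _) _; apply: lerD; first by move: rx r_gt0; lra.
by rewrite normrZ ger0_norm ?subr_ge0 // ler_piMl // (le_trans _ tau_le1) // gerBl.
Qed.

Let b_le : `|b| <= 2 * r + `|b|. Proof. by rewrite lerDr mulr_ge0 // ltW. Qed.

Lemma weight_Gam_le s p : 0 <= s -> s <= tau -> 0 <= carre G (weight s) (weight s) p <= V / sig ^+ 2.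
Proof.
move=> s0 st; have Wc := weight_C1 s0 st; rewrite Gam_ge0 //=.
have V0 : 0 <= V by apply: le_trans (normr_ge0 _) (ip_V b_le b_le).
have RHS0 : 0 <= V / sig ^+ 2 by rewrite divr_ge0 // sqr_ge0.
have [cp|ncp] := pselect (chart_dom c p); last first.
  have nK : ~ (chart_from c @` cube xz r) p by move=> [x /sub cx xp]; apply: ncp; rewrite -xp; exact: chart_from_dom.
  rewrite (_ : carre G (weight s) (weight s) p = 0) // /carre.
  rewrite (@pair_near _ _ _ G _ (cst (K + 2^-1))) ?pair_cst //; first exact: grad_compat.
  apply: (ext_near_out M_hausdorff (cube_compact (x := xz) (r := r))) nK => // x _ nx.
  by apply: trunc_out; rewrite leNgt; apply/negP => lt; apply: nx; exact: phi_cube lt.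
rewrite Gam_weight //; set x := chart_to c p.
have [Kp|/(phi_cube s0 st) rx] := leP (K + 1) (phi s x); first by rewrite trunc'_out // expr0n /= mul0r.
have /andP[t0 t1] := trunc'_itv K (phi s x); have [l0 l1 lk] := lam_bounds.
apply: (@le_trans _ _ (al s x)).
  by rewrite -[leRHS]mul1r; apply: ler_wpM2r; [exact: al_ge0|exact: exprn_ile1].
apply: le_trans (al_le s rx) _.
have sD := D_ge st; have D0 := D_gt0 st.
have NV : N (x - y s) <= V by apply: le_trans (ler_norm _) (ip_V (v_le s0 st rx) (v_le s0 st rx)).
have D2 : (D s ^+ 2)^-1 <= (sig ^+ 2)^-1.
  by rewrite lef_pV2 ?posrE ?exprn_gt0 //; apply: lerXn2r; rewrite ?nnegrE ?(ltW D0) ?(ltW sig_gt0).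
have -> : lam ^+ 2 / (4 * D s ^+ 2) * ((1 + kap) * N (x - y s)) =
    (lam ^+ 2 * (1 + kap) / 4) * (N (x - y s) * (D s ^+ 2)^-1) by field; rewrite gt_eqF.
rewrite -[leRHS]mul1r; apply: ler_pM.
- by rewrite divr_ge0 // mulr_ge0 ?sqr_ge0 // addr_ge0 // ltW.
- by rewrite mulr_ge0 // invr_ge0 sqr_ge0.
- rewrite ler_pdivrMr // mul1r; apply: (@le_trans _ _ (1 * 2)); last by lra.
  apply: ler_pM; rewrite ?sqr_ge0 //; first by rewrite addr_ge0 // ltW.
    by apply: exprn_ile1 => //; exact: ltW.
  by move: kap_le; lra.
- by apply: ler_pM => //; rewrite invr_ge0 sqr_ge0.
Qed.

(** Quadratic-over-linear functions are convex in time, so the increment of [phi] is at least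
    [h * dphi]; the truncation adds an error quadratic in the increment. Off the cube the weight has
    zero gradient and does not change in time. *)
Lemma weight_step s h p : 0 <= s -> 0 <= h -> s + h <= tau ->
  h * (carre G (weight s) (weight s) p + pair (weight s) X p - eta) - (V / sig ^+ 2) ^+ 2 * h ^+ 2 <=
  weight (s + h) p - weight s p.
Proof.
move=> s0 h0 sht; have st : s <= tau by apply: le_trans sht; rewrite lerDl.
have sh0 : 0 <= s + h by rewrite addr_ge0.
have Wc := weight_C1 s0 st; set C := (V / sig ^+ 2) ^+ 2.
have C0 : 0 <= C by rewrite sqr_ge0.
have trivial_case : carre G (weight s) (weight s) p = 0 -> pair (weight s) X p = 0 ->
    weight (s + h) p = weight s p ->
    h * (carre G (weight s) (weight s) p + pair (weight s) X p - eta) - C * h ^+ 2 <= weight (s + h) p - weight s p.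
  move=> -> -> ->; rewrite addr0 sub0r subrr mulrN -opprD oppr_le0.
  by apply: addr_ge0; apply: mulr_ge0 => //; [exact: ltW|exact: sqr_ge0].
have [cp|ncp] := pselect (chart_dom c p); last first.
  have nK : ~ (chart_from c @` cube xz r) p by move=> [x /sub cx xp]; apply: ncp; rewrite -xp; exact: chart_from_dom.
  have nw : \forall q \near p, weight s q = cst (K + 2^-1) q.
    apply: (ext_near_out M_hausdorff (cube_compact (x := xz) (r := r))) nK => // x _ nx.
    by apply: trunc_out; rewrite leNgt; apply/negP => lt; apply: nx; exact: phi_cube lt.
  apply: trivial_case.
  - by rewrite /carre (pair_near _ nw) pair_cst //; exact: grad_compat.
  - by rewrite (pair_near _ nw) pair_cst.
  - by rewrite !weight_out // => -[].
set x := chart_to c p; have [rx|nrx] := pselect (cube xz r x); last first.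
  have Kp : K + 1 <= phi s x by rewrite leNgt; apply/negP => lt; apply: nrx; exact: phi_cube lt.
  apply: trivial_case.
  - by rewrite Gam_weight // trunc'_out // expr0n /= mul0r.
  - by rewrite pair_weight // trunc'_out // mul0r.
  - by rewrite !weight_out // => -[].
rewrite /weight !extE // -/x /weightF /=.
have := weight_gain s0 st cp rx; rewrite -/x.
set gp := carre _ _ _ _ + pair _ _ _ => gain.
have D0 := D_gt0 st; have Dh0 := D_gt0 sht; have [l0 l1 lk] := lam_bounds.
have /andP[t0 t1] := trunc'_itv K (phi s x).
have DhE : D (s + h) = D s - h by rewrite /D; ring.
have vE : x - y (s + h) = (x - y s) + h *: b.
  rewrite /y (_ : tau - (s + h) = (tau - s) - h); last by ring.
  by rewrite scalerBl !opprD opprK !addrA.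
pose a := N (x - y s); pose e := ip g0 (x - y s) b; pose f := N b.
have NvE : N (x - y (s + h)) = a + 2 * h * e + h ^+ 2 * f.
  by rewrite vE Nquad ipZr /a /e /f /N ipZl ipZr; ring.
pose dl := phi (s + h) x - phi s x.
have dlE : dl = lam / 4 * ((a + 2 * h * e + h ^+ 2 * f) / (D s - h) - a / D s).
  rewrite /dl /phi -/(N _) -/(N _) NvE DhE -/a; rewrite DhE in Dh0.
  by field; rewrite !gt_eqF.
have Dh0' : 0 < D s - h by rewrite -DhE.
have sq : 0 <= a / D s ^+ 2 + 2 * e / D s + f.
  have := N_ge0 ((D s)^-1 *: (x - y s) + b); rewrite Nquad ipZl /N ipZl ipZr -/(N _) -/(N b) -/a -/e -/f.
  by move=> H; apply: le_trans H _; rewrite le_eqVlt; apply/orP; left; apply/eqP; field; rewrite gt_eqF.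
have l4 : 0 <= lam / 4 by rewrite divr_ge0 // ltW.
have dl1 : h * dphi s x <= dl.
  rewrite dlE /dphi -/a -/e.
  have H := ler_wpM2l l4 (quad_over_lin_convex Dh0' D0 sq).
  apply: le_trans H; rewrite le_eqVlt; apply/orP; left; apply/eqP; ring.
have h1 : h <= 1 by apply: le_trans (le_trans _ sht) tau_le1; rewrite lerDr.
have sig1 : sig <= 1.
  rewrite /sig -[leRHS]mulr1; apply: ler_pM => //; [exact: ltW|exact: ltW|].
  by apply: le_trans kap_le _; lra.
have dl2 : `|dl| <= h * (V / sig ^+ 2).
  rewrite dlE normrM (ger0_norm l4).
  have vb := v_le s0 st rx.
  have := quad_over_lin_lip h0 Dh0' D0 (ip_V vb vb) (ip_V vb b_le) (ip_V b_le b_le) h1 sig_gt0 _ sig1.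
  rewrite -DhE => /(_ (D_ge sht)); rewrite DhE -/(N _) -/(N _) -/a -/e -/f => H.
  apply: le_trans (ler_wpM2l l4 H) _.
  have -> : lam / 4 * (h * (4 * V / sig ^+ 2)) = lam * (h * (V / sig ^+ 2)) by field; rewrite gt_eqF.
  rewrite ler_piMl //; apply: mulr_ge0 => //; rewrite divr_ge0 ?sqr_ge0 //.
  by apply: le_trans (normr_ge0 _) (ip_V b_le b_le).
have dl3 : dl ^+ 2 <= C * h ^+ 2.
  rewrite -(real_normK (num_real dl)) /C -exprMn (mulrC (V / _)).
  by apply: lerXn2r => //; rewrite nnegrE; apply: le_trans dl2.
have phE : phi s x + dl = phi (s + h) x by rewrite /dl addrC subrK.
have := trunc_taylor K (phi s x) dl; rewrite phE ler_norml => /andP[+ _].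
have d4 := ler_wpM2l t0 dl1.
have d5 := ler_wpM2l h0 gain.
rewrite (mulrDr h (_ * _)) (mulrCA h) in d5; rewrite mulrBr (mulrC dl).
move: d4 d5 dl3; lra.
Qed.

(** Near the target the weight only pays for the motion of the centre, which is [(tau - s) *: b]; at
    [s = tau] nothing is left but [eta * tau]. *)
Lemma weight_near : exists2 r', 0 < r' & r' <= r /\ forall s p, 0 <= s -> s <= tau -> chart_dom c p ->
  cube xz r' (chart_to c p) -> weight s p <= Av * (tau - s) + eta * tau.
Proof.
(* Calibrated so that the distance from [x] to the fixed centre contributes at most [eta * tau], as
   [D s >= sig]. *)
have q0 : 0 < 4 * sig * (eta * tau) / (1 + kap^-1).
  by rewrite divr_gt0 ?mulr_gt0 // addr_gt0 // invr_gt0.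
set q := (X in 0 < X) in q0.
have C0 : 0 < (n * n)%:R * Bg + 1 by rewrite ltr_wpDl // mulr_ge0.
set C := (X in 0 < X) in C0.
exists (Num.min r (Num.min 1 (q / C))); first by rewrite !lt_min r_gt0 ltr01 divr_gt0.
set r' := Num.min _ _; split; first by rewrite ge_min lexx.
have r'1 : r' <= 1 by rewrite /r' !ge_min lexx orbT.
have r'q : r' <= q / C by rewrite /r' !ge_min lexx !orbT.
have r'0 : 0 < r' by rewrite !lt_min r_gt0 ltr01 divr_gt0.
move=> s p s0 st cp /(cubeE _ _ (ltW r'0)) rx; rewrite /weight extE // /weightF /=.
apply: le_trans (trunc_le _ _) _; set x := chart_to c p in rx *.
have [l0 l1 lk] := lam_bounds; have D0 := D_gt0 st; have sD := D_ge st.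
have Nu : N (x - xz) <= q.
  apply: le_trans (ler_norm _) _; apply: le_trans (ip_norm_le _ _ g0_entry) _.
  apply: (@le_trans _ _ (C * r')); last by rewrite mulrC -ler_pdivlMr.
  have h1 : `|x - xz| * `|x - xz| <= r' by rewrite -[leRHS]mulr1; apply: ler_pM => //; exact: le_trans rx r'1.
  by apply: ler_pM; rewrite ?mulr_ge0 // /C lerDl.
have NE : N (x - y s) <= (1 + kap) * ((tau - s) ^+ 2 * (4 * Av)) + (1 + kap^-1) * q.
  have -> : x - y s = (s - tau) *: b + (x - xz).
    by rewrite /y opprD addrA addrC -scaleNr opprB.
  apply: le_trans (N_young _ _) _; apply: lerD; apply: ler_wpM2l => //.
  - by rewrite addr_ge0 // ltW.
  - by rewrite /N ipZl ipZr mulrA -expr2 -sqrrN opprB; apply: ler_wpM2l => //; exact: sqr_ge0.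
  - by rewrite addr_ge0 // invr_ge0 ltW.
have Av0 : 0 <= Av by rewrite -(pmulr_rge0 _ (ltr0n _ 4)); apply: le_trans H4.
rewrite /phi -/(N _); have lD : 0 <= lam / (4 * D s) by rewrite divr_ge0 ?ltW // mulr_gt0.
apply: le_trans (ler_wpM2l lD NE) _; rewrite mulrDr; apply: lerD.
  have -> : lam / (4 * D s) * ((1 + kap) * ((tau - s) ^+ 2 * (4 * Av))) =
      (lam * (1 + kap)) * ((tau - s) / D s) * (Av * (tau - s)) by field; rewrite gt_eqF.
  have ts0 : 0 <= tau - s by rewrite subr_ge0.
  have tsD : (tau - s) / D s <= 1 by rewrite ler_pdivrMr // mul1r /D lerDl ltW.
  rewrite lk -[leRHS]mul1r; apply: ler_wpM2r; first exact: mulr_ge0.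
  by rewrite -[leRHS]mulr1; apply: ler_pM => //; [move: kap_le; lra|rewrite divr_ge0 // ltW|rewrite gerBl ltW].
have k1 : 0 < 1 + kap^-1 by rewrite addr_gt0 // invr_gt0.
have -> : lam / (4 * D s) * ((1 + kap^-1) * q) = lam * (sig / D s) * (eta * tau).
  by rewrite /q; field; rewrite !gt_eqF //= addr_gt0.
rewrite -[leRHS]mul1r; apply: ler_wpM2r; first by rewrite mulr_ge0 // ltW.
rewrite -[leRHS]mulr1; apply: ler_pM => //; [exact: ltW|by rewrite divr_ge0 // ltW|].
by rewrite ler_pdivrMr // mul1r.
Qed.

(** The chart segment from the centre to [p] is an admissible path. Two factors [1 + kap] come from
    comparing metric and field with their frozen values; two more and [(1 - kap)^-1] come from
    [D 0 = (1 + kap) * tau] and from [lam]. The condition on [mu] pays for all of them. *)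
Lemma weight0_Dr mu p : 0 <= mu -> mu <= 1 -> (1 - mu) * (1 + kap) ^+ 4 <= 1 - kap ->
  (1 - mu) * Dr X K (chart_from c xz) p tau <= weight 0 p + eta * tau.
Proof.
move=> mu0 mu1 muk; have K0 := ltW K_gt0; have et0 : 0 <= eta * tau by rewrite mulr_ge0 // ltW.
have DK := Dr_le X (chart_from c xz) p tau K0; have D0 := Dr_ge0 X (chart_from c xz) p tau K0.
have Kcase : K <= weight 0 p -> (1 - mu) * Dr X K (chart_from c xz) p tau <= weight 0 p + eta * tau.
  move=> Kw; apply: le_trans (_ : K <= _); last by apply: le_trans Kw _; rewrite lerDl.
  by rewrite -[leRHS]mul1r; apply: ler_pM => //; [rewrite subr_ge0|rewrite gerBl].
have t00 : 0 <= tau by exact: ltW.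
have [[cp rx]|H] := pselect (chart_dom c p /\ cube xz r (chart_to c p)); last first.
  by apply: Kcase; rewrite weight_out // lerDl.
set x := chart_to c p in rx *.
have wE : weight 0 p = trunc K (phi 0 x) by rewrite /weight extE.
have [Kp|pK] := leP K (phi 0 x); first by apply: Kcase; rewrite wE; apply: trunc_ge.
rewrite wE trunc_id; last exact: ltW.
pose v := x - y 0.
pose B := (1 + kap) * ((1 + kap) * (N v / tau ^+ 2) + (1 + kap^-1) * (eta * kap)).
have HR : reach X (chart_from c xz) p tau (tau * B).
  rewrite -(chart_toK cp) -/x; apply: (reach_cube X_compat sub) => //; first by apply: cube_center; exact: ltW.
  move=> z rz; apply: le_trans (H1b _ rz) _; rewrite /B; apply: ler_wpM2l; first by rewrite addr_ge0 // ltW.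
  have -> : tau^-1 *: (x - xz) - X c z = tau^-1 *: v + (b - X c z).
    have vE : v = (x - xz) - tau *: b by rewrite /v /y subr0 opprD addrA.
    by rewrite vE (scalerBr _ (x - xz)) scalerA mulVf ?gt_eqF // scale1r addrA subrK.
  apply: le_trans (N_young _ _) _; apply: lerD; apply: ler_wpM2l.
  - by rewrite addr_ge0 // ltW.
  - by rewrite /N ipZl ipZr le_eqVlt; apply/orP; left; apply/eqP; field; rewrite gt_eqF.
  - by rewrite addr_ge0 // invr_ge0 ltW.
  - exact: H2.
have k1 : 0 < 1 + kap by rewrite addr_gt0.
have k2 : 0 < 1 - kap by move: kap_le; lra.
have NvE : N v = 4 * tau * (1 + kap) ^+ 2 / (1 - kap) * phi 0 x.
  rewrite /phi -/(N _) -/v /D subr0 /sig /lam; field.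
  by rewrite !gt_eqF // -[X in X + _]mul1r -mulrDl mulr_gt0.
have BE : tau * B / 4 = (1 + kap) ^+ 4 / (1 - kap) * phi 0 x + eta * tau * ((1 + kap) ^+ 2 / 4).
  by rewrite /B NvE; field; rewrite !gt_eqF.
have mu10 : 0 <= 1 - mu by rewrite subr_ge0.
have H := Dr_reach K0 HR; rewrite BE in H.
apply: le_trans (ler_wpM2l mu10 H) _; rewrite mulrDr; apply: lerD.
  have -> : (1 - mu) * ((1 + kap) ^+ 4 / (1 - kap) * phi 0 x) = ((1 - mu) * (1 + kap) ^+ 4 / (1 - kap)) * phi 0 x by field; rewrite gt_eqF.
  rewrite -[leRHS]mul1r; apply: ler_wpM2r; first by apply: phi_ge0; exact: ltW.
  by rewrite ler_pdivrMr // mul1r.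
rewrite mulrCA -[leRHS]mulr1; apply: ler_wpM2l => //.
rewrite -[leRHS]mulr1; apply: ler_pM => //; [by rewrite divr_ge0 // sqr_ge0|by rewrite gerBl|].
rewrite ler_pdivrMr // mul1r; apply: (@le_trans _ _ (2 ^+ 2)); last by rewrite expr2; lra.
by apply: lerXn2r; rewrite ?nnegrE ?(ltW k1) //; move: kap_le; lra.
Qed.

Lemma weight_ge0 s p : s <= tau -> 0 <= weight s p.
Proof.
move=> st; have K0 := ltW K_gt0; rewrite /weight /ext; case: asboolP => _; last by rewrite addr_ge0.
rewrite /weightF /=; have ph := phi_ge0 (chart_to c p) st.
have [Kp|/ltW pK] := leP K (phi s (chart_to c p)); last by rewrite trunc_id.
exact: le_trans (trunc_ge Kp).
Qed.

End Weight.

Lemma norm_sq_le (R : realType) n (w : 'rV[R]_n) B : 0 <= B -> (forall j, w 0 j ^+ 2 <= B) -> `|w| ^+ 2 <= B.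
Proof.
move=> B0 H; rewrite -[leRHS](sqr_sqrtr B0); apply: lerXn2r; rewrite ?nnegrE ?sqrtr_ge0 //.
apply: rV_norm_le => [|j]; first exact: sqrtr_ge0.
by rewrite -sqrtr_sqr ler_wsqrtr.
Qed.

Lemma ip_perturb (R : realType) n (A1 A2 : 'M[R]_n) (w : 'rV[R]_n) d B k : 0 <= d -> 0 <= B ->
  (forall i j, `|A1 i j - A2 i j| <= d) -> `|w| ^+ 2 <= B * ip A2 w w -> 0 <= ip A2 w w ->
  (n * n)%:R * d * B <= k -> ip A1 w w <= (1 + k) * ip A2 w w.
Proof.
move=> d0 B0 Hd Hw N0 Hk.
have E : ip A1 w w = ip (A1 - A2) w w + ip A2 w w.
  by rewrite /ip mulmxBr mulmxBl [in RHS]mxE [X in _ + X + _]mxE subrK.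
have h : `|ip (A1 - A2) w w| <= (n * n)%:R * d * (`|w| * `|w|).
  by apply: ip_norm_le => i j; rewrite !mxE.
rewrite E addrC mulrDl mul1r lerD2l; apply: le_trans (ler_norm _) (le_trans h _).
rewrite -expr2; apply: (@le_trans _ _ ((n * n)%:R * d * (B * ip A2 w w))).
  by apply: ler_wpM2l => //; exact: mulr_ge0.
by rewrite mulrA; apply: ler_wpM2r.
Qed.

(** * Weights with constants uniform over the manifold *)

Section Uniform.
Context {R : realType} {n : nat} {M : ptopologicalType} (G : riemannian R n M).
Hypotheses (M_hausdorff : hausdorff_space M) (M_compact : compact [set: M]).
Variable X : vfield G.
Hypotheses (X_compat : vf_compat X) (X_C1 : vf_C1 X).
Variables (K mu eta : R).
Hypotheses (K_gt0 : 0 < K) (mu_gt0 : 0 < mu) (mu_le1 : mu <= 1) (eta_gt0 : 0 < eta).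

(* gw_step is the Hamilton-Jacobi inequality d_s W + eta >= |grad W|^2 + X . grad W, in discrete form. *)
Record good_weight (Av tau : R) (z : M) (W : R -> M -> R) (B : set M) (C : R) : Prop := GoodWeight {
  gw_closed : closed B;
  gw_nbhs : nbhs z B;
  gw_C1 : forall s, 0 <= s -> s <= tau -> C1M G (W s);
  gw_ge0 : forall s p, s <= tau -> 0 <= W s p;
  gw_Gam : forall s p, 0 <= s -> s <= tau -> carre G (W s) (W s) p <= C;
  gw_step : forall s h p, 0 <= s -> 0 <= h -> s + h <= tau ->
    h * (carre G (W s) (W s) p + pair (W s) X p - eta) - C * h ^+ 2 <= W (s + h) p - W s p;
  gw_near : forall s p, 0 <= s -> s <= tau -> B p -> W s p <= Av * (tau - s) + eta * tau;
  gw_Dr : forall p, (1 - mu) * Dr X K z p tau <= W 0 p + eta * tau }.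

Let kap := mu / 8.
Let kap_gt0 : 0 < kap. Proof. by rewrite divr_gt0. Qed.
Let kap_le : kap <= 1 / 8. Proof. by rewrite ler_wpM2r. Qed.
Let mu_kap : (1 - mu) * (1 + kap) ^+ 4 <= 1 - kap.
Proof.
have -> : mu = 8 * kap by rewrite /kap; field.
have k0 := kap_gt0; have k8 := kap_le; rewrite -subr_ge0.
have -> : 1 - kap - (1 - 8 * kap) * (1 + kap) ^+ 4 =
  kap * (3 + 26 * kap + 44 * kap ^+ 2 + 31 * kap ^+ 3 + 8 * kap ^+ 4) by ring.
apply: mulr_ge0; first exact: ltW.
by rewrite !addr_ge0 // mulr_ge0 // ?exprn_ge0 // ltW.
Qed.

Lemma good_weight_local (p0 : M) : exists U tau0 Av, [/\ nbhs p0 U, 0 < tau0, 0 <= Av &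
  forall z tau, U z -> 0 < tau -> tau <= tau0 -> exists W B C, good_weight Av tau z W B C].
Proof.
have cp := chart_atP G p0; set c := chart_at G p0 in cp; set xp := chart_to c p0.
have [rho1 rho10 sub1] := chart_cube (chart_codP cp) (@filterT _ (nbhs xp) _).
pose rho := rho1 / 3; have rho0 : 0 < rho by rewrite divr_gt0.
have sub3 : cube xp (3 * rho) `<=` chart_cod c.
  have r13 : 3 * rho = rho1 by rewrite /rho; field.
  have le3 : 3 * rho <= rho1 + rho1 by rewrite r13 lerDl ltW.
  by move=> y ry; have [] := sub1 y (cube_le le3 ry).
have sub : cube xp rho `<=` chart_cod c by move=> y ry; apply: sub3; apply: cube_le ry; rewrite ler_peMl ?ltW //; lra.
have [L L0 lipX] := C1_lipschitz X_C1 rho0 sub3.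
have [Lg Lg0 lipg] : exists2 Lg, 0 < Lg & forall i j y z, cube xp rho y -> cube xp rho z ->
    `|metric c y i j - metric c z i j| <= Lg * `|y - z|.
  have [|i|Lg Lg0 H] := @fin_bound _ n (fun i L => forall j y z, cube xp rho y -> cube xp rho z ->
      `|metric c y i j - metric c z i j| <= L * `|y - z|).
  - by move=> i B B' BB' H j y z ry rz; apply: le_trans (H j y z ry rz) _; apply: ler_wpM2r.
  - pose Y : vfield G := fun d y => \row_k metric d y i k.
    have YC : vf_C1 Y.
      move=> d j; apply: (@C1_on_eq _ _ _ (@chart_cod_open _ _ _ _ d) (fun z => metric d z i j)).
        by move=> z _; rewrite mxE.
      exact: (C1_of_Ck (@chart_cod_open _ _ _ _ d) (metric_smooth d i j 1)).
    have [L' _ H] := C1_lipschitz YC rho0 sub3; exists L' => j y z ry rz.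
    by have := H j y z ry rz; rewrite !mxE.
  - by exists Lg.
have [B0 B00 coordB] := metric_coord_bound sub.
have [Bm Bm0 HBm] := metric_bound sub; have [BX BX0 HBX] := vf_bound X_C1 (ltW rho0) sub.
pose Av := (n * n)%:R * Bm * (BX * BX).
have Av0 : 0 <= Av by rewrite !mulr_ge0 // ltW.
pose C1 := (n * n)%:R * Lg * B0 + 1; have C10 : 0 < C1 by rewrite ltr_wpDl // !mulr_ge0 // ltW.
pose C2 := (n * n)%:R * Bm * (L * L) + 1; have C20 : 0 < C2 by rewrite ltr_wpDl // !mulr_ge0 // ltW.
have rho20 : 0 < rho / 2 by rewrite divr_gt0.
(* The last two bounds make the oscillation over the cube at most [kap] for the metric, relatively,
   and at most [eta * kap] for the squared norm of the field. *)
pose r := Num.min (rho / 2) (Num.min 1 (Num.min (kap / C1) (eta * kap / C2))).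
have ek0 : 0 < eta * kap by rewrite mulr_gt0.
have r0 : 0 < r by rewrite !lt_min rho20 ltr01 !divr_gt0.
have r1 : r <= rho / 2 by rewrite ge_min lexx.
have r2 : r <= 1 by rewrite !ge_min lexx orbT.
have r3 : C1 * r <= kap by rewrite mulrC -ler_pdivlMr // /r !ge_min lexx !orbT.
have r4 : C2 * r <= eta * kap by rewrite mulrC -ler_pdivlMr // /r !ge_min lexx !orbT.
(* The last two bounds confine the sublevel set of the quadratic function, and the motion of its
   centre, to half the cube each. *)
pose tau0 := Num.min 1 (Num.min ((r / 2) ^+ 2 / (B0 * (8 * (K + 1)))) (r / 2 / BX)).
have K10 : 0 < K + 1 by rewrite addr_gt0.
have Q0 : 0 < B0 * (8 * (K + 1)) by rewrite !mulr_gt0.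
have tau00 : 0 < tau0 by rewrite !lt_min ltr01 !divr_gt0 // exprn_gt0 // divr_gt0.
have rho2 : rho / 2 <= rho by rewrite ler_pdivrMr // ler_peMr ?ltW //; lra.
exists (patch_cube c xp (rho / 2)), tau0, Av; split=> //.
  apply: patch_cube_nbhs => // y ry; exact/sub/(cube_le rho2).
move=> z tau [xz rxz <-] tau_gt0 tt0.
have t1 : tau <= 1 by apply: le_trans tt0 _; rewrite ge_min lexx.
have t2 : B0 * (8 * (K + 1) * tau) <= (r / 2) ^+ 2.
  by rewrite mulrA mulrC -ler_pdivlMr // (le_trans tt0) // !ge_min lexx orbT.
have rxz' : cube xp rho xz by exact: cube_le rxz.
have big y : cube xz r y -> cube xp rho y.
  move=> ry k; have := ry k; have := rxz k; move: (y 0 k) (xz 0 k) (xp 0 k) => a b e h1 h2.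
  have -> : a - e = (a - b) + (b - e) by ring.
  apply: le_trans (ler_normD _ _) _; apply: le_trans (lerD h2 h1) _; move: r1; lra.
have cxz : cube xz r xz by exact/cube_center/ltW.
have subz : cube xz r `<=` chart_cod c by move=> y /big /sub.
have near_r y : cube xz r y -> `|y - xz| <= r by move/(cubeE _ _ (ltW r0)).
have H3 y w : cube xp rho y -> `|w| ^+ 2 <= B0 * norm_sq c y w.
  move=> ry; apply: norm_sq_le => [|j]; last exact: coordB.
  by rewrite mulr_ge0 ?(ltW B00) //; apply: ip_ge0; apply: metric_posdef; exact: sub.
have N0 y w : cube xp rho y -> 0 <= norm_sq c y w by move=> ry; apply: ip_ge0; apply: metric_posdef; exact: sub.
have hk : (n * n)%:R * (Lg * r) * B0 <= kap.
  apply: le_trans r3; have -> : (n * n)%:R * (Lg * r) * B0 = ((n * n)%:R * Lg * B0) * r by ring.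
  by apply: ler_wpM2r; [exact: ltW|rewrite /C1 lerDl].
have Lr0 : 0 <= Lg * r by rewrite mulr_ge0 // ltW.
have H1a y w : cube xz r y -> ip (metric c xz) w w <= (1 + kap) * norm_sq c y w.
  move=> ry; apply: (ip_perturb Lr0 (ltW B00) _ (H3 y w (big y ry)) (N0 y w (big y ry)) hk) => i j.
  apply: le_trans (lipg i j _ _ rxz' (big y ry)) _; rewrite distrC.
  by apply: ler_wpM2l; [exact: ltW|exact: near_r].
have H1b y w : cube xz r y -> norm_sq c y w <= (1 + kap) * ip (metric c xz) w w.
  move=> ry; apply: (ip_perturb Lr0 (ltW B00) _ (H3 xz w rxz') (N0 xz w rxz') hk) => i j.
  apply: le_trans (lipg i j _ _ (big y ry) rxz') _.
  by apply: ler_wpM2l; [exact: ltW|exact: near_r].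
have H2 y : cube xz r y -> ip (metric c xz) (X c xz - X c y) (X c xz - X c y) <= eta * kap.
  move=> ry; apply: le_trans (ler_norm _) _.
  apply: le_trans (ip_norm_le _ _ (fun i j => HBm i j xz rxz')) _.
  have hX : `|X c xz - X c y| <= L * r.
    apply: rV_norm_le => [|j]; first by rewrite mulr_ge0 // ltW.
    rewrite !mxE; apply: le_trans (lipX j _ _ rxz' (big y ry)) _; rewrite distrC.
    by apply: ler_wpM2l; [exact: ltW|exact: near_r].
  apply: le_trans (_ : (n * n)%:R * Bm * (L * r * (L * r)) <= _).
    by apply: ler_wpM2l; [rewrite mulr_ge0 // ltW|exact: ler_pM].
  apply: le_trans r4; have -> : (n * n)%:R * Bm * (L * r * (L * r)) = ((n * n)%:R * Bm * (L * L)) * (r * r) by ring.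
  apply: ler_pM; rewrite ?mulr_ge0 ?(ltW r0) ?(ltW Bm0) ?(ltW L0) //; first by rewrite /C2 lerDl.
  by rewrite ler_piMr // ltW.
have H4 : ip (metric c xz) (X c xz) (X c xz) <= 4 * Av.
  apply: le_trans (ler_norm _) _; apply: le_trans (ip_norm_le _ _ (fun i j => HBm i j xz rxz')) _.
  apply: (@le_trans _ _ Av); last by rewrite ler_peMl //; lra.
  by apply: ler_wpM2l; [rewrite mulr_ge0 // ltW|apply: ler_pM => //; exact: HBX].
have H6 : tau * `|X c xz| <= r / 2.
  apply: (@le_trans _ _ (tau * BX)); first by apply: ler_wpM2l; [exact: ltW|exact: HBX].
  by rewrite -ler_pdivlMr // (le_trans tt0) // !ge_min lexx !orbT.
have H3' w : `|w| ^+ 2 <= B0 * ip (metric c xz) w w by exact: H3.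
have k0 := kap_gt0; have k8 := kap_le.
pose C := (n * n)%:R * (\sum_i \sum_j `|metric c xz i j|) *
  ((2 * r + `|X c xz|) * (2 * r + `|X c xz|)) / (kap * tau) ^+ 2.
have Wstep := weight_step M_hausdorff X_compat r0 subz K_gt0 k0 k8 eta_gt0 tau_gt0 t1 H1a H2 B00 H3' t2 H6.
have WGam := weight_Gam_le M_hausdorff r0 subz K_gt0 k0 k8 tau_gt0 t1 H1a B00 H3' t2 H6.
have WC1 := weight_C1 M_hausdorff r0 subz K_gt0 k0 k8 tau_gt0 B00 H3' t2 H6.
have WDr := weight0_Dr X_compat r0 subz K_gt0 k0 k8 eta_gt0 tau_gt0 H1b H2 B00 H3' t2 H6.
have [r' r'0 [r'r Wnear]] := weight_near K r0 subz k0 k8 eta_gt0 tau_gt0 H4.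
have sub' : cube xz r' `<=` chart_cod c by move=> y ry; apply: subz; exact: cube_le ry.
have cz : chart_dom c (chart_from c xz) by exact/chart_from_dom/sub.
have zE : chart_to c (chart_from c xz) = xz by rewrite chart_fromK //; exact: sub.
exists (weight X c xz K kap tau), (patch_cube c xz r'), (Num.max C (C ^+ 2)).
have CC : C <= Num.max C (C ^+ 2) by rewrite le_max lexx.
have CC2 : C ^+ 2 <= Num.max C (C ^+ 2) by rewrite le_max lexx orbT.
split.
- exact: patch_cube_closed.
- by have := patch_cube_nbhs cz r'0; rewrite zE; apply.
- by move=> s s0 st; exact (WC1 s s0 st).
- by move=> s p st; exact: (weight_ge0 X r0 subz K_gt0 k0 k8 tau_gt0).
- by move=> s p s0 st; have /andP[_ H] := WGam s p s0 st; exact: le_trans CC.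
- move=> s h p s0 h0 sht; apply: le_trans (Wstep s h p s0 h0 sht).
  by rewrite lerD2l lerN2; apply: ler_wpM2r; [exact: sqr_ge0|exact: CC2].
- move=> s p s0 st [y ry <-]; apply: Wnear => //; first exact/chart_from_dom/sub'.
  by rewrite chart_fromK //; exact: sub'.
- by move=> p; apply: WDr => //; exact: ltW.
Qed.

Lemma good_weight_Av Av Av' tau z W B C : Av <= Av' -> good_weight Av tau z W B C -> good_weight Av' tau z W B C.
Proof.
move=> AA [? ? ? ? ? ? H ?]; split=> // s p s0 st Bp; apply: le_trans (H s p s0 st Bp) _.
by rewrite lerD2r; apply: ler_wpM2r; rewrite ?subr_ge0.
Qed.

Lemma seq_min_gt0 (I : eqType) (s : seq I) (t : I -> R) : (forall i, i \in s -> 0 < t i) ->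
  exists2 t0, 0 < t0 & forall i, i \in s -> t0 <= t i.
Proof.
elim: s => [|i s IH] H; first by exists 1.
have [j js|t0 t00 Ht0] := IH; first by apply: H; rewrite inE js orbT.
exists (Num.min (t i) t0); first by rewrite lt_min t00 H ?mem_head.
by move=> j; rewrite inE => /orP[/eqP->|/Ht0 le]; [rewrite ge_min lexx|rewrite ge_min le orbT].
Qed.

Lemma good_weight_exists : exists tau0 Av, [/\ 0 < tau0, 0 <= Av &
  forall z tau, 0 < tau -> tau <= tau0 -> exists W B C, good_weight Av tau z W B C].
Proof.
have /choice[UTA H] (p : M) : exists UTA : set M * (R * R), [/\ nbhs p UTA.1, 0 < UTA.2.1, 0 <= UTA.2.2 &
  forall z tau, UTA.1 z -> 0 < tau -> tau <= UTA.2.1 -> exists W B C, good_weight UTA.2.2 tau z W B C].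
  by have [U [t [A HU]]] := good_weight_local p; exists (U, (t, A)).
have [s [_ cov]] := @compact_nbhs_cover M setT (fun p => (UTA p).1) M_compact
  (fun p _ => let: And4 h _ _ _ := H p in h).
have [tau0 tau00 Htau] := @seq_min_gt0 M s (fun p => (UTA p).2.1) (fun p _ => let: And4 _ h _ _ := H p in h).
exists tau0, (\sum_(p <- s) (UTA p).2.2); split=> //.
  by apply: sumr_ge0 => p _; have [] := H p.
move=> z tau tau_gt0 tt0; have [p ps Up] := cov z I.
have [_ _ _ Hp] := H p; have [W [B [C gw]]] := Hp z tau Up tau_gt0 (le_trans tt0 (Htau p ps)).
exists W, B, C; apply: good_weight_Av gw.
rewrite (big_rem p) //= lerDl; apply: sumr_ge0 => q _; by have [] := H q.
Qed.
End Uniform.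

(** * Weighted energy estimates *)

(** From [exp (- x) <= (1 + x)^-1]. In [2 * C1 + 1] the 2 bounds [1 + (a - b)] and the 1 pays for
    the errors of order [h ^+ 2]. *)
Lemma exp_step (R : realType) (a b h A B C1 : R) : 0 <= h -> h <= 1 -> 0 <= A -> 0 <= B -> 0 <= C1 ->
  `|a| <= A * h -> b = B * h ^+ 2 -> h * (A ^+ 2 + B + A * B) <= 1 -> h * (A + B) <= 2^-1 ->
  (2 * C1 + 1) * h <= 2^-1 -> (1 - (2 * C1 + 1) * h) * expR (- (a - b)) <= 1 - a - h * C1.
Proof.
move=> h0 h1 A0 B0 C0 aA bE H1 H2 H3.
have hh : h ^+ 2 <= h by rewrite expr2 -[leRHS]mulr1 ler_wpM2l.
have b0 : 0 <= b by rewrite bE mulr_ge0 ?sqr_ge0.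
have bB : b <= B * h by rewrite bE; apply: ler_wpM2l.
have [a1 a2] : - (A * h) <= a /\ a <= A * h by move: aA; rewrite ler_norml => /andP.
have y0 : 0 < 1 + (a - b).
  by move: H2; rewrite mulrDr (mulrC h A) (mulrC h B); lra.
have y2 : 1 + (a - b) <= 2.
  have Bh : 0 <= B * h by exact: mulr_ge0.
  by move: H2; rewrite mulrDr (mulrC h A) (mulrC h B); lra.
apply: (@le_trans _ _ ((1 - (2 * C1 + 1) * h) * (1 + (a - b))^-1)).
  apply: ler_wpM2l; first by move: H3; lra.
  by rewrite expRN lef_pV2 ?posrE ?expR_gt0 // expR_ge1Dx.
rewrite ler_pdivrMr //.
have e1 : a ^+ 2 <= A ^+ 2 * h ^+ 2.
  rewrite -exprMn -(real_normK (num_real a)); apply: lerXn2r => //; rewrite nnegrE //; exact: mulr_ge0.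
have e2 : - (a * b) <= A * h * (B * h ^+ 2).
  rewrite -bE -mulNr; apply: ler_wpM2r => //; move: a1; lra.
have e2' : A * h * (B * h ^+ 2) <= A * B * h ^+ 2.
  have -> : A * h * (B * h ^+ 2) = h * (A * B * h ^+ 2) by ring.
  by rewrite ler_piMl // !mulr_ge0 // sqr_ge0.
have e3 : h * C1 * (1 + (a - b)) <= h * C1 * 2 by apply: ler_wpM2l => //; exact: mulr_ge0.
have e4 : h * (h * (A ^+ 2 + B + A * B)) <= h * 1 by apply: ler_wpM2l.
have -> : (1 - a - h * C1) * (1 + (a - b)) = 1 - b - a ^+ 2 + a * b - h * C1 * (1 + (a - b)) by ring.
have e4' : A ^+ 2 * h ^+ 2 + B * h ^+ 2 + A * B * h ^+ 2 <= h.
  have -> : A ^+ 2 * h ^+ 2 + B * h ^+ 2 + A * B * h ^+ 2 = h * (h * (A ^+ 2 + B + A * B)) by ring.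
  by rewrite mulr1 in e4.
rewrite -bE in e4'; move: e1 e2 e2' e3 e4'.
have -> : (2 * C1 + 1) * h = h * C1 * 2 + h by ring.
move: (A ^+ 2 * h ^+ 2) (A * B * h ^+ 2) (A * h * (B * h ^+ 2)) (h * C1 * (1 + (a - b))) (h * C1 * 2) => t1 t2 t3 t4 t5.
move: (a ^+ 2) (a * b) => t6 t7; lra.
Qed.

Section Energy.
Context {R : realType} {n : nat} {M : ptopologicalType} (G : riemannian R n M).
Hypotheses (M_hausdorff : hausdorff_space M) (M_compact : compact [set: M]).
Variables (mu : {measure set (borel M) -> \bar R}) (mu_volume : is_volume G mu).
Variables (f : M -> R) (fC : Ck G 3 f) (q : M -> R) (Q : R).
Hypotheses (mq : measurable_fun setT (q : borel M -> R)) (qQ : forall p, `|q p| <= Q).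
Notation X := (grad f (G := G)).
Notation Gam := (carre G).
Notation C1M := (C1M G).
Notation bmf := (@bmf R M).
Let fC1 : C1M f. Proof. exact: C1M_Ck fC. Qed.
Let X_compat : vf_compat X. Proof. exact: grad_compat. Qed.

Section Exponential.
Variables (k a : R) (W : M -> R).
Hypothesis WC : C1M W.
Let V p := - k * (W p + a).
Let rho p := expR (V p).

Let V_C1 : C1M V. Proof. by apply: C1MZ; apply: C1MD => //; exact: C1M_cst. Qed.
Lemma exp_C1 : C1M rho.
Proof.
apply: (@C1M_comp _ _ _ G expR expR V) => // p; exact: continuous_expR.
Qed.

Let affD x : is_derive x (1 : R) (fun x => - k * (x + a)) (- k).
Proof.
apply: (@is_derive_quadratic _ _ _ _ 0) => // h; rewrite mul0r.
by rewrite (_ : - k * (x + h + a) - - k * (x + a) - h * - k = 0) ?normr0 //; ring.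
Qed.

Lemma exp_Gam p : Gam rho rho p = k ^+ 2 * rho p ^+ 2 * Gam W W p.
Proof.
have -> : Gam rho rho p = expR (V p) ^+ 2 * Gam V V p.
  by apply: (@Gam_comp2 _ _ _ G expR expR V) => // x; exact: continuous_expR.
have -> : Gam V V p = (- k) ^+ 2 * Gam W W p.
  by apply: (@Gam_comp2 _ _ _ G (fun x => - k * (x + a)) (fun=> - k) W) => // x; exact: cst_continuous.
by rewrite sqrrN mulrA (mulrC _ (k ^+ 2)).
Qed.

Lemma exp_pair p : pair rho X p = - k * rho p * pair W X p.
Proof.
rewrite (@pair_comp _ _ _ G X X_compat expR (expR (V p)) V) //; last exact exp_C1.
rewrite (pair_comp X_compat (affD (W p)) WC V_C1).
by rewrite /rho; ring.
Qed.
End Exponential.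

Variables (K mm eta T : R).
Hypotheses (K_gt0 : 0 < K) (eta_gt0 : 0 < eta) (T_ge0 : 0 <= T).
Let Q_ge0 : 0 <= Q. Proof. by apply: le_trans (qQ point). Qed.

(** The Agmon weight. The added [eta * s] compensates the error [eta] of [gw_step], so that only an
    error of second order in the step remains. *)
Definition rho (eps : R) (W : R -> M -> R) s p := expR (- (2 / eps) * (W s p + eta * s)).

Lemma div_bound : exists2 C1, 0 <= C1 & forall p, `|divergence X p| <= C1.
Proof.
have XC : vf_C1 X := grad_C1 fC.
have [B B0 HB] := cont_bound M_compact (divergence_cont M_hausdorff M_compact mu_volume X_compat XC).
by exists B; [exact: ltW|].
Qed.

Variables (C1 : R).
Hypotheses (C1_ge0 : 0 <= C1) (C1P : forall p, `|divergence X p| <= C1).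
Let c1 := 2 * C1 + 1.
Definition growth := expR (2 * (Q + c1) * T).

(** [weighted_iter] for the weights [rho], whose step hypothesis is [exp_step] with [a] the
    Hamiltonian and [b] the quadratic error. The threshold [h1] and the error [Err] depend on [eps],
    but the factor [growth] does not. *)
Lemma discrete_step Av tau z W B C eps u0 : good_weight X K mm eta Av tau z W B C ->
  0 <= tau -> 0 < eps -> C1M u0 -> (forall p, 0 <= u0 p) ->
  exists h1 Err : R, [/\ 0 < h1, 0 <= Err & forall dt u k0 J, 0 < dt -> dt <= 1 -> dt <= h1 ->
    rothe G mu f q eps dt u0 u -> J%:R * dt <= tau -> (k0 + J)%:R * dt <= T ->
    \int[mu]_p (u (k0 + J)%N p ^+ 2 * rho eps W (J%:R * dt) p) <=
    growth * (\int[mu]_p (u k0 p ^+ 2 * rho eps W 0 p) + Err * dt)].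
Proof.
move=> gw tau0 eps0 u0C u00; pose k := 2 / eps; have k0' : 0 < k by rewrite divr_gt0.
have Cn : 0 <= C.
  by apply: le_trans (gw_Gam gw point (lexx 0) tau0); apply: Gam_ge0; exact (gw_C1 gw (lexx 0) tau0).
have [Bf Bf0 HBf] := cont_bound M_compact (Gam_cont fC1 fC1).
pose A := C + (C + Bf) / 2; have A0 : 0 <= A by rewrite addr_ge0 // divr_ge0 // addr_ge0 // ltW.
have gA s p : 0 <= s -> s <= tau -> `|Gam (W s) (W s) p + pair (W s) X p| <= A.
  move=> s0 st; have WC := gw_C1 gw s0 st; have GC := gw_Gam gw p s0 st.
  have G0 := @Gam_ge0 _ _ _ G (W s) p WC.
  have := @Gam_young _ _ _ G (W s) f p 1 1 WC fC1; have := @Gam_young _ _ _ G (W s) f p 1 (-1) WC fC1.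
  have := HBf p; rewrite (_ : pair (W s) X p = Gam (W s) f p) // /A.
  move/(le_trans (ler_norm _)); rewrite !expr1n sqrrN !expr1n !mul1r ler_norml.
  move: (Gam (W s) f p) (Gam (W s) (W s) p) G0 GC (Gam f f p) => x y y0 yC w wB h1 h2.
  by apply/andP; split; lra.
pose A' := k * A; pose B' := k * C.
have A'0 : 0 <= A' by rewrite mulr_ge0 // ltW. have B'0 : 0 <= B' by rewrite mulr_ge0 // ltW.
pose D1 := A' ^+ 2 + B' + A' * B' + 1; have D10 : 0 < D1 by rewrite ltr_wpDl // !addr_ge0 ?sqr_ge0 // mulr_ge0.
pose D2 := A' + B' + c1; have c10 : 0 < c1 by rewrite ltr_wpDl // mulr_ge0.
have D20 : 0 < D2 by rewrite ltr_wpDl // addr_ge0.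
have wC : C1M (wt f eps) := wt_C1 fC eps.
have iC : C1M (fun p => (wt f eps p)^-1) by apply: C1MV => // p; rewrite gt_eqF // wt_gt0.
have [Bi Bi0 HBi] := cont_bound M_compact (C1M_cont iC).
have [Bg Bg0 HBg] := cont_bound M_compact (Gam_cont iC iC).
pose BB := Bi ^+ 2 + 2 * (Bg + Bi ^+ 2 * (k ^+ 2 * C)).
pose Err := 2 * T * (1 + 2 * (BB * (12 + 16 * eps) * KPhi G mu f Q eps u0 T)).
exists (Num.min D1^-1 (2^-1 / D2)), `|Err|; split=> //.
  by rewrite lt_min invr_gt0 D10 divr_gt0 // invr_gt0.
move=> dt u k0 J dt0 dt1; rewrite le_min => /andP[dtD1 dtD2] Hu JT kT.
have sI i : (i <= J)%N -> 0 <= i%:R * dt /\ i%:R * dt <= tau.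
  move=> iJ; split; first by rewrite mulr_ge0 // ltW.
  by apply: le_trans JT; rewrite ler_wpM2r ?ler_nat // ltW.
have c1dt : c1 * dt <= 2^-1.
  apply: (@le_trans _ _ (D2 * dt)); last by rewrite mulrC -ler_pdivlMr.
  by apply: ler_wpM2r; [exact: ltW|rewrite /D2 lerDr addr_ge0].
have := @weighted_iter _ _ _ G M_hausdorff M_compact mu mu_volume f fC q Q eps mq qQ eps0
  (fun i => rho eps W (i%:R * dt)) BB C1 c1 T dt u0 u k0 J dt0 dt1 u0C u00 Hu T_ge0 kT (ltW c10) c1dt C1_ge0 C1P.
rewrite mul0r => H; apply: le_trans (H _ _) _; last first.
- by apply: ler_wpM2l; [exact: expR_ge0|rewrite lerD2l; apply: ler_wpM2r; [exact: ltW|exact: ler_norm]].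
- move=> i p iJ; have [s0 st] := sI i (ltnW iJ); have [_ st'] := sI i.+1 iJ.
  have sE : i.+1%:R * dt = i%:R * dt + dt by rewrite -natr1 mulrDl mul1r.
  rewrite sE in st' *; set s := i%:R * dt in s0 st st' *.
  have WC := gw_C1 gw s0 st; have r0 : 0 < rho eps W s p by exact: expR_gt0.
  pose g := Gam (W s) (W s) p + pair (W s) X p.
  have HE : Hrho G f eps (rho eps W s) p = k * rho eps W s p * g.
    rewrite /Hrho (_ : Gam _ _ p = k ^+ 2 * rho eps W s p ^+ 2 * Gam (W s) (W s) p); last exact: exp_Gam.
    rewrite (_ : pair _ _ p = - k * rho eps W s p * pair (W s) X p); last exact: exp_pair.
    by rewrite /g /k; field; rewrite !gt_eqF.
  rewrite HE; have stp := gw_step gw p s0 (ltW dt0) st'.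
  have rE : rho eps W (s + dt) p <= rho eps W s p * expR (- (k * dt * g - B' * dt ^+ 2)).
    rewrite /rho -expRD ler_expR -/k.
    have := ler_wpM2l (ltW k0') stp; rewrite -/g /B'.
    have -> : k * (dt * (g - eta) - C * dt ^+ 2) = k * dt * g - k * C * dt ^+ 2 - k * (eta * dt) by ring.
    have -> : - k * (W (s + dt) p + eta * (s + dt)) = - (k * (W (s + dt) p - W s p)) + - k * (W s p + eta * s) - k * (eta * dt) by ring.
    by move: (k * (W (s + dt) p - W s p)) (- k * _) (k * dt * g) (k * C * dt ^+ 2) (k * (eta * dt)) => *; lra.
  have := @exp_step _ (k * dt * g) (B' * dt ^+ 2) dt A' B' C1 (ltW dt0) dt1 A'0 B'0 C1_ge0 _ erefl _ _ c1dt.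
  have h1 : `|k * dt * g| <= A' * dt.
    rewrite normrM (ger0_norm (mulr_ge0 (ltW k0') (ltW dt0))) /A' mulrAC; apply: ler_wpM2r; first exact: ltW.
    by apply: ler_wpM2l; [exact: ltW|exact: gA].
  have h2 : dt * (A' ^+ 2 + B' + A' * B') <= 1.
    apply: le_trans (_ : dt * D1 <= _); first by apply: ler_wpM2l; [exact: ltW|rewrite /D1 lerDl].
    by rewrite -ler_pdivlMr // div1r.
  have h3 : dt * (A' + B') <= 2^-1.
    apply: le_trans (_ : dt * D2 <= _); first by apply: ler_wpM2l; [exact: ltW|rewrite /D2 lerDl ltW].
    by rewrite -ler_pdivlMr.
  move=> /(_ h1 h2 h3) E.
  have c1dt' : 0 <= 1 - c1 * dt by move: c1dt; lra.
  apply: le_trans (ler_wpM2l c1dt' rE) _.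
  rewrite mulrCA; apply: le_trans (ler_wpM2l (ltW r0) E) _.
  by rewrite le_eqVlt; apply/orP; left; apply/eqP; ring.
- move=> i iJ; have [s0 st] := sI i iJ; set s := i%:R * dt in s0 st *.
  have WC := gw_C1 gw s0 st; have rC : C1M (rho eps W s) by exact: exp_C1.
  have r1 p : rho eps W s p <= 1.
    have H0 : 0 <= k * (W s p + eta * s).
      apply: mulr_ge0; first exact: ltW.
      by apply: addr_ge0; [exact: (gw_ge0 gw)|apply: mulr_ge0 => //; exact: ltW].
    by rewrite /rho -[leRHS]expR0 ler_expR -/k mulNr oppr_le0.
  have r0 p : 0 < rho eps W s p by exact: expR_gt0.
  have BiB p : (wt f eps p)^-1 ^+ 2 <= Bi ^+ 2.
    rewrite -(real_normK (num_real (wt f eps p)^-1)); apply: lerXn2r; rewrite ?nnegrE ?(ltW Bi0) //; exact: HBi.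
  have r2 p : rho eps W s p ^+ 2 <= 1 by apply: exprn_ile1; [exact: ltW|exact: r1].
  split=> // p.
  + rewrite exprMn; apply: (@le_trans _ _ (1 * Bi ^+ 2)).
      by apply: ler_pM; rewrite ?sqr_ge0.
    by rewrite mul1r /BB lerDl mulr_ge0 // addr_ge0 ?(ltW Bg0) // mulr_ge0 ?sqr_ge0 // mulr_ge0 ?sqr_ge0.
  + have := @GamM_le _ _ _ G (rho eps W s) (fun p => (wt f eps p)^-1) p rC iC.
    move/le_trans; apply; apply: le_trans (_ : 2 * (Bg + Bi ^+ 2 * (k ^+ 2 * C)) <= _); last by rewrite /BB lerDr sqr_ge0.
    apply: ler_wpM2l => //; apply: lerD.
      rewrite -[leRHS]mul1r; apply: ler_pM; rewrite ?sqr_ge0 //; first exact: Gam_ge0.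
      exact: le_trans (ler_norm _) (HBg p).
    apply: ler_pM; rewrite ?sqr_ge0 //; first exact: Gam_ge0.
    rewrite (_ : Gam _ _ p = k ^+ 2 * rho eps W s p ^+ 2 * Gam (W s) (W s) p); last exact: exp_Gam.
    rewrite -mulrA; apply: ler_wpM2l; first exact: sqr_ge0.
    rewrite -[leRHS]mul1r; apply: ler_pM; rewrite ?sqr_ge0 //; first exact: Gam_ge0.
    exact: (gw_Gam gw p s0 st).
Qed.

(** The field [sc_align] makes every multiple of [tau] a grid time, so that consecutive short steps
    join without rounding. *)
Record scheme (tau eps : R) (u0 : M -> R) (U : set_system nat) (dt : nat -> R)
    (u : nat -> nat -> M -> R) : Prop := Scheme {
  sc_eps : 0 < eps;
  sc_C1 : C1M u0;
  sc_ge0 : forall p, 0 <= u0 p;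
  sc_ultra : UltraFilter U;
  sc_oo : \oo `<=` U;
  sc_dt0 : forall j, 0 < dt j;
  sc_dt1 : forall j, dt j <= 1;
  sc_cvg : dt @ \oo --> (0 : R);
  sc_rothe : forall j, rothe G mu f q eps (dt j) u0 (u j);
  sc_align : forall j, exists N : nat, N%:R * dt j = tau }.

Section Limit.
Variables (tau eps : R) (u0 : M -> R) (U : set_system nat) (dt : nat -> R) (u : nat -> nat -> M -> R).
Hypothesis S : scheme tau eps u0 U dt u.

(** The limit of the energies of the scheme. It may exceed the energy of the weak limit, but unlike
    the latter it is an upper bound at one step and an initial value at the next. *)
Definition Sf_lim t (g : M -> R) := ulim U (fun j => \int[mu]_p (uu dt u t j p ^+ 2 * g p)).

Lemma uu_bmf t j : bmf (uu dt u t j).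
Proof. exact: (u_bmf M_compact (sc_C1 S) (sc_rothe S)). Qed.

Lemma E_bdd t g : bmf g -> bdd (fun j => \int[mu]_p (uu dt u t j p ^+ 2 * g p)).
Proof.
move=> Hg; have [C C0 HC] := uu_L2 M_hausdorff M_compact mu_volume fC mq qQ (sc_eps S) (sc_C1 S) (sc_dt0 S) (sc_dt1 S) (sc_rothe S) t.
have [_ [B HB]] := Hg; exists (`|B| * C) => j; have Hu := bmfX (uu_bmf t j).
apply: le_trans (I_norm M_hausdorff M_compact mu_volume (bmfM Hu Hg)) _.
apply: (@le_trans _ _ (\int[mu]_p (`|B| * uu dt u t j p ^+ 2))).
  apply: (I_le M_hausdorff M_compact mu_volume).
  - by have [mg [A HA]] := bmfM Hu Hg; split; [exact: measurableT_comp|exists A => p; rewrite normr_id].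
  - exact: bmfZ.
  - move=> p; rewrite normrM (ger0_norm (sqr_ge0 _)) mulrC; apply: ler_wpM2r; first exact: sqr_ge0.
    exact: le_trans (HB p) (ler_norm _).
rewrite (I_Z M_hausdorff M_compact mu_volume) //; apply: ler_wpM2l => //; exact: HC.
Qed.

Lemma Sf_le t g h : bmf g -> bmf h -> (forall p, g p <= h p) -> Sf_lim t g <= Sf_lim t h.
Proof.
move=> Hg Hh gh; apply: (ulim_le (sc_ultra S)); try exact: E_bdd.
move=> j; apply: (I_le M_hausdorff M_compact mu_volume).
- by apply: bmfM => //; apply: bmfX; exact: uu_bmf.
- by apply: bmfM => //; apply: bmfX; exact: uu_bmf.
- by move=> p; apply: ler_wpM2l => //; exact: sqr_ge0.
Qed.

Lemma SfZ t a g : bmf g -> Sf_lim t (fun p => a * g p) = a * Sf_lim t g.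
Proof.
move=> Hg; rewrite /Sf_lim -(ulimZ (sc_ultra S)); last exact: E_bdd.
congr (ulim U _); apply/funext => j.
rewrite -(I_Z M_hausdorff M_compact mu_volume); last by apply: bmfM => //; apply: bmfX; exact: uu_bmf.
by apply: I_eq => p; ring.
Qed.

Lemma SfD t g h : bmf g -> bmf h -> Sf_lim t (fun p => g p + h p) = Sf_lim t g + Sf_lim t h.
Proof.
move=> Hg Hh; rewrite /Sf_lim -(ulimD (sc_ultra S)); try exact: E_bdd.
congr (ulim U _); apply/funext => j.
rewrite -(I_D M_hausdorff M_compact mu_volume); try by apply: bmfM => //; apply: bmfX; exact: uu_bmf.
by apply: I_eq => p; ring.
Qed.

Lemma Sf_ge0 t g : bmf g -> (forall p, 0 <= g p) -> 0 <= Sf_lim t g.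
Proof.
move=> Hg g0; rewrite -(mul0r (Sf_lim t (cst 1))) -SfZ; last exact: bmf_cst.
apply: Sf_le => //; first exact/bmfZ/bmf_cst.
by move=> p; rewrite mul0r.
Qed.

Lemma Sf_sum t (T0 : Type) (s : seq T0) (F : T0 -> M -> R) : (forall i, bmf (F i)) ->
  Sf_lim t (fun p => \sum_(i <- s) F i p) = \sum_(i <- s) Sf_lim t (F i).
Proof.
move=> HF; elim: s => [|i s IH].
  rewrite big_nil (_ : (fun p => _) = (fun p => 0 * cst 1 p)); last by apply/funext => p; rewrite big_nil mul0r.
  by rewrite SfZ ?mul0r //; exact: bmf_cst.
rewrite big_cons -IH -SfD //; last exact: bmf_sum.
by congr (Sf_lim t _); apply/funext => p; rewrite big_cons.
Qed.

Lemma kk_align (k : nat) (N : nat) j : N%:R * dt j = tau -> kk dt (k%:R * tau) j = (k * N)%N.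
Proof.
move=> <-; rewrite /kk mulrA -natrM mulfK; last by rewrite gt_eqF // (sc_dt0 S).
by rewrite natrK.
Qed.

Lemma exp_bmf k (w : M -> R) : continuous w -> bmf (fun p => expR (k * w p)).
Proof.
move=> wc; apply: bmf_cont => // p.
apply: (@continuous_comp _ _ _ (fun p => k * w p) expR); last exact: continuous_expR.
by apply: contM; [exact: cont_cst|exact: wc].
Qed.

(** At the end of a full step the weight near the target is of order [eta * tau] only; an incomplete
    step pays the full action of the drift. In the chain only the last step can be incomplete. *)
Definition loss (Av tau s : R) := if s == tau then 0 else Av * tau.

(** On [B] the Agmon weight at the final time is bounded below through [gw_near]. The error
    [Err * dt j] vanishes along the ultrafilter, so the constant depends on [eps] only through the
    displayed exponential. *)
Lemma est_step Av z W B C k s : good_weight X K mm eta Av tau z W B C -> 0 <= Av -> 0 < tau ->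
  0 <= s -> s <= tau -> k%:R * tau + s <= T ->
  Sf_lim (k%:R * tau + s) (\1_B) <=
  growth * expR (2 / eps * (2 * (eta * tau) + loss Av tau s)) *
  Sf_lim (k%:R * tau) (fun p => expR (- (2 / eps) * W 0 p)).
Proof.
move=> gw Av0 tau0 s0 st tT; have eps0 := sc_eps S; have e2 : 0 < 2 / eps by rewrite divr_gt0.
have [h1 [Err [h10 Err0 H]]] := discrete_step gw (ltW tau0) eps0 (sc_C1 S) (sc_ge0 S).
set t := k%:R * tau + s in tT *; set t0 := k%:R * tau.
have t00 : 0 <= t0 by rewrite mulr_ge0 // ltW.
have tt0 : t0 <= t by rewrite lerDl.
have mB : bmf (\1_B) by apply: bmf_indic; apply: closed_borel; exact: gw_closed gw.
have W0C := gw_C1 gw (lexx 0) (ltW tau0).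
have mw : bmf (fun p => expR (- (2 / eps) * W 0 p)) by apply: exp_bmf; exact: C1M_cont.
set c := growth * _.
have c0 : 0 <= c by rewrite mulr_ge0 // expR_ge0.
have bE := E_bdd t0 mw.
have bD : bdd dt by exists 1 => j; rewrite gtr0_norm ?(sc_dt0 S) //; exact: sc_dt1 S _.
have cvgE : ulim U (fun j => c * (\int[mu]_p (uu dt u t0 j p ^+ 2 * expR (- (2 / eps) * W 0 p)) + Err * dt j)) =
    c * Sf_lim t0 (fun p => expR (- (2 / eps) * W 0 p)).
  rewrite (ulimZ (sc_ultra S)); last by apply: bddD => //; exact: bddZ.
  rewrite (ulimD (sc_ultra S)) //; last exact: bddZ.
  by rewrite (ulimZ (sc_ultra S)) // (ulim_cvg (sc_ultra S) (sc_oo S) (sc_cvg S)) mulr0 addr0.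
rewrite -cvgE; apply: (ulim_le_near (sc_ultra S)).
- exact: E_bdd.
- by apply: bddZ; apply: bddD => //; exact: bddZ.
(* The threshold [h1] depends on [eps], so the discrete estimate is available only for large [j]. *)
have near_h : \forall j \near \oo, dt j <= h1.
  have H1 := cvgr0_norm_le _ (sc_cvg S) _ h10.
  by near=> j; rewrite -(gtr0_norm (sc_dt0 S j)); near: j; exact: H1.
apply: (sc_oo S); apply: filterS near_h => j dth /=.
have dt0 := sc_dt0 S j; have [N HN] := sc_align S j.
have kkt0 : kk dt t0 j = (k * N)%N by exact: kk_align.
have kmono := kk_mono (sc_dt0 S) j tt0.
have [J kJ] : exists J, kk dt t j = (kk dt t0 j + J)%N by exists (kk dt t j - kk dt t0 j)%N; rewrite subnKC.
have t_ge0 : 0 <= t := le_trans t00 tt0.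
have kkle := kk_le (sc_dt0 S) j t_ge0.
have k0E : (kk dt t0 j)%:R * dt j = t0 by rewrite kkt0 natrM -mulrA HN.
have JE : J%:R * dt j <= s by move: kkle; rewrite kJ natrD mulrDl k0E /t lerD2l.
have JT : J%:R * dt j <= tau by exact: le_trans st.
have Jtau : s = tau -> J%:R * dt j = tau.
  move=> sE; have : t = k.+1%:R * tau by rewrite /t sE -natr1 mulrDl mul1r.
  move=> tE; have := kk_align k.+1 HN; rewrite -tE kJ kkt0 mulSn addnC => /addIn JN.
  by rewrite JN HN.
have kT : (kk dt t0 j + J)%:R * dt j <= T by rewrite -kJ; exact: le_trans kkle tT.
have D := H (dt j) (u j) (kk dt t0 j) J dt0 (sc_dt1 S j) dth (sc_rothe S j) JT kT.
have J0 : 0 <= J%:R * dt j by rewrite mulr_ge0 // ltW.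
have WJ := gw_C1 gw J0 JT.
pose r p := rho eps W (J%:R * dt j) p.
have mr : bmf r.
  have WcJ : continuous (fun p => W (J%:R * dt j) p + eta * (J%:R * dt j)).
    by move=> p; apply: cvgD; [exact: (C1M_cont WJ)|exact: cvg_cst].
  exact: (exp_bmf _ WcJ).
have mu2 : bmf (fun p => uu dt u t j p ^+ 2) by apply: bmfX; exact: uu_bmf.
pose le := expR (2 / eps * (2 * (eta * tau) + loss Av tau s)).
apply: (@le_trans _ _ (\int[mu]_p (le * (uu dt u t j p ^+ 2 * r p)))).
  apply: (I_le M_hausdorff M_compact mu_volume); [exact: bmfM|exact/bmfZ/bmfM|].
  move=> p; rewrite mulrCA; apply: ler_wpM2l; first exact: sqr_ge0.
  rewrite indicE; case: (boolP (p \in B)) => [|_]; last by rewrite mulr_ge0 // expR_ge0.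
  rewrite inE => Bp; rewrite /le /r /rho -expRD -[leLHS]expR0 ler_expR mulNr -mulrBr.
  apply: mulr_ge0; first exact: ltW.
  have := gw_near gw J0 JT Bp.
  have eJ : eta * (J%:R * dt j) <= eta * tau by apply: ler_wpM2l => //; exact: ltW.
  have lossP : Av * (tau - J%:R * dt j) <= loss Av tau s.
    rewrite /loss; case: eqP => [/Jtau->|_]; first by rewrite subrr mulr0.
    by apply: ler_wpM2l => //; rewrite gerBl.
  by move: eJ lossP; move: (W _ p) (eta * _) (eta * tau) (Av * _) (loss _ _ _) => *; lra.
rewrite (I_Z M_hausdorff M_compact mu_volume); last exact: bmfM.
rewrite /c -/le (mulrC growth) -mulrA; apply: ler_wpM2l; first exact: expR_ge0.
rewrite /r /uu kJ; apply: le_trans D _.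
apply: ler_wpM2l; first exact: expR_ge0.
rewrite lerD2r le_eqVlt; apply/orP; left; apply/eqP; apply: I_eq => p.
by rewrite /rho mulr0 addr0.
Unshelve. all: end_near.
Qed.
End Limit.

Section Chain.
Variables (tau Av : R).
Hypotheses (tau_gt0 : 0 < tau) (Av_ge0 : 0 <= Av) (mm_ge0 : 0 <= mm) (mm_le1 : mm <= 1).
Hypothesis weights : forall z, exists W B C, good_weight X K mm eta Av tau z W B C.

(** The minimum starts from [K], an upper bound of the truncated distance, so the default value does
    not spoil lower bounds by [Dr]. *)
Definition minlist (F : M -> M -> R) (s : seq M) (p : M) : R := foldr (fun x a => Num.min (F x p) a) K s.

Lemma minlist_le F s x p : x \in s -> minlist F s p <= F x p.
Proof.
elim: s => // y s IH; rewrite inE => /orP[/eqP->|/IH xs] /=; first by rewrite ge_min lexx.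
by rewrite ge_min xs orbT.
Qed.

Lemma minlist_ge F s a p : a <= K -> (forall x, x \in s -> a <= F x p) -> a <= minlist F s p.
Proof.
move=> aK; elim: s => // y s IH H /=; rewrite le_min H ?mem_head // IH // => x xs.
by apply: H; rewrite inE xs orbT.
Qed.

Lemma minlist_cont F s : (forall x, continuous (F x)) -> continuous (minlist F s).
Proof.
move=> Fc; elim: s => [|y s IH] p /=; first exact: cst_continuous.
apply: (@continuous_near_eq _ _ _ (fun p => - Num.max (- F y p) (- minlist F s p))).
  by apply: filterS filterT => z _; rewrite /= -oppr_min opprK.
by apply: contN; apply: cont_max; apply: contN; [exact: Fc|exact: IH].
Qed.

(* Infimal convolution in time: near a point the next weight dominates the minimum of finitely
   many weights of the previous steps, and Dr_triangle bounds the result from below. *)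
Lemma chain (k : nat) z : exists B W Cst, [/\ closed B, nbhs z B, continuous W,
  forall p, (1 - mm) * Dr X K z p (k.+1%:R * tau) <= W p + k.+1%:R * (2 * (eta * tau)) &
  0 <= Cst /\ forall eps u0 U dt u, scheme tau eps u0 U dt u -> forall s, 0 <= s -> s <= tau -> k%:R * tau + s <= T ->
    Sf_lim U dt u (k%:R * tau + s) (\1_B) <=
    Cst * expR (2 / eps * (k.+1%:R * (4 * (eta * tau)) + loss Av tau s)) *
    Sf_lim U dt u 0 (fun p => expR (- (2 / eps) * W p))].
Proof.
have et0 : 0 <= eta * tau by rewrite mulr_ge0 // ltW.
have g0 : 0 <= growth by exact: expR_ge0.
elim: k z => [|k IH] z.
  have [W [B [C gw]]] := weights z; have W0C := C1M_cont (gw_C1 gw (lexx 0) (ltW tau_gt0)).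
  exists B, (W 0), growth; split=> //.
  - exact: gw_closed gw.
  - exact: gw_nbhs gw.
  - by move=> p; rewrite !mul1r; apply: le_trans (gw_Dr gw p) _; rewrite lerD2l; lra.
  split=> // eps u0 U dt u S s s0 st tT.
  have := est_step S gw Av_ge0 tau_gt0 s0 st tT; rewrite mul0r => H.
  have e2 : 0 < 2 / eps by rewrite divr_gt0 // (sc_eps S).
  apply: le_trans H _; apply: ler_wpM2r.
    by apply: (Sf_ge0 S) => [|p]; [exact: exp_bmf|exact: expR_ge0].
  apply: ler_wpM2l => //; rewrite ler_expR; apply: ler_wpM2l; first exact: ltW.
  by rewrite lerD2r mul1r; lra.
have /choice[BWC H] (x : M) := let: ex_intro B (ex_intro W (ex_intro C h)) := IH x in
  ex_intro (fun bwc : set M * (M -> R) * R => [/\ closed bwc.1.1, nbhs x bwc.1.1, continuous bwc.1.2,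
  forall p, (1 - mm) * Dr X K x p (k.+1%:R * tau) <= bwc.1.2 p + k.+1%:R * (2 * (eta * tau)) &
  0 <= bwc.2 /\ forall eps u0 U dt u, scheme tau eps u0 U dt u -> forall s, 0 <= s -> s <= tau -> k%:R * tau + s <= T ->
    Sf_lim U dt u (k%:R * tau + s) (\1_bwc.1.1) <=
    bwc.2 * expR (2 / eps * (k.+1%:R * (4 * (eta * tau)) + loss Av tau s)) *
    Sf_lim U dt u 0 (fun p => expR (- (2 / eps) * bwc.1.2 p))]) (B, W, C) h.
have [W [B [C gw]]] := weights z; have W0C := C1M_cont (gw_C1 gw (lexx 0) (ltW tau_gt0)).
(* On [BB x] the weight [W 0] is at least its value at [x] minus [eta * tau]. There the exponential
   can be replaced by a constant times the indicator of a set to which the induction hypothesis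
   applies. *)
pose BB x : set M := (BWC x).1.1 `&` [set p | W 0 x - eta * tau <= W 0 p].
have nB x : nbhs x (BB x).
  have [_ nb _ _ _] := H x; apply: filterI => //.
  have et : 0 < eta * tau by rewrite mulr_gt0.
  have lt : W 0 x - eta * tau < W 0 x by rewrite gtrBl.
  by apply: (near_comp (W0C x) (lt_nbhsr lt)) => y /ltW.
have [s [_ cov]] := @compact_nbhs_cover M setT BB M_compact (fun p _ => nB p).
pose F x p := W 0 x + (BWC x).1.2 p.
have Fc x : continuous (F x) by move=> p; have [_ _ c _ _] := H x; apply: contD; [exact: cont_cst|exact: c].
exists B, (minlist F s), (growth * \sum_(x <- s) (BWC x).2).
have K0 := ltW K_gt0; have kt0 : 0 < k.+1%:R * tau by rewrite mulr_gt0 // ltr0n.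
have m10 : 0 <= 1 - mm by rewrite subr_ge0.
have C0 x : 0 <= (BWC x).2 by have [_ _ _ _ []] := H x.
split.
- exact: gw_closed gw.
- exact: gw_nbhs gw.
- exact: minlist_cont.
- move=> p; rewrite -lerBlDr; apply: minlist_ge.
    rewrite lerBlDr; apply: (@le_trans _ _ K); last by rewrite lerDl mulr_ge0 // mulr_ge0.
    by rewrite -[leRHS]mul1r; apply: ler_pM => //; [exact: Dr_ge0|rewrite gerBl|exact: Dr_le].
  move=> x xs; have [_ _ _ Hx _] := H x; rewrite lerBlDr /F.
  have tE : k.+2%:R * tau = tau + k.+1%:R * tau by rewrite -(natr1 k.+1) mulrDl mul1r addrC.
  rewrite tE; apply: le_trans (ler_wpM2l m10 (Dr_triangle _ z x p K0 tau_gt0 kt0)) _ => //.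
  rewrite mulrDr; apply: le_trans (lerD (gw_Dr gw x) (Hx p)) _.
  have kE2 : k.+2%:R * (2 * (eta * tau)) = k.+1%:R * (2 * (eta * tau)) + 2 * (eta * tau).
    by rewrite -(natr1 k.+1) mulrDl mul1r.
  have ar (a b c e : R) : 0 <= e -> a + e + (b + c) <= a + b + (c + 2 * e) by lra.
  by rewrite kE2; exact: ar.
split; first by rewrite mulr_ge0 // sumr_ge0.
move=> eps u0 U dt u S r r0 rt tT.
have e0 := sc_eps S; have e2 : 0 < 2 / eps by rewrite divr_gt0.
pose ex a := expR (2 / eps * a).
have exE w : (fun p => expR (- (2 / eps) * w p)) = (fun p => ex (- w p) : R) :> (M -> R).
  by apply/funext => p; rewrite /ex mulrN mulNr.
have mW0 := exp_bmf (- (2 / eps)) W0C.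
have mi x : bmf (\1_((BWC x).1.1)) by apply: bmf_indic; apply: closed_borel; have [] := H x.
have step1 := est_step S gw Av_ge0 tau_gt0 r0 rt tT.
have kE : k.+1%:R * tau = k%:R * tau + tau by rewrite -natr1 mulrDl mul1r.
have mm1 : bmf (fun p => expR (- (2 / eps) * minlist F s p)) by apply: exp_bmf; exact: minlist_cont.
set I0 := Sf_lim U dt u 0 (fun p => expR (- (2 / eps) * minlist F s p)).
have I00 : 0 <= I0 by apply: (Sf_ge0 S) => // p; exact: expR_ge0.
have kT : k%:R * tau + tau <= T by rewrite -kE; apply: le_trans tT; rewrite lerDl.
have step2 : Sf_lim U dt u (k.+1%:R * tau) (fun p => expR (- (2 / eps) * W 0 p)) <=
    \sum_(x <- s) (ex (- (W 0 x - eta * tau)) * Sf_lim U dt u (k.+1%:R * tau) (\1_((BWC x).1.1))).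
  have -> : \sum_(x <- s) (ex (- (W 0 x - eta * tau)) * Sf_lim U dt u (k.+1%:R * tau) (\1_((BWC x).1.1))) =
      Sf_lim U dt u (k.+1%:R * tau) (fun p => \sum_(x <- s) ex (- (W 0 x - eta * tau)) * \1_((BWC x).1.1) p).
    by rewrite (Sf_sum S) => [|x]; [apply: eq_bigr => x _; rewrite (SfZ S)|exact: bmfZ].
  apply: (Sf_le S) => //; first by apply: bmf_sum => x; exact: bmfZ.
  move=> p; have [x xs [Bx Wx]] := cov p I.
  rewrite (big_rem x) //=; apply: ler_wpDr.
    by apply: sumr_ge0 => y _; rewrite mulr_ge0 ?expR_ge0 // indicE; case: (_ \in _).
  rewrite indicE mem_set // mulr1 /ex ler_expR mulNr -mulrN; apply: ler_wpM2l; first exact: ltW.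
  by rewrite lerN2.
(* The induction hypothesis is used over a full step, [s = tau], where [loss] vanishes. *)
have step3 x : x \in s -> ex (- (W 0 x - eta * tau)) * Sf_lim U dt u (k.+1%:R * tau) (\1_((BWC x).1.1)) <=
    (BWC x).2 * ex (k.+1%:R * (4 * (eta * tau)) + eta * tau) * I0.
  move=> xs; have [_ _ cx _ [_ Hx]] := H x.
  have := Hx eps u0 U dt u S tau (ltW tau_gt0) (lexx _) kT; rewrite -kE /loss eqxx addr0 => {}Hx.
  apply: le_trans (ler_wpM2l (expR_ge0 _) Hx) _.
  have mx : bmf (fun p => expR (- (2 / eps) * (BWC x).1.2 p)) by exact: exp_bmf.
  have : ex (- W 0 x) * Sf_lim U dt u 0 (fun p => expR (- (2 / eps) * (BWC x).1.2 p)) <= I0.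
    rewrite -(SfZ S) //; apply: (Sf_le S) => //; first exact: bmfZ.
    move=> p; rewrite /ex -expRD ler_expR mulrN -mulNr -mulrDr !mulNr lerN2.
    by apply: ler_wpM2l; [exact: ltW|exact: (minlist_le F p xs)].
  move=> /(ler_wpM2l (mulr_ge0 (C0 x) (expR_ge0 (2 / eps * (k.+1%:R * (4 * (eta * tau)) + eta * tau))))).
  apply: le_trans; rewrite le_eqVlt; apply/orP; left; apply/eqP.
  rewrite /ex (_ : - (W 0 x - eta * tau) = - W 0 x + eta * tau); last by ring.
  by rewrite !mulrDr !expRD; ring.
have step4 : Sf_lim U dt u (k.+1%:R * tau) (fun p => expR (- (2 / eps) * W 0 p)) <=
    (\sum_(x <- s) (BWC x).2) * ex (k.+1%:R * (4 * (eta * tau)) + eta * tau) * I0.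
  apply: le_trans step2 _; rewrite !mulr_suml big_seq [leRHS]big_seq; apply: ler_sum => x xs.
  exact: step3.
apply: le_trans step1 _.
apply: le_trans (ler_wpM2l (mulr_ge0 g0 (expR_ge0 _)) step4) _.
set CC := \sum_(x <- s) _; have CC0 : 0 <= CC by apply: sumr_ge0.
rewrite -/(ex (2 * (eta * tau) + loss Av tau r)) -/(ex (k.+2%:R * (4 * (eta * tau)) + loss Av tau r)).
have exD a b : ex a * ex b = ex (a + b) by rewrite /ex mulrDr expRD.
have -> : growth * ex (2 * (eta * tau) + loss Av tau r) * (CC * ex (k.+1%:R * (4 * (eta * tau)) + eta * tau) * I0) =
   growth * CC * (ex (2 * (eta * tau) + loss Av tau r) * ex (k.+1%:R * (4 * (eta * tau)) + eta * tau)) * I0 by ring.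
apply: ler_wpM2r => //; apply: ler_wpM2l; first exact: mulr_ge0.
rewrite exD /ex ler_expR; apply: ler_wpM2l; first exact: ltW.
have kE4 : k.+2%:R * (4 * (eta * tau)) = k.+1%:R * (4 * (eta * tau)) + 4 * (eta * tau).
  by rewrite -(natr1 k.+1) mulrDl mul1r.
have ar (b a l : R) : 0 <= b -> 2 * b + l + (a + b) <= a + 4 * b + l by lra.
by rewrite kE4; exact: ar.
Qed.
End Chain.

End Energy.

(** * The observed energy *)

Lemma nbhs_all (M : ptopologicalType) (y : M) (s : seq M) (P : M -> set M) :
  (forall x, x \in s -> nbhs y (P x)) -> nbhs y [set p | forall x, x \in s -> P x p].
Proof.
elim: s => [|a s IH] H; first exact: filterS filterT.
have /IH h x : x \in s -> nbhs y (P x) by move=> xs; apply: H; rewrite inE xs orbT.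
apply: filterS (filterI (H a (mem_head _ _)) h) => p [Pa Ps] x.
by rewrite inE => /orP[/eqP->|/Ps].
Qed.

(** * From the chained estimates to a solution that is hard to observe *)

Section Observation.
Context {R : realType} {n : nat} {M : ptopologicalType} (G : riemannian R n M).
Hypotheses (M_hausdorff : hausdorff_space M) (M_compact : compact [set: M]).
Variables (mu : {measure set (borel M) -> \bar R}) (mu_volume : is_volume G mu).
Variables (f : M -> R) (fC : Ck G 3 f) (q : M -> R) (Q : R).
Hypotheses (mq : measurable_fun setT (q : borel M -> R)) (qQ : forall p, `|q p| <= Q).
Notation X := (grad f (G := G)).
Notation bmf := (@bmf R M).
Variables (K mm eta T : R).
Hypotheses (K_gt0 : 0 < K) (eta_gt0 : 0 < eta) (T_ge0 : 0 <= T).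
Variables (tau Av : R).
Hypotheses (tau_gt0 : 0 < tau) (Av_ge0 : 0 <= Av) (mm_ge0 : 0 <= mm) (mm_le1 : mm <= 1).
Hypothesis weights : forall z, exists W B C, good_weight X K mm eta Av tau z W B C.
Notation scheme := (scheme G mu f q).
Notation Sf := (Sf_lim mu).

Variables (F : set M) (F_closed : closed F) (y0 : M) (D : R).

Definition upper_rate eps := expR (2 / eps * (4 * (eta * T) + Av * tau)) * expR (- (2 / eps) * D).

(** [V] is the set where the finitely many weights attached to a cover of the compact set [F] all
    exceed [D]. Neither [V] nor [C] depends on [eps], so the initial datum can be fixed
    beforehand. *)
Lemma obs_upper_step k : k.+1%:R * tau <= T ->
  (forall z, F z -> D < (1 - mm) * Dr X K z y0 (k.+1%:R * tau) - k.+1%:R * (2 * (eta * tau))) ->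
  exists2 V, nbhs y0 V & exists2 C, 0 <= C & forall eps u0 U dt u, scheme tau eps u0 U dt u ->
    (forall p, ~ V p -> u0 p = 0) -> forall s, 0 <= s -> s <= tau ->
    Sf U dt u (k%:R * tau + s) (\1_F) <= C * upper_rate eps * \int[mu]_p (u0 p ^+ 2).
Proof.
move=> kT HD.
have [C1 C10 HC1] := div_bound M_hausdorff M_compact mu_volume fC.
pose P x (bwc : set M * (M -> R) * R) := [/\ closed bwc.1.1, nbhs x bwc.1.1, continuous bwc.1.2,
  forall p, (1 - mm) * Dr X K x p (k.+1%:R * tau) <= bwc.1.2 p + k.+1%:R * (2 * (eta * tau)) &
  0 <= bwc.2 /\ forall eps u0 U dt u, scheme tau eps u0 U dt u -> forall s, 0 <= s -> s <= tau -> k%:R * tau + s <= T ->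
    Sf U dt u (k%:R * tau + s) (\1_bwc.1.1) <=
    bwc.2 * expR (2 / eps * (k.+1%:R * (4 * (eta * tau)) + loss Av tau s)) *
    Sf U dt u 0 (fun p => expR (- (2 / eps) * bwc.1.2 p))].
have /choice[b Hb] x : exists bwc, P x bwc.
  have [B [W [C h]]] := chain M_hausdorff M_compact mu_volume fC mq qQ K_gt0 eta_gt0 T_ge0 C10 HC1 tau_gt0 Av_ge0 mm_ge0 mm_le1 weights k x.
  by exists (B, W, C).
have cF : compact F by apply: subclosed_compact M_compact _.
have [s [sF cov]] := @compact_nbhs_cover M F (fun x => (b x).1.1) cF
  (fun x _ => let: And5 _ h _ _ _ := Hb x in h).
have C0 x : 0 <= (b x).2 by have [_ _ _ _ []] := Hb x.
exists [set p | forall x, x \in s -> D < (b x).1.2 p].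
  apply: nbhs_all => x xs; have [_ _ c HW _] := Hb x.
  have lt : D < (b x).1.2 y0.
    by have := HD x (sF x xs); have := HW y0; move: (_ * Dr _ _ _ _ _) => a; lra.
  by apply: (near_comp (c y0) (lt_nbhsr lt)).
exists (\sum_(x <- s) (b x).2); first exact: sumr_ge0.
move=> eps u0 U dt u S u0V r r0 rt.
have e2 : 0 < 2 / eps by rewrite divr_gt0 // (sc_eps S).
have bB x : bmf (\1_((b x).1.1)) by apply: bmf_indic; apply: closed_borel; have [] := Hb x.
have u0B : bmf u0 := C1_bmf M_compact (sc_C1 S).
have I00 : 0 <= \int[mu]_p (u0 p ^+ 2) by apply: I_ge0 => p; exact: sqr_ge0.
apply: (@le_trans _ _ (\sum_(x <- s) Sf U dt u (k%:R * tau + r) (\1_((b x).1.1)))).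
  rewrite -(Sf_sum M_hausdorff M_compact mu_volume fC mq qQ S) //.
  apply: (Sf_le M_hausdorff M_compact mu_volume fC mq qQ S).
  - by apply: bmf_indic; exact: closed_borel.
  - exact: bmf_sum.
  - move=> p; rewrite indicE; have [/set_mem Fp|_] := boolP (p \in F); last by apply: sumr_ge0.
    have [x xs Bx] := cov p Fp; rewrite (big_rem x xs) /= indicE mem_set //= lerDl.
    exact: sumr_ge0.
rewrite -mulrA mulr_suml big_seq [leRHS]big_seq; apply: ler_sum => x xs.
have [_ _ c _ [_ Hx]] := Hb x.
have krT : k%:R * tau + r <= T.
  by apply: le_trans kT; rewrite -natr1 mulrDl mul1r lerD2l.
apply: le_trans (Hx eps u0 U dt u S r r0 rt krT) _.
rewrite -mulrA; apply: ler_wpM2l => //.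
rewrite /upper_rate -[leRHS]mulrA; apply: ler_pM; first exact: expR_ge0.
- by apply: (Sf_ge0 M_hausdorff M_compact mu_volume fC mq qQ S) => [|p]; [exact: exp_bmf|exact: expR_ge0].
- rewrite ler_expR; apply: ler_wpM2l; first exact: ltW.
  have l1 : k.+1%:R * (4 * (eta * tau)) <= 4 * (eta * T).
    have -> : k.+1%:R * (4 * (eta * tau)) = 4 * (eta * (k.+1%:R * tau)) by ring.
    by apply: ler_wpM2l => //; apply: ler_wpM2l => //; exact: ltW.
  have l2 : loss Av tau r <= Av * tau.
    by rewrite /loss; case: eqP => // _; apply: mulr_ge0 => //; exact: ltW.
  exact: lerD.
have -> : Sf U dt u 0 (fun p => expR (- (2 / eps) * (b x).1.2 p)) =
    \int[mu]_p (u0 p ^+ 2 * expR (- (2 / eps) * (b x).1.2 p)).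
  rewrite /Sf_lim -[RHS](ulim_cst (sc_ultra S)); congr (ulim U _); apply/funext => j.
  have u0E : uu dt u 0 j = u0 by rewrite /uu (kk0 (sc_dt0 S)); case: (sc_rothe S j).
  by rewrite u0E.
rewrite -(I_Z M_hausdorff M_compact mu_volume); last exact: bmfX.
apply: (I_le M_hausdorff M_compact mu_volume).
- by apply: bmfM; [exact: bmfX|exact: exp_bmf].
- by apply: bmfZ; exact: bmfX.
move=> p; have [Vp|/u0V ->] := pselect (forall x, x \in s -> D < (b x).1.2 p); last first.
  by rewrite expr0n /= mul0r mulr0.
rewrite mulrC; apply: ler_wpM2r; first exact: sqr_ge0.
rewrite ler_expR !mulNr lerN2; apply: ler_wpM2l; first exact: ltW.
exact: ltW (Vp x xs).
Qed.

Lemma obs_upper m : T = m.+1%:R * tau ->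
  (forall z k, F z -> (k <= m)%N ->
    D < (1 - mm) * Dr X K z y0 (k.+1%:R * tau) - k.+1%:R * (2 * (eta * tau))) ->
  exists2 V, nbhs y0 V & exists2 C, 0 <= C & forall eps u0 U dt u, scheme tau eps u0 U dt u ->
    (forall p, ~ V p -> u0 p = 0) -> forall t, 0 <= t -> t <= T ->
    Sf U dt u t (\1_F) <= C * upper_rate eps * \int[mu]_p (u0 p ^+ 2).
Proof.
move=> TE HD.
have kT (k : 'I_m.+1) : k.+1%:R * tau <= T by rewrite TE ler_pM2r // ler_nat.
have /choice[VC H] (k : 'I_m.+1) : exists VC : set M * R, nbhs y0 VC.1 /\ 0 <= VC.2 /\
   forall eps u0 U dt u, scheme tau eps u0 U dt u ->
    (forall p, ~ VC.1 p -> u0 p = 0) -> forall s, 0 <= s -> s <= tau ->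
    Sf U dt u (k%:R * tau + s) (\1_F) <= VC.2 * upper_rate eps * \int[mu]_p (u0 p ^+ 2).
  have [V nV [C C0 HC]] := obs_upper_step (kT k) (fun z Fz => HD z k Fz (ltn_ord k)).
  by exists (V, C).
exists [set p | forall k, (VC k).1 p].
  by apply: filter_forall => k; have [] := H k.
exists (\sum_k (VC k).2); first by apply: sumr_ge0 => k _; have [_ []] := H k.
move=> eps u0 U dt u S u0V t t0 tT.
have I00 : 0 <= \int[mu]_p (u0 p ^+ 2) by apply: I_ge0 => p; exact: sqr_ge0.
have [k [s [s0 st tE]]] : exists (k : 'I_m.+1) s, [/\ 0 <= s, s <= tau & t = k%:R * tau + s].
  (* The time [T] is placed at the end of the last window; rounding down would start a further
     one. *)
  have [->|tn] := eqVneq t T.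
    exists ord_max, tau; split=> //; first exact: ltW.
    by rewrite TE -natr1 mulrDl mul1r.
  have tlt : t < T by rewrite lt_neqAle tn.
  have /andP[h1 h2] := truncn_itv (divr_ge0 t0 (ltW tau_gt0)).
  have km : (Num.truncn (t / tau) < m.+1)%N.
    rewrite -(@ltr_nat R); apply: le_lt_trans h1 _.
    by rewrite ltr_pdivrMr // -TE.
  exists (Ordinal km), (t - (Num.truncn (t / tau))%:R * tau); split.
  - by rewrite subr_ge0 -ler_pdivlMr.
  - by move: h2; rewrite ltr_pdivrMr // -natr1 mulrDl mul1r lerBlDl => /ltW.
  - by rewrite addrC subrK.
rewrite tE; have [_ [C0 Hk]] := H k.
apply: le_trans (Hk eps u0 U dt u S _ s s0 st) _.
  by move=> p nV; apply: u0V => /(_ k).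
apply: ler_wpM2r => //; apply: ler_wpM2r; first by rewrite mulr_ge0 // expR_ge0.
rewrite (bigD1 k) //= lerDl; apply: sumr_ge0 => i _; by have [_ []] := H i.
Qed.

Lemma bump_exists (V : set M) (p : M) : nbhs p V -> exists u0, [/\ C1M G u0, forall x, 0 <= u0 x,
  forall x, ~ V x -> u0 x = 0 & 0 < \int[mu]_x u0 x].
Proof.
move=> nV; pose c := chart_at G p; have cp : chart_dom c p := chart_atP G p.
have N2 : nbhs (chart_to c p) (chart_from c @^-1` V).
  have := chart_from_cont (chart_codP cp); rewrite /prop_for /continuous_at (chart_toK cp) => H.
  exact: (H _ nV).
have [r r0 sub] := chart_cube (chart_codP cp) N2.
have sub' y : cube (chart_to c p) r y -> (chart_cod c `&` chart_from c @^-1` V) y.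
  by move=> yr; apply: sub; apply: cube_le yr; rewrite lerDl ltW.
have sub1 : cube (chart_to c p) r `<=` chart_cod c by move=> y /sub'[].
have uC := mbump_C1 M_hausdorff r0 sub1.
exists (mbump c (chart_to c p) r); split=> //.
- by move=> x; exact: mbump_ge0.
- by move=> x nx; apply: (mbump_out r0 sub1) => -[y /sub'[_ Vy] yx]; apply: nx; rewrite -yx.
- apply: (Rintegral_gt0 M_hausdorff M_compact mu_volume (p := p)); first exact: C1M_cont uC.
  + by move=> x; exact: mbump_ge0.
  + by have := mbump_gt0 r0 (chart_codP cp); rewrite chart_toK.
Qed.

(** The bound is uniform for [eps <= 1], so that the decay rate of the mass does not depend on
    [eps]. *)
Lemma adj0_cst_bound : exists2 CA, 0 <= CA & forall eps, 0 < eps -> eps <= 1 -> forall p, `|adj0 G f eps (cst 1) p| <= CA.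
Proof.
have c2 : Ck G 2 (cst (1 : R)) by exact: Ck_cst.
have XC : vf_C1 X := grad_C1 fC. have Xc : vf_compat X by apply: grad_compat; exact: C1M_Ck fC.
have [A A0 HA] := cont_bound M_compact (divergence_cont M_hausdorff M_compact mu_volume
  (scale_compat Xc (cst 1)) (scale_C1 (C1M_cst 1) XC)).
have [B B0 HB] := cont_bound M_compact (divergence_cont M_hausdorff M_compact mu_volume
  (grad_compat (C1M_cst 1)) (grad_C1 c2)).
exists (A + B); first by rewrite addr_ge0 // ltW.
move=> eps e0 e1 p; rewrite /adj0; apply: le_trans (ler_normD _ _) _; rewrite normrN.
apply: lerD; first exact: HA.
rewrite normrM (gtr0_norm e0) -[leRHS]mul1r; apply: ler_pM => //; first exact: ltW.
exact: HB.
Qed.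

(** Steps are fractions of [tau], for alignment, with denominators starting late enough for the
    smallness condition of [mass_bound]. *)
Lemma time_steps (B : R) : 0 <= B -> exists dt : nat -> R, [/\ forall j, 0 < dt j,
  forall j, dt j * (2 * B + 1) <= 1, dt @ \oo --> (0 : R) & forall j, exists N : nat, N%:R * dt j = tau].
Proof.
move=> B0; have b0 : 0 < 2 * B + 1 by rewrite ltr_wpDl // mulr_ge0.
pose N := Num.truncn (tau * (2 * B + 1)).
exists (fun j => tau * (j + N).+1%:R^-1); split.
- by move=> j; rewrite divr_gt0.
- move=> j; rewrite mulrAC ler_pdivrMr // mul1r; apply: le_trans (ltW (truncnS_gt _)) _.
  by rewrite ler_nat ltnS leq_addl.
- rewrite -(mulr0 tau); apply: cvgM; first exact: cvg_cst.
  have := @cvg_harmonic R; rewrite -(cvg_shiftn N); exact.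
- by move=> j; exists (j + N).+1; rewrite mulrC divfK // pnatr_eq0.
Qed.

Lemma mass_gt0 : 0 < fine (mu setT).
Proof.
rewrite fine_gt0 // (mu_fin M_hausdorff M_compact mu_volume) andbT.
exact: (mu_open_gt0 M_hausdorff mu_volume (p := point) measurableT filterT).
Qed.

(** Cauchy-Schwarz, obtained by expanding [(v - a) ^+ 2 >= 0] with the optimal constant [a]. *)
Lemma sq_lower (v : M -> R) (c0 : R) : (v : borel M -> R) \in Lfun mu 2%:E -> 0 <= c0 ->
  intb mu v -> c0 <= \int[mu]_p v p ->
  ((c0 ^+ 2 / fine (mu setT))%:E <= \int[mu]_p ((v p ^+ 2)%:E : \bar R))%E.
Proof.
move=> vL c00 vI cv.
have m0 := mass_gt0; set m := fine _ in m0 *.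
pose a := c0 / m; have a0 : 0 <= a by rewrite divr_ge0 // ltW.
have i1 : mu.-integrable setT (EFin \o (fun p : borel M => 2 * a * v p)) by exact: (integrableZl _ (2 * a) vI).
have i2 : mu.-integrable setT (EFin \o (fun _ : borel M => a ^+ 2)).
  exact: (bmf_integrable M_hausdorff M_compact mu_volume (bmf_cst _)).
have i3 := Lfun2_integrable_sqr vL.
have fE : (\int[mu]_p ((v p ^+ 2)%:E : \bar R) = (\int[mu]_p (v p ^+ 2))%:E)%E.
  by rewrite /Rintegral fineK //; exact: (integrable_fin_num measurableT i3).
rewrite fE lee_fin; apply: (@le_trans _ _ (\int[mu]_p (2 * a * v p - a ^+ 2))).
  rewrite (RintegralB measurableT i1 i2) (RintegralZl _ measurableT vI) (Rintegral_cst mu measurableT).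
  apply: (@le_trans _ _ (2 * a * c0 - a ^+ 2 * m)); last by rewrite lerD2r ler_wpM2l // mulr_ge0.
  rewrite /a; have mn := lt0r_neq0 m0.
  by rewrite (_ : 2 * (c0 / m) * c0 - (c0 / m) ^+ 2 * m = c0 ^+ 2 / m) //; field.
apply: (le_Rintegral measurableT _ i3); first exact: (integrableB measurableT i1 i2).
by move=> p _; have := sqr_ge0 (v p - a); rewrite sqrrB mulr2n; move: (v p ^+ 2) (a ^+ 2) => x y; lra.
Qed.

(** [c0] and [b] come before [eps]: neither the bump, nor the rate of decay of its mass, nor the
    prefactor of [obs_upper] involves it, so [upper_rate] is the only factor depending on [eps]. *)
Lemma good_solution (omega : set M) m : 0 < T -> open omega -> omega `<=` F -> T = m.+1%:R * tau ->
  (forall z k, F z -> (k <= m)%N ->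
    D < (1 - mm) * Dr X K z y0 (k.+1%:R * tau) - k.+1%:R * (2 * (eta * tau))) ->
  exists c0 b, [/\ 0 < c0, 0 <= b & forall eps, 0 < eps -> eps <= 1 -> exists u0 v,
    [/\ C1M G u0, forall p, 0 <= u0 p, weak_solution G mu f q eps u0 v,
      (c0%:E <= \int[mu]_p ((v T p ^+ 2)%:E : \bar R))%E &
      forall t, 0 <= t -> t <= T ->
      (\int[mu]_(p in (omega : set (borel M))) ((v t p ^+ 2)%:E : \bar R) <= (b * upper_rate eps)%:E)%E]].
Proof.
move=> T0 oo oF TE HD.
have [V nV [C C0 HC]] := obs_upper TE HD.
have [u0 [u0C u00 u0V Iu0]] := bump_exists nV.
have [CA CA0 HCA] := adj0_cst_bound.
have Q0 : 0 <= Q := le_trans (normr_ge0 _) (qQ point).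
have QC0 : 0 <= Q + CA by exact: addr_ge0.
have [dt [dt0 dtB dtc dta]] := time_steps QC0.
have dt1 j : dt j <= 1.
  apply: le_trans (dtB j); rewrite -[leLHS]mulr1; apply: ler_wpM2l; first exact: ltW.
  by rewrite lerDr mulr_ge0.
have dtQ j : dt j * Q <= 1.
  apply: le_trans (dtB j); apply: ler_wpM2l; first exact: ltW.
  by move: Q0 CA0; lra.
have dtm j : (Q + CA) * dt j <= 2^-1.
  by have := dtB j; rewrite mulrDr mulr1 mulrCA (mulrC (dt j)); have := dt0 j; move: ((Q + CA) * dt j) => a; lra.
pose cm := expR (- (2 * ((Q + CA) * T))) * \int[mu]_p u0 p.
have cm0 : 0 < cm by rewrite mulr_gt0 // expR_gt0.
exists (cm ^+ 2 / fine (mu setT)), (C * \int[mu]_p (u0 p ^+ 2)).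
have m0 := mass_gt0.
split; first by rewrite divr_gt0 // exprn_gt0.
  by rewrite mulr_ge0 //; apply: I_ge0 => p; exact: sqr_ge0.
move=> eps e0 e1; exists u0.
have /choice[u Hu] (j : nat) := rothe_exists M_hausdorff M_compact mu_volume fC mq qQ e0 (dt0 j) (dtQ j) u0C u00.
have [U [UU Uoo]] := ultraFilterLemma (@eventually_filter).
have S : scheme tau eps u0 U dt u by split.
have [v Hv] := limit_exists M_hausdorff M_compact mu_volume fC mq qQ e0 u0C UU dt0 dt1 Hu.
exists v.
have vI t : intb mu (v t) by have [] := Hv t.
have vE t g : bmf g -> \int[mu]_p (v t p * g p) = ulim U (fun j => \int[mu]_p (uu dt u t j p * g p)).
  by move=> Hg; have [_ ->] := Hv t.
have vL t : (v t : borel M -> R) \in Lfun mu 2%:E.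
  exact: (v_L2 M_hausdorff M_compact mu_volume fC mq qQ e0 u0C UU dt0 dt1 Hu vI vE).
split=> //.
- exact (limit_weak_solution M_hausdorff M_compact mu_volume fC mq qQ e0 u0C UU Uoo dt0 dt1 dtc Hu vI vE).
- apply: sq_lower => //; first exact: ltW.
  have -> : \int[mu]_p v T p = ulim U (fun j => \int[mu]_p (uu dt u T j p * cst 1 p)).
    by rewrite -vE; [apply: I_eq => p; rewrite mulr1|exact: bmf_cst].
  have [Km Km0 HKm] := mass_bound M_hausdorff M_compact mu_volume fC mq qQ e0 CA0 (HCA eps e0 e1) T_ge0.
  have <- : ulim U (fun j => cm - T * Km * dt j) = cm.
    apply: (ulim_cvg UU Uoo); rewrite -[X in _ --> X]subr0 -(mulr0 (T * Km)).
    by apply: cvgB; [exact: cvg_cst|apply: cvgM => //; exact: cvg_cst].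
  apply: (ulim_le UU).
  + exists (cm + T * Km) => j; apply: le_trans (ler_normB _ _) _; rewrite (gtr0_norm cm0).
    rewrite lerD2l ger0_norm; last by rewrite !mulr_ge0 // ltW.
    by rewrite -[leRHS]mulr1; apply: ler_wpM2l => //; exact: mulr_ge0.
  + exact: (uu_bdd M_hausdorff M_compact mu_volume fC mq qQ e0 u0C dt0 dt1 Hu T (bmf_cst 1)).
  + move=> j; have := HKm (dt j) u0 (u j) (dt0 j) (dt1 j) (dtm j) u0C u00 (Hu j) (kk dt T j) (kk_le dt0 j T_ge0).
    rewrite (_ : \int[mu]_p u j (kk dt T j) p = \int[mu]_p (uu dt u T j p * cst 1 p)) //.
    by apply: I_eq => p; rewrite mulr1.
- move=> t t0 tT; have SF := HC eps u0 U dt u S u0V t t0 tT.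
  have -> : (\int[mu]_(p in (omega : set (borel M))) ((v t p ^+ 2)%:E : \bar R) =
      \int[mu]_p ((v t p ^+ 2 * \1_omega p)%:E : \bar R))%E.
    rewrite integral_mkcond; apply: eq_integral => p _; rewrite patchE indicE.
    by case: (p \in omega); rewrite ?mulr1 ?mulr0.
  apply: le_trans (_ : (Sf U dt u t (\1_F))%:E <= _)%E; last by rewrite lee_fin mulrAC.
  have Fb : bmf (\1_F) by apply: bmf_indic; exact: closed_borel.
  have ob : bmf (\1_omega) by apply: bmf_indic; exact: open_borel.
  apply: (v_lsc M_hausdorff M_compact mu_volume fC mq qQ e0 u0C UU dt0 dt1 Hu vI vE) => //.
  + exact: (E_bdd M_hausdorff M_compact mu_volume fC mq qQ S).
  + have Hx j : bmf (fun p => uu dt u t j p ^+ 2) by apply: bmfX; exact: (uu_bmf M_compact S).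
    move=> j; apply: (I_le M_hausdorff M_compact mu_volume); try exact: bmfM.
    move=> p; apply: ler_wpM2l; first exact: sqr_ge0.
    rewrite !indicE; case: (boolP (p \in omega)) => // /set_mem/oF Fp.
    by rewrite mem_set.
Qed.
End Observation.

(** Changing the potential on a null set preserves the weak equation. The scheme may thus use a
    representative that is bounded everywhere. *)
Lemma weak_solution_ae {R : realType} {n : nat} {M : ptopologicalType} (G : riemannian R n M)
  (M_hausdorff : hausdorff_space M) (M_compact : compact [set: M])
  (mu : {measure set (borel M) -> \bar R}) (mu_volume : is_volume G mu)
  (f : M -> R) (fC : Ck G 3 f) (q r : M -> R) (eps : R) u0 u :
  measurable_fun setT (q : borel M -> R) -> measurable_fun setT (r : borel M -> R) ->
  {ae mu, forall p, q p = r p} -> weak_solution G mu f q eps u0 u -> weak_solution G mu f r eps u0 u.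
Proof.
move=> mq mr qr [uL uc ui uw]; split=> // h Hh t t0; rewrite (uw h Hh t t0); congr (_ + _).
apply: eq_Rintegral => s; rewrite inE /= in_itv /= => /andP[s0 _].
have mu_s : measurable_fun setT (u s : borel M -> R).
  by have := uL s s0; rewrite inE => /andP[]; rewrite inE.
have hm : measurable_fun setT (h : borel M -> R) by have [] := C1_bmf M_compact (C1M_smooth Hh).
have am : measurable_fun setT (adj0 G f eps h : borel M -> R).
  by have [] := adj0_bmf M_hausdorff M_compact mu_volume fC eps (Hh 2%N).
have me (r' : M -> R) : measurable_fun setT (r' : borel M -> R) ->
    measurable_fun setT (fun p : borel M => (u s p * adjoint_op G f r' eps h p)%:E).
  move=> mr'; apply/measurable_EFinP; apply: measurable_funM => //.
  rewrite (_ : (adjoint_op G f r' eps h : borel M -> R) = (fun p => adj0 G f eps h p + r' p * h p)).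
    by apply: measurable_funD => //; exact: measurable_funM.
  by apply/funext => p; rewrite /adjoint_op /adj0; ring.
rewrite /Rintegral; congr fine; apply: ae_eq_integral => //; try exact: me.
have [N [mN N0 HN]] := qr; exists N; split=> // p Hp; apply: HN => qp; apply: Hp => _.
by rewrite /adjoint_op qp.
Qed.

Lemma ae_bounded {R : realType} {n : nat} {M : ptopologicalType} (G : riemannian R n M)
  (M_hausdorff : hausdorff_space M) (mu : {measure set (borel M) -> \bar R}) (mu_volume : is_volume G mu)
  (q : M -> R) : (q : borel M -> R) \in Lfun mu +oo%E ->
  exists r Q, [/\ measurable_fun setT (r : borel M -> R), forall p, `|r p| <= Q,
    measurable_fun setT (q : borel M -> R) & {ae mu, forall p, r p = q p}].
Proof.
rewrite inE => /andP[]; rewrite inE => mq; rewrite inE /= /finite_norm unlock.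
have -> : (0 < mu setT)%E by apply: (mu_open_gt0 M_hausdorff mu_volume (p := point) measurableT filterT).
move=> /ess_supr_bounded[Q HQ].
have mA : measurable ([set p | `|q p| <= Q] : set (borel M)).
  rewrite -[X in measurable X]setTI; apply: measurable_fun_le => //; exact: measurableT_comp.
exists (fun p => q p * \1_([set p | `|q p| <= Q]) p), `|Q|; split=> //.
- by apply: measurable_funM => //; exact: measurable_indic.
- move=> p; rewrite indicE; have [/set_mem /= H|_] := boolP (p \in _); last by rewrite mulr0 normr0.
  by rewrite mulr1 (le_trans H) // ler_norm.
- by apply: filterS HQ => p Hp; rewrite indicE mem_set ?mulr1.
Qed.

(* Since [C ^ 2 T b rate <= T b exp (- delta / eps)] whenever [C < exp ((d - delta) / eps)]. *)
Lemma constant_lower (R : realType) (d delta T c0 b : R) : 0 < delta -> 0 < T -> 0 < c0 -> 0 <= b ->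
  exists2 eps0, 0 < eps0 & eps0 <= 1 /\ forall eps r C, 0 < eps -> eps < eps0 -> 0 <= C ->
    r <= expR (- (2 / eps) * (d - delta / 2)) -> c0 <= C ^+ 2 * (b * r * T) ->
    expR ((d - delta) * eps^-1) <= C.
Proof.
move=> de0 T0 c00 b0; have Tb0 : 0 <= T * b by rewrite mulr_ge0 // ltW.
have Tb1 : 0 < T * b + 1 by rewrite ltr_wpDl.
exists (Num.min 1 (c0 * delta / (T * b + 1))).
  by rewrite lt_min ltr01 divr_gt0 // mulr_gt0.
split; first by rewrite ge_min lexx.
move=> eps r C e0; rewrite lt_min => /andP[_ e1] C0 Hr Hc; rewrite leNgt; apply/negP => HC.
have C2 : C ^+ 2 <= expR (2 / eps * (d - delta)).
  rewrite (_ : 2 / eps * (d - delta) = 2%:R * ((d - delta) / eps)); last by ring.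
  by rewrite expRM_natl; apply: lerXn2r => //; rewrite ?nnegrE ?expR_ge0 // ltW.
have H1 : C ^+ 2 * (b * r * T) <= T * b * expR (- (delta / eps)).
  rewrite (_ : C ^+ 2 * (b * r * T) = T * b * (C ^+ 2 * r)); last by ring.
  apply: ler_wpM2l => //; apply: (@le_trans _ _ (C ^+ 2 * expR (- (2 / eps) * (d - delta / 2)))).
    by apply: ler_wpM2l => //; exact: sqr_ge0.
  apply: le_trans (ler_wpM2r (expR_ge0 _) C2) _; rewrite -expRD ler_expR le_eqVlt; apply/orP; left; apply/eqP.
  by have := lt0r_neq0 e0 => en; field.
have x0 : 0 < delta / eps by rewrite divr_gt0.
have H2 : expR (- (delta / eps)) <= eps / delta.
  rewrite -[eps / delta]invrK expRN lef_pV2 ?posrE ?expR_gt0 ?invr_gt0 ?divr_gt0 // invf_div.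
  by apply: le_trans (expR_ge1Dx _); rewrite lerDr.
have : c0 < c0.
  apply: le_lt_trans Hc _; apply: le_lt_trans H1 _; apply: le_lt_trans (ler_wpM2l Tb0 H2) _.
  rewrite mulrA ltr_pdivrMr //; apply: (@le_lt_trans _ _ ((T * b + 1) * eps - eps)); first by rewrite mulrDl mul1r addrK.
  by move: e1; rewrite ltr_pdivlMr // mulrC; move: ((T * b + 1) * eps) => z; lra.
by rewrite ltxx.
Qed.

Theorem proposition1p12 (R : realType) (n : nat) (M : ptopologicalType)
    (G : riemannian R n M)
    (M_hausdorff : hausdorff_space M)
    (M_compact : compact [set: M])
    (M_connected : connected [set: M])
    (mu : {measure set (borel M) -> \bar R}) (mu_volume : is_volume G mu)
    (f : M -> R) (f_C3 : Ck G 3 f)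
    (q : M -> R) (q_bounded : (q : borel M -> R) \in Lfun mu +oo%E)
    (omega : set M) (omega_open : open omega) (omega_nonempty : omega !=set0)
    (T : R) (T_gt0 : 0 < T)
    (phi : R -> M -> M) (phi_flow : is_flow (G := G) (grad f) phi)
    (not_GCC : ~ GCC phi (closure omega)) :
  let d := action_dist_set (G := G) (grad f) T (closure omega) in
  (0 < d)%E /\
  forall delta : R, 0 < delta ->
  exists2 eps0 : R, 0 < eps0 &
  forall eps : R, 0 < eps -> eps < eps0 ->
    (C0plus G mu f q eps T omega <= C0 G mu f q eps T omega)%E /\
    (expeR ((d - delta%:E) * (eps^-1)%:E) <= C0plus G mu f q eps T omega)%E.
Proof.
have Xc : vf_compat (grad f (G := G)) := grad_compat (C1M_Ck f_C3).
have XC : vf_C1 (grad f (G := G)) := grad_C1 f_C3.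
move=> dd; have d_gt0 : (0 < dd)%E := action_dist_set_gt0 M_hausdorff Xc XC T_gt0 phi_flow not_GCC.
split=> // delta delta_gt0.
have [d dE d0] : exists2 d : R, dd = d%:E & 0 < d.
  have [B HB] := action_dist_set_fin M_compact Xc XC M_connected omega_nonempty T_gt0.
  move: d_gt0 HB; rewrite -/dd; case: dd => [d|//|//].
  by rewrite lte_fin => ? _; exists d.
have [y0 Hy0] : exists y0, forall z t, closure omega z -> 0 <= t -> t <= T ->
    ((d - delta / 8)%:E <= action_dist (grad f (G := G)) z y0 t)%E.
  have lt : ((d - delta / 8)%:E < dd)%E by rewrite dE lte_fin gtrBl divr_gt0.
  have [_ [y _ <-] /ltW Hy] := ereal_sup_gt lt; exists y => z t Fz t0 tT.
  by apply: le_trans Hy _; apply: ereal_inf_lbound; exists z, t.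
(* Truncating above [d] preserves the lower bound [d - delta / 8]. The factor [1 - mm] costs at most
   [mm * K <= delta / 8] more and the additive errors [2 * (eta * T) = delta / 32], which leaves
   more than [d - 3 * delta / 8]. *)
pose K := d + 1; have K0 : 0 < K by rewrite addr_gt0.
pose mm := Num.min 1 (delta / (8 * K)).
have mm0 : 0 < mm by rewrite lt_min ltr01 divr_gt0 // mulr_gt0.
have mm1 : mm <= 1 by rewrite ge_min lexx.
have mmK : mm * K <= delta / 8.
  have : mm <= delta / (8 * K) by rewrite ge_min lexx orbT.
  by rewrite ler_pdivlMr ?mulr_gt0 // mulrCA ler_pdivlMr // mulrC.
pose eta := delta / (64 * T); have eta0 : 0 < eta by rewrite divr_gt0 // mulr_gt0.
have etaT : eta * T = delta / 64 by rewrite /eta; have := lt0r_neq0 T_gt0 => Tn; field.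
have [tau0 [Av [tau00 Av0 Hw]]] := good_weight_exists M_hausdorff M_compact Xc XC K0 mm0 mm1 eta0.
pose tm := Num.min tau0 (delta / (16 * (Av + 1))).
have tm0 : 0 < tm by rewrite lt_min tau00 divr_gt0 // mulr_gt0 // ltr_wpDl.
(* [tau] is at most [tm] and divides [T] exactly, so that [[0, T]] consists of whole windows. *)
pose m := Num.truncn (T / tm); pose tau := T / m.+1%:R.
have tau_gt0 : 0 < tau by rewrite divr_gt0.
have tau_tm : tau <= tm.
  rewrite ler_pdivrMr // mulrC -ler_pdivrMr //; exact: ltW (truncnS_gt _).
have TE : T = m.+1%:R * tau by rewrite mulrC divfK // pnatr_eq0.
have Avt : Av * tau <= delta / 16.
  have : tau <= delta / (16 * (Av + 1)) by apply: le_trans tau_tm _; rewrite ge_min lexx orbT.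
  rewrite ler_pdivlMr ?mulr_gt0 ?ltr_wpDl // ler_pdivlMr // => H; apply: le_trans H.
  by rewrite (_ : tau * (16 * (Av + 1)) = Av * tau * 16 + 16 * tau); [rewrite lerDl mulr_ge0 // ltW|ring].
have weights z : exists W B C, good_weight (grad f (G := G)) K mm eta Av tau z W B C.
  by apply: Hw => //; apply: le_trans tau_tm _; rewrite ge_min lexx.
have HD z k : closure omega z -> (k <= m)%N ->
    d - 3 * delta / 8 < (1 - mm) * Dr (grad f (G := G)) K z y0 (k.+1%:R * tau) - k.+1%:R * (2 * (eta * tau)).
  move=> Fz km.
  have kT : k.+1%:R * tau <= T by rewrite [leRHS]TE ler_pM2r // ler_nat.
  have h1 : d - delta / 8 <= Dr (grad f (G := G)) K z y0 (k.+1%:R * tau).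
    apply: Dr_lb; [exact: ltW| |apply: Hy0 => //; by rewrite mulr_ge0 // ltW].
    by rewrite /K; move: delta_gt0; lra.
  have h2 : k.+1%:R * (2 * (eta * tau)) <= 2 * (delta / 64).
    rewrite -etaT (_ : k.+1%:R * (2 * (eta * tau)) = 2 * (eta * (k.+1%:R * tau))); last by ring.
    by apply: ler_wpM2l => //; apply: ler_wpM2l => //; exact: ltW.
  have h3 : mm * Dr (grad f (G := G)) K z y0 (k.+1%:R * tau) <= delta / 8.
    by apply: le_trans mmK; apply: ler_wpM2l; [exact: ltW|exact: Dr_le (ltW K0)].
  have ar (x a b e : R) : 0 < e -> d - e / 8 <= x -> b <= 2 * (e / 64) -> a <= e / 8 -> d - 3 * e / 8 < x - a - b by lra.
  by rewrite mulrBl mul1r; exact: ar.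
have [r [Q [mr rQ mq rq]]] := ae_bounded M_hausdorff mu_volume q_bounded.
have cF : closed (closure omega) by exact: closed_closure.
have [c0 [b [c00 b0 Hsol]]] := good_solution M_hausdorff M_compact mu_volume f_C3 mr rQ K0 eta0 (ltW T_gt0)
  tau_gt0 Av0 (ltW mm0) mm1 weights cF T_gt0 omega_open (@subset_closure _ omega) TE HD.
have [eps0 e00 [e01 Heps]] := @constant_lower R d delta T c0 b delta_gt0 T_gt0 c00 b0.
exists eps0 => // eps e0 e1; split.
  by apply: le_ereal_inf => _ [C [C0 HC] <-]; exists C => //; split=> // u0 u Hu0 _; exact: HC.
rewrite dE -EFinB -EFinM /=; apply: le_ereal_inf_tmp => _ [C [C0 HC] <-]; rewrite lee_fin.
have [u0 [v [u0C u00 vS vT vo]]] := Hsol eps e0 (le_trans (ltW e1) e01).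
have u0B := C1_bmf M_compact u0C.
have u0L : (u0 : borel M -> R) \in Lfun mu 2%:E.
  apply: Lfun2_intro; first by case: u0B.
  exact: (integrable_lty measurableT (bmf_integrable M_hausdorff M_compact mu_volume (bmfX u0B))).
have vS' := weak_solution_ae M_hausdorff M_compact mu_volume f_C3 mr mq rq vS.
pose rate := upper_rate eta T tau Av (d - 3 * delta / 8) eps.
have rate0 : 0 <= rate by rewrite mulr_ge0 // expR_ge0.
apply: (Heps eps rate C e0 e1 C0).
  (* In the rate, [4 * (eta * T)] and [Av * tau] contribute at most [delta / 16] each, which lowers
     [d - 3 * delta / 8] to [d - delta / 2]. *)
  rewrite /rate /upper_rate -expRD ler_expR mulNr -mulrBr mulNr -mulrN; apply: ler_wpM2l.
    by rewrite divr_ge0 // ltW.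
  by rewrite etaT; move: (Av * tau) Avt delta_gt0 => x; lra.
have u0a : {ae mu, forall p, 0 <= u0 p} by exact: aeW.
have H := HC u0 v u0L u0a vS'.
rewrite -lee_fin; apply: le_trans vT _; rewrite -(Lnorm2_sq mu (v T)); apply: le_trans H _.
rewrite [leRHS]EFinM; apply: lee_wpmul2l; first by rewrite lee_fin sqr_ge0.
(* The observed energy is not known to be measurable in time; as a lower integral it is still
   bounded by the integral of its uniform bound. *)
apply: (@le_trans _ _ (\int[@lebesgue_measure R]_(t in `[0%R, T]) (b * rate)%:E)%E).
  apply: le_lower_integral => t /=; rewrite in_itv /= => /andP[t0 tT].
    by apply: integral_ge0 => p _; rewrite lee_fin sqr_ge0.
  apply: le_trans (vo t t0 tT); apply: le_lower_integral => p _; rewrite lee_fin ?sqr_ge0 //.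
  by rewrite real_normK ?num_real.
rewrite integral_cst //= lebesgue_measure_itv /= lte_fin T_gt0 -EFinB subr0 -EFinM.
by rewrite lee_fin.
Qed.
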